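(* Let $p$ be an odd prime and let $L$ be a primitive ternary lattice on a positive definite quadratic space $V$ over $\mathbb{Q}$ with $\mathrm{ord}_p(dL)\ge 2$. Put $N=\Lambda_p(L)$, and assume that $p\neq 3$ if $|O(N)|=24$. Let $\Gamma=\Gamma_p^L(N)$, let $S(N)$ be the set of symmetries in $O(N)$, and set $w=|\Gamma|$, $f=\sum_{\sigma\in S(N)}|\Gamma_\sigma|$, and let $s$ be the number of symmetries $\sigma\in O(N)$ for which there exists a lattice $M\in\Gamma_\sigma$ to which $\sigma$ is special. For a positive integer $n$ let $[w]_n$ denote the remainder of $w$ upon division by $n$. For each positive integer $d$, let $h_{2d}$ be the number of isometry classes of lattices in $\Gamma$ whose isometry group has order $2d$. Then: - if $|O(N)|=2$: $h_2=w$ and $h_4=h_8=h_{12}=h_{16}=h_{24}=0$; - if $|O(N)|=4$: $h_2=\frac{w-f}{2}$, $h_4=f$, $h_8=h_{12}=h_{16}=h_{24}=0$; - if $|O(N)|=8$: $h_2=\frac{w-f+2s}{4}$, $h_4=\frac{f-3s}{2}$, $h_8=s$, $h_{12}=h_{16}=h_{24}=0$; - if $|O(N)|=12$: $h_2=\frac{w-f+2[w]_3}{6}$, $h_4=\frac{f-3[w]_3}{3}$, $h_8=0$, $h_{12}=[w]_3$, $h_{16}=h_{24}=0$; - if $|O(N)|=16$: $h_2=\frac{w-f+2s+2[w]_2}{8}$, $h_4=\frac{f-3s-2[w]_2}{4}$, $h_8=\frac{s-[w]_2}{2}$, $h_{12}=0$, $h_{16}=[w]_2$, $h_{24}=0$;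 - if $|O(N)|=24$: $h_2=\frac{w-f+2s+4[w]_3}{12}$, $h_4=\frac{f-3s-4[w]_3}{6}$, $h_8=\frac{s-[w]_3}{3}$, $h_{12}=h_{16}=0$, $h_{24}=[w]_3$; - if $|O(N)|=48$: $h_{24}=h_{48}=0$, $h_{12}=(1-\delta_{3p})\frac{1+\left(\frac{3d_0}{p}\right)}{2}$, $h_{16}=\frac{1+\left(\frac{d_0}{p}\right)}{2}$, where $\delta_{3p}$ is the Kronecker delta, $d_0$ is the discriminant of a unimodular Jordan component of $L_p$ and $\left(\frac{\cdot}{p}\right)$ is the Legendre symbol; moreover $h_8=\frac{s-3h_{16}}{6}$, $h_4=\frac{f-18h_8-12h_{12}-15h_{16}}{12}$ and $h_2=\frac{w-f+12h_8+8h_{12}+12h_{16}}{24}$.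
   Context: Quadratic spaces are positive definite over $\mathbb{Q}$; a lattice is a $\mathbb{Z}$-lattice on such a space with quadratic map $Q$ and bilinear form $B$, $Q(x)=B(x,x)$. A lattice is primitive if its scale ideal (the ideal generated by $B(L,L)$) is $\mathbb{Z}$. $dL$ is the determinant of a Gram matrix; $O(L)$ is the isometry group, $O^+(L)$ its subgroup of determinant-one isometries; $\mathrm{gen}(L)$ is the set of lattices on $V$ in the genus of $L$; $L_p=\mathbb{Z}_p\otimes L$. For a positive integer $m$, $\Lambda_m(L)=\{x\in L: Q(x+y)\equiv Q(y)\pmod m \text{ for all } y\in L\}$. For $N$ in the genus of $\Lambda_p(L)$, $\Gamma_p^L(N)=\{M\in\mathrm{gen}(L):\Lambda_p(M)=N\}$; $O(N)$ acts on it, and for $\sigma\in O(N)$, $\Gamma_p^L(N)_\sigma=\{M\in\Gamma_p^L(N):\sigma(M)=M\}$. For nonzero $x$, $\tau_x(y)=y-\frac{2B(x,y)}{Q(x)}x$ is the symmetry along $x$. For a symmetry $\sigma$ of a lattice $M$, $Q_M(\sigma)=Q(x)$ where $x$ is a primitive vector of $M$ with $\sigma=\tau_x$. A symmetry $\sigma\in O(M)$ of a ternary lattice $M$ is called special to $M$ if $Q_M(\sigma)\not\equiv 0\pmod p$ when the unimodular Jordan component of $M_p$ has rank $1$, and $Q_M(\sigma)\equiv 0\pmod p$ otherwise. *)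

(* Defs.v *)
From HB Require Import structures.
From mathcomp Require Import all_boot all_order all_algebra.
From mathcomp Require Import finmap.
From mathcomp Require Import boolp classical_sets functions cardinality fsbigop.
Set Implicit Arguments.
Unset Strict Implicit.
Unset Printing Implicit Defensive.
Import Order.TTheory GRing.Theory Num.Theory.
Local Open Scope classical_set_scope.
Local Open Scope ring_scope.

(* Z_p as the inverse limit of the rings Z/p^n: an element is the sequence of
   its canonical residues 0 <= x n < p^n. *)
Record padic_int (p : nat) (pr_p : prime p) := PadicInt {
  padic_res :> nat -> int;
  padic_resP : forall n, padic_res n = (padic_res n.+1 %% p%:Z ^+ n)%Z }.

Section PadicRing.
Variables (p : nat) (pr_p : prime p).
Local Notation Zp := (padic_int pr_p).
Implicit Types x y z : Zp.

Lemma padic_eq x y : (forall n, x n = y n) -> x = y.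
Proof.
case: x y => [x xP] [y yP] /= /funext exy; case: _ / exy yP => yP.
by congr PadicInt; apply: Prop_irrelevance.
Qed.

Lemma padic_mod x n : (x n %% p%:Z ^+ n)%Z = x n.
Proof. by rewrite padic_resP modz_mod. Qed.

Lemma padic_modS x n : (x n.+1 = x n %[mod p%:Z ^+ n])%Z.
Proof. by rewrite padic_mod -padic_resP. Qed.

Fact padic_mk_subproof (f : nat -> int) :
  (forall n, f n.+1 = f n %[mod p%:Z ^+ n])%Z ->
  forall n, (f n %% p%:Z ^+ n)%Z
    = ((f n.+1 %% p%:Z ^+ n.+1)%Z %% p%:Z ^+ n)%Z.
Proof.
move=> fP n; rewrite -fP; apply/eqP; rewrite eqz_mod_dvd exprS.
rewrite {1}(divz_eq (f n.+1) (p%:Z * p%:Z ^+ n)) addrK.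
by rewrite dvdz_mull // dvdz_mull.
Qed.

Definition padic_mk (f : nat -> int)
    (fP : (forall n, f n.+1 = f n %[mod p%:Z ^+ n])%Z) : Zp :=
  PadicInt pr_p (padic_mk_subproof fP).

Fact padic_cst_subproof (c : int) :
  (forall n, c = c %[mod p%:Z ^+ n])%Z.
Proof. by []. Qed.
Fact padic_add_subproof x y :
  (forall n, x n.+1 + y n.+1 = x n + y n %[mod p%:Z ^+ n])%Z.
Proof. by move=> n; rewrite -modzDm !padic_modS modzDm. Qed.
Fact padic_opp_subproof x :
  (forall n, - x n.+1 = - x n %[mod p%:Z ^+ n])%Z.
Proof. by move=> n; rewrite -modzNm padic_modS modzNm. Qed.
Fact padic_mul_subproof x y :
  (forall n, x n.+1 * y n.+1 = x n * y n %[mod p%:Z ^+ n])%Z.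
Proof. by move=> n; rewrite -modzMm !padic_modS modzMm. Qed.

Definition padic_cst (c : int) := padic_mk (padic_cst_subproof c).
Definition padic_add x y := padic_mk (padic_add_subproof x y).
Definition padic_opp x := padic_mk (padic_opp_subproof x).
Definition padic_mul x y := padic_mk (padic_mul_subproof x y).

HB.instance Definition _ := gen_eqMixin Zp.
HB.instance Definition _ := gen_choiceMixin Zp.

Fact padic_addA : associative padic_add.
Proof.
by move=> x y z; apply: padic_eq => n /=; rewrite modzDmr modzDml addrA.
Qed.
Fact padic_addC : commutative padic_add.
Proof. by move=> x y; apply: padic_eq => n /=; rewrite addrC. Qed.
Fact padic_add0 : left_id (padic_cst 0) padic_add.
Proof.
by move=> x; apply: padic_eq => n /=; rewrite modzDml add0r padic_mod.
Qed.
Fact padic_addN : left_inverse (padic_cst 0) padic_opp padic_add.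
Proof.
by move=> x; apply: padic_eq => n /=; rewrite modzDml addNr.
Qed.
HB.instance Definition _ := GRing.isZmodule.Build Zp
  padic_addA padic_addC padic_add0 padic_addN.

Fact padic_mulA : associative padic_mul.
Proof.
by move=> x y z; apply: padic_eq => n /=; rewrite modzMmr modzMml mulrA.
Qed.
Fact padic_mulC : commutative padic_mul.
Proof. by move=> x y; apply: padic_eq => n /=; rewrite mulrC. Qed.
Fact padic_mul1 : left_id (padic_cst 1) padic_mul.
Proof.
by move=> x; apply: padic_eq => n /=; rewrite modzMml mul1r padic_mod.
Qed.
Fact padic_mulD : left_distributive padic_mul padic_add.
Proof.
by move=> x y z; apply: padic_eq => n /=; rewrite modzMml mulrDl modzDm.
Qed.
Fact padic_1neq0 : padic_cst 1 != 0.
Proof.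
apply/eqP => /(congr1 (fun x : Zp => x 1%N)) /=.
by rewrite mod0z expr1 modz_small // ltz_nat prime_gt1.
Qed.
HB.instance Definition _ := GRing.Zmodule_isComNzRing.Build Zp
  padic_mulA padic_mulC padic_mul1 padic_mulD padic_1neq0.

Definition padic_unit : {pred Zp} := fun x => `[< exists y, y * x = 1 >].
Definition padic_inv x : Zp :=
  if pselect (exists y, y * x = 1) is left ex then projT1 (cid ex) else x.

Fact padic_mulV : {in padic_unit, left_inverse 1 padic_inv *%R}.
Proof.
move=> x; rewrite unfold_in /padic_inv => /asboolP ux.
by case: pselect => // ex; case: cid.
Qed.
Fact padic_unitP x y : y * x = 1 -> padic_unit x.
Proof. by move=> xy; apply/asboolP; exists y. Qed.
Fact padic_inv_out : {in [predC padic_unit], padic_inv =1 id}.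
Proof.
move=> x; rewrite inE unfold_in /padic_inv => /asboolP ux.
by case: pselect.
Qed.
HB.instance Definition _ := GRing.ComNzRing_hasMulInverse.Build Zp
  padic_mulV padic_unitP padic_inv_out.

Lemma padic_modD x n k : (x (k + n)%N = x n %[mod p%:Z ^+ n])%Z.
Proof.
elim: k => // k IHk; rewrite -IHk addSn; apply/eqP; rewrite eqz_mod_dvd.
have /eqP := padic_modS x (k + n); rewrite eqz_mod_dvd; apply: dvdz_trans.
by rewrite exprD dvdz_mull.
Qed.

Fact padic_integral : GRing.integral_domain_axiom Zp.
Proof.
move=> x y xy0; case: eqP => //= x0; case: eqP => //= y0.
have nz (z : Zp) : z <> 0 -> exists n, forall k, ~~ (p%:Z ^+ n %| z (k + n)%N)%Z.
  move=> z0; apply: contrapT => /forallNP h; apply: z0; apply: padic_eq => n.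
  move/existsNP: (h n) => [k /negP]; rewrite negbK => /dvdz_mod0P.
  by rewrite padic_modD padic_mod /= mod0z.
have [n xn] := nz _ x0; have [m /(_ n) ym] := nz _ y0; have {}xn := xn m.
rewrite addnC in ym; have := congr1 (fun z : Zp => z (m + n)%N) xy0.
rewrite /= mod0z => /dvdz_mod0P; move: xn ym; rewrite !dvdzE abszM !abszX /=.
move: `|x _|%N `|y _|%N => a b an bm.
have a0 : (0 < a)%N by case: a an => //; rewrite dvdn0.
have b0 : (0 < b)%N by case: b bm => //; rewrite dvdn0.
move: an bm; rewrite !pfactor_dvdn ?muln_gt0 ?a0 // lognM // -!ltnNge => an bm.
by rewrite leqNgt addnC -addnS leq_add // ltnW.
Qed.
HB.instance Definition _ := GRing.ComUnitRing_isIntegral.Build Zp padic_integral.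

End PadicRing.

Notation padic pr_p := {fraction padic_int pr_p}.

(* Quadratic spaces are F^n, in row vectors, with the form given by a symmetric
   matrix G; linear maps are matrices acting on the right. *)

Definition bform (F : fieldType) n (G : 'M[F]_n) (x y : 'rV[F]_n) : F :=
  (x *m G *m y^T) 0 0.

Definition qform (F : fieldType) n (G : 'M[F]_n) (x : 'rV[F]_n) : F :=
  bform G x x.

Definition posdef n (G : 'M[rat]_n) : Prop :=
  G^T = G /\ forall x, x != 0 -> 0 < qform G x.

Definition isometry_of (F : fieldType) n (G : 'M[F]_n) (s : 'M[F]_n) : Prop :=
  s \in unitmx /\ forall x y, bform G (x *m s) (y *m s) = bform G x y.

Definition act (F : fieldType) n (s : 'M[F]_n) (M : set 'rV[F]_n) :
  set 'rV[F]_n := [set x *m s | x in M].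

(* The rows of E form a Z-basis of L. *)
Definition lattice_basis n (E : 'M[rat]_n) (L : set 'rV[rat]_n) : Prop :=
  E \in unitmx /\ L = [set map_mx intr c *m E | c in [set: 'rV[int]_n]].

Definition is_lattice n (L : set 'rV[rat]_n) : Prop :=
  exists E, lattice_basis E L.

Definition lattice_det n (G : 'M[rat]_n) (L : set 'rV[rat]_n) : rat :=
  xget 0 [set \det (E *m G *m E^T) | E in [set E | lattice_basis E L]].

Definition ordq (p : nat) (r : rat) : int :=
  (logn p `|numq r|%N)%:Z - (logn p `|denq r|%N)%:Z.

Definition scale n (G : 'M[rat]_n) (L : set 'rV[rat]_n) : set rat :=
  [set r | exists t : seq (int * ('rV[rat]_n * 'rV[rat]_n)),
     (forall u, u \in t -> L u.2.1 /\ L u.2.2) /\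
     r = \sum_(u <- t) u.1%:~R * bform G u.2.1 u.2.2].

Definition primitive_lattice n (G : 'M[rat]_n) (L : set 'rV[rat]_n) : Prop :=
  scale G L = range (intr : int -> rat).

Definition congq (m : nat) (a b : rat) : Prop :=
  exists k : int, a - b = m%:R * k%:~R.

Definition Lambda n (G : 'M[rat]_n) (m : nat) (L : set 'rV[rat]_n) :
    set 'rV[rat]_n :=
  [set x | L x /\ forall y, L y -> congq m (qform G (x + y)) (qform G y)].

Definition isom_group n (G : 'M[rat]_n) (L : set 'rV[rat]_n) :
    set 'M[rat]_n :=
  [set s | isometry_of G s /\ act s L = L].

Definition isometry_class n (G : 'M[rat]_n) (L : set 'rV[rat]_n) :
    set (set 'rV[rat]_n) :=
  [set act s L | s in isometry_of G].

Definition form_at p (pr_p : prime p) n (G : 'M[rat]_n) : 'M[padic pr_p]_n :=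
  map_mx ratr G.

(* L_p = Z_p (x) L, the Z_p-span of L inside Q_p (x) V. *)
Definition localize p (pr_p : prime p) n (L : set 'rV[rat]_n) :
    set 'rV[padic pr_p]_n :=
  [set v | exists t : seq (padic_int pr_p * 'rV[rat]_n),
     (forall u, u \in t -> L u.2) /\
     v = \sum_(u <- t) tofrac u.1 *: map_mx ratr u.2].
Arguments localize {p} pr_p {n} L.

(* No condition at the real place: both lattices lie on the same space. *)
Definition genus n (G : 'M[rat]_n) (L : set 'rV[rat]_n) :
    set (set 'rV[rat]_n) :=
  [set M | is_lattice M /\
     forall p (pr_p : prime p), exists2 s, isometry_of (form_at pr_p G) s &
       act s (localize pr_p L) = localize pr_p M].

Definition Gamma n (G : 'M[rat]_n) (p : nat) (L N : set 'rV[rat]_n) :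
    set (set 'rV[rat]_n) :=
  [set M | genus G L M /\ Lambda G p M = N].

Definition Gamma_fix n (G : 'M[rat]_n) (p : nat) (L N : set 'rV[rat]_n)
    (s : 'M[rat]_n) : set (set 'rV[rat]_n) :=
  [set M | Gamma G p L N M /\ act s M = M].

Definition tau n (G : 'M[rat]_n) (x y : 'rV[rat]_n) : 'rV[rat]_n :=
  y - (2 * bform G x y / qform G x) *: x.

Definition is_symmetry_along n (G : 'M[rat]_n) (s : 'M[rat]_n)
    (x : 'rV[rat]_n) : Prop :=
  x <> 0 /\ forall y, y *m s = tau G x y.

Definition symmetries n (G : 'M[rat]_n) (N : set 'rV[rat]_n) :
    set 'M[rat]_n :=
  [set s | isom_group G N s /\ exists x, is_symmetry_along G s x].

Definition primitive_vector n (M : set 'rV[rat]_n) (x : 'rV[rat]_n) : Prop :=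
  [/\ M x, x <> 0 &
      forall (k : int) y, M y -> x = k%:~R *: y -> k = 1 \/ k = -1].

Definition symmetry_norm n (G : 'M[rat]_n) (M : set 'rV[rat]_n)
    (s : 'M[rat]_n) : rat :=
  xget 0 [set qform G x | x in
    [set x | primitive_vector M x /\ is_symmetry_along G s x]].

Section Jordan.
Variables (p : nat) (pr_p : prime p) (n : nat).
Local Notation Zp := (padic_int pr_p).
Local Notation Qp := (padic pr_p).
Implicit Types (G : 'M[Qp]_n) (M : set 'rV[Qp]_n) (e : seq 'rV[Qp]_n).

Definition gram_seq G e : 'M[Qp]_(size e) :=
  \matrix_(i, j) bform G e`_i e`_j.

Definition local_basis M e : Prop :=
  free e /\
  M = [set \sum_(i < size e) tofrac (c i) *: e`_i | c in [set: 'I_(size e) -> Zp]].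

Definition modular G (a : int) e : Prop :=
  exists2 U : 'M[Zp]_(size e), U \in unitmx &
    gram_seq G e = (p%:R ^ a) *: map_mx (@tofrac _) U.

(* A Jordan splitting M = J_1 _|_ ... _|_ J_t, given as the sequence of the
   pairs (a_i, basis of J_i) with J_i nonzero and p^(a_i)-modular and with
   a_1 < ... < a_t. *)
Definition jordan_splitting G M (J : seq (int * seq 'rV[Qp]_n)) : Prop :=
  [/\ sorted <%R [seq c.1 | c <- J],
      forall c, c \in J -> c.2 <> [::] /\ modular G c.1 c.2,
      forall c d, c \in J -> d \in J -> c.1 <> d.1 ->
        forall x y, x \in c.2 -> y \in d.2 -> bform G x y = 0
    & local_basis M (flatten [seq c.2 | c <- J])].

Definition unimodular_component G M e : Prop :=
  exists2 J, jordan_splitting G M J & (0, e) \in J.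

End Jordan.

Definition unimodular_rank1 p (pr_p : prime p) n (G : 'M[rat]_n)
    (M : set 'rV[rat]_n) : Prop :=
  exists2 e, unimodular_component (form_at pr_p G) (localize pr_p M) e &
    size e = 1%N.

Definition unimodular_disc p (pr_p : prime p) n (G : 'M[rat]_n)
    (M : set 'rV[rat]_n) (d0 : padic_int pr_p) : Prop :=
  exists2 e, unimodular_component (form_at pr_p G) (localize pr_p M) e &
    \det (gram_seq (form_at pr_p G) e) = tofrac d0.

Definition special p (pr_p : prime p) n (G : 'M[rat]_n) (M : set 'rV[rat]_n)
    (s : 'M[rat]_n) : Prop :=
  symmetries G M s /\
  (unimodular_rank1 pr_p G M -> ~ congq p (symmetry_norm G M s) 0) /\
  (~ unimodular_rank1 pr_p G M -> congq p (symmetry_norm G M s) 0).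

(* x 1 is the residue of x modulo p. *)
Definition legendre p (pr_p : prime p) (x : padic_int pr_p) : rat :=
  let a : 'F_p := (x 1%N)%:~R in
  if a == 0 then 0 else if [exists b : 'F_p, b ^+ 2 == a] then 1 else -1.

(* Only meaningful for finite A (it is 0 otherwise). *)
Definition ncard (T : choiceType) (A : set T) : nat := #|` fset_set A|%fset.

Definition count_classes n (G : 'M[rat]_n) (A : set (set 'rV[rat]_n))
    (k : nat) : nat :=
  ncard [set isometry_class G M | M in
    [set M | A M /\ ncard (isom_group G M) = k]].

(* Main.v *)
(* Since -1 is an isometry, O(N) is the product of {1, -1} and its rotation
   group H, and isometry classes in Gamma are orbits of H on Gamma; a lattice
   with stabiliser of order d has an isometry group of order 2d. A symmetry of N
   is -t for a half turn t in H, and it fixes the same lattices as t.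

   Call the axis of a half turn special to M when the symmetry is. A special axis
   determines M from N (so the centraliser of t stabilises M), three orthogonal
   axes of M contain exactly one special axis, and the axis of a rotation of
   order 4, or of order 3 when p <> 3, is special. At p = 3 a rotation of order 3
   stabilising M forces an element of order 6 in H. Hence the stabilisers that
   occur have order 1, 2, 4, 6, 8 or 12, with 0, 1, 3, 3, 5, 7 half turns of
   which 0, 0, 1, 0, 1, 1 are special as soon as 4 divides |H|, and w, f and s
   are sums over stabiliser orders.

   If |H| = 24, the axes of three orthogonal rotations of order 4 give vectors
   f_i in N / p of common norm 1 or 4. An axis l in N / p with Q(l) prime to p
   is the special axis of a lattice in Gamma if and only if Q(l) d_0 is a square
   modulo p; l = f_1 and l = f_1 + f_2 + f_3 give the Legendre symbols of d_0
   and 3 d_0. *)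

(* The group theory uses no classification of finite rotation groups: it rests on the four facts in
   [crystal_group], and the geometry enters the orbit count only through [special_action]. The
   remainders of w modulo 2 and 3 arise as follows. A stabiliser of order 8 is a Sylow 2-subgroup of
   H, one of order 6 contains a Sylow 3-subgroup and one of order 12 is all of H, while a rotation
   of order 3 or 4 fixes at most one lattice; so each of these orders gives at most one orbit, and
   the residue of w decides whether it occurs. The geometry is expressed by congruences between
   integers: a local isometry yields a map between lattices that preserves B modulo p, which carries
   over ranks and Gram determinants. Conversely, to place a lattice with prescribed axis l in the
   genus, a p-adic isometry has to be exhibited. It is the symmetry along y - l, where y is an axis
   of L with Q(y) = Q(l) modulo p; as in the proof of Witt's theorem, one of y - l and y + l has
   norm prime to p. The prime 3 is an obstacle because averaging over a rotation of order 3 divides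
   by 3. *)
Require Import Defs.
From HB Require Import structures.
From mathcomp Require Import all_boot all_order all_algebra all_fingroup.
From mathcomp Require Import cyclic pgroup nilpotent sylow.
From mathcomp Require Import zify ring lra.
Set Implicit Arguments.
Unset Strict Implicit.
Unset Printing Implicit Defensive.
Import Order.TTheory GRing.Theory Num.Theory.

(** * Finite groups of crystallographic type *)

Section RotationGroups.
Local Open Scope nat_scope.
Local Open Scope group_scope.

(* What the orbit counts use of the group of rotations of a ternary lattice. *)
Record crystal_group (gT : finGroupType) : Prop := CrystalGroup {
  crystal_order : forall g : gT, #[g] \in [:: 1; 2; 3; 4; 6]%N;
  crystal_dihedral : forall g : gT, 2 < #[g] ->
    exists2 h, #[h] = 2 & g ^ h = g^-1;
  crystal_cent3 : forall z a b : gT, #[z] = 3 -> #[a] = 2 -> #[b] = 2 ->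
    commute a z -> commute b z -> a = b;
  crystal_exp2 : forall A : {group gT},
    (forall g, g \in A -> g ^+ 2 = 1) -> #|A| <= 4 }.

Variable gT : finGroupType.
Implicit Types (g h z y a b t : gT) (A K P : {group gT}).

Lemma order2P t : reflect (t <> 1 /\ t * t = 1) (#[t] == 2).
Proof.
apply: (iffP eqP) => [t2|[t1 tt]].
  split=> [t1|]; first by rewrite t1 order1 in t2.
  by have := expg_order t; rewrite t2 expgS expg1.
by apply: nt_prime_order => //; rewrite ?expgS ?expg1 //; apply/eqP.
Qed.

Lemma invol_inv t : #[t] = 2 -> t^-1 = t.
Proof. by move/eqP/order2P=> [_ tt]; apply: (mulgI t); rewrite mulgV tt. Qed.

Lemma order_pow2 z : #[z] = 4 -> #[z ^+ 2] = 2.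
Proof. by move=> z4; rewrite orderXdiv z4. Qed.

Lemma norm_cycle_inv z h : z ^ h = z^-1 -> h \in 'N(<[z]>).
Proof.
by move=> zh; apply/normP; rewrite -cycleJ zh cycleV.
Qed.

Lemma dihedral_not_abelian z h A : 2 < #[z] -> z ^ h = z^-1 ->
  z \in A -> h \in A -> ~~ abelian A.
Proof.
move=> z2 zh zA hA; apply/negP => /centsP cA.
have : z ^ h = z by apply/conjg_fixP/commgP; apply: cA.
rewrite zh => zz; have : z ^+ 2 = 1 by rewrite expgS expg1 -{1}zz mulVg.
by move/eqP; rewrite -order_dvdn => /dvdn_leq - /(_ isT); rewrite leqNgt z2.
Qed.

Lemma card4_order4 A z : #|A| = 4 -> z \in A -> #[z] = 4 -> abelian A.
Proof.
move=> A4 zA z4; suff -> : A :=: <[z]> by apply: cycle_abelian.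
by apply/esym/eqP; rewrite eqEcard cycle_subG zA A4 -z4 orderE leqnn.
Qed.

Lemma conj_order3 z g : #[z] = 3 -> g \in 'N(<[z]>) -> z ^ g = z \/ z ^ g = z^-1.
Proof.
move=> z3 /normP Ng.
have : z ^ g \in <[z]> by rewrite -Ng memJ_conjg cycle_id.
case/cyclePmin => i; rewrite z3 => ilt zg.
have zg1 : z ^ g != 1.
  by rewrite -order_gt1 orderJ z3.
case: i ilt zg => [|[|[|//]]] _ zg; last 1 first.
- right; rewrite zg; apply: (mulgI z); rewrite mulgV -expgS -z3; exact: expg_order.
- by move: zg1; rewrite zg expg0 eqxx.
- by left; rewrite zg expg1.
Qed.

(** Every element of [A] centralises or inverts [z], and the inverting ones fill a single coset of
    the centraliser. *)
Lemma card_cent3 A z h : #[z] = 3 -> z ^ h = z^-1 -> A \subset 'N(<[z]>) ->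
  h \in A -> #|A| <= 2 * #|'C_A[z]|.
Proof.
move=> z3 zh nA hA.
have : A \subset 'C_A[z] :|: ('C_A[z] :* h^-1).
  apply/subsetP => g gA; rewrite inE.
  have [zg|zg] := conj_order3 z3 (subsetP nA g gA).
    apply/orP; left; rewrite inE gA; apply/cent1P.
    by apply: commute_sym; apply/commgP/conjg_fixP.
  apply/orP; right; rewrite mem_rcoset invgK inE groupM //.
  by apply/cent1P/commute_sym/commgP/conjg_fixP; rewrite conjgM zg conjVg zh invgK.
move/subset_leq_card/leq_trans; apply.
by rewrite (leq_trans (leq_card_setU _ _)) // card_rcoset mulSn mul1n.
Qed.

(** The number of Sylow 3-subgroups is the index of the normaliser. The order of the normaliser is a
    multiple of 6, because of [z] and [h], and by hypothesis a multiple of 12 when [A] has order 24.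
    So the index is at most 2, and being 1 modulo 3 it is 1. *)
Lemma Sylow3_normal A z h : #[z] = 3 -> z \in A -> h \in A -> #[h] = 2 ->
  z ^ h = z^-1 -> #|A| = 12 \/ #|A| = 24 /\ 12 %| #|'N_A(<[z]>)| ->
  A \subset 'N(<[z]>).
Proof.
move=> z3 zA hA h2 zh cA.
have sylz : 3.-Sylow(A) <[z]>.
  rewrite pHallE cycle_subG zA /= -orderE z3.
  by case: cA => [->|[-> _]]; rewrite p_part; vm_compute.
have zN : <[z]> \subset 'N_A(<[z]>) by rewrite subsetI cycle_subG zA normG.
have hN : <[h]> \subset 'N_A(<[z]>).
  by rewrite cycle_subG inE hA norm_cycle_inv.
have d3 := cardSg zN; have d2 := cardSg hN; rewrite -!orderE z3 h2 in d3 d2.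
have sN : 'N_A(<[z]>) \subset A by apply: subsetIl.
have L := Lagrange sN.
have := card_Syl_mod A (isT : prime 3); rewrite (card_Syl sylz) => m1.
suff i1 : #|A : 'N_A(<[z]>)| = 1%N.
  by move/eqP: i1; rewrite indexg_eq1 => /subset_trans; apply; apply: subsetIr.
move: L m1 d2 d3; move: #|A : _| => i; move: cA; move: #|_ :&: _| => n cA L m1 d2 d3.
have d6 : 6 %| n by rewrite (@Gauss_dvd 2 3) // d2.
case/dvdnP: d6 => k nE; subst n.
case: cA => [c|[c /dvdnP [k' kE]]]; rewrite c in L; [have : i <= 2|have : i <= 2];
  try nia.
all: case: i m1 L => [|[|[|i]]] //=; lia.
Qed.

(** The subgroup generated by [z] is normal, so the centraliser of [z] has index at most 2 and even
    order; an involution there times [z] has order 6. *)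
Lemma card12_order6 A : crystal_group gT -> #|A| = 12 ->
  (forall z, z \in A -> #[z] = 3 -> exists h, [/\ h \in A, #[h] = 2 & z ^ h = z^-1]) ->
  exists2 y, y \in A & #[y] = 6.
Proof.
move=> cg A12 hA.
have [|z zA z3] := @Cauchy _ 3 A isT; first by rewrite A12.
have [h [hAA h2 zh]] := hA z zA z3.
have nA : A \subset 'N(<[z]>) by apply: (Sylow3_normal z3 zA hAA h2 zh); left.
have cC := card_cent3 z3 zh nA hAA; rewrite A12 in cC.
have d3 : 3 %| #|'C_A[z]|.
  by rewrite -z3 orderE; apply: cardSg; rewrite cycle_subG inE zA cent1id.
have d12 : #|'C_A[z]| %| 12 by rewrite -A12; apply: cardSg; apply: subsetIl.
have d2 : 2 %| #|'C_A[z]|.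
  move: cC d3 d12; move: #|_ :&: _| => n c /dvdnP [k kE] d; subst n.
  have := dvdn_leq (isT : 0 < 12) d.
  by case: k c d => [|[|[|[|[|k]]]]] // _ _; lia.
have [a aC a2] := Cauchy (isT : prime 2) d2.
case/setIP: aC => aA /cent1P az.
exists (a * z); first by rewrite groupM.
by rewrite orderM ?a2 ?z3.
Qed.

(** An element [y] of order 6 would make the subgroup of [z = y ^+ 2] normal, with a centraliser of
    order divisible by 4. A Sylow 2-subgroup of this centraliser has a single involution by
    [crystal_cent3], and no element of order 4 or more, since the product with [z] would have a
    forbidden order; so it is too small. *)
Lemma card24_no_order6 y : crystal_group gT -> #|[set: gT]| = 24 -> #[y] <> 6.
Proof.
move=> cg c24 y6; have [|h h2 yh] := @crystal_dihedral _ cg y; first by rewrite y6.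
pose z := y ^+ 2; have z3 : #[z] = 3 by rewrite orderXdiv y6.
have zh : z ^ h = z^-1 by rewrite /z conjXg yh expgVn.
have hNy : h \notin <[y]>.
  apply/negP => hy; have := @dihedral_not_abelian y h <[y]>%G.
  by rewrite y6 cycle_id cycle_abelian; move/(_ isT yh isT hy).
have yN : <[y]> \subset 'N_[set: gT](<[z]>).
  rewrite setTI cycle_subG; apply/normP; rewrite -cycleJ /z; congr <[_]>.
  by apply/conjg_fixP/commgP/commute_sym/commuteX.
have hN : h \in 'N_[set: gT](<[z]>) by rewrite setTI norm_cycle_inv.
have d12 : 12 %| #|'N_[set: gT](<[z]>)|.
  have := cardSg yN; have : #|<[y]>| < #|'N_[set: gT](<[z]>)|.
    apply: proper_card; apply/properP; split=> //; by exists h.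
  have : #|'N_[set: gT](<[z]>)| %| 24 by rewrite -c24; apply/cardSg/subsetIl.
  rewrite -orderE y6; move: #|_ :&: _| => n d24 lt6 /dvdnP [k kE]; subst n.
  have := dvdn_leq (isT : 0 < 24) d24.
  by case: k lt6 d24 => [|[|[|[|[|k]]]]] // _ _; lia.
have nz : [set: gT] \subset 'N(<[z]>).
  by apply: (@Sylow3_normal [group of [set: gT]] z h) => //; rewrite ?inE //; right.
have := @card_cent3 [group of [set: gT]] z h z3 zh nz (in_setT _).
rewrite /= c24 setTI => c12.
have d4 : 4 %| #|'C[z]|.
  have : #|'C[z]| %| 24 by rewrite -c24; apply/cardSg/subsetT.
  have : 3 %| #|'C[z]| by rewrite -z3 orderE; apply: cardSg; rewrite cycle_subG cent1id.
  move: c12; move: #|'C[_]| => n c /dvdnP [k kE] d; subst n.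
  have := dvdn_leq (isT : 0 < 24) d.
  by case: k c d => [|[|[|[|[|[|[|[|[|k]]]]]]]]] // _ _; lia.
have [P sylP] := Sylow_exists 2 'C[z].
have P4 : 4 %| #|P|.
  by rewrite (card_Hall sylP) p_part -[4]/(2 ^ 2)%N dvdn_exp2l // -pfactor_dvdn // cardG_gt0.
have [|a aP a2] := @Cauchy _ 2 P isT; first exact: dvdn_trans P4.
have PC : P \subset 'C[z] := pHall_sub sylP.
have all1 b : b \in P -> b != 1 -> b = a.
  move=> bP b1; have bz : commute b z by apply/cent1P/(subsetP PC).
  have az : commute a z by apply/cent1P/(subsetP PC).
  apply: (crystal_cent3 cg z3 _ a2 bz az).
  have : 2.-elt b by apply: mem_p_elt bP; apply: pHall_pgroup sylP.
  have := crystal_order cg b; rewrite !inE /p_elt.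
  rewrite order_eq1 (negPf b1) /=.
  case/or4P => /eqP bE; rewrite bE // => _.
  have := crystal_order cg (b * z); rewrite orderM ?bE ?z3 //.
have : #|P| <= #|[set 1; a]|.
  apply/subset_leq_card/subsetP => b bP; rewrite !inE.
  by case: eqP => //= /eqP b1; rewrite (all1 b).
rewrite cards2; have := dvdn_leq (cardG_gt0 _) P4; by clear; case: (_ != _); lia.
Qed.

Lemma card8_order4 A : crystal_group gT -> #|A| = 8 ->
  exists2 z, z \in A & #[z] = 4.
Proof.
move=> cg A8; case: (pickP [pred z in A | #[z] == 4]) => [z /andP [zA /eqP z4]|none].
  by exists z.
suff : #|A| <= 4 by rewrite A8.
apply: (crystal_exp2 cg) => g gA; apply/eqP; rewrite -order_dvdn.
have := none g; rewrite /= gA /= => g4.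
have := order_dvdG gA; rewrite A8; have := crystal_order cg g.
by rewrite !inE g4 => /or4P [|||/orP []] // /eqP ->.
Qed.

Definition involutions A := [set t in A | #[t] == 2].

(** The involutions are [z ^+ n] and the 2n elements of the coset [h *: <[z]>]; the first commutes
    with the others because [h] inverts [z]. *)
Lemma card_involutions_dihedral A z n : 2 < #[z] -> #[z] = n.*2 -> #|A| = n.*2.*2 ->
  z \in A -> (exists2 h, h \in A & #[h] = 2 /\ z ^ h = z^-1) ->
  #|involutions A| = n.*2.+1 /\ {in involutions A, forall t, commute t (z ^+ n)}.
Proof.
move=> z2 zn An zA [h hA [h2 zh]].
have hz : h \notin <[z]>.
  apply/negP => hz; have := @dihedral_not_abelian z h <[z]>%G.
  by rewrite cycle_id cycle_abelian; move/(_ z2 zh isT hz).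
have n0 : 0 < n by have := order_gt0 z; rewrite zn double_gt0.
have zn2 : #[z ^+ n] = 2 by rewrite orderXdiv zn -muln2 ?dvdn_mulr // mulKn.
have AE : A :=: <[z]> :|: (h *: <[z]>).
  apply/esym/eqP; rewrite eqEcard subUset cycle_subG zA /=.
  rewrite mul_subG ?sub1set // ?cycle_subG // cardsU card_lcoset -orderE zn.
  rewrite [_ :&: _](_ : _ = set0) ?cards0 ?subn0 ?addnn ?An //; first exact: leqnn.
  apply/setP => u; rewrite !inE mem_lcoset; apply/negP => /andP [uz hu].
  by case/negP: hz; rewrite -groupV -(mulgK u h^-1) groupMr // groupV.
have hzi i : (h * z ^+ i) * (h * z ^+ i) = 1.
  have hh : h^-1 = h by apply: invol_inv.
  have := conjXg z h i; rewrite zh /conjg hh expgVn => e.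
  by rewrite mulgA -(mulgA h (z ^+ i)) e mulVg.
have inE' : involutions A = (z ^+ n) |: (h *: <[z]>).
  apply/setP => t; rewrite !inE; apply/idP/idP.
    case/andP; rewrite AE inE => /orP [|-> _]; last by rewrite orbT.
    case/cyclePmin => i ilt -> /order2P [zi1 zi2]; apply/orP; left.
    have : #[z] %| i + i by rewrite order_dvdn expgD zi2.
    rewrite zn addnn -!muln2 dvdn_pmul2r // => /dvdnP [k kE].
    rewrite zn -muln2 in ilt; have : k < 2 by nia.
    by case: k kE => [|[|//]] iE _; rewrite iE ?mul1n // mul0n in zi1 *.
  case/orP => [/eqP ->|]; first by rewrite zn2 groupX.
  move=> th; rewrite AE inE th orbT /=; case/lcosetP: th => u /cycleP [i ->] ->.
  apply/order2P; split=> // e; case/negP: hz.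
  by rewrite (canRL (mulgK _) e) mul1g groupV mem_cycle.
split.
  rewrite inE' cardsU1 card_lcoset -orderE zn mem_lcoset.
  suff -> : h^-1 * z ^+ n \notin <[z]> by [].
  by apply: contra hz; rewrite groupMr ?mem_cycle // groupV.
move=> t; rewrite inE' !inE => /orP [/eqP ->//|/lcosetP [u /cycleP [i ->] ->]].
apply: commute_sym; apply: commuteM; last exact/commuteX2.
by apply/commgP/conjg_fixP; rewrite conjXg zh expgVn invol_inv.
Qed.

Lemma card_involutions_V4 A : #|A| = 4 -> (forall z, z \in A -> #[z] <> 4) ->
  exists a b, [/\ #[a] = 2, #[b] = 2, a <> b, commute a b &
    A :=: [set 1; a; b; a * b]] /\ involutions A = [set a; b; a * b].
Proof.
move=> A4 no4.
have two t : t \in A -> t != 1 -> #[t] = 2.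
  move=> tA t1; have := order_dvdG tA; rewrite A4 => /dvdn_leq - /(_ isT) le4.
  have := order_dvdG tA; rewrite A4; have := order_gt1 t; rewrite t1.
  by case: #[t] (no4 t tA) le4 => [|[|[|[|[|]]]]].
have [a aA a1] : exists2 a, a \in A & a != 1.
  by apply/trivgPn; rewrite -cardG_gt1 A4.
have a2 := two a aA a1.
have [b bA bna] : exists2 b, b \in A & b \notin <[a]>.
  by apply/subsetPn; apply/negP => /subset_leq_card; rewrite A4 -orderE a2.
have b1 : b != 1 by apply: contraNneq bna => ->.
have b2 := two b bA b1.
have ab : a <> b by move=> e; rewrite e cycle_id in bna.
have ab1 : a * b != 1.
  by apply/eqP => e; apply: ab; rewrite -[RHS]invol_inv // -(canRL (mulgK _) e) mul1g invol_inv // invol_inv || rewrite (canRL (mulgK _) e) mul1g invol_inv.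
have ab2 := two _ (groupM aA bA) ab1.
have cab : commute a b.
  have := invol_inv ab2; rewrite invMg !invol_inv // /commute => ->; exact: erefl.
have aab : a * b != a by rewrite -{2}(mulg1 a) (inj_eq (mulgI a)).
have bab : a * b != b by rewrite -{2}(mul1g b) (inj_eq (mulIg b)).
have AE : A :=: [set 1; a; b; a * b].
  apply/esym/eqP; rewrite eqEcard; apply/andP; split.
    by rewrite !subUset !sub1set group1 aA bA groupM.
  have -> : [set 1; a; b; a * b] = (a * b) |: (b |: (a |: [set 1])).
    by apply/setP => u; rewrite !inE; case: (u == 1); case: (u == a); case: (u == b); case: (u == a * b).
  rewrite A4 !cardsU1 !inE cards1 (negPf ab1) (negPf aab) (negPf bab) (negPf a1) (negPf b1).
  by rewrite (introF eqP (nesym ab)).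
exists a, b; split; first by split.
apply/setP => u; rewrite !inE AE !inE.
case: (eqVneq u 1) => [->|u1] /=.
  by rewrite order1 !(eq_sym 1) (negPf a1) (negPf b1) (negPf ab1).
apply: andb_idr; case/orP => [/orP [/eqP ->|/eqP ->]|/eqP ->]; exact/eqP.
Qed.

Lemma card_involutions6 A : #|A| = 6 -> (forall y, y \in A -> #[y] <> 6) ->
  (forall y, y \in A -> #[y] <> 4) -> #|involutions A| = 3.
Proof.
move=> A6 no6 no4.
have [|z zA z3] := @Cauchy _ 3 A isT; first by rewrite A6.
have zi : #|A : <[z]>| = 2 by rewrite -divgS ?cycle_subG // A6 -orderE z3.
have zs : <[z]> \subset A by rewrite cycle_subG.
suff -> : involutions A = A :\: <[z]>.
  by rewrite cardsD (setIidPr zs) A6 -orderE z3.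
apply/setP => t; rewrite !inE andbC; case: (boolP (t \in A)) => tA; rewrite ?andbF // !andbT.
apply/idP/idP => [/eqP t2|tz].
  apply/negP => /order_dvdG; rewrite -orderE z3 t2 //.
have t1 : t != 1 by apply: contraNneq tz => ->.
have nz : <[z]> <| A by apply: index2_normal.
have d := order_dvdG tA; rewrite A6 in d.
have le6 := dvdn_leq (isT : 0 < 6) d; have gt1 := order_gt1 t; rewrite t1 in gt1.
case E : #[t] d le6 gt1 (no6 t tA) (no4 t tA) => [|[|[|[|[|[|[|k]]]]]]] // _ _ _ _ _.
case/negP: tz.
have sz : 3.-Sylow(A) <[z]> by rewrite pHallE zs A6 -orderE z3 p_part.
by rewrite (mem_normal_Hall sz nz tA) /p_elt E.
Qed.

(* The Klein group core: the 2-element z permutes the two cosets other than P,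
   so its square fixes every coset. *)
Lemma card24_frame : crystal_group gT -> #|[set: gT]| = 24 ->
  exists z g, [/\ #[z] = 4, #[g] = 3, commute (z ^+ 2) ((z ^+ 2) ^ g)
    & z ^+ 2 <> (z ^+ 2) ^ g].
Proof.
move=> cg c24.
have [P sylP] := Sylow_exists 2 [set: gT].
have P8 : #|P| = 8 by rewrite (card_Hall sylP) c24 p_part.
have [z zP z4] := card8_order4 cg P8.
have [|g _ g3] := @Cauchy _ 3 [set: gT] isT; first by rewrite c24.
have zs : <[z]> \subset P by rewrite cycle_subG.
have zi : #|P : <[z]>| = 2 by rewrite -divgS // P8 -orderE z4.
have nz : P \subset 'N(<[z]>) by have /andP [] := index2_normal zs zi.
have z22 := order_pow2 z4.
(* [z ^+ 2] is the only involution of the subgroup generated by [z], which has index 2 and is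
   normalised by [P]. *)
have Pc u : u \in P -> commute u (z ^+ 2).
  move=> uP; have zu : (z ^+ 2) ^ u \in <[z]>.
    by rewrite memJ_norm ?(subsetP nz) // mem_cycle.
  apply: commute_sym; apply/commgP/conjg_fixP.
  case/cyclePmin: zu => i; rewrite z4 => ilt e.
  have : #[(z ^+ 2) ^ u] = 2 by rewrite orderJ.
  rewrite e; case: i ilt e => [|[|[|[|//]]]] _ e.
  - by rewrite expg0 order1.
  - by rewrite expg1 z4.
  - by [].
  - by rewrite orderXgcd z4.
exists z, g; split=> //; last first.
  (* If the two involutions coincided, [z ^+ 2] would commute with [g] and the product would have
     order 6. *)
  move=> e; apply: (@card24_no_order6 (z ^+ 2 * g) cg c24).
  rewrite orderM ?z22 ?g3 //; by apply/commgP/conjg_fixP.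
suff : (z ^+ 2) ^ g^-1 \in P.
  move/Pc => e; have := congr1 (conjg^~ g) (e : _ = _).
  by rewrite /= (conjMg ((z ^+ 2) ^ g^-1)) (conjMg (z ^+ 2)) conjgKV.
have gP : g \notin P.
  by apply/negP => /order_dvdG; rewrite g3 P8.
have ggP : g * g \notin P.
  have -> : g * g = g^-1.
    by apply: (mulgI g); rewrite mulgV -(expg_order g) g3 !expgS expg0 mulg1.
  by rewrite groupV.
(* A fourth right coset of [P] would bring the number of elements to 32. *)
have cos u : [|| u \in P, u * g^-1 \in P | u * (g * g)^-1 \in P].
  apply/negPn/negP; rewrite !negb_or => /and3P [uP ug ugg].
  have : #|P :|: (P :* g) :|: (P :* (g * g)) :|: (P :* u)| <= 24.
    by rewrite -c24 subset_leq_card // subsetT.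
  have dis a b : b * a^-1 \notin P -> [disjoint P :* a & P :* b].
    move=> ab; rewrite -setI_eq0; apply/eqP/setP => v; rewrite !inE !mem_rcoset.
    apply/negP => /andP [va vb]; case/negP: ab.
    by rewrite -(mulgKV v b) -mulgA groupM // -groupV invMg invgK.
  have cU (B C : {set gT}) : [disjoint B & C] -> #|B :|: C| = (#|B| + #|C|)%N.
    by move=> d; apply/eqP; rewrite -(leq_card_setU B C).2 in d *.
  rewrite -{1}(rcoset1 P) !cU ?card_rcoset ?P8 //.
  - by apply: dis; rewrite invg1 mulg1.
  - rewrite disjoints_subset subUset -!disjoints_subset; apply/andP; split; apply: dis.
      by rewrite invg1 mulg1.
    by rewrite -mulgA mulgV mulg1.
  - rewrite disjoints_subset !subUset -!disjoints_subset -andbA; apply/and3P; split; apply: dis => //.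
    by rewrite invg1 mulg1.
have zPP : z ^+ 2 \in P by rewrite groupX.
rewrite conjgE invgK expgS expg1.
case/or3P: (cos (g * z)) => H1.
- by case/negP: gP; rewrite -(mulgK z g) groupMr // groupV.
- have -> : g * (z * z * g^-1) = (g * z * g^-1) * (g * z * g^-1).
    by rewrite !mulgA mulgKV.
  by rewrite groupM.
case/or3P: (cos (g * g * z)) => H2.
- by case/negP: ggP; rewrite -(mulgK z (g * g)) groupMr // groupV.
- have -> : g * (z * z * g^-1) = (g * z * (g * g)^-1) * (g * g * z * g^-1).
    by rewrite invMg !mulgA !mulgKV.
  by rewrite groupM.
case/negP: gP; have := groupM H2 (groupVr H1).
by rewrite !invMg !invgK !mulgA !mulgKV !mulgK.
Qed.

(** In a Sylow 2-subgroup [P] through [t], which has order at least 4, the normaliser of [<[t]>] is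
    strictly larger than [<[t]>], because normalisers grow in nilpotent groups; normalising a group
    of order 2 means centralising it. *)
Lemma invol_cent4 t : #[t] = 2 -> 4 %| #|[set: gT]| -> 4 %| #|'C[t]|.
Proof.
move=> t2 d4; have [||P sylP tP] := @Sylow_superset 2 _ [group of [set: gT]] <[t]>%G; rewrite ?subsetT //; first by rewrite /pgroup -orderE t2.
have pP := pHall_pgroup sylP.
have P4 : 4 %| #|P|.
  by rewrite (card_Hall sylP) p_part -[4]/(2 ^ 2)%N dvdn_exp2l // -pfactor_dvdn // cardG_gt0.
have NE : 'N_P(<[t]>) \subset 'C[t].
  apply/subsetP => u /setIP [_ /normP uN]; apply/cent1P/commute_sym/commgP/conjg_fixP.
  have : t ^ u \in <[t]> by rewrite -uN memJ_conjg cycle_id.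
  case/cyclePmin => i; rewrite t2; case: i => [|[|//]] _ e; last by rewrite e expg1.
  by have : #[t ^ u] = 2 by [rewrite orderJ]; rewrite e order1.
have pr : <[t]> \proper P.
  rewrite properEcard tP -orderE t2; have := dvdn_leq (cardG_gt0 _) P4; lia.
have := nilpotent_proper_norm (pgroup_nil pP) pr => /proper_card; rewrite -orderE t2 => lt2.
have pN : 2.-group 'N_P(<[t]>) by apply: pgroupS pP; apply: subsetIl.
apply: dvdn_trans (cardSg NE).
have [k kE] := p_natP pN; rewrite kE in lt2 *.
by case: k kE lt2 => [|[|k]] // kE _; rewrite (dvdn_exp2l 2 (isT : 2 <= k.+2)).
Qed.

End RotationGroups.

(** * Orbit counting from stabilisers and special half turns *)

Section OrbitCounting.
Local Open Scope nat_scope.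
Local Open Scope group_scope.

(* [sp M t] stands for: the symmetry [- t] is special to the lattice [M]. *)
Record special_action (gT : finGroupType) (X : finType)
    (to : {action gT &-> X}) (sp : X -> gT -> bool) : Prop := SpecialAction {
  special_invol : forall M t, sp M t -> t \in 'C[M | to] /\ #[t] = 2;
  special_cent : forall M t, sp M t -> 'C[t] \subset 'C[M | to];
  special_inj : forall M M' t, sp M t -> sp M' t -> M = M';
  special_V4 : forall M a b, a \in 'C[M | to] -> b \in 'C[M | to] ->
    #[a] = 2 -> #[b] = 2 -> a <> b -> commute a b ->
    (sp M a + sp M b + sp M (a * b)%g)%N = 1%N;
  special_order4 : forall M z, z \in 'C[M | to] -> #[z] = 4 -> sp M (z ^+ 2);
  special_order6 : forall M z, #|[set: gT]| = 12 -> z \in 'C[M | to] ->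
    #[z] = 6 -> sp M (z ^+ 3);
  special_order3 : forall M z, z \in 'C[M | to] -> #[z] = 3 ->
    ('N(<[z]>) \subset 'C[M | to] /\
       forall M', z \in 'C[M' | to] -> M' = M) \/
    (#|[set: gT]| <> 12 /\ exists y : gT, #[y] = 6) }.

Variables (gT : finGroupType) (X : finType) (to : {action gT &-> X}).
Variable sp : X -> gT -> bool.
Hypothesis cg : crystal_group gT.
Hypothesis sa : special_action to sp.
Hypothesis cardG : #|[set: gT]| \in [:: 1; 2; 4; 6; 8; 12; 24]%N.
Implicit Types (M : X) (t z g h : gT).

Definition stab_count d := #|[set M | #|'C[M | to]| == d]|.
Definition orbit_count d :=
  #|[set orbit to [set: gT] M | M in [set M | #|'C[M | to]| == d]]|.

Lemma orbit_countM d : (stab_count d * d = #|[set: gT]| * orbit_count d)%N.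
Proof.
set S := [set M | #|'C[M | to]| == d].
have actS : [acts [set: gT], on S | to].
  apply/actsP => g _ M; rewrite !inE astab1_act cardJg //.
rewrite /stab_count -/S -(acts_sum_card_orbit actS) big_distrl /=.
rewrite (eq_bigr (fun=> #|[set: gT]|)); last first.
  move=> T /imsetP [M]; rewrite inE => /eqP Md ->.
  by rewrite card_orbit setTI -Md mulnC Lagrange ?subsetT.
by rewrite sum_nat_const mulnC.
Qed.

(** The order of the group would be 6 or 24. In order 6 the group would be generated by [y],
    although some element inverts [y]. *)
Lemma no_order6 (y : gT) : #|[set: gT]| <> 12 -> #[y] <> 6.
Proof.
move=> n12 y6; have := order_dvdG (in_setT y); rewrite y6.
move: cardG n12; rewrite !inE => /or4P [/eqP c|/eqP c|/eqP c|/or4P [/eqP c|/eqP c|/eqP c|/eqP c]];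
  rewrite c // => _ _; last exact: (card24_no_order6 cg c y6).
have [|h h2 yh] := @crystal_dihedral _ cg y; first by rewrite y6.
have cy : <[y]> = [set: gT].
  by apply/eqP; rewrite eqEcard subsetT c -orderE y6.
have := @dihedral_not_abelian _ y h [group of [set: gT]].
by rewrite y6 !inE /= -cy cycle_abelian => /(_ isT yh isT isT).
Qed.

Lemma stab_order3 M z : z \in 'C[M | to] -> #[z] = 3 ->
  'N(<[z]>) \subset 'C[M | to] /\ forall M', z \in 'C[M' | to] -> M' = M.
Proof.
move=> zK z3; case: (special_order3 sa zK z3) => // -[n12 [y y6]].
by case: (no_order6 n12 y6).
Qed.

(** For order 3 the inverter normalises [<[z]>]; for order 4 it centralises [z ^+ 2], which is
    special to [M]. Either property forces it into the stabiliser. *)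
Lemma stab_inverter M z : z \in 'C[M | to] -> 2 < #[z] -> #[z] <> 6 ->
  exists h, [/\ h \in 'C[M | to], #[h] = 2 & z ^ h = z^-1].
Proof.
move=> zK z2 z6; have [h h2 zh] := crystal_dihedral cg z2; exists h; split=> //.
have o := crystal_order cg z; rewrite !inE in o.
case/or4P: o => [/eqP zE|/eqP zE|/eqP zE|/orP [/eqP zE|/eqP zE //]].
- by rewrite zE in z2.
- by rewrite zE in z2.
- have [nK _] := stab_order3 zK zE; apply: (subsetP nK).
  exact: norm_cycle_inv.
- have s2 := special_order4 sa zK zE; apply: (subsetP (special_cent sa s2)).
  apply/cent1P/commute_sym/commgP/conjg_fixP; rewrite conjXg zh expgVn.
  by rewrite invol_inv // order_pow2.
Qed.

Lemma special_dvd4 M t : 4 %| #|[set: gT]| -> sp M t -> 4 %| #|'C[M | to]|.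
Proof.
move=> d4 st; have [_ t2] := special_invol sa st.
apply: dvdn_trans (invol_cent4 t2 d4) _; apply: cardSg; exact: special_cent st.
Qed.

Definition special_set M := [set t | sp M t].

(** A second special involution would commute with [c] and generate with it a Klein group containing
    two special involutions. *)
Lemma special_set_eq M c : sp M c ->
  {in involutions 'C[M | to], forall t, commute t c} -> special_set M = [set c].
Proof.
move=> sc ct; apply/setP => t; rewrite !inE; apply/idP/eqP => [st|-> //].
have [tK t2] := special_invol sa st; have [cK c2] := special_invol sa sc.
apply/eqP; apply: contraT => /eqP tc.
have ctc : commute t c by apply: ct; rewrite inE tK t2.
by have := special_V4 sa tK cK t2 c2 tc ctc; rewrite st sc.
Qed.

(** The entries at 1, 2, 4, 6, 8 and 12 are the numbers of involutions in the trivial group, C_2,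
    the Klein group, S_3 and the dihedral groups of orders 8 and 12; the others are fillers. *)
Definition invol_number k :=
  nth 0 [:: 0; 0; 1; 0; 3; 0; 3; 0; 5; 0; 0; 0; 7]%N k.
Definition special_number k := nat_of_bool (k \in [:: 4; 8; 12]%N).

Lemma special_set0 M : 4 %| #|[set: gT]| -> ~~ (4 %| #|'C[M | to]|) ->
  #|special_set M| = 0%N.
Proof.
move=> d4 nd; apply/eqP; rewrite cards_eq0 -subset0; apply/subsetP => t.
rewrite !inE => st; case/negP: nd; exact: special_dvd4 st.
Qed.

(** An element of order 3 or 4 of the stabiliser is inverted inside it, which rules out order 3 and
    cyclic groups of order 4. A stabiliser of order 6 contains the normaliser of a subgroup of order
    3, which is everything in a group of order 12. A stabiliser of order 12 contains an element of
    order 6, which exists only in a group of order 12. *)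
Lemma stab_table M :
  [/\ #|'C[M | to]| \in [:: 1; 2; 4; 6; 8; 12]%N,
      #|involutions 'C[M | to]| = invol_number #|'C[M | to]|,
      4 %| #|[set: gT]| -> #|special_set M| = special_number #|'C[M | to]|
    & (#|'C[M | to]| = 6 -> #|[set: gT]| <> 12) /\
      (#|'C[M | to]| = 12 -> #|[set: gT]| = 12)].
Proof.
set K := 'C[M | to]; have dK : #|K| %| #|[set: gT]| by apply/cardSg/subsetT.
have : #|K| \in [:: 1; 2; 3; 4; 6; 8; 12; 24]%N.
  move: cardG dK; rewrite !inE => /or4P [/eqP c|/eqP c|/eqP c|/or4P [/eqP c|/eqP c|/eqP c|/eqP c]];
  rewrite c; have := cardG_gt0 'C[M | to]; rewrite -/K; move: #|K| => k k0 kd;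
  have := dvdn_leq (ltn0Sn _) kd; move: kd k0; do 25 (case: k => [|k] //).
have no6 y : #|[set: gT]| <> 12 -> #[y] <> 6 := @no_order6 y.
have s0 : ~~ (4 %| #|K|) -> 4 %| #|[set: gT]| -> #|special_set M| = 0%N.
  by move=> nd d4; apply: special_set0.
have K3 z : z \in K -> #[z] = 3 -> exists h, [/\ h \in K, #[h] = 2 & z ^ h = z^-1].
  by move=> zK z3; apply: stab_inverter; rewrite // z3.
rewrite !inE => /or4P [/eqP k|/eqP k|/eqP k|/or4P [/eqP k|/eqP k|/eqP k|/orP [/eqP k|/eqP k]]];
  rewrite k.
- split; [by []| |by move=> d; apply: s0; rewrite ?k|by []].
  apply/eqP; rewrite cards_eq0 -subset0; apply/subsetP => t /setIdP [tK /eqP t2].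
  by have := order_dvdG (tK : t \in 'C[M | to]%G); rewrite t2 k.
- split; [by []| |by move=> d; apply: s0; rewrite ?k|by []].
  have [|t tK t2] := @Cauchy _ 2 'C[M | to]%G isT; first by rewrite /= -/K k.
  rewrite [involutions _](_ : _ = [set t]) ?cards1 //.
  have KE : K = <[t]>.
    by apply/esym/eqP; rewrite eqEcard cycle_subG tK -orderE t2 k.
  apply/setP => u; rewrite in_set1; apply/setIdP/eqP => [[]|->]; rewrite /= -/K KE.
    case/cyclePmin => i; rewrite t2 => ilt -> /eqP.
    by case: i ilt => [|[|]] //; rewrite ?order1 ?expg1.
  by rewrite cycle_id t2.
- have [|z zK z3] := @Cauchy _ 3 'C[M | to]%G isT; first by rewrite /= -/K k.
  have [h [hK h2 _]] := K3 z zK z3.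
  by have := order_dvdG (hK : h \in 'C[M | to]%G); rewrite h2 /= -/K k.
- have no4 z : z \in K -> #[z] <> 4.
    move=> zK z4; have [||h [hK _ zh]] := @stab_inverter M z zK; rewrite ?z4 //.
    have := @dihedral_not_abelian _ z h 'C[M | to]%G.
    by rewrite z4 (@card4_order4 _ 'C[M | to]%G z) // => /(_ isT zh zK hK).
  have [a [b [[a2 b2 ab cab KE] IE]]] := @card_involutions_V4 _ 'C[M | to]%G k no4.
  have [aK bK] : a \in K /\ b \in K by rewrite /K KE !inE !eqxx !orbT.
  have I3 : #|involutions 'C[M | to]| = 3.
    rewrite IE; have -> : [set a; b; a * b] = (a * b) |: [set a; b].
      by apply/setP => u; rewrite !inE orbC.
    have a1 : a != 1 by rewrite -order_gt1 a2.
    have b1 : b != 1 by rewrite -order_gt1 b2.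
    rewrite cardsU1 cards2 !inE -{2}(mulg1 a) (inj_eq (mulgI a)) (negPf b1).
    by rewrite -{2}(mul1g b) (inj_eq (mulIg b)) (negPf a1) (introN eqP ab).
  split=> // _; have := special_V4 sa aK bK a2 b2 ab cab.
  have sI t : sp M t -> t \in [set a; b; a * b].
    by move=> st; rewrite -IE inE; have [-> ->] := special_invol sa st.
  have sE c : sp M c -> (forall t, t \in [set a; b; a * b] -> sp M t -> t = c) ->
      #|special_set M| = 1%N.
    move=> sc u; rewrite [special_set M](_ : _ = [set c]) ?cards1 //.
    apply/setP => t; rewrite !inE; apply/idP/eqP => [st|-> //].
    by apply: u => //; apply: sI.
  case Ea: (sp M a); case Eb: (sp M b); case Eab: (sp M (a * b)) => // _.
  + apply: (sE a) => // t; rewrite !inE => /orP [/orP [/eqP ->|/eqP ->]|/eqP ->] //.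
      by rewrite Eb.
    by rewrite Eab.
  + apply: (sE b) => // t; rewrite !inE => /orP [/orP [/eqP ->|/eqP ->]|/eqP ->] //.
      by rewrite Ea.
    by rewrite Eab.
  + apply: (sE (a * b)) => // t; rewrite !inE => /orP [/orP [/eqP ->|/eqP ->]|/eqP ->] //.
      by rewrite Ea.
    by rewrite Eb.
- have n12 : #|[set: gT]| <> 12.
    move=> c12; have [|z zK z3] := @Cauchy _ 3 'C[M | to]%G isT; first by rewrite /= -/K k.
    have [h [hK h2 zh]] := K3 z zK z3; have [nK _] := stab_order3 zK z3.
    have nz : [group of [set: gT]] \subset 'N(<[z]>).
      by apply: (@Sylow3_normal _ [group of [set: gT]] z h); rewrite ?inE //; left.
    by have := subset_leq_card (subset_trans nz nK); rewrite /= -/K k c12.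
  split; [by []| |by move=> d; apply: s0; rewrite ?k|by []].
  apply: card_involutions6 => // y yK; first exact: no6.
  by move=> y4; have := order_dvdG yK; rewrite y4 /= -/K k.
- have [z zK z4] := @card8_order4 _ 'C[M | to]%G cg k.
  have [||h [hK h2 zh]] := stab_inverter zK; rewrite ?z4 //.
  have [|||||I5 cI] := @card_involutions_dihedral _ 'C[M | to]%G z 2; rewrite ?z4 //.
    by exists h.
  split=> // _; rewrite (special_set_eq (special_order4 sa zK z4)) ?cards1 //.
- have c12 : #|[set: gT]| = 12.
    case: (eqVneq #|[set: gT]| 12) => // /eqP n12.
    have [y _ y6] := @card12_order6 _ 'C[M | to]%G cg k K3.
    by case: (no6 y n12 y6).
  have [y yK y6] := @card12_order6 _ 'C[M | to]%G cg k K3.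
  have [|h h2 yh] := @crystal_dihedral _ cg y; first by rewrite y6.
  have hK : h \in K.
    have -> : K = [set: gT] by apply/eqP; rewrite eqEcard subsetT k c12.
    by rewrite inE.
  have [|||||I5 cI] := @card_involutions_dihedral _ 'C[M | to]%G y 3; rewrite ?y6 //.
    by exists h.
  split=> // _; rewrite (special_set_eq (special_order6 sa c12 yK y6)) ?cards1 //.
(* Order 24 does not occur: [card24_frame] would give two commuting special involutions in a Klein
   group. *)
- have c24 : #|[set: gT]| = 24.
    move: cardG dK; rewrite k !inE => /or4P [/eqP c|/eqP c|/eqP c|/or4P [/eqP c|/eqP c|/eqP c|/eqP c]]; by rewrite c.
  have KT : K = [set: gT] by apply/eqP; rewrite eqEcard subsetT k c24.
  have [z [g [z4 g3 cz nz]]] := card24_frame cg c24.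
  have inK u : u \in K by rewrite KT inE.
  have s1 := special_order4 sa (inK z) z4.
  have s2 : sp M ((z ^+ 2) ^ g).
    by rewrite conjXg; apply: (special_order4 sa (inK _)); rewrite orderJ.
  have := special_V4 sa (inK _) (inK _) (order_pow2 z4) (etrans (orderJ _ _) (order_pow2 z4)) nz cz.
  by rewrite s1 s2.
Qed.

Lemma sum_stab (F : nat -> nat) :
  \sum_M F #|'C[M | to]| =
  (\sum_(k <- [:: 1; 2; 4; 6; 8; 12]) stab_count k * F k)%N.
Proof.
rewrite (eq_bigr (fun M => \sum_(k <- [:: 1; 2; 4; 6; 8; 12]%N | k == #|'C[M | to]|) F k)%N).
  rewrite (exchange_big_dep predT) //=; apply: eq_bigr => k _.
  rewrite sum_nat_const; congr muln; rewrite /stab_count -sum1dep_card -sum1_card.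
  by apply: eq_bigl => M; apply: eq_sym.
move=> M _; have [kM _ _ _] := stab_table M.
by rewrite -big_filter filter_pred1_uniq ?big_seq1.
Qed.

Lemma card_stab_sum :
  #|X| = (\sum_(k <- [:: 1; 2; 4; 6; 8; 12]) stab_count k)%N.
Proof.
rewrite -sum1_card (sum_stab (fun=> 1%N)); apply: eq_bigr => k _; exact: muln1.
Qed.

Lemma fix_stab_sum : (\sum_(t : gT | #[t] == 2) #|'Fix_to[t]|)%N =
  (\sum_(k <- [:: 1; 2; 4; 6; 8; 12]) stab_count k * invol_number k)%N.
Proof.
rewrite -sum_stab (eq_bigr (fun t => \sum_(M | t \in 'C[M | to]) 1)%N); last first.
  move=> t _; rewrite -sum1_card; apply: eq_bigl => M.
  by apply/afix1P/astab1P.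
rewrite (exchange_big_dep predT) //=; apply: eq_bigr => M _.
have [_ <- _ _] := stab_table M.
by rewrite sum1dep_card; apply: eq_card => t; rewrite !inE andbC.
Qed.

(** By [special_inj] a special involution belongs to one lattice only, so counting these involutions
    amounts to counting pairs. *)
Lemma special_stab_sum : 4 %| #|[set: gT]| ->
  #|[set t | [exists M, sp M t]]| =
  (\sum_(k <- [:: 1; 2; 4; 6; 8; 12]) stab_count k * special_number k)%N.
Proof.
move=> d4; rewrite -sum_stab.
rewrite (eq_bigr (fun M => #|special_set M|)); last first.
  by move=> M _; have [_ _ -> // _] := stab_table M.
rewrite -sum1dep_card (eq_bigr (fun t => \sum_(M | sp M t) 1)%N); last first.
  move=> t /existsP [M sM]; rewrite (big_pred1 M) // => M'.
  by rewrite /=; apply/idP/eqP => [sM'|-> //]; apply: (special_inj sa sM' sM).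
rewrite (exchange_big_dep predT) //=; apply: eq_bigr => M _.
rewrite sum1dep_card; apply: eq_card => t; rewrite !inE andb_idl // => sM.
by apply/existsP; exists M.
Qed.

Lemma orbit_count0 k : ~~ (k %| #|[set: gT]|) -> orbit_count k = 0%N.
Proof.
move=> nk; apply/eqP; rewrite cards_eq0 -subset0; apply/subsetP => T /imsetP [M].
by rewrite inE => /eqP Mk; case/negP: nk; rewrite -Mk cardSg // subsetT.
Qed.

Lemma orbit_count_ne0 k : orbit_count k <> 0%N -> exists M, #|'C[M | to]| = k.
Proof.
move/eqP; rewrite cards_eq0 => /set0Pn [T /imsetP [M]]; rewrite inE => /eqP Mk _.
by exists M.
Qed.

Lemma orbit_count24 : orbit_count 24 = 0%N.
Proof.
apply: contraTeq isT => /eqP/orbit_count_ne0 [M Mk].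
by have [] := stab_table M; rewrite Mk.
Qed.

Lemma orbit_count12 : #|[set: gT]| <> 12 -> orbit_count 12 = 0%N.
Proof.
move=> n12; apply/eqP; apply: contraT => /eqP/orbit_count_ne0 [M Mk].
by have [_ _ _ [_ /(_ Mk)]] := stab_table M.
Qed.

Lemma orbit_count6 : #|[set: gT]| = 12 -> orbit_count 6 = 0%N.
Proof.
move=> c12; apply/eqP; apply: contraT => /eqP/orbit_count_ne0 [M Mk].
by have [_ _ _ [/(_ Mk)]] := stab_table M.
Qed.

Lemma orbit_count_le1 k :
  (forall M M', #|'C[M | to]| = k -> #|'C[M' | to]| = k -> exists g, M' = to M g) ->
  orbit_count k <= 1.
Proof.
move=> tr; apply: contraT; rewrite -ltnNge => /card_gt1P [T [T' []]].
move=> /imsetP [M]; rewrite inE => /eqP Mk -> /imsetP [M']; rewrite inE => /eqP Mk' ->.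
have [g ->] := tr M M' Mk Mk'; by rewrite orbit_act ?inE ?eqxx.
Qed.

(** A stabiliser of order 8 is a Sylow 2-subgroup, the whole group having order 8 or 24. After
    conjugation two such stabilisers coincide and share an element of order 4, whose square is
    special to both lattices. *)
Lemma orbit_count8_le1 : orbit_count 8 <= 1.
Proof.
apply: orbit_count_le1 => M M' Mk Mk'.
have syl Y : #|'C[Y | to]| = 8 -> 2.-Sylow([set: gT]) 'C[Y | to].
  move=> Yk; rewrite pHallE subsetT Yk /=.
  have := cardSg (subsetT 'C[Y | to]); rewrite Yk.
  by move: cardG; rewrite !inE => /or4P [/eqP c|/eqP c|/eqP c|/or4P [/eqP c|/eqP c|/eqP c|/eqP c]];
    rewrite c // p_part; vm_compute.
have [g _ KE] := Sylow_trans (syl M Mk) (syl M' Mk').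
exists g; have [z zK z4] := @card8_order4 _ 'C[M' | to]%G cg Mk'.
apply: (special_inj sa (special_order4 sa zK z4)); apply: (special_order4 sa) => //.
by rewrite astab1_act -KE.
Qed.

(** Such a stabiliser is the whole group, so an element of order 3 fixes both lattices; in a group
    of order 12 it fixes only one. *)
Lemma orbit_count12_le1 : orbit_count 12 <= 1.
Proof.
apply: orbit_count_le1 => M M' Mk Mk'; exists 1; rewrite act1.
have [_ _ _ [_ /(_ Mk) c12]] := stab_table M.
have KT Y : #|'C[Y | to]| = 12 -> 'C[Y | to] = [set: gT].
  by move=> Yk; apply/eqP; rewrite eqEcard subsetT Yk c12.
have [|z zT z3] := @Cauchy _ 3 [group of [set: gT]] isT; first by rewrite /= c12.
have zM : z \in 'C[M | to] by rewrite KT.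
have [|[]] := special_order3 sa zM z3; last by rewrite c12.
by case=> _; apply; rewrite KT.
Qed.

(** The whole group has order 6 or 24, so its subgroups of order 3 are Sylow and conjugate, and an
    element of order 3 in a stabiliser fixes no other lattice. *)
Lemma orbit_count6_le1 : orbit_count 6 <= 1.
Proof.
apply: orbit_count_le1 => M M' Mk Mk'.
have syl z : #[z] = 3 -> #|[set: gT]| = 6 \/ #|[set: gT]| = 24 -> 3.-Sylow([set: gT]) <[z]>.
  by move=> z3 c; rewrite pHallE subsetT -orderE z3; case: c => ->; rewrite p_part; vm_compute.
have c : #|[set: gT]| = 6 \/ #|[set: gT]| = 24.
  have [_ _ _ [/(_ Mk) n12 _]] := stab_table M.
  have := cardSg (subsetT 'C[M | to]); rewrite Mk; move: cardG n12.
  rewrite !inE => /or4P [/eqP c|/eqP c|/eqP c|/or4P [/eqP c|/eqP c|/eqP c|/eqP c]];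
  rewrite c //; tauto.
have [|z zK z3] := @Cauchy _ 3 'C[M | to]%G isT; first by rewrite /= Mk.
have [|z' zK' z3'] := @Cauchy _ 3 'C[M' | to]%G isT; first by rewrite /= Mk'.
have [g _ ZE] := Sylow_trans (syl z z3 c) (syl z' z3' c).
exists g; have [_ U] := stab_order3 zK' z3'; apply/esym/U.
by rewrite astab1_act (subsetP _ _ (cycle_id z')) // ZE conjSg cycle_subG.
Qed.

(** The element [z] lies in a Sylow 2-subgroup, and these are the conjugates of a stabiliser of
    order 8. Conversely a stabiliser containing [z] has order divisible by 4, is not abelian and
    does not have order 12. *)
Lemma orbit_count8_order4 z : #|[set: gT]| = 24 -> #[z] = 4 ->
  orbit_count 8 = 1%N <-> exists M, z \in 'C[M | to].
Proof.
move=> c24 z4; split=> [o1|[M zM]].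
  have [|M Mk] := @orbit_count_ne0 8; first by rewrite o1.
  have sylM : 2.-Sylow([set: gT]) 'C[M | to].
    by rewrite pHallE subsetT Mk /= c24 p_part; vm_compute.
  have [||P sylP zP] := @Sylow_superset 2 _ [group of [set: gT]] <[z]>%G; rewrite ?subsetT //.
    by rewrite /pgroup -orderE z4.
  have [g _ PE] := Sylow_trans sylM sylP; exists (to M g).
  by rewrite astab1_act -PE -cycle_subG.
have Mk : #|'C[M | to]| = 8.
  have [||h [hK h2 zh]] := @stab_inverter M z zM; rewrite ?z4 //.
  have z2 : 2 < #[z] by rewrite z4.
  have na := dihedral_not_abelian z2 zh zM hK.
  have := order_dvdG zM; have [kM _ _ [_ k12]] := stab_table M.
  move: kM k12; rewrite z4 !inE => /or4P [/eqP k|/eqP k|/eqP k|/or3P [/eqP k|/eqP k|/eqP k]]; rewrite k // => k12 _.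
    by rewrite (card4_order4 k zM z4) in na.
  by rewrite k12 in c24.
apply/eqP; rewrite eqn_leq orbit_count8_le1 lt0n cards_eq0; apply/set0Pn.
by exists (orbit to [set: gT] M); apply/imsetP; exists M; rewrite // inE Mk.
Qed.

Lemma orbit_count6_order3 z : #|[set: gT]| = 24 -> #[z] = 3 ->
  orbit_count 6 = 1%N <-> exists M, z \in 'C[M | to].
Proof.
move=> c24 z3; split=> [o1|[M zM]].
  have [|M Mk] := @orbit_count_ne0 6; first by rewrite o1.
  have [|y yK y3] := @Cauchy _ 3 'C[M | to]%G isT; first by rewrite /= Mk.
  have syl u : #[u] = 3 -> 3.-Sylow([set: gT]) <[u]>.
    by move=> u3; rewrite pHallE subsetT -orderE u3 c24 p_part; vm_compute.
  have [g _ ZE] := Sylow_trans (syl y y3) (syl z z3); exists (to M g).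
  by rewrite astab1_act (subsetP _ _ (cycle_id z)) // ZE conjSg cycle_subG.
have Mk : #|'C[M | to]| = 6.
  have := order_dvdG zM; have [kM _ _ [_ k12]] := stab_table M.
  move: kM k12; rewrite z3 !inE => /or4P [/eqP k|/eqP k|/eqP k|/or3P [/eqP k|/eqP k|/eqP k]]; rewrite k // => k12 _.
  by rewrite k12 in c24.
apply/eqP; rewrite eqn_leq orbit_count6_le1 lt0n cards_eq0; apply/set0Pn.
by exists (orbit to [set: gT] M); apply/imsetP; exists M; rewrite // inE Mk.
Qed.

End OrbitCounting.

From mathcomp Require Import finmap.
From mathcomp Require Import boolp classical_sets cardinality fsbigop.
Import Defs.
Local Open Scope classical_set_scope.
Local Open Scope ring_scope.

(** * Bilinear forms and isometries on row vectors *)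

Section RowIdentities.
Variables (F : fieldType) (n : nat).

Lemma rvD (u v : 'rV[F]_n) j : (u + v) 0 j = u 0 j + v 0 j.
Proof. by rewrite mxE. Qed.
Lemma rvN (u : 'rV[F]_n) j : (- u) 0 j = - u 0 j.
Proof. by rewrite mxE. Qed.
Lemma rvZ a (u : 'rV[F]_n) j : (a *: u) 0 j = a * u 0 j.
Proof. by rewrite mxE. Qed.
Lemma rv0 j : (0 : 'rV[F]_n) 0 j = 0.
Proof. by rewrite mxE. Qed.
Definition rvE := (rvD, rvN, rvZ, rv0).

Variable G : 'M[F]_n.
Implicit Types x y z : 'rV[F]_n.

Lemma bformDl x y z : bform G (x + y) z = bform G x z + bform G y z.
Proof. by rewrite /bform !mulmxDl mxE. Qed.
Lemma bformDr x y z : bform G x (y + z) = bform G x y + bform G x z.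
Proof. by rewrite /bform linearD /= mulmxDr mxE. Qed.
Lemma bformZl a x y : bform G (a *: x) y = a * bform G x y.
Proof. by rewrite /bform -!scalemxAl mxE. Qed.
Lemma bformZr a x y : bform G x (a *: y) = a * bform G x y.
Proof. by rewrite /bform linearZ -scalemxAr mxE. Qed.
Lemma bformNl x y : bform G (- x) y = - bform G x y.
Proof. by rewrite -scaleN1r bformZl mulN1r. Qed.
Lemma bformNr x y : bform G x (- y) = - bform G x y.
Proof. by rewrite -scaleN1r bformZr mulN1r. Qed.
Lemma bform0l y : bform G 0 y = 0.
Proof. by rewrite -(scale0r 0) bformZl mul0r. Qed.
Lemma bform0r y : bform G y 0 = 0.
Proof. by rewrite -(scale0r 0) bformZr mul0r. Qed.
Definition bformE := (bformDl, bformDr, bformNl, bformNr, bformZl, bformZr, bform0l, bform0r).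

Lemma bform_sym x y : G^T = G -> bform G x y = bform G y x.
Proof.
move=> sG; rewrite /bform.
have -> : (x *m G *m y^T) 0 0 = ((x *m G *m y^T)^T) 0 0 by rewrite [RHS]mxE.
by rewrite !trmx_mul trmxK sG mulmxA.
Qed.

Lemma bform_sumr (I : Type) (r : seq I) (P : pred I) (f : I -> 'rV[F]_n) y :
  bform G y (\sum_(i <- r | P i) f i) = \sum_(i <- r | P i) bform G y (f i).
Proof. by elim/big_rec2: _ => [|i u v _ <-]; rewrite ?bform0r ?bformDr. Qed.

Lemma bform_rowr m (T : 'M[F]_(m, n)) v j :
  (v *m G *m T^T) 0 j = bform G v (row j T).
Proof.
rewrite /bform [LHS]mxE [RHS]mxE; apply: eq_bigr => k _; congr (_ * _).
by rewrite !mxE.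
Qed.

Lemma bform_row m (T : 'M[F]_(m, n)) i j :
  (T *m G *m T^T) i j = bform G (row i T) (row j T).
Proof.
rewrite -bform_rowr -!row_mul.
by rewrite [RHS]mxE.
Qed.

Lemma isometry_mx s : isometry_of G s -> s *m G *m s^T = G.
Proof.
case=> _ iso; apply/matrixP => i j; rewrite bform_row.
have := iso (row i 1%:M) (row j 1%:M); rewrite -!row_mul !mul1mx => ->.
by rewrite -bform_row mul1mx trmx1 mulmx1.
Qed.

Lemma isometry1 : isometry_of G 1%:M.
Proof. by split; [exact: unitmx1|move=> x y; rewrite !mulmx1]. Qed.

Lemma isometryM s t : isometry_of G s -> isometry_of G t -> isometry_of G (s *m t).
Proof.
move=> [su si] [tu ti]; split; first by rewrite unitmx_mul su.
by move=> x y; rewrite !mulmxA ti si.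
Qed.

Lemma isometryV s : isometry_of G s -> isometry_of G (invmx s).
Proof.
move=> [su si]; split; first by rewrite unitmx_inv.
by move=> x y; rewrite -si !mulmxKV.
Qed.

Lemma isometryN s : isometry_of G s -> isometry_of G (- s).
Proof.
move=> [su si]; split; first by rewrite -scaleN1r unitmxZ // unitrN1.
by move=> x y; rewrite !mulmxN bformNl bformNr opprK si.
Qed.

End RowIdentities.

Section Actions.
Variables (F : fieldType) (n : nat).
Implicit Types (s t : 'M[F]_n) (M : set 'rV[F]_n).

Lemma act1 M : act 1%:M M = M.
Proof.
apply/seteqP; split=> [x [y My <-]|x Mx]; first by rewrite mulmx1.
by exists x => //; rewrite mulmx1.
Qed.

Lemma actM s t M : act (s *m t) M = act t (act s M).
Proof.
apply/seteqP; split=> [x [y My <-]|x [_ [y My <-] <-]].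
  by exists (y *m s); rewrite ?mulmxA //; exists y.
by exists y; rewrite ?mulmxA.
Qed.

Lemma actK s M : s \in unitmx -> act (invmx s) (act s M) = M.
Proof. by move=> su; rewrite -actM mulmxV // act1. Qed.

End Actions.

(** * Rotations and half turns of a positive definite ternary space *)

Section Rotations.
Variable G : 'M[rat]_3.
Hypothesis posG : posdef G.
Local Notation B := (bform G).
Local Notation Q := (qform G).
Implicit Types (x y z v w : 'rV[rat]_3) (g h s : 'M[rat]_3).

Lemma bformC x y : B x y = B y x.
Proof. by apply: bform_sym; case: posG. Qed.

Lemma qform_gt0 x : x != 0 -> 0 < Q x.
Proof. by case: posG => _; apply. Qed.

Lemma qform_eq0 x : (Q x == 0) = (x == 0).
Proof.
case: (eqVneq x 0) => [->|/qform_gt0 /gt_eqF //].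
by rewrite /qform bform0l eqxx.
Qed.

Lemma qform_ge0 x : 0 <= Q x.
Proof.
case: (eqVneq x 0) => [->|/qform_gt0 /ltW //].
by rewrite /qform bform0l.
Qed.

Lemma unitG : G \in unitmx.
Proof.
rewrite unitmxE unitfE; apply/negP => /det0P [v v0 vG].
by have := qform_gt0 v0; rewrite /qform /bform vG mul0mx mxE ltxx.
Qed.

Definition mx3 x y z : 'M[rat]_3 := \matrix_(i < 3) nth 0 [:: x; y; z] i.

Lemma row_mx3 x y z i : row i (mx3 x y z) = nth 0 [:: x; y; z] i.
Proof. by rewrite rowK. Qed.

Lemma ord3P (P : 'I_3 -> Prop) : P 0 -> P 1 -> P 2%:R -> forall i, P i.
Proof.
move=> P0 P1 P2 [[|[|[|//]]] ilt].
- by have -> : Ordinal ilt = 0 by apply: val_inj.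
- by have -> : Ordinal ilt = 1 by apply: val_inj.
- by have -> : Ordinal ilt = 2%:R by apply: val_inj.
Qed.

Lemma mx3_unit x y z : x != 0 -> y != 0 -> z != 0 ->
  B x y = 0 -> B x z = 0 -> B y z = 0 -> mx3 x y z \in unitmx.
Proof.
move=> x0 y0 z0 xy xz yz.
have : mx3 x y z *m G *m (mx3 x y z)^T = diag_mx (\row_i nth 0 [:: Q x; Q y; Q z] i).
  apply/matrixP => i j; rewrite bform_row !row_mx3 !mxE.
  move: i j; apply: ord3P; apply: ord3P; rewrite /= ?mulr1n ?mulr0n //;
    by rewrite bformC.
move/(congr1 determinant); rewrite !det_mulmx det_diag !big_ord_recl big_ord0 !mxE /= => e.
rewrite unitmxE unitfE; apply/eqP => d0; move/eqP: e.
rewrite d0 !mul0r eq_sym !mulf_eq0 !qform_eq0 (negPf x0) (negPf y0) (negPf z0) /=.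
by rewrite oner_eq0.
Qed.

Lemma ortho3 x y z v : x != 0 -> y != 0 -> z != 0 ->
  B x y = 0 -> B x z = 0 -> B y z = 0 -> B v x = 0 -> B v y = 0 -> B v z = 0 ->
  v = 0.
Proof.
move=> x0 y0 z0 xy xz yz vx vy vz; have Tu := mx3_unit x0 y0 z0 xy xz yz.
have : v *m G *m (mx3 x y z)^T = 0.
  apply/rowP => j; rewrite [RHS]mxE.
  rewrite bform_rowr.
  by rewrite row_mx3; move: j; apply: ord3P.
move/(congr1 (mulmx^~ (invmx (mx3 x y z)^T))); rewrite mulmxK ?unitmx_tr // mul0mx.
by move/(congr1 (mulmx^~ (invmx G))); rewrite mulmxK ?unitG // mul0mx.
Qed.

Definition proj x v := (B v x / Q x) *: x.
Definition perp x v := v - proj x v.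

Lemma perp_ortho x v : x != 0 -> B x (perp x v) = 0.
Proof.
move=> x0; rewrite /perp /proj !bformE -/(Q x) divfK ?qform_eq0 // bformC subrr //.
Qed.

Lemma proj_perp x v : proj x v + perp x v = v.
Proof. by rewrite /perp addrC subrK. Qed.

Lemma projZ x a v : proj x (a *: v) = a *: proj x v.
Proof. by rewrite /proj bformZl scalerA mulrA. Qed.

Lemma projD x u v : proj x (u + v) = proj x u + proj x v.
Proof. by rewrite /proj bformDl mulrDl scalerDl. Qed.

Lemma proj_scale a x v : a != 0 -> proj (a *: x) v = proj x v.
Proof.
move=> a0; case: (eqVneq x 0) => [->|x0]; first by rewrite scaler0.
rewrite /proj /qform !bformE scalerA; congr (_ *: _); have := x0; rewrite -qform_eq0 /qform => q0.
by field; rewrite q0.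
Qed.

Lemma proj_id x a : x != 0 -> proj x (a *: x) = a *: x.
Proof. by move=> x0; rewrite /proj bformZl -/(Q x) mulfK // qform_eq0. Qed.

Lemma proj_ortho x v : B x v = 0 -> proj x v = 0.
Proof. by move=> xv; rewrite /proj bformC xv mul0r scale0r. Qed.

Definition rot g := isometry_of G g /\ \det g = 1.

Lemma isom_det s : isometry_of G s -> \det s = 1 \/ \det s = -1.
Proof.
move=> /isometry_mx/(congr1 determinant); rewrite !det_mulmx det_tr => e.
have dG : \det G != 0 by have := unitG; rewrite unitmxE unitfE.
have : (\det s) ^+ 2 = 1 ^+ 2.
  by apply: (mulIf dG); rewrite expr1n mul1r -[RHS]e expr2; ring.
by move/eqP; rewrite eqf_sqr => /orP [] /eqP; [left|right].
Qed.

Lemma rotM g h : rot g -> rot h -> rot (g *m h).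
Proof. by move=> [gi gd] [hi hd]; split; [apply: isometryM|rewrite det_mulmx gd hd mulr1]. Qed.
Lemma rot1 : rot 1%:M. Proof. by split; [apply: isometry1|rewrite det1]. Qed.
Lemma rotV g : rot g -> rot (invmx g).
Proof. by move=> [gi gd]; split; [apply: isometryV|rewrite det_inv gd invr1]. Qed.
Lemma rotB g x y : rot g -> B (x *m g) (y *m g) = B x y.
Proof. by case=> -[_ gi] _; apply: gi. Qed.

(** The isometry relation gives [(g - 1) G g^T = - G (g - 1)^T], and the dimension is odd, so the
    determinant equals its own opposite. *)
Lemma rot_det_sub1 g : rot g -> \det (g - 1%:M) = 0.
Proof.
move=> [gi gd]; have e := isometry_mx gi.
have : (g - 1%:M) *m G *m g^T = - (G *m (g - 1%:M)^T).
  by rewrite mulmxBl mulmxBl e mul1mx linearB /= trmx1 mulmxBr mulmx1 opprB.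
move/(congr1 determinant); rewrite -[X in _ = \det X]scaleN1r detZ !det_mulmx !det_tr gd mulr1.
have dG : \det G != 0 by have := unitG; rewrite unitmxE unitfE.
rewrite -signr_odd /= expr1 => h; apply: (mulIf dG); rewrite mul0r; lra.
Qed.

Lemma rot_axis g : rot g -> exists2 x : 'rV[rat]_3, x != 0 & x *m g = x.
Proof.
move/rot_det_sub1/eqP/det0P => [x x0 xg]; exists x => //.
by apply/eqP; rewrite -subr_eq0 -{2}(mulmx1 x) -mulmxBr xg.
Qed.

(** Twice the cosine of the rotation angle. *)
Definition rotcos g := \tr g - 1.

(* The characteristic polynomial of a rotation is determined by its trace, its
   determinant and the root 1. *)
Lemma rot_char g : rot g ->
  g *m g *m g = \tr g *: (g *m g) - \tr g *: g + 1%:M.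
Proof.
move=> rg; have [x x0 xg] := rot_axis rg; have [gi gd] := rg.
have := Cayley_Hamilton g; have szp := size_char_poly g.
have root1 : (char_poly g).[1] = 0.
  apply/rootP; rewrite -eigenvalue_root_char; apply/eigenvalueP; exists x => //.
  by rewrite scale1r.
have c3 : (char_poly g)`_3 = 1.
  by have /monicP := char_poly_monic g; rewrite lead_coefE szp.
have c2 : (char_poly g)`_2 = - \tr g by rewrite (char_poly_trace g).
have c0 : (char_poly g)`_0 = -1.
  by rewrite char_poly_det gd mulr1 -signr_odd /= expr1.
have pE : char_poly g = \poly_(i < 4) (char_poly g)`_i.
  by rewrite -szp coefK.
have c1 : (char_poly g)`_1 = \tr g.
  move: root1; rewrite {1}pE horner_poly !big_ord_recr big_ord0 /= !expr1n !mulr1 c0 c2 c3.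
  by move=> ?; lra.
rewrite pE poly_def rmorph_sum /= !big_ord_recr big_ord0 /=.
rewrite !linearZ /= !rmorphXn /= horner_mx_X c0 c1 c2 c3 expr0 expr1 => e.
rewrite -[LHS]/(g * g * g) -[in RHS]/(g * g); move: e.
rewrite !exprS expr0 mulr1 mulrA => e.
by apply/eqP; rewrite -subr_eq0 -[X in _ == X]e; apply/eqP/matrixP => i j; rewrite !mxE; ring.
Qed.

(** A displacement [d = v *m g - v] is orthogonal to both fixed vectors, hence an eigenvector with
    eigenvalue 1 or -1. The first makes [Q d] vanish, the second makes the determinant -1. *)
Lemma rot_fix2 g x y : rot g -> x != 0 -> y != 0 -> B x y = 0 ->
  x *m g = x -> y *m g = y -> g = 1%:M.
Proof.
move=> rg x0 y0 xy xg yg.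
suff fixv v : v *m g = v.
  by apply/row_matrixP => i; rewrite -[g]mul1mx row_mul fixv.
apply/eqP; rewrite -subr_eq0; apply: contraT.
pose d := v *m g - v; have dE : d = v *m g - v by []; rewrite -/d; clearbody d => d0.
have dx : B d x = 0 by rewrite dE !bformE -{1}xg rotB // subrr.
have dy : B d y = 0 by rewrite dE !bformE -{1}yg rotB // subrr.
pose e := B (d *m g) d / Q d.
have dg : d *m g = e *: d.
  apply/eqP; rewrite -subr_eq0; apply/eqP; apply: (@ortho3 x y d) => //; rewrite 1?bformC //.
  - by rewrite bformE bformNr bformZr -{1}xg rotB // (bformC x) dx mulr0 subrr.
  - by rewrite bformE bformNr bformZr -{1}yg rotB // (bformC y) dy mulr0 subrr.
  - by rewrite !bformE -/(Q d) /e (bformC (d *m g)) divfK ?qform_eq0 ?subrr.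
have e2 : e ^+ 2 = 1 ^+ 2.
  have := rotB d d rg; rewrite dg !bformE -/(Q d) mulrA -expr2 => h.
  have q0 : Q d != 0 by rewrite qform_eq0.
  by apply: (mulIf q0); rewrite h expr1n mul1r.
move/eqP: e2; rewrite eqf_sqr => /orP [] /eqP ee.
  have := rotB v d rg; rewrite dg ee scale1r => h.
  have : Q d = 0 by rewrite /qform {1}dE !bformE h subrr.
  by move/eqP; rewrite qform_eq0 (negPf d0).
have Tu : mx3 x y d \in unitmx.
  by apply: mx3_unit; rewrite // 1?bformC.
have : mx3 x y d *m g = diag_mx (\row_i nth 0 [:: 1; 1; -1] i) *m mx3 x y d.
  apply/row_matrixP => i; rewrite row_mul row_mx3.
  have -> D : row i (diag_mx D *m mx3 x y d) = D 0 i *: row i (mx3 x y d).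
    by apply/rowP => j; rewrite mul_diag_mx !mxE.
  rewrite row_mx3 mxE.
  by move: i; apply: ord3P; rewrite /= ?scale1r // dg ee.
move/(congr1 determinant); rewrite !det_mulmx det_diag !big_ord_recl big_ord0 !mxE /=.
case: rg => _ ->; rewrite !mul1r mulr1 mulr1 => /eqP.
have := Tu; rewrite unitmxE unitfE => t0; rewrite mulN1r -subr_eq0 opprK -mulr2n mulrn_eq0 /=.
by rewrite (negPf t0).
Qed.

Lemma rot_fix_line g x y : rot g -> g <> 1%:M -> x != 0 -> x *m g = x ->
  y *m g = y -> proj x y = y.
Proof.
move=> rg g1 x0 xg yg; apply/eqP; rewrite eq_sym -subr_eq0 -/(perp x y).
apply: contraT => p0; case: g1; apply: (rot_fix2 rg x0 p0 (perp_ortho y x0) xg).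
by rewrite mulmxBl yg -scalemxAl xg.
Qed.

(** The difference of the two sides is killed by [g - 1], by the characteristic equation, and is
    orthogonal to the axis. *)
Lemma rot_plane g x w : rot g -> g <> 1%:M -> x != 0 -> x *m g = x -> B x w = 0 ->
  w *m g *m g = rotcos g *: (w *m g) - w.
Proof.
move=> rg g1 x0 xg xw.
have xwg v : B x v = 0 -> B x (v *m g) = 0 by move=> <-; rewrite -{1}xg rotB.
apply/eqP; rewrite -subr_eq0; set y := (X in X == 0).
have yg : y *m g = y.
  have e := congr1 (mulmx w) (rot_char rg).
  move: e; rewrite mulmxDr mulmxBr mulmx1 -!scalemxAr !mulmxA /y /rotcos => e.
  rewrite opprB mulmxDl e mulmxBl -scalemxAl.
  move: (w *m g *m g) (w *m g) => a b; apply/rowP => j; rewrite !rvE; ring.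
apply: contraT => y0; case: g1; apply: (rot_fix2 rg x0 y0 _ xg yg).
by rewrite /y !bformE !xwg ?xw ?xwg //; ring.
Qed.

Lemma rot_plane_norm g x w : rot g -> g <> 1%:M -> x != 0 -> x *m g = x -> B x w = 0 ->
  2 * B w (w *m g) = rotcos g * Q w.
Proof.
move=> rg g1 x0 xg xw.
have := rotB (w *m g) w rg; rewrite (rot_plane rg g1 x0 xg xw) !bformE (rotB w w rg).
by rewrite (bformC (w *m g) w) -/(Q w) => e; lra.
Qed.

Lemma ortho_exists x : exists2 w, w != 0 & B x w = 0.
Proof.
have : kermx (G *m x^T) != 0.
  rewrite -mxrank_eq0 mxrank_ker subn_eq0 -ltnNge.
  by apply: leq_ltn_trans (rank_leq_col _) _.
case/rowV0Pn => w /sub_kermxP wk w0; exists w => //.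
by rewrite bformC /bform -mulmxA wk mxE.
Qed.

(** The axis of [g] is orthogonal to [x], since pairing the two changes sign under [g]; so [g *m g]
    fixes two orthogonal vectors. *)
Lemma rot_flip g x : rot g -> x != 0 -> x *m g = - x -> g *m g = 1%:M.
Proof.
move=> rg x0 xg; have [y y0 yg] := rot_axis rg.
apply: (@rot_fix2 _ x y); rewrite ?mulmxA //; first exact: rotM.
- have := rotB x y rg; rewrite xg yg bformNl => e; lra.
- by rewrite xg mulNmx xg opprK.
- by rewrite !yg.
Qed.

Lemma rot_invol g x v : rot g -> g <> 1%:M -> g *m g = 1%:M -> x != 0 ->
  x *m g = x -> v *m g = 2 *: proj x v - v.
Proof.
move=> rg g1 gg x0 xg; rewrite -{1}(proj_perp x v) mulmxDl.
have -> : proj x v *m g = proj x v by rewrite -scalemxAl xg.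
set w := perp x v; have xw : B x w = 0 by apply: perp_ortho.
have : w + w *m g = 0.
  apply/eqP; apply: contraT => p0; case: g1.
  apply: (rot_fix2 rg x0 p0 _ xg); last first.
    by rewrite mulmxDl -mulmxA gg mulmx1 addrC.
  by rewrite bformDr xw -{1}xg rotB // xw addr0.
move/eqP; rewrite addrC addr_eq0 => /eqP ->; rewrite /w /perp.
by apply/rowP => j; rewrite !rvE; ring.
Qed.

Definition refl x : 'M[rat]_3 := 1%:M - (2 / Q x) *: (G *m x^T *m x).

Lemma reflE x v : v *m refl x = v - (2 * B v x / Q x) *: x.
Proof.
rewrite /refl mulmxBr mulmx1 -scalemxAr !mulmxA; congr (_ - _).
have -> : v *m G *m x^T *m x = B v x *: x.
  by rewrite [v *m G *m x^T in LHS]mx11_scalar mul_scalar_mx.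
by rewrite scalerA; congr (_ *: _); rewrite mulrAC.
Qed.

Lemma refl_tau x v : v *m refl x = tau G x v.
Proof. by rewrite reflE /tau (bformC v). Qed.

Lemma refl_invol x : x != 0 -> refl x *m refl x = 1%:M.
Proof.
move=> x0; apply/row_matrixP => i; rewrite -[refl x *m _]mul1mx row_mul.
set v := row i 1%:M; rewrite mulmxA !reflE; have := x0; rewrite -qform_eq0 => q0.
rewrite !bformE -/(Q x).
by apply/rowP => j; rewrite !rvE; field.
Qed.

Lemma refl_isom x : x != 0 -> isometry_of G (refl x).
Proof.
move=> x0; split; first by case: (mulmx1_unit (refl_invol x0)).
move=> u v; rewrite !reflE !bformE -/(Q x) (bformC x v); have := x0; rewrite -qform_eq0 => q0.
by field.
Qed.

Lemma refl_trace x : x != 0 -> \tr (refl x) = 1.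
Proof.
move=> x0; rewrite /refl linearB /= linearZ /= mxtrace1 mxtrace_mulC.
have -> : \tr (x *m (G *m x^T)) = Q x by rewrite mulmxA /mxtrace big_ord1.
have := x0; rewrite -qform_eq0 => q0; by field.
Qed.

(** With determinant 1, the characteristic equation of a rotation of trace 1, applied to [x], would
    read [- x = 3 x]. *)
Lemma refl_det x : x != 0 -> \det (refl x) = -1.
Proof.
move=> x0; have [d1|//] := isom_det (refl_isom x0).
have rr : rot (refl x) by split => //; apply: refl_isom.
have := rot_char rr; rewrite refl_invol // mul1mx refl_trace // !scale1r.
have xr : x *m refl x = - x.
  rewrite reflE -/(Q x); have := x0; rewrite -qform_eq0 => q0; rewrite mulfK //.
  by apply/rowP => j; rewrite !rvE; ring.
move/(congr1 (mulmx x)); rewrite xr mulmxDr mulmxBr mulmx1 xr => e.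
case/negP: x0; apply/eqP/rowP => j; have := congr1 (fun u : 'rV_3 => u 0 j) e.
by rewrite !rvE => ?; lra.
Qed.

Lemma rot_halfturn x : x != 0 -> rot (- refl x).
Proof.
move=> x0; split; first exact/isometryN/refl_isom.
by rewrite -scaleN1r detZ refl_det // -signr_odd /= expr1 mulrNN mulr1.
Qed.

Lemma halfturnE x v : v *m (- refl x) = 2 *: proj x v - v.
Proof.
rewrite mulmxN reflE /proj scalerA.
by apply/rowP => j; rewrite !rvE; ring.
Qed.

End Rotations.

Section Subgroup.
Variables (n : nat) (N : set 'rV[rat]_n).
Hypotheses (N0 : N 0) (NB : forall x y, N x -> N y -> N (x - y)).

Lemma subgrpN x : N x -> N (- x).
Proof. by move=> Nx; rewrite -sub0r; apply: NB. Qed.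
Lemma subgrpD x y : N x -> N y -> N (x + y).
Proof. by move=> Nx Ny; rewrite -[y]opprK; apply: NB => //; apply: subgrpN. Qed.
Lemma subgrpZn (k : nat) x : N x -> N (k%:R *: x).
Proof.
move=> Nx; elim: k => [|k IH]; first by rewrite scale0r.
by rewrite -natr1 scalerDl scale1r; apply: subgrpD.
Qed.
Lemma subgrpZ (k : int) x : N x -> N (k%:~R *: x).
Proof.
move=> Nx; case: k => k; first exact: subgrpZn.
by rewrite NegzE mulrNz scaleNr; apply: subgrpN; apply: subgrpZn.
Qed.

End Subgroup.

(** * Integral lattices and the crystallographic restriction *)

Section IntegralLattices.
Variable G : 'M[rat]_3.
Hypothesis posG : posdef G.
Local Notation B := (bform G).
Local Notation Q := (qform G).
Implicit Types (x y z v w : 'rV[rat]_3) (g h s : 'M[rat]_3).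
Implicit Types (M N S : set 'rV[rat]_3).

Lemma rat_absurd : (1 : rat) <= 0 -> False.
Proof. by rewrite ler10. Qed.

(** A description without a basis: it passes to [Lambda_p] by a direct check and suffices for
    arguments with shortest vectors. *)
Record int_lattice N : Prop := IntLattice {
  int_lattice0 : N 0;
  int_latticeB : forall x y, N x -> N y -> N (x - y);
  int_lattice_int : forall x y, N x -> N y -> B x y \is a Num.int;
  int_lattice_full : forall v, exists2 k : nat, (0 < k)%N & N (k%:R *: v) }.

Lemma il_D N x y : int_lattice N -> N x -> N y -> N (x + y).
Proof. by case=> N0 NB _ _; apply: subgrpD. Qed.
Lemma il_N N x : int_lattice N -> N x -> N (- x).
Proof. by case=> N0 NB _ _; apply: subgrpN. Qed.
Lemma il_Z N (k : int) x : int_lattice N -> N x -> N (k%:~R *: x).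
Proof. by case=> N0 NB _ _; apply: subgrpZ. Qed.
Lemma il_Zn N (k : nat) x : int_lattice N -> N x -> N (k%:R *: x).
Proof. by case=> N0 NB _ _; apply: subgrpZn. Qed.

Lemma round_rat (r : rat) : exists n : int, `|r - n%:~R| <= 1 / 2.
Proof.
exists (Num.floor (r + 1 / 2)); have /andP [] := floor_itv (r + 1 / 2).
rewrite rmorphD /= => h1 h2; rewrite ler_norml; apply/andP; split; lra.
Qed.

Lemma shortest_exists N S : int_lattice N -> S `<=` N -> (exists2 v, S v & v != 0) ->
  exists w, [/\ S w, w != 0 & forall v, S v -> v != 0 -> Q w <= Q v].
Proof.
move=> iN SN [v Sv v0].
have Qnat u : S u -> exists n : nat, Q u = n%:R.
  move=> Su; have /intrP [m Qm] := int_lattice_int iN (SN _ Su) (SN _ Su).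
  have := qform_ge0 posG u; rewrite {1}/qform Qm ler0z => m0.
  by exists `|m|%N; rewrite /qform Qm -{1}(gez0_abs m0).
pose P n := `[< exists u, [/\ S u, u != 0 & Q u = n%:R] >].
have exP : exists n, P n.
  by have [n Qn] := Qnat v Sv; exists n; apply/asboolP; exists v.
case: (ex_minnP exP) => n /asboolP [w [Sw w0 Qw]] mn; exists w; split=> // u Su u0.
have [m Qm] := Qnat u Su; rewrite Qw Qm ler_nat; apply: mn.
by apply/asboolP; exists u.
Qed.

(** Subtracting from [r] a nearest integer leaves a vector of [S] of norm at most a quarter of
    [Q w], hence 0. *)
Lemma shortest_mult S w r : (forall x y, S x -> S y -> S (x - y)) ->
  S w -> w != 0 -> (forall v, S v -> v != 0 -> Q w <= Q v) ->
  S (r *: w) -> r \is a Num.int.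
Proof.
move=> SB Sw w0 mw Sr; have [n rn] := round_rat r.
have S0 : S 0 by rewrite -(subrr w); apply: SB.
have := mw ((r - n%:~R) *: w); rewrite scalerBl => mw'.
have Sd := SB _ _ Sr (subgrpZ S0 SB n Sw).
case: (eqVneq (r - n%:~R) 0) => [/eqP|d0].
  by rewrite subr_eq0 => /eqP ->; apply: intr_int.
have {}mw' := mw' Sd; rewrite -scalerBl scaler_eq0 (negPf d0) (negPf w0) in mw'.
have := mw' isT; have := qform_gt0 posG w0; rewrite /qform !bformE => q0.
move: rn; rewrite ler_norml => /andP [l1 l2] h; exfalso.
move: (r - _) l1 l2 h => e l1 l2 h.
have : e * e <= 1 / 4 by nra.
by move=> e4; nra.
Qed.

Lemma act_stabP g N : g \in unitmx -> act g N = N <-> (forall x, N (x *m g) <-> N x).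
Proof.
move=> gu; split=> [e x|e].
  split=> [|Nx]; last by rewrite -e; exists x.
  by rewrite -{1}e => -[y Ny /(can_inj (mulmxK gu)) <-].
apply/seteqP; split=> [_ [x Nx <-]|x Nx]; first exact/e.
by exists (x *m invmx g); rewrite ?mulmxKV //; apply/e; rewrite mulmxKV.
Qed.

Lemma rot_unit g : rot G g -> g \in unitmx.
Proof. by case=> -[]. Qed.

Lemma perp_exists N x : int_lattice N ->
  exists2 v, (N v /\ B x v = 0) & v != 0.
Proof.
move=> iN; have [w w0 xw] := ortho_exists posG x.
have [k k0 Nk] := int_lattice_full iN w; exists (k%:R *: w).
  by rewrite bformZr xw mulr0.
by rewrite scaler_eq0 (negPf w0) orbF pnatr_eq0 -lt0n.
Qed.

Definition shortest_perp N x w :=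
  [/\ N w /\ B x w = 0, w != 0
    & forall v, N v /\ B x v = 0 -> v != 0 -> Q w <= Q v].

Lemma shortest_perp_exists N x : int_lattice N -> exists w, shortest_perp N x w.
Proof.
move=> iN; have [v v1 v0] := perp_exists x iN.
apply: (shortest_exists iN) => [u []|] //; by exists v.
Qed.

Section Turn.
Variables (N : set 'rV[rat]_3) (g : 'M[rat]_3) (x w : 'rV[rat]_3).
Hypotheses (iN : int_lattice N) (rg : rot G g) (g1 : g <> 1%:M).
Hypotheses (gN : forall v, N (v *m g) <-> N v) (x0 : x != 0) (xg : x *m g = x).
Hypothesis sw : shortest_perp N x w.
Local Notation lam := (rotcos g).

Lemma perp_rot v : B x v = 0 -> B x (v *m g) = 0.
Proof. by move=> <-; rewrite -{1}xg rotB. Qed.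

(** The crystallographic restriction: [w *m g] is again shortest in the plane section, and
    [rotcos g *: (w *m g) = w *m g *m g + w] lies in that section. *)
Lemma rotcos_int : lam \is a Num.int.
Proof.
case: sw => -[Nw xw] w0 mw.
pose S := fun v => N v /\ B x v = 0.
apply: (@shortest_mult S (w *m g)).
- move=> u v [Nu xu] [Nv xv]; split; first exact: int_latticeB.
  by rewrite !bformE xu xv subrr.
- by split; [apply/gN|apply: perp_rot].
- by apply: contraNneq w0 => e; rewrite -(mulmxK (rot_unit rg) w) e mul0mx.
- by move=> v Sv v0; rewrite /qform rotB //; apply: mw.
- have e := rot_plane posG rg g1 x0 xg xw.
  have -> : lam *: (w *m g) = w *m g *m g + w by rewrite e subrK.
  split; first by apply: il_D => //; do 2! apply/gN.
  by rewrite !bformE xw !perp_rot ?addr0.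
Qed.

(** The bounds express [0 <= Q (w + w *m g)] and [0 < Q (w *m g - w)]. *)
Lemma rotcos_bound : -2 <= lam < 2.
Proof.
case: sw => -[Nw xw] w0 mw.
have e := rot_plane_norm posG rg g1 x0 xg xw; have q0 := qform_gt0 posG w0.
have q1 := qform_ge0 posG (w + w *m g).
have q2 : 0 < Q (w *m g - w).
  apply: qform_gt0 => //; rewrite subr_eq0; apply/eqP => wg; case: g1.
  exact: (rot_fix2 posG rg x0 w0 xw xg wg).
move: q1 q2; rewrite /qform !bformE (rotB _ _ rg) (bformC posG (w *m g) w) -/(Q w) => q1 q2.
by apply/andP; split; nra.
Qed.

Lemma rotcos_cases : [\/ lam = -2, lam = -1, lam = 0 | lam = 1].
Proof.
have /andP [] := rotcos_bound; have /intrP [m ->] := rotcos_int.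
rewrite -[2]/(2%:~R) -!mulrNz ler_int ltr_int => l1 l2.
have : m = -2 \/ m = -1 \/ m = 0 \/ m = 1 by lia.
by case=> [->|[->|[->|->]]]; [constructor 1|constructor 2|constructor 3|constructor 4].
Qed.

Lemma rotcos_half v : lam = -2 -> B x v = 0 -> v *m g = - v.
Proof.
move=> l xv; have e := rot_plane_norm posG rg g1 x0 xg xv.
apply/eqP; rewrite -addr_eq0 -(qform_eq0 posG) /qform !bformE (rotB _ _ rg).
rewrite (bformC posG (v *m g) v) -/(Q v); apply/eqP; rewrite l in e; lra.
Qed.

Lemma turn_eq1 h : x *m h = x -> (forall v, B x v = 0 -> v *m h = v) -> h = 1%:M.
Proof.
move=> xh vh; apply/row_matrixP => i; rewrite -[h]mul1mx row_mul.
rewrite -{1}(proj_perp G x (row i 1%:M)) mulmxDl.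
rewrite [perp G x _ *m h]vh ?perp_ortho //.
have -> : proj G x (row i 1%:M) *m h = proj G x (row i 1%:M).
  by rewrite /proj -scalemxAl xh.
by rewrite proj_perp.
Qed.

Lemma rot_sq_rotcos : g *m g = 1%:M -> lam = -2.
Proof.
move=> gg; case: sw => -[Nw xw] w0 _.
have := rot_invol posG w rg g1 gg x0 xg; rewrite proj_ortho // scaler0 sub0r => wg.
have := rot_plane_norm posG rg g1 x0 xg xw; rewrite wg bformNr -/(Q w) => e.
have := qform_gt0 posG w0; nra.
Qed.

Lemma rot_sq : lam = -2 -> g *m g = 1%:M.
Proof.
move=> l; apply: turn_eq1; first by rewrite mulmxA !xg.
by move=> v xv; rewrite mulmxA (rotcos_half l xv) mulNmx (rotcos_half l xv) opprK.
Qed.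

Lemma rot_cube v : lam = -1 \/ lam = 1 -> B x v = 0 -> v *m g *m g *m g = - lam *: v.
Proof.
move=> l xv; rewrite (rot_plane posG rg g1 x0 xg xv) mulmxBl -scalemxAl.
rewrite (rot_plane posG rg g1 x0 xg xv); move: (v *m g) => u.
by apply/rowP => j; rewrite !rvE; case: l => ->; ring.
Qed.

Lemma rot_order_cases :
  [\/ lam = -2 /\ g *m g = 1%:M,
      lam = -1 /\ g *m g *m g = 1%:M /\ g *m g <> 1%:M,
      lam = 0 /\ g *m g *m g *m g = 1%:M /\ g *m g <> 1%:M
    | lam = 1 /\ g *m g *m g *m g *m g *m g = 1%:M /\ g *m g <> 1%:M /\ g *m g *m g <> 1%:M].
Proof.
have sq l : lam = l -> l <> -2 -> g *m g <> 1%:M by move=> <- l2 /rot_sq_rotcos.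
case: rotcos_cases => l.
- by constructor 1; split => //; apply: rot_sq.
- constructor 2; split=> //; split; last by apply: (sq _ l); lra.
  apply: turn_eq1; first by rewrite !mulmxA !xg.
  by move=> v xv; rewrite !mulmxA rot_cube ?l ?opprK ?scale1r //; left.
- constructor 3; split=> //; split; last by apply: (sq _ l); lra.
  have W v : B x v = 0 -> v *m g *m g = - v.
    by move=> xv; rewrite (rot_plane posG rg g1 x0 xg xv) l scale0r sub0r.
  apply: turn_eq1; first by rewrite !mulmxA !xg.
  by move=> v xv; rewrite !mulmxA (W _ xv) !mulNmx (W _ xv) opprK.
- constructor 4; split=> //; split; last first.
    split; first by apply: (sq _ l); lra.
    move=> e; case: sw => -[_ xw] w0 _.
    have := rot_cube (or_intror l) xw; rewrite -!mulmxA (mulmxA g g g) e mulmx1 l => h.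
    case/negP: w0; apply/eqP/rowP => j; have := congr1 (fun u : 'rV_3 => u 0 j) h.
    by rewrite !rvE => ?; lra.
  have W v : B x v = 0 -> v *m g *m g *m g = - v.
    by move=> xv; rewrite rot_cube ?l ?scaleN1r //; right.
  apply: turn_eq1; first by rewrite !mulmxA !xg.
  by move=> v xv; rewrite !mulmxA (W _ xv) !mulNmx (W _ xv) opprK.
Qed.

(** Rounding the two coordinates of [v] leaves a vector whose norm is [Q w] times
    [a^2 + lam a b + b^2] with [a] and [b] of absolute value at most 1/2, hence at most 3/4 of
    [Q w]. *)
Lemma turn_gens v : lam = 0 \/ lam = -1 -> N v -> B x v = 0 ->
  exists a b : int, v = a%:~R *: w + b%:~R *: (w *m g).
Proof.
move=> l Nv xv; case: sw => -[Nw xw] w0 mw.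
have e := rot_plane_norm posG rg g1 x0 xg xw; have q0 := qform_gt0 posG w0.
set u := w *m g in e *; have Qu : Q u = Q w by rewrite /qform rotB.
have xu : B x u = 0 by apply: perp_rot.
(* The component of [w *m g] orthogonal to [w], which gives the coordinates of [v] by orthogonal
   projection. *)
pose y := u - (lam / 2) *: w; have yE : y = u - (lam / 2) *: w by []; clearbody y.
have wy : B w y = 0 by rewrite yE !bformE -/(Q w); lra.
have xy : B x y = 0 by rewrite yE !bformE xw xu; lra.
have Qy : Q y = (1 - lam ^+ 2 / 4) * Q w.
  rewrite {1}/qform {1}yE !bformE wy yE !bformE -/(Q u) Qu (bformC posG u w).
  have -> : B w u = lam * Q w / 2 by lra.
  by field.
have y0 : y != 0.
  by rewrite -(qform_eq0 posG) Qy mulf_neq0 ?(qform_eq0 posG) //; case: l => ->; lra.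
have qw : Q w != 0 by rewrite qform_eq0.
have qy : Q y != 0 by rewrite qform_eq0.
have [a [b vE]] : exists a b : rat, v = a *: w + b *: u.
  exists (B v w / Q w - B v y / Q y * (lam / 2)), (B v y / Q y).
  apply/eqP; rewrite -subr_eq0; apply/eqP; apply: (@ortho3 G posG x w y) => //.
  - by rewrite bformC // !bformE xv xw xu; ring.
  - rewrite !bformE -/(Q w) (bformC posG u w).
    have -> : B w u = lam * Q w / 2 by lra.
    by field; rewrite ?qw ?qy.
  - have uy : B u y = Q y by rewrite /qform {2}yE !bformE wy mulr0 subr0.
    by rewrite !bformE wy uy; field; rewrite ?qw ?qy.
have [m am] := round_rat a; have [k bk] := round_rat b.
exists m, k; apply/eqP; rewrite -subr_eq0; apply: contraT => d0.
have := mw _ _ d0 => /(_ _) h; exfalso.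
have {}h : Q w <= Q (v - (m%:~R *: w + k%:~R *: u)).
  apply: h; split; last by rewrite !bformE xv xw xu; ring.
  apply: int_latticeB => //; apply: il_D => //; apply: il_Z => //; exact/gN.
move: h; have -> : v - (m%:~R *: w + k%:~R *: u) = (a - m%:~R) *: w + (b - k%:~R) *: u.
  by rewrite vE; apply/rowP => j; rewrite !rvE; ring.
move: am bk; rewrite !ler_norml => /andP [a1 a2] /andP [b1 b2].
clear vE; move: (a - m%:~R) (b - k%:~R) a1 a2 b1 b2 => {}a {}b a1 a2 b1 b2.
rewrite /qform !bformE -/(Q w) -/(Q u) Qu (bformC posG u w).
have -> : B w u = lam * Q w / 2 by lra.
have : a * a + lam * (a * b) + b * b <= 3 / 4.
  have : a * a <= 1 / 4 by nra.
  have : b * b <= 1 / 4 by nra.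
  have : - (a * b) <= 1 / 4 by nra.
  by case: l => ->; lra.
by move=> h1 h2; exfalso; apply: rat_absurd; nra.
Qed.

(* [w] is shortest, so [w] and [w g] generate the plane section; the reflection
   along [w] then preserves [N] because the coefficient [2 B(w, v) / Q(w)] is
   read off from [v - v g] (order 3) or [v - v g^2] (order 4). *)
Lemma shortest_refl : lam = 0 \/ lam = -1 -> forall v, N v -> N (v *m refl G w).
Proof.
move=> l v Nv; case: (sw) => -[Nw xw] w0 mw.
have e := rot_plane_norm posG rg g1 x0 xg xw; have q0 := qform_gt0 posG w0.
have qw : Q w != 0 by rewrite qform_eq0.
suff /intrP [m mE] : 2 * B v w / Q w \is a Num.int.
  rewrite reflE mE; apply: int_latticeB => //; exact: il_Z.
pose v' := perp G x v; have v'E : v' = perp G x v by [].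
clearbody v'; have xv' : B x v' = 0 by rewrite v'E perp_ortho.
have vv' : B v w = B v' w.
  by rewrite v'E /perp /proj !bformE xw mulr0 subr0.
have gv u : u *m g - u = perp G x u *m g - perp G x u.
  rewrite /perp /proj mulmxBl -scalemxAl xg.
  by apply/rowP => j; rewrite !rvE; ring.
have pl := rot_plane posG rg g1 x0 xg xv'.
case: l => l.
- have N2 : N (v - v *m g *m g) by apply: int_latticeB => //; do 2! apply/gN.
  have E2 : v - v *m g *m g = 2 *: v'.
    have -> : v - v *m g *m g = v' - v' *m g *m g.
      rewrite v'E /perp /proj !mulmxBl -!scalemxAl !xg.
      by apply/rowP => j; rewrite !rvE; ring.
    by rewrite pl l; apply/rowP => j; rewrite !rvE; ring.
  have [|a [b ab]] := @turn_gens (v - v *m g *m g) (or_introl l) N2.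
    by rewrite E2 bformZr xv' mulr0.
  have -> : 2 * B v w / Q w = a%:~R.
    have : B (v - v *m g *m g) w = B (2 *: v') w by rewrite E2.
    rewrite ab !bformE -/(Q w) (bformC posG (w *m g)) -vv' => h.
    have wg : B w (w *m g) = 0 by rewrite l in e; lra.
    by rewrite -h wg; field.
  exact: intr_int.
- have N1 : N (v - v *m g) by apply: int_latticeB => //; apply/gN.
  have E1 : v - v *m g = v' - v' *m g.
    by rewrite -[LHS]opprB gv opprB v'E.
  have [|a [b ab]] := @turn_gens (v - v *m g) (or_intror l) N1.
    by rewrite E1 !bformE xv' perp_rot // subrr.
  have -> : 2 * B v w / Q w = (a - b)%:~R.
    (* v' is (y - y g^2)/3 for y = v' - v' g *)
    have h : 3 *: v' = (v' - v' *m g) - (v' - v' *m g) *m g *m g.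
      rewrite !mulmxBl pl mulmxBl -scalemxAl pl l.
      by apply/rowP => j; rewrite !rvE; ring.
    have := congr1 (fun u => B u w) h; rewrite -E1 ab.
    have wg : 2 * B w (w *m g) = - Q w by rewrite e l mulN1r.
    have pw := rot_plane posG rg g1 x0 xg xw.
    rewrite !mulmxDl -!scalemxAl pw mulmxBl -scalemxAl pw l.
    rewrite !bformE -/(Q w) (bformC posG (w *m g)) -vv' => h'.
    rewrite rmorphB /=; apply: (mulIf qw); rewrite divfK //.
    have wgE : B w (w *m g) = - Q w / 2 by lra.
    by move: h'; rewrite wgE => ?; lra.
  exact: intr_int.
Qed.

End Turn.

Lemma halfturn_flip x w : B x w = 0 -> x *m (- refl G w) = - x.
Proof. by move=> xw; rewrite halfturnE proj_ortho ?scaler0 ?sub0r // bformC. Qed.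

Lemma stab_invol h N : h *m h = 1%:M -> (forall v, N v -> N (v *m h)) ->
  forall v, N (v *m h) <-> N v.
Proof.
move=> hh Nh v; split; last exact: Nh.
by move/Nh; rewrite -mulmxA hh mulmx1.
Qed.

(** The inverter is the half turn about a shortest vector [w] of the section orthogonal to the axis
    of [g]. It reverses this axis, and so does [g *m h], which is therefore an involution. When [g]
    has order 6, invariance of [N] is obtained from [g *m g], which has the same axis. *)
Lemma dihedral_exists N g : int_lattice N -> rot G g -> g *m g <> 1%:M ->
  (forall v, N (v *m g) <-> N v) ->
  exists h, [/\ rot G h, forall v, N (v *m h) <-> N v, h *m h = 1%:M,
    h <> 1%:M & g *m h *m (g *m h) = 1%:M].
Proof.
move=> iN rg gg gN.
have g1 : g <> 1%:M by move=> e; apply: gg; rewrite e mulmx1.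
have [x x0 xg] := rot_axis posG rg; have [w sw] := shortest_perp_exists x iN.
have [[Nw xw] w0 _] := sw.
have hh : (- refl G w) *m (- refl G w) = 1%:M.
  by rewrite mulNmx mulmxN opprK refl_invol.
have rh := rot_halfturn posG w0.
have xh : x *m (- refl G w) = - x by apply: halfturn_flip.
exists (- refl G w); split=> //.
- apply: stab_invol => // v Nv; rewrite mulmxN; apply: il_N => //.
  have := rot_order_cases iN rg g1 gN x0 xg sw; case=> [[_ /gg] //|[l _]|[l _]|[l [_ [_ g3]]]].
  + by apply: (shortest_refl iN rg g1 gN x0 xg sw) => //; right.
  + by apply: (shortest_refl iN rg g1 gN x0 xg sw) => //; left.
  + have rgg := rotM rg rg; have xgg : x *m (g *m g) = x by rewrite mulmxA !xg.
    have gNN u : N (u *m (g *m g)) <-> N u by rewrite mulmxA !gN.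
    apply: (shortest_refl iN rgg gg gNN x0 xgg sw) => //.
    case: (rot_order_cases iN rgg gg gNN x0 xgg sw) => [[_ e]|[-> _]|[-> _]|[l2 _]].
    * have := rot_plane posG rg g1 x0 xg xw; have := rot_cube rg g1 x0 xg (or_intror l) xw.
      move=> c3 _; have : w *m (g *m g *m (g *m g)) = w by rewrite e mulmx1.
      rewrite !mulmxA c3 l -scalemxAl => c4.
      have := rot_plane_norm posG rg g1 x0 xg xw; rewrite l => n1.
      have := qform_gt0 posG w0; have := congr1 (fun u => B w u) c4; rewrite !bformE -/(Q w) => h1 h2.
      by exfalso; apply: rat_absurd; lra.
    * by right.
    * by left.
    * have := rot_plane_norm posG rgg gg x0 xgg xw; rewrite l2 mulmxA.
      rewrite (rot_plane posG rg g1 x0 xg xw) l !bformE -/(Q w).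
      have := rot_plane_norm posG rg g1 x0 xg xw; rewrite l.
      by have := qform_gt0 posG w0; move=> a b c; exfalso; apply: rat_absurd; lra.
- move=> e; have := xh; rewrite e mulmx1 => ex; case/negP: x0; apply/eqP/rowP => j.
  by have := congr1 (fun u : 'rV_3 => u 0 j) ex; rewrite !rvE => ?; lra.
- by apply: (rot_flip posG (rotM rg rh) x0); rewrite mulmxA xg xh.
Qed.

(** Commuting with [a], the half turn [b] preserves the axis of [a]. If it fixed that axis pointwise
    the two half turns would be equal; so it reverses it. *)
Lemma commuting_axes a b x y : rot G a -> rot G b -> a <> 1%:M -> b <> 1%:M ->
  a *m a = 1%:M -> b *m b = 1%:M -> a <> b -> a *m b = b *m a ->
  x != 0 -> y != 0 -> x *m a = x -> y *m b = y -> B x y = 0 /\ x *m b = - x.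
Proof.
move=> ra rb a1 b1 aa bb ab cab x0 y0 xa yb.
have xba : x *m b *m a = x *m b by rewrite -mulmxA -cab mulmxA xa.
have xb := rot_fix_line posG ra a1 x0 xa xba; rewrite /proj in xb.
set c := _ / _ in xb; have c2 : c ^+ 2 = 1 ^+ 2.
  have q0 : Q x != 0 by rewrite qform_eq0.
  apply: (mulIf q0); have := rotB x x rb; rewrite -xb !bformE -/(Q x) => h.
  by rewrite expr1n mul1r -[RHS]h expr2 mulrA.
move/eqP: c2; rewrite eqf_sqr => /orP [] /eqP ce; rewrite ce in xb.
  case: ab; apply/row_matrixP => i; rewrite -[a]mul1mx -[b]mul1mx !row_mul.
  rewrite (rot_invol posG _ ra a1 aa x0 xa) (rot_invol posG _ rb b1 bb x0) //.
  by rewrite -xb scale1r.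
rewrite scaleN1r in xb; split=> //.
by have := rotB x y rb; rewrite -xb yb bformNl => ?; lra.
Qed.

Lemma invol_axis_eq a b x : rot G a -> rot G b -> a <> 1%:M -> b <> 1%:M ->
  a *m a = 1%:M -> b *m b = 1%:M -> x != 0 -> x *m a = x -> x *m b = x -> a = b.
Proof.
move=> ra rb a1 b1 aa bb x0 xa xb.
apply/row_matrixP => i; rewrite -[a]mul1mx -[b]mul1mx !row_mul.
by rewrite (rot_invol posG _ ra a1 aa x0 xa) (rot_invol posG _ rb b1 bb x0).
Qed.

(** The alternative is that [a] reverses the axis of [z]. Then [z] scales the axis of [a] by a
    rational cube root of unity, that is by 1, so the two axes coincide and [a] would both fix and
    reverse its axis. *)
Lemma invol_cent3_axis (a z : 'M[rat]_3) x : rot G a -> rot G z -> a <> 1%:M -> z <> 1%:M ->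
  a *m a = 1%:M -> z *m z *m z = 1%:M -> a *m z = z *m a -> x != 0 -> x *m z = x ->
  x *m a = x.
Proof.
move=> ra rz a1 z1 aa zzz caz x0 xz.
have xaz : x *m a *m z = x *m a by rewrite -mulmxA caz mulmxA xz.
have xa := rot_fix_line posG rz z1 x0 xz xaz; rewrite /proj in xa.
set c := _ / _ in xa; have c2 : c ^+ 2 = 1 ^+ 2.
  have q0 : Q x != 0 by rewrite qform_eq0.
  apply: (mulIf q0); have := rotB x x ra; rewrite -xa !bformE -/(Q x) => h.
  by rewrite expr1n mul1r -[RHS]h expr2 mulrA.
move/eqP: c2; rewrite eqf_sqr => /orP [] /eqP ce; rewrite ce in xa.
  by rewrite -xa scale1r.
have [u u0 ua] := rot_axis posG ra.
have uza : u *m z *m a = u *m z by rewrite -mulmxA -caz mulmxA ua.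
have uz := rot_fix_line posG ra a1 u0 ua uza; rewrite /proj in uz.
set d := _ / _ in uz; have d3 : d ^+ 3 = 1.
  have : u *m (z *m z *m z) = u by rewrite zzz mulmx1.
  rewrite !mulmxA -uz -!scalemxAl -uz -!scalemxAl -uz !scalerA => h.
  apply/eqP; rewrite -subr_eq0; apply: contraT => dn; case/negP: u0.
  have : (d ^+ 3 - 1) *: u = 0 by rewrite scalerBl scale1r -{2}h !exprS expr0 mulr1 mulrA subrr.
  by move/eqP; rewrite scaler_eq0 (negPf dn).
have d1 : d = 1.
  have : (d - 1) * (d ^+ 2 + d + 1) = d ^+ 3 - 1 by ring.
  rewrite d3 subrr.
  move/eqP; rewrite mulf_eq0 => /orP [/eqP|/eqP h]; first by lra.
  by exfalso; apply: rat_absurd; nra.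
have uz' : u *m z = u by rewrite -uz d1 scale1r.
have ux := rot_fix_line posG rz z1 x0 xz uz'.
have : u *m a = - u.
  by rewrite -ux /proj -scalemxAl -xa scaleN1r scalerN.
rewrite ua => eu; case/negP: u0; apply/eqP/rowP => j.
by have := congr1 (fun v : 'rV_3 => v 0 j) eu; rewrite !rvE => ?; lra.
Qed.

End IntegralLattices.

(** * Special axes modulo p *)

Section SpecialAxes.
Variable G : 'M[rat]_3.
Hypothesis posG : posdef G.
Variables (p : nat) (pr_p : prime p) (odd_p : odd p).
Local Notation B := (bform G).
Local Notation Q := (qform G).
Local Notation prj := (proj G).
Local Notation prp := (perp G).
Local Notation il0 := (@int_lattice0 G _).
Local Notation ilB := (@int_latticeB G _).
Local Notation ilD := (@il_D G _ _ _).
Local Notation ilN := (@il_N G _ _).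
Local Notation ilZ := (@il_Z G _ _ _).
Local Notation ilZn := (@il_Zn G _ _ _).
Implicit Types (x y z v w u : 'rV[rat]_3) (g h s : 'M[rat]_3).
Implicit Types (M N S : set 'rV[rat]_3).

(** Divisibility by p among the integers, stated for rationals so that values of [B] need no
    conversion. *)
Definition pZ (r : rat) := r / p%:R \is a Num.int.

Lemma p_neq0 : p%:R != 0 :> rat.
Proof. by rewrite pnatr_eq0 -lt0n prime_gt0. Qed.

Lemma pZ0 : pZ 0. Proof. by rewrite /pZ mul0r rpred0. Qed.
Lemma pZD a b : pZ a -> pZ b -> pZ (a + b).
Proof. by rewrite /pZ mulrDl => ? ?; apply: rpredD. Qed.
Lemma pZN a : pZ a -> pZ (- a).
Proof. by rewrite /pZ mulNr rpredN. Qed.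
Lemma pZB a b : pZ a -> pZ b -> pZ (a - b).
Proof. by move=> ? ?; apply: pZD => //; apply: pZN. Qed.
Lemma pZMl a b : a \is a Num.int -> pZ b -> pZ (a * b).
Proof. by rewrite /pZ -mulrA => ? ?; apply: rpredM. Qed.
Lemma pZMr a b : a \is a Num.int -> pZ b -> pZ (b * a).
Proof. by rewrite mulrC; apply: pZMl. Qed.
Lemma pZp a : a \is a Num.int -> pZ (p%:R * a).
Proof. by rewrite /pZ [p%:R * a]mulrC mulfK // p_neq0. Qed.
Lemma pZ_intr (m : int) : pZ m%:~R = (p %| m)%Z.
Proof.
apply/idP/idP => [/intrP [k kE]|/dvdzP [k ->]].
  apply/dvdzP; exists k; apply: (intr_inj (R := rat)).
  by rewrite intrM -kE divfK ?p_neq0.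
by rewrite /pZ intrM mulfK ?p_neq0 // intr_int.
Qed.

Lemma pZM a b : pZ (a * b) -> a \is a Num.int -> b \is a Num.int -> pZ a \/ pZ b.
Proof.
move=> ab /intrP [m mE] /intrP [n nE]; move: ab; rewrite mE nE -intrM !pZ_intr.
by rewrite !dvdzE abszM Euclid_dvdM // => /orP.
Qed.

Lemma pZ_nat (k : nat) : pZ k%:R = (p %| k)%N.
Proof. by rewrite -[k%:R]/((Posz k)%:~R) pZ_intr. Qed.

Lemma pZ_cancel (k : nat) a : ~~ (p %| k)%N -> a \is a Num.int -> pZ (k%:R * a) -> pZ a.
Proof.
move=> pk ia /pZM [||h|//] //.
by rewrite pZ_nat (negPf pk) in h.
Qed.

(** Compares 2 by 2 minors whose entries agree modulo p up to a common factor [c], which is prime to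
    p in the applications. *)
Lemma pZ_minor (c x1 x2 x3 x4 y1 y2 y3 y4 : rat) : c \is a Num.int ->
  x2 \is a Num.int -> x4 \is a Num.int -> y1 \is a Num.int -> y3 \is a Num.int ->
  pZ (c * x1 - y1) -> pZ (c * x2 - y2) -> pZ (c * x3 - y3) -> pZ (c * x4 - y4) ->
  pZ (y1 * y2 - y3 * y4) -> pZ (c * c * (x1 * x2 - x3 * x4)).
Proof.
move=> ic i2 i4 j1 j3 p1 p2 p3 p4 pm.
have -> : c * c * (x1 * x2 - x3 * x4) = (c * x1 - y1) * (c * x2) + y1 * (c * x2 - y2)
  - (c * x3 - y3) * (c * x4) - y3 * (c * x4 - y4) + (y1 * y2 - y3 * y4) by ring.
apply: pZD => //; apply: pZB; [apply: pZB; [apply: pZD|]|].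
- by apply: pZMr => //; apply: rpredM.
- exact: pZMl.
- by apply: pZMr => //; apply: rpredM.
- exact: pZMl.
Qed.

Lemma p_ndvd2 : ~~ (p %| 2)%N.
Proof.
apply/negP => /(dvdn_leq (isT : 0 < 2)%N); have := prime_gt1 pr_p => h1 h2.
by have p2 : p = 2%N by [lia]; move: odd_p; rewrite p2.
Qed.

Lemma p_ndvdM k l : ~~ (p %| k)%N -> ~~ (p %| l)%N -> ~~ (p %| k * l)%N.
Proof. by rewrite Euclid_dvdM // negb_or => -> ->. Qed.

Lemma int_abs (a : rat) : a \is a Num.int -> exists n : nat, a = n%:R \/ a = - n%:R.
Proof.
case/intrP => m ->; exists `|m|%N; case: (lerP 0 m) => m0.
  by left; rewrite -{1}(gez0_abs m0).
by right; rewrite -{1}[m]opprK -(ltz0_abs m0) mulrNz.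
Qed.

(* N = Lambda_p M; r1 says that M has rank 1 modulo p. *)
Record good (r1 : Prop) N M : Prop := Good {
  good_il : int_lattice G M;
  good_Lambda : forall x, N x <-> M x /\ forall y, M y -> pZ (B x y);
  good_neq : exists2 x, M x & ~ N x;
  good_det3 : forall x y z, M x -> M y -> M z ->
    pZ (Q x * (Q y * Q z - B y z * B y z) - B x y * (B x y * Q z - B y z * B x z)
        + B x z * (B x y * B y z - Q y * B x z));
  good_rank1 : r1 -> forall x y z t, M x -> M y -> M z -> M t ->
    pZ (B x z * B y t - B x t * B y z);
  good_rank2 : ~ r1 -> exists x y z t,
    [/\ M x, M y, M z, M t & ~~ pZ (B x z * B y t - B x t * B y z)] }.

Section OneLattice.
Variables (r1 : Prop) (N M : set 'rV[rat]_3).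
Hypothesis gM : good r1 N M.
Let iM := good_il gM.

Lemma good_int x y : M x -> M y -> B x y \is a Num.int.
Proof. exact: int_lattice_int. Qed.

Lemma good_sub x : N x -> M x.
Proof. by case/(good_Lambda gM). Qed.

Lemma good_N x y : N x -> M y -> pZ (B x y).
Proof. by case/(good_Lambda gM) => _; apply. Qed.

Lemma good_p x : M x -> N (p%:R *: x).
Proof.
move=> Mx; apply/(good_Lambda gM); split; first exact: ilZn.
by move=> y My; rewrite bformZl; apply: pZp; apply: good_int.
Qed.

Lemma good_ilN : int_lattice G N.
Proof.
split.
- apply/(good_Lambda gM); split; first exact: il0.
  by move=> y _; rewrite bform0l pZ0.
- move=> x y /(good_Lambda gM) [Mx px] /(good_Lambda gM) [My py].
  apply/(good_Lambda gM); split; first exact: ilB.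
  by move=> z Mz; rewrite !bformE; apply: pZB; [apply: px|apply: py].
- by move=> x y Nx Ny; apply: good_int; apply: good_sub.
- move=> v; have [k k0 Mk] := int_lattice_full iM v.
  exists (p * k)%N; first by rewrite muln_gt0 prime_gt0.
  by rewrite natrM -scalerA; apply: good_p.
Qed.

Lemma good_N_cancel (k : nat) v : ~~ (p %| k)%N -> M v -> N (k%:R *: v) -> N v.
Proof.
move=> pk Mv Nk; apply/(good_Lambda gM); split=> // y My.
by apply: (pZ_cancel pk (good_int Mv My)); rewrite -bformZl; apply: good_N.
Qed.

Lemma subgrp_coprime S (k : nat) v : S 0 -> (forall x y, S x -> S y -> S (x - y)) ->
  ~~ (p %| k)%N -> S (k%:R *: v) -> S (p%:R *: v) -> S v.
Proof.
move=> S0 SB pk Sk Sp.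
have k0 : (0 < k)%N by case: (k) pk => //; rewrite dvdn0.
case: (egcdnP p k0) => a b e _.
have /eqP g1 : coprime k p by rewrite coprime_sym prime_coprime.
have -> : v = a%:R *: (k%:R *: v) - b%:R *: (p%:R *: v).
  by rewrite !scalerA -scalerBl -!natrM e g1 natrD addrC addKr scale1r.
exact: SB _ _ (subgrpZn S0 SB a Sk) (subgrpZn S0 SB b Sp).
Qed.

Lemma good_M_cancel (k : nat) v : ~~ (p %| k)%N -> M (k%:R *: v) -> M (p%:R *: v) -> M v.
Proof. apply: subgrp_coprime; [exact: il0|exact: ilB]. Qed.

Lemma good_M_cancel_int (a : rat) v : a \is a Num.int -> ~~ pZ a ->
  M (a *: v) -> M (p%:R *: v) -> M v.
Proof.
move=> ia pa Ma Mp; have [n [aE|aE]] := int_abs ia.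
  by apply: (@good_M_cancel n) => //; [rewrite -pZ_nat -aE|rewrite -aE].
apply: (@good_M_cancel n) => //.
  by rewrite -pZ_nat; apply: contra pa => h; rewrite aE; apply: pZN.
by rewrite -[n%:R]opprK -aE scaleNr; apply: ilN.
Qed.

Lemma parallelZ x a y : prj x y = y -> prj x (a *: y) = a *: y.
Proof. by move=> e; rewrite projZ e. Qed.

Lemma parallel_proj x v : x != 0 -> prj x (prj x v) = prj x v.
Proof. by move=> x0; apply: proj_id. Qed.

Lemma parallel_gram x y z : prj x y = y -> prj x z = z ->
  B y z * B y z = Q y * Q z.
Proof.
by move=> <- <-; rewrite /qform /proj !bformE; ring.
Qed.

Lemma parallel_minor x y z u v : prj x y = y -> prj x z = z -> prj x u = u ->
  prj x v = v -> B y u * B z v - B y v * B z u = 0.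
Proof. by move=> <- <- <- <-; rewrite /proj !bformE; ring. Qed.

Lemma perpZ x a v : prp x (a *: v) = a *: prp x v.
Proof. by rewrite /perp projZ scalerBr. Qed.

Lemma bform_perp_proj x u v : x != 0 -> B (prp x u) (prj x v) = 0.
Proof. by move=> x0; rewrite bformC // /proj bformZl perp_ortho ?mulr0. Qed.

Lemma bform_perp x u v : x != 0 -> B (prp x u) v = B (prp x u) (prp x v).
Proof. by move=> x0; rewrite -{1}(proj_perp G x v) bformDr bform_perp_proj // add0r. Qed.

Lemma bform_proj x u v : x != 0 -> B (prj x u) v = B (prj x u) (prj x v).
Proof.
move=> x0; rewrite -{1}(proj_perp G x v) bformDr [X in _ + X](bformC posG).
by rewrite bform_perp_proj // addr0.
Qed.

(** At p the lattice is the orthogonal sum of its parts on the axis and orthogonal to it; the factor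
    [k] replaces passing to the localisation. *)
Definition split_axis x :=
  exists2 k : nat, ~~ (p %| k)%N & forall v, M v -> M (k%:R *: prj x v).

Definition axis_in x := forall y, M y -> prj x y = y -> N y.

(** For a split axis: it carries the unit part of the form when this part has rank 1; otherwise it
    carries the part divisible by p, and the unit part sits in the orthogonal plane. *)
Definition special_axis x := (r1 -> ~ axis_in x) /\ (~ r1 -> axis_in x).

Lemma split_perp x (k : nat) : (forall v, M v -> M (k%:R *: prj x v)) ->
  forall v, M v -> M (k%:R *: prp x v).
Proof.
move=> sk v Mv; rewrite /perp scalerBr; apply: ilB => //; last exact: sk.
exact: ilZn.
Qed.

(** By the splitting, pairing [y] with any vector reduces to pairing it with a vector [v] of the
    same axis, where the square of [B y v] is [Q y * Q v]. *)
Lemma axis_norm x y : x != 0 -> split_axis x -> M y -> prj x y = y ->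
  pZ (Q y) -> N y.
Proof.
move=> x0 [k pk sk] My yx pQ; apply/(good_Lambda gM); split=> // u Mu.
apply: (pZ_cancel pk (good_int My Mu)).
rewrite -bformZr -{1}yx bform_proj // yx projZ.
set v := k%:R *: prj x u; have Mv : M v by apply: sk.
have vx : prj x v = v by rewrite /v projZ parallel_proj.
have : pZ (B y v * B y v).
  rewrite (parallel_gram yx vx); apply: pZMr => //; exact: good_int.
by move/pZM => /(_ (good_int My Mv) (good_int My Mv)) [].
Qed.

Lemma not_axis_in x : x != 0 -> split_axis x -> ~ axis_in x ->
  exists y, [/\ M y, prj x y = y & ~~ pZ (Q y)].
Proof.
move=> x0 sx nE; apply: contrapT => none; apply: nE => y My yx.
case: (boolP (pZ (Q y))) => pQ; first exact: (axis_norm x0 sx).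
by case: none; exists y.
Qed.

Lemma axis_in_norm x y : axis_in x -> M y -> prj x y = y -> pZ (Q y).
Proof. by move=> ex My yx; apply: good_N => //; apply: ex. Qed.

(** The condition involves [N], [x] and the rank but not [M]: its equivalence with membership in [M]
    is what lets a special axis determine the lattice. *)
Definition axis_desc x v := N (p%:R *: v) /\
  ((r1 /\ exists2 k : nat, ~~ (p %| k)%N & N (k%:R *: prp x v)) \/
   (~ r1 /\ exists2 k : nat, ~~ (p %| k)%N & N (k%:R *: prj x v))).

(** Cramer's rule in the plane orthogonal to [x]: both sides have the same pairings with [a3] and
    [a4], which span the plane since [D] is nonzero. *)
Lemma minor_span x a1 a2 a3 a4 n D : D = B a1 a3 * B a2 a4 - B a1 a4 * B a2 a3 ->
  x != 0 -> B x a1 = 0 -> B x a2 = 0 -> B x a3 = 0 -> B x a4 = 0 -> B x n = 0 ->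
  D != 0 ->
  D *: n = (B n a3 * B a2 a4 - B n a4 * B a2 a3) *: a1
           - (B n a3 * B a1 a4 - B n a4 * B a1 a3) *: a2.
Proof.
move=> DE x0 x1 x2 x3 x4 xn D0; apply/eqP; rewrite -subr_eq0; apply/eqP.
set e := (X in X = 0).
have a30 : a3 != 0.
  by apply: contraNneq D0 => a30; rewrite DE a30 !bform0r mul0r mulr0 subrr.
pose c := B a4 a3 / Q a3; pose b := a4 - c *: a3.
have q3 : Q a3 != 0 by rewrite qform_eq0.
have b0 : b != 0.
  apply: contraNneq D0 => /eqP; rewrite subr_eq0 => /eqP a4E.
  by rewrite DE a4E !bformE; apply/eqP; ring.
have e3 : B e a3 = 0 by rewrite /e DE !bformE; ring.
have e4 : B e a4 = 0 by rewrite /e DE !bformE; ring.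
have ex : B e x = 0 by rewrite bformC // /e !bformE x1 x2 xn; ring.
clearbody e; apply: (@ortho3 G posG x a3 b) => //.
- by rewrite /b !bformE x3 x4; ring.
- by rewrite /b !bformE (bformC posG a3 a4) -/(Q a3) /c; field.
- by rewrite /b !bformE e3 e4; ring.
Qed.

(** In rank 1 an axis vector [y] of norm prime to p forces the orthogonal part of [M] into [N], by
    the vanishing minors, and recovers the axis part of [v] from its pairing with [y]. Otherwise a
    unit minor of [M] can be moved into the orthogonal plane, where [minor_span] recovers the plane
    part of [v] from its pairings. *)
Lemma special_axisP x v : x != 0 -> split_axis x -> special_axis x ->
  M v <-> axis_desc x v.
Proof.
move=> x0 sx [n1 n2]; have [k pk sk] := sx; have iN := good_ilN; split.
  move=> Mv; split; first exact: good_p.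
  have [h|h] := EM r1; [left|right]; split=> //; exists k => //; last first.
    by apply: (n2 h); [apply: sk|rewrite projZ parallel_proj].
  have [y [My yx pQ]] := not_axis_in x0 sx (n1 h).
  have Mp := split_perp sk Mv; apply/(good_Lambda gM); split=> // u Mu.
  have := good_rank1 gM h My Mp My Mu.
  have -> : B (k%:R *: prp x v) y = 0.
    by rewrite -yx bformZl bform_perp_proj ?mulr0.
  rewrite mulr0 subr0 => /pZM [||h1|//]; try exact: good_int.
  by rewrite -/(Q y) h1 in pQ.
case=> Np; case=> [[h [l pl Nl]]|[h [l pl Nl]]].
  have [y [My yx pQ]] := not_axis_in x0 sx (n1 h).
  have Nn : N (p%:R *: (l%:R *: prj x v)).
    have -> : p%:R *: (l%:R *: prj x v) = l%:R *: (p%:R *: v) - p%:R *: (l%:R *: prp x v).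
      by rewrite /perp; apply/rowP => j; rewrite !rvE; ring.
    by apply: ilB => //; apply: ilZn.
  have My' : M (Q y *: (l%:R *: prj x v)).
    have /intrP [m mE] : B (p%:R *: (l%:R *: prj x v)) y / p%:R \is a Num.int.
      exact: good_N Nn My.
    have -> : Q y *: (l%:R *: prj x v) = m%:~R *: y.
      rewrite -mE -yx /qform /proj !bformE !scalerA; congr (_ *: _).
      have q0 : Q x != 0 by rewrite qform_eq0.
      by rewrite -/(Q x); field; rewrite q0 p_neq0.
    exact: ilZ.
  have MQ : M ((Q y * l%:R) *: v).
    have -> : (Q y * l%:R) *: v = Q y *: (l%:R *: prj x v) + Q y *: (l%:R *: prp x v).
      by rewrite /perp; apply/rowP => j; rewrite !rvE; ring.
    apply: ilD => //; have /intrP [m ->] : Q y \is a Num.int by apply: good_int.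
    by apply: ilZ => //; apply: good_sub.
  apply: (@good_M_cancel_int (Q y * l%:R)) => //; last exact: good_sub.
    by apply: rpredM; [apply: good_int|apply: (intr_int _ (Posz l))].
  apply/negP => /pZM [||/(negP pQ)|] //; first exact: good_int.
  by rewrite pZ_nat (negPf pl).
have [u1 [u2 [u3 [u4 [M1 M2 M3 M4 pm]]]]] := good_rank2 gM h.
pose a u := k%:R *: prp x u.
have Ma u : M u -> M (a u) by apply: split_perp.
have xa u : B x (a u) = 0 by rewrite /a bformZr perp_ortho ?mulr0.
(* The axis parts lie in [N], so passing to orthogonal parts changes the form modulo p only by the
   factor [k * k]. *)
have ca u w : M u -> M w -> pZ ((k * k)%:R * B u w - B (a u) (a w)).
  move=> Mu Mw; have -> : (k * k)%:R * B u w - B (a u) (a w) = k%:R * B (k%:R *: prj x u) w.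
    have e : B u w = B (prj x u) w + B (prp x u) (prp x w).
      by rewrite -{1}(proj_perp G x u) bformDl bform_perp.
    rewrite /a natrM e; move: (prj x u) (prp x u) (prp x w) => a' b' c'.
    by rewrite !bformE; ring.
  apply: pZMl => //.
  by apply: good_N => //; apply: (n2 h); [apply: sk|rewrite projZ parallel_proj].
clearbody a.
set D := B (a u1) (a u3) * B (a u2) (a u4) - B (a u1) (a u4) * B (a u2) (a u3).
have iB u w : M u -> M w -> B (a u) (a w) \is a Num.int.
  by move=> Mu Mw; apply: good_int; apply: Ma.
have iD : D \is a Num.int by apply: rpredB; apply: rpredM; apply: iB.
have pD : ~~ pZ D.
  apply/negP => hD; case/negP: pm; apply: (pZ_cancel (k := (k * k) * (k * k))).
  - by rewrite !p_ndvdM.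
  - by apply: rpredB; apply: rpredM; apply: good_int.
  rewrite natrM; apply: (pZ_minor _ _ _ _ _ (ca _ _ M1 M3) (ca _ _ M2 M4) (ca _ _ M1 M4) (ca _ _ M2 M3) hD) => //;
    (exact: iB || exact: good_int).
have D0 : D != 0 by apply: contraNneq pD => ->; apply: pZ0.
pose n := p%:R *: (l%:R *: prp x v); have nE : n = p%:R *: (l%:R *: prp x v) by [].
clearbody n; have Nn : N n.
  have -> : n = l%:R *: (p%:R *: v) - p%:R *: (l%:R *: prj x v).
    by rewrite nE /perp; apply/rowP => j; rewrite !rvE; ring.
  by apply: ilB => //; apply: ilZn.
have xn : B x n = 0 by rewrite nE !bformZr perp_ortho ?mulr0.
have Dn := minor_span (erefl D) x0 (xa u1) (xa u2) (xa u3) (xa u4) xn D0.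
have M' : M (D *: (l%:R *: prp x v)).
  have -> : D *: (l%:R *: prp x v) =
     ((B n (a u3) / p%:R) * B (a u2) (a u4) - (B n (a u4) / p%:R) * B (a u2) (a u3)) *: a u1
     - ((B n (a u3) / p%:R) * B (a u1) (a u4) - (B n (a u4) / p%:R) * B (a u1) (a u3)) *: a u2.
    have -> : D *: (l%:R *: prp x v) = p%:R^-1 *: (D *: n).
      rewrite nE !scalerA; congr (_ *: _); field; exact: p_neq0.
    rewrite Dn; move: (a u1) (a u2) => b1 b2; apply/rowP => j; rewrite !rvE; ring.
  have iN' u : M u -> B n (a u) / p%:R \is a Num.int.
    by move=> Mu; apply: (good_N Nn (Ma _ Mu)).
  have ic c u : c \is a Num.int -> M u -> M (c *: a u).
    by move=> /intrP [m ->] Mu; apply: ilZ => //; apply: Ma.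
  by apply: ilB => //; apply: ic => //; apply: rpredB; apply: rpredM;
    (apply: iB || apply: iN').
have MD : M ((D * l%:R) *: v).
  have -> : (D * l%:R) *: v = D *: (l%:R *: prj x v) + D *: (l%:R *: prp x v).
    by rewrite /perp; apply/rowP => j; rewrite !rvE; ring.
  apply: ilD => //; case/intrP: iD => m ->.
  by apply: ilZ => //; apply: good_sub.
apply: (@good_M_cancel_int (D * l%:R)) => //; last exact: good_sub.
  by apply: rpredM => //; apply: (intr_int _ (Posz l)).
apply/negP => /pZM [||/(negP pD)|] //.
by rewrite pZ_nat (negPf pl).
Qed.

Lemma split_halfturn x : x != 0 -> (forall v, M v -> M (2 *: prj x v - v)) ->
  split_axis x.
Proof.
move=> x0 h; exists 2%N; first exact: p_ndvd2.
move=> v Mv; have -> : 2%:R *: prj x v = (2 *: prj x v - v) + v by rewrite subrK.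
by apply: ilD => //; apply: h.
Qed.

(* Three orthogonal axes split M at p, so exactly one of them is special. *)
Lemma special_axis_V4 x y z : x != 0 -> y != 0 -> z != 0 ->
  B x y = 0 -> B x z = 0 -> B y z = 0 ->
  (forall v, M v -> M (2%:R *: prj x v)) -> (forall v, M v -> M (2%:R *: prj y v)) ->
  (forall v, M v -> M (2%:R *: prj z v)) ->
  [\/ [/\ special_axis x, ~ special_axis y & ~ special_axis z],
      [/\ ~ special_axis x, special_axis y & ~ special_axis z]
    | [/\ ~ special_axis x, ~ special_axis y & special_axis z]].
Proof.
move=> x0 y0 z0 xy xz yz hx hy hz.
have sp u : (forall v, M v -> M (2%:R *: prj u v)) -> split_axis u.
  by move=> h; exists 2%N => //; apply: p_ndvd2.
have qx : Q x != 0 by rewrite qform_eq0.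
have qy : Q y != 0 by rewrite qform_eq0.
have qz : Q z != 0 by rewrite qform_eq0.
have sum v : v = prj x v + prj y v + prj z v.
  apply/eqP; rewrite -subr_eq0; apply/eqP; apply: (@ortho3 G posG x y z) => //.
  - rewrite /proj !bformE -/(Q x) (bformC posG y x) (bformC posG z x) xy xz.
    by field; rewrite ?qx ?qy ?qz.
  - rewrite /proj !bformE -/(Q y) (bformC posG z y) xy yz.
    by field; rewrite ?qx ?qy ?qz.
  - rewrite /proj !bformE -/(Q z) xz yz.
    by field; rewrite ?qx ?qy ?qz.
have iN := good_ilN.
have par a b (a0 : a != 0) (b0 : b != 0) u v : B a b = 0 -> prj a u = u -> prj b v = v -> B u v = 0.
  by move=> ab <- <-; rewrite /proj !bformE ab; ring.
have two : ~~ (p %| 2)%N := p_ndvd2.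
have [h|h] := EM r1.
  (* Two orthogonal axes outside [N] would carry vectors of norm prime to p, hence a unit minor. *)
  have no2 a b : a != 0 -> b != 0 -> B a b = 0 -> (forall v, M v -> M (2%:R *: prj a v)) ->
      (forall v, M v -> M (2%:R *: prj b v)) -> ~ axis_in a -> ~ axis_in b -> False.
    move=> a0 b0 ab ha hb /(not_axis_in a0 (sp _ ha)) [u [Mu au pu]].
    move=> /(not_axis_in b0 (sp _ hb)) [v [Mv bv pv]].
    have := good_rank1 gM h Mu Mv Mu Mv.
    rewrite (par a b a0 b0 u v ab au bv) mul0r subr0 => /pZM [||h1|h1]; try exact: good_int.
      by rewrite -/(Q u) h1 in pu.
    by rewrite -/(Q v) h1 in pv.
  have some1 : axis_in x -> axis_in y -> axis_in z -> False.
    move=> ex ey ez; have [v Mv nv] := good_neq gM; apply: nv.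
    apply: (good_N_cancel two Mv); rewrite [X in _ *: X]sum !scalerDr.
    apply: ilD => //; first apply: ilD => //.
    - by apply: ex; [apply: hx|rewrite projZ parallel_proj].
    - by apply: ey; [apply: hy|rewrite projZ parallel_proj].
    - by apply: ez; [apply: hz|rewrite projZ parallel_proj].
  have sE u : special_axis u = (~ axis_in u).
    by apply/propext; split=> [[H _]|H]; [apply: H|split=> // /(_ h)].
  rewrite !sE; have [ex|ex] := EM (axis_in x); have [ey|ey] := EM (axis_in y);
    have [ez|ez] := EM (axis_in z).
  - by case: (some1 ex ey ez).
  - by constructor 3; split=> //; apply.
  - by constructor 2; split=> //; apply.
  - by case: (no2 y z y0 z0 yz hy hz ey ez).
  - by constructor 1; split=> //; apply.
  - by case: (no2 x z x0 z0 xz hx hz ex ez).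
  - by case: (no2 x y x0 y0 xy hx hy ex ey).
  - by case: (no2 x y x0 y0 xy hx hy ex ey).
(* Two axes inside [N] leave only the third one modulo p, and all minors vanish on a line. *)
have no2 a b c : c != 0 -> (forall v, v = prj a v + prj b v + prj c v) -> a != 0 -> b != 0 ->
    (forall v, M v -> M (2%:R *: prj a v)) ->
    (forall v, M v -> M (2%:R *: prj b v)) -> (forall v, M v -> M (2%:R *: prj c v)) ->
    axis_in a -> axis_in b -> False.
  move=> c0 sm a0 b0 ha hb hc ea eb.
  have [u1 [u2 [u3 [u4 [M1 M2 M3 M4 pm]]]]] := good_rank2 gM h.
  pose q u := 2%:R *: prj c u; have Mq u : M u -> M (q u) by apply: hc.
  have qq u : prj c (q u) = q u by rewrite /q projZ parallel_proj.
  have cq u w : M u -> M w -> pZ (2 * B u w - B (q u) w).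
    move=> Mu Mw; have -> : 2 * B u w - B (q u) w = B (2%:R *: prj a u + 2%:R *: prj b u) w.
      by rewrite {1}(sm u) /q !bformE; ring.
    apply: good_N => //; apply: ilD => //.
      by apply: ea; [apply: ha|rewrite projZ parallel_proj].
    by apply: eb; [apply: hb|rewrite projZ parallel_proj].
  have cq2 u w : M u -> M w -> pZ ((2 * 2)%:R * B u w - B (q u) (q w)).
    move=> Mu Mw.
    have -> : (2 * 2)%:R * B u w - B (q u) (q w) = 2 * (2 * B u w - B (q u) w) + (2 * B w (q u) - B (q w) (q u)).
      by rewrite (bformC posG w) (bformC posG (q w)) natrM; ring.
    by apply: pZD; [apply: pZMl; [exact: (intr_int _ (Posz 2))|apply: cq]|apply: cq => //; apply: Mq].
  case/negP: pm; apply: (pZ_cancel (k := (2 * 2) * (2 * 2))).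
  - by rewrite !p_ndvdM.
  - by apply: rpredB; apply: rpredM; apply: good_int.
  have iq u w : M u -> M w -> B (q u) (q w) \is a Num.int.
    by move=> Mu Mw; apply: good_int; apply: Mq.
  rewrite natrM; apply: (pZ_minor _ _ _ _ _ (cq2 _ _ M1 M3) (cq2 _ _ M2 M4) (cq2 _ _ M1 M4) (cq2 _ _ M2 M3)) => //;
    try (exact: iq || exact: good_int).
  by rewrite (parallel_minor (qq u1) (qq u2) (qq u3) (qq u4)) pZ0.
(* Three axes outside [N] would give a Gram determinant prime to p. *)
have some1 : ~ axis_in x -> ~ axis_in y -> ~ axis_in z -> False.
  move=> /(not_axis_in x0 (sp _ hx)) [u [Mu xu pu]].
  move=> /(not_axis_in y0 (sp _ hy)) [v [Mv yv pv]].
  move=> /(not_axis_in z0 (sp _ hz)) [w [Mw zw pw]].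
  have := good_det3 gM Mu Mv Mw.
  rewrite (par x y x0 y0 u v xy xu yv) (par x z x0 z0 u w xz xu zw) (par y z y0 z0 v w yz yv zw).
  rewrite ?mul0r ?mulr0 ?subr0 ?addr0 => /pZM [||h1|/pZM [||h1|h1]]; try exact: good_int.
  - by apply: rpredM; apply: good_int.
  - by rewrite h1 in pu.
  - by rewrite h1 in pv.
  - by rewrite h1 in pw.
have sE u : special_axis u = axis_in u.
  by apply/propext; split=> [[_ H]|H]; [apply: H|split=> // /h].
have sm1 v : v = prj x v + prj z v + prj y v by rewrite {1}(sum v) addrAC.
have sm2 v : v = prj y v + prj z v + prj x v by rewrite {1}(sum v) -addrA addrC.
rewrite !sE; have [ex|ex] := EM (axis_in x); have [ey|ey] := EM (axis_in y);
  have [ez|ez] := EM (axis_in z).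
- by case: (no2 x y z).
- by case: (no2 x y z).
- by case: (no2 x z y).
- by constructor 1.
- by case: (no2 y z x).
- by constructor 2.
- by constructor 3.
- by case: (some1 ex ey ez).
Qed.

Section TurnSpecial.
Variables (g : 'M[rat]_3) (x : 'rV[rat]_3).
Hypotheses (rg : rot G g) (g1 : g <> 1%:M) (x0 : x != 0) (xg : x *m g = x).
Hypothesis gM' : forall v, M (v *m g) <-> M v.
Hypothesis lam : rotcos g = 0 \/ rotcos g = -1 /\ p <> 3%N.

(** The projection is an average over the powers of [g]: 4 or 3 times it is a sum of images of [v],
    and this factor is prime to p. *)
Lemma turn_split : split_axis x.
Proof.
have xp v : B x (prp x v) = 0 by apply: perp_ortho.
have pl v := rot_plane posG rg g1 x0 xg (xp v).
have gM1 v : M v -> M (v *m g) by move=> Mv; apply/gM'.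
have pg v : prj x v *m g = prj x v by rewrite /proj -scalemxAl xg.
case: lam => [l|[l p3]].
  exists 4%N; first by rewrite (@p_ndvdM 2 2) // p_ndvd2.
  move=> v Mv.
  have -> : 4%:R *: prj x v = v + v *m g + v *m g *m g + v *m g *m g *m g.
    have E (a b : 'rV[rat]_3) : a *m g = a -> b *m g *m g = - b ->
        4%:R *: a = (a + b) + (a + b) *m g + (a + b) *m g *m g + (a + b) *m g *m g *m g.
      move=> ag bg; rewrite !mulmxDl !ag bg mulNmx.
      by move: (b *m g) => u; apply/rowP => j; rewrite !rvE; ring.
    have := E _ (prp x v) (pg v); rewrite proj_perp; apply.
    by rewrite pl l scale0r sub0r.
  by repeat first [assumption|apply: ilD|apply gM1].
exists 3%N; first by rewrite dvdn_prime2 //; apply/eqP.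
move=> v Mv.
have -> : 3%:R *: prj x v = v + v *m g + v *m g *m g.
  have E (a b : 'rV[rat]_3) : a *m g = a -> b *m g *m g = rotcos g *: (b *m g) - b ->
      3%:R *: a = (a + b) + (a + b) *m g + (a + b) *m g *m g.
    move=> ag bg; rewrite !mulmxDl !ag bg l.
    by move: (b *m g) => u; apply/rowP => j; rewrite !rvE; ring.
  by have := E _ _ (pg v) (pl v); rewrite proj_perp.
by repeat first [assumption|apply: ilD|apply gM1].
Qed.

(** The Gram determinant of [a] and [a *m g] is the square of [Q a], or 3/4 of it in order 3, where
    3 is prime to p. *)
Lemma turn_norm a : M a -> B x a = 0 ->
  pZ (Q a * Q a - B a (a *m g) * B a (a *m g)) -> pZ (Q a).
Proof.
move=> Ma xa; have n1 := rot_plane_norm posG rg g1 x0 xg xa.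
have ia : Q a \is a Num.int by apply: good_int.
case: lam => [l|[l p3]]; rewrite l in n1.
  have -> : B a (a *m g) = 0 by lra.
  by rewrite mulr0 subr0 => /pZM [].
have -> : B a (a *m g) = - Q a / 2 by lra.
move=> h; have : pZ (3%:R * (Q a * Q a)).
  have -> : 3%:R * (Q a * Q a) = 4 * (Q a * Q a - - Q a / 2 * (- Q a / 2)) by field.
  by apply: pZMl => //; exact: (intr_int _ (Posz 4)).
have n3 : ~~ (p %| 3)%N by rewrite dvdn_prime2 //; apply/eqP.
by move/(pZ_cancel n3 (rpredM ia ia))/pZM => -[].
Qed.

(** By [turn_norm] a degenerate plane section is zero modulo p. In rank 1 the minors vanish, so the
    plane is in [N] and the axis cannot be. Otherwise an axis vector of unit norm would, through the
    Gram determinant, make the plane vanish modulo p and leave only rank 1. *)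
Lemma turn_special : special_axis x.
Proof.
have [k pk sk] := turn_split; have iN := good_ilN.
have sW := split_perp sk.
have par v : prj x (k%:R *: prj x v) = k%:R *: prj x v by rewrite projZ parallel_proj.
have iso : (forall a, M a -> B x a = 0 -> pZ (Q a)) ->
    forall a b, M a -> M b -> B x a = 0 -> B x b = 0 -> pZ (B a b).
  move=> h a b Ma Mb xa xb; apply: (pZ_cancel p_ndvd2 (good_int Ma Mb)).
  have -> : 2%:R * B a b = Q (a + b) - Q a - Q b.
    by rewrite /qform !bformE (bformC posG b a); ring.
  apply: pZB; [apply: pZB|]; apply: h => //; last by rewrite bformDr xa xb addr0.
  exact: ilD.
split=> h.
  move=> ex; have Q0 a : M a -> B x a = 0 -> pZ (Q a).
    move=> Ma xa; apply: turn_norm => //.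
    have Mg : M (a *m g) by apply/gM'.
    have := good_rank1 gM h Ma Mg Ma Mg.
    by rewrite -/(Q a) (rotB _ _ rg) -/(Q a) (bformC posG (a *m g)).
  have [v Mv nv] := good_neq gM; apply: nv; apply: (good_N_cancel pk Mv).
  rewrite -{1}(proj_perp G x v) scalerDr; apply: ilD => //; first by apply: ex; [apply: sk|].
  apply/(good_Lambda gM); split; first exact: sW.
  move=> u Mu; apply: (pZ_cancel pk); first by apply: good_int => //; apply: sW.
  rewrite -bformZr !bformZl bform_perp // -bformZl perpZ.
  by apply: (iso Q0); rewrite ?bformZr ?perp_ortho ?mulr0 //; apply: sW.
move=> y My yx; apply: contrapT => nN.
have pQ : ~~ pZ (Q y).
  by apply/negP => pQ; apply: nN; apply: (axis_norm x0 turn_split My yx pQ).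
have xy a : B x a = 0 -> B y a = 0 by move=> xa; rewrite -yx /proj bformZl xa mulr0.
have Q0 a : M a -> B x a = 0 -> pZ (Q a).
  move=> Ma xa; apply: turn_norm => //.
  have Mg : M (a *m g) by apply/gM'.
  have := good_det3 gM My Ma Mg.
  rewrite (xy _ xa) (xy (a *m g)) ?(perp_rot rg xg) // !mul0r subr0 addr0.
  rewrite /qform (rotB _ _ rg) => /pZM [||h1|//]; try exact: good_int.
    by apply: rpredB; apply: rpredM; apply: good_int.
  by rewrite -/(Q y) (negPf pQ) in h1.
have [u1 [u2 [u3 [u4 [M1 M2 M3 M4 pm]]]]] := good_rank2 gM h.
case/negP: pm; apply: (pZ_cancel (k := (k * k) * (k * k))).
- by rewrite !p_ndvdM.
- by apply: rpredB; apply: rpredM; apply: good_int.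
pose q u := k%:R *: prj x u.
have cq u w : M u -> M w -> pZ ((k * k)%:R * B u w - B (q u) (q w)).
  move=> Mu Mw.
  have -> : (k * k)%:R * B u w - B (q u) (q w) = B (k%:R *: prp x u) (k%:R *: prp x w).
    have e : B u w = B (prj x u) (prj x w) + B (prp x u) (prp x w).
      by rewrite -{1}(proj_perp G x u) bformDl bform_proj // bform_perp.
    rewrite /q natrM e; move: (prj x u) (prj x w) (prp x u) (prp x w) => a b c d.
    by rewrite !bformE; ring.
  by apply: (iso Q0); rewrite ?bformZr ?perp_ortho ?mulr0 //; apply: sW.
have iq u w : M u -> M w -> B (q u) (q w) \is a Num.int.
  by move=> Mu Mw; apply: good_int; apply: sk.
rewrite natrM; apply: (pZ_minor _ _ _ _ _ (cq _ _ M1 M3) (cq _ _ M2 M4) (cq _ _ M1 M4) (cq _ _ M2 M3)) => //;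
  try (exact: iq || exact: good_int).
by rewrite (parallel_minor (par u1) (par u2) (par u3) (par u4)) pZ0.
Qed.

End TurnSpecial.

(* At p = 3 the projection of N to the axis of an element of order 3 stays in N,
   so the half turn about this axis preserves N. *)
Lemma turn3_halfturn g x : p = 3%N -> rot G g -> g <> 1%:M -> x != 0 -> x *m g = x ->
  (forall v, M (v *m g) <-> M v) -> rotcos g = -1 ->
  forall n, N n -> N (prj x n).
Proof.
move=> p3 rg g1 x0 xg gM' l.
have iN := good_ilN.
have [w sw] := shortest_perp_exists posG x iM; have [[Mw xw] w0 _] := sw.
have xp v : B x (prp x v) = 0 by apply: perp_ortho.
have pl v := rot_plane posG rg g1 x0 xg (xp v).
have gM1 v : M v -> M (v *m g) by move=> Mv; apply/gM'.
have pg v : prj x v *m g = prj x v by rewrite /proj -scalemxAl xg.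
have tr v : 3%:R *: prj x v = v + v *m g + v *m g *m g.
  have E (a b : 'rV[rat]_3) : a *m g = a -> b *m g *m g = rotcos g *: (b *m g) - b ->
      3%:R *: a = (a + b) + (a + b) *m g + (a + b) *m g *m g.
    move=> ag bg; rewrite !mulmxDl !ag bg l.
    by move: (b *m g) => u; apply/rowP => j; rewrite !rvE; ring.
  by have := E _ _ (pg v) (pl v); rewrite proj_perp.
have gN v : N v -> N (v *m g).
  move=> /(good_Lambda gM) [Mv pv]; apply/(good_Lambda gM); split; first exact/gM'.
  move=> y My; have gu := rot_unit rg.
  rewrite -(mulmxKV gu y) rotB //; apply: pv; apply/gM'; by rewrite mulmxKV.
have [z sz] : exists z, [/\ M z /\ prj x z = z, z != 0
    & forall v, M v /\ prj x v = v -> v != 0 -> Q z <= Q v].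
  apply: (shortest_exists posG iM) => [u []|] //.
  have [k k0 Mk] := int_lattice_full iM x; exists (k%:R *: x).
    by split=> //; rewrite -{2}[x]scale1r scalerA mulr1 proj_id.
  by rewrite scaler_eq0 (negPf x0) orbF pnatr_eq0 -lt0n.
have [[Mz xz] z0 mz] := sz.
have parz v : prj x v = v -> exists r, v = r *: z.
  move=> vx; have cx : B z x / Q x != 0.
    by apply: contraNneq z0 => c0; rewrite -xz /proj c0 scale0r.
  have vE : v = (B v x / Q x) *: x by rewrite -{1}vx.
  have zE : z = (B z x / Q x) *: x by rewrite -{1}xz.
  move: cx vE zE; move: (B v x / Q x) (B z x / Q x) => cv cz cx -> ->.
  by exists (cv / cz); rewrite scalerA divfK.
have zint r : M (r *: z) -> r \is a Num.int.
  move=> Mr; apply: (@shortest_mult G posG (fun v => M v /\ prj x v = v) z) => //.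
    move=> u v [Mu ux] [Mv vx]; split; first exact: ilB.
    by rewrite projD -scaleN1r projZ ux vx.
  by split=> //; rewrite projZ xz.
have tri v : M v -> exists t : int, 3%:R *: prj x v = t%:~R *: z.
  move=> Mv; have M3 : M (3%:R *: prj x v) by rewrite tr; repeat first [assumption|apply: ilD|apply gM1].
  have [r rE] := parz (3%:R *: prj x v) (parallelZ _ (parallel_proj _ x0)).
  by rewrite rE in M3 *; have /intrP [t ->] := zint _ M3; exists t.
have dv3 (t : int) v : 3%:R *: prj x v = t%:~R *: z -> (3 %| t)%Z -> M (prj x v).
  move=> e /dvdzP [s tE]; have -> : prj x v = s%:~R *: z.
    apply: (scalerI (a := 3%:R)) => //; rewrite e tE intrM scalerA.
    by rewrite mulrC.
  exact: ilZ.
have three : p%:R = 3 :> rat by rewrite p3.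
have pdv (t : int) : ~~ (3 %| t)%Z -> ~~ pZ t%:~R by rewrite pZ_intr p3.
(* If the projection of [n] were not in [M], then multiples prime to 3 of the axis generator [z] and
   of the plane generators [w] and [w *m g] would lie in [N]; together with [n] they would put all
   of [M] into [N]. *)
have glue n : N n -> M (prj x n).
  move=> Nn; apply: contrapT => nM; have Mn := good_sub Nn.
  have [t te] := tri n Mn.
  have t3 : ~~ (3 %| t)%Z by apply/negP => /(dv3 t n te).
  have Ntz : N (t%:~R *: z) by rewrite -te tr; repeat first [assumption|apply: ilD|apply gN].
  have M1 : M (n - n *m g) by apply: ilB => //; apply/gM'.
  have x1 : B x (n - n *m g) = 0 by rewrite !bformE -{2}xg rotB // subrr.
  have [a [b ab]] := turn_gens posG iM rg g1 gM' x0 xg sw (or_intror l) M1 x1.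
  have pw := rot_plane posG rg g1 x0 xg xw.
  (* When 3 divides [a + b], the plane vector [w2] satisfies [w2 - w2 *m g = n - n *m g]; then
     [n - w2] lies on the axis and is the projection of [n]. *)
  have ab3 : ~~ (3 %| a + b)%Z.
    apply/negP => /dvdzP [c cE]; apply: nM.
    have bE : b = c * 3 - a by rewrite -cE; ring.
    have Mw' : M (a%:~R *: w + c%:~R *: (w *m g - w)).
      by apply: ilD => //; apply: ilZ => //; apply: ilB => //; apply/gM'.
    set w2 := a%:~R *: w + c%:~R *: (w *m g - w) in Mw'.
    have w2E : w2 - w2 *m g = n - n *m g.
      rewrite ab /w2 bE !mulmxDl -!scalemxAl mulmxBl pw l rmorphB rmorphM /=.
      by move: (w *m g) => u; apply/rowP => j; rewrite !rvE; ring.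
    have fx : (n - w2) *m g = n - w2.
      rewrite mulmxBl; apply/eqP; rewrite -subr_eq0; apply/eqP.
      have -> : n *m g - w2 *m g - (n - w2) = (w2 - w2 *m g) - (n - n *m g).
        by move: (n *m g) (w2 *m g) => u u'; apply/rowP => j; rewrite !rvE; ring.
      by rewrite w2E subrr.
    have := rot_fix_line posG rg g1 x0 xg fx.
    have xw2 : B x w2 = 0.
      by rewrite /w2 !bformE (perp_rot rg xg xw) xw; ring.
    rewrite projD -scaleN1r projZ (proj_ortho posG xw2) scaler0 addr0 => ->.
    by rewrite scaleN1r; apply: ilB.
  have N1 : N (n - n *m g) by apply: ilB => //; apply: gN.
  (* The norm of [a + b omega], with the cube root of unity [omega] standing for [g]: multiplying
     [n - n *m g] by the conjugate isolates [w]. Modulo 3 it is the square of [a + b]. *)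
  pose m := a * a - a * b + b * b.
  have m3 : ~~ (3 %| m)%Z.
    apply/negP => m3; have : (3 %| (a + b) ^+ 2)%Z.
      have -> : (a + b) ^+ 2 = m + 3 * (a * b) by rewrite /m; ring.
      by apply: rpredD => //; rewrite dvdz_mulr ?dvdzz.
    by rewrite dvdzE abszX Euclid_dvdX //= => /andP [h _]; rewrite dvdzE h in ab3.
  have Nmw : N (m%:~R *: w).
    have -> : m%:~R *: w = a%:~R *: (n - n *m g) + b%:~R *: ((n - n *m g) *m g *m g).
      rewrite ab !mulmxDl -!scalemxAl pw mulmxBl -!scalemxAl pw l /m.
      rewrite rmorphD rmorphB !rmorphM /=.
      by move: (w *m g) => u; apply/rowP => j; rewrite !rvE; ring.
    by apply: ilD => //; apply: ilZ => //; do 2? apply: (gN).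
  have Nmwg : N (m%:~R *: (w *m g)) by rewrite scalemxAl; apply: gN.
  have [y My nN] := good_neq gM; apply: nN.
  have [s se] := tri y My.
  have [j js] : exists j : int, (3 %| s - j * t)%Z.
    have /coprimezP [[u v] /= uv] : coprimez t 3.
      by rewrite coprimezE coprime_sym prime_coprime //; move: t3; rewrite dvdzE.
    exists (s * u); apply/dvdzP; exists (s * v).
    have e : s * (u * t + v * 3) = s by rewrite uv mulr1.
    by rewrite -{1}e; ring.
  pose y' := y - j%:~R *: n.
  have My' : M y' by apply: ilB => //; apply: ilZ.
  have y'e : 3%:R *: prj x y' = (s - j * t)%:~R *: z.
    rewrite /y' projD -scaleN1r !projZ scalerDr se rmorphB rmorphM /=.
    have -> : 3%:R *: (-1 *: (j%:~R *: prj x n)) = - (j%:~R *: (3%:R *: prj x n)).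
      by apply/rowP => i; rewrite !rvE; ring.
    by rewrite te; apply/rowP => i; rewrite !rvE; ring.
  have Mx' := dv3 _ _ y'e js.
  have MW : M (prp x y') by rewrite /perp; apply: ilB.
  have [a' [b' ab']] := turn_gens posG iM rg g1 gM' x0 xg sw (or_intror l) MW (perp_ortho posG _ x0).
  have NW : N (m%:~R *: prp x y').
    rewrite ab' scalerDr !scalerA ![m%:~R * _]mulrC -!scalerA.
    by apply: ilD => //; apply: ilZ.
  have NX : N (t%:~R *: prj x y').
    have [r rE] := parz _ (parallel_proj y' x0); rewrite rE in Mx' *.
    have /intrP [c ->] := zint _ Mx'; rewrite scalerA mulrC -scalerA.
    exact: ilZ.
  have Ny' : N ((t * m)%:~R *: y').
    rewrite -{1}(proj_perp G x y') scalerDr intrM; apply: ilD => //.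
      by rewrite mulrC -scalerA; apply: ilZ.
    by rewrite -scalerA; apply: ilZ.
  have {}Ny' : N y'.
    apply/(good_Lambda gM); split=> // u Mu.
    have : pZ ((t * m)%:~R * B y' u) by rewrite -bformZl; apply: good_N.
    case/pZM => [||h|//]; try exact: intr_int; try exact: good_int.
    by move: t3 m3 h; rewrite pZ_intr p3 !dvdzE abszM Euclid_dvdM //= => /negPf -> /negPf ->.
  by rewrite -[y](subrK (j%:~R *: n)); apply: ilD => //; apply: ilZ.
move=> n Nn; have Mx := glue n Nn; apply/(good_Lambda gM); split=> // y My.
have [t te] := tri y My.
have [k kE] : exists k : int, prj x n = k%:~R *: z.
  have [r rE] := parz _ (parallel_proj n x0); rewrite rE in Mx *.
  by have /intrP [k ->] := zint _ Mx; exists k.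
case: (boolP (3 %| t)%Z) => t3.
  rewrite bform_proj // (bformC posG) -bform_proj // (bformC posG).
  by apply: good_N => //; apply: (dv3 t).
have [a [b ab]] : exists a b : rat, Q y = a /\ B y (y *m g) = b by exists (Q y), (B y (y *m g)).
case: ab => Qa Bb; have gu := rot_unit rg.
have My1 : M (y *m g) by apply/gM'.
have My2 : M (y *m g *m g) by apply/gM'.
have ggg : forall v, v *m g *m g *m g = v.
  move=> v; have E (c d : 'rV[rat]_3) : c *m g = c -> d *m g *m g *m g = d ->
      (c + d) *m g *m g *m g = c + d.
    by move=> cg dg; rewrite !mulmxDl !cg dg.
  have := E _ (prp x v) (pg v); rewrite proj_perp; apply.
  by rewrite (rot_cube posG rg g1 x0 xg (or_introl l)) // l opprK scale1r.
have B2 : B y (y *m g *m g) = b.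
  by rewrite -Bb -(rotB y (y *m g *m g) rg) ggg (bformC posG).
have ia : a \is a Num.int by rewrite -Qa; apply: good_int.
have ib : b \is a Num.int by rewrite -Bb; apply: good_int.
(* The Gram matrix of [y], [y *m g], [y *m g *m g] is circulant with determinant
   [(a - b)^2 (a + 2 b)], whose factors agree modulo 3. The number [a + 2 b] is the pairing of [y]
   with three times its projection. *)
have pab : pZ (a + 2 * b).
  have := good_det3 gM My My1 My2.
  rewrite /qform !(rotB _ _ rg) -/(Q y) Qa Bb B2.
  have -> : a * (a * a - b * b) - b * (b * a - b * b) + b * (b * b - a * b) = (a - b) * ((a - b) * (a + 2 * b)) by ring.
  have iab : a - b \is a Num.int by apply: rpredB.
  have ia2 : a + 2 * b \is a Num.int by apply: rpredD => //; apply: rpredM => //; exact: (intr_int _ (Posz 2)).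
  have p3b : pZ (3 * b) by rewrite -three; apply: pZp.
  case/pZM => [||h|/pZM [||h|//]] //; first exact: rpredM.
    have -> : a + 2 * b = (a - b) + 3 * b by ring.
  exact: pZD.
  have -> : a + 2 * b = (a - b) + 3 * b by ring.
  exact: pZD.
have it : t%:~R \is a @Num.int rat by apply: intr_int.
have h1 : t%:~R * B (prj x n) y = k%:~R * (a + 2 * b).
  rewrite kE bformZl.
  have e1 : B (3%:R *: prj x y) y = a + 2 * b.
    by rewrite tr !bformE -/(Q y) Qa (bformC posG (y *m g)) (bformC posG (y *m g *m g)) Bb B2; ring.
  by rewrite -e1 te bformZl; ring.
have : pZ (t%:~R * B (prj x n) y) by rewrite h1; apply: pZMl => //; apply: intr_int.
case/pZM => [||h|//] //; first exact: good_int.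
by rewrite pZ_intr p3 (negPf t3) in h.
Qed.

End OneLattice.

Lemma special_axis_inj r1 N M M' x : good r1 N M -> good r1 N M' -> x != 0 ->
  split_axis M x -> split_axis M' x -> special_axis r1 N M x -> special_axis r1 N M' x ->
  M = M'.
Proof.
move=> gM gM' x0 sM sM' nM nM'; apply/seteqP; split=> v.
  by move/(special_axisP gM v x0 sM nM)/(special_axisP gM' v x0 sM' nM').
by move/(special_axisP gM' v x0 sM' nM')/(special_axisP gM v x0 sM nM).
Qed.

(** The description [axis_desc] is invariant under isometries that preserve [N] and the axis. *)
Lemma special_axis_stab r1 N M x h : good r1 N M -> x != 0 ->
  split_axis M x -> special_axis r1 N M x -> isometry_of G h ->
  (forall v, N (v *m h) <-> N v) -> x *m h = x \/ x *m h = - x ->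
  forall v, M (v *m h) <-> M v.
Proof.
move=> gM x0 sM nM [hu hi] hN xh v.
have ph : prj x (v *m h) = prj x v *m h.
  rewrite /proj -scalemxAl.
  have : B (v *m h) (x *m h) = B v x by apply: hi.
  case: xh => ->; first by move=> ->.
  by move=> <-; rewrite bformNr mulNr scaleNr scalerN opprK.
have qh : prp x (v *m h) = prp x v *m h by rewrite /perp ph mulmxBl.
rewrite (special_axisP gM (v *m h) x0 sM nM) (special_axisP gM v x0 sM nM).
have E (c : rat) (y : 'rV[rat]_3) : N (c *: (y *m h)) <-> N (c *: y).
  by rewrite scalemxAl; apply: hN.
rewrite /axis_desc ph qh E; split=> -[Np H]; split=> //; case: H => -[r [k pk Nk]];
  [left|right|left|right]; split=> //; exists k => //; exact/E.
Qed.

End SpecialAxes.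

(** * Residues, units and rationals among the p-adic numbers *)

Section PadicArithmetic.
Variables (q : nat) (pr_q : prime q).
Local Notation Zq := (padic_int pr_q).
Local Notation Qq := (padic pr_q).
Implicit Types x y z : Zq.

Lemma padic_intrE (m : int) k : (m%:~R : Zq) k = (m %% q%:Z ^+ k)%Z.
Proof.
have nE (n : nat) j : (n%:R : Zq) j = (n%:Z %% q%:Z ^+ j)%Z.
  elim: n j => [|n IH] j; first by rewrite mulr0n.
  rewrite -natr1.
  have -> : (n%:R + 1 : Zq) j = (((n%:R : Zq) j + (1 %% q%:Z ^+ j)%Z) %% q%:Z ^+ j)%Z by [].
  by rewrite IH modzDm -addn1 PoszD.
case: m => n; first by rewrite -nE.
by rewrite NegzE mulrNz -[RHS]modzNm -nE.
Qed.

Lemma padic_intr_inj : injective (intr : int -> Zq).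
Proof.
move=> a b ab; apply/eqP; rewrite -subr_eq0; apply: contraT => n0.
have e k : (q%:Z ^+ k %| a - b)%Z.
  apply/dvdz_mod0P; rewrite -padic_intrE.
  have -> : ((a - b)%:~R : Zq) = 0 by rewrite intrB ab subrr.
  exact: mod0z.
have := e `|a - b|%N; rewrite dvdzE abszX /= => /dvdn_leq.
rewrite absz_gt0 n0 => /(_ isT); rewrite leqNgt.
by rewrite ltn_expl ?prime_gt1.
Qed.

(** Dividing by q loses one level of precision, so the quotient at level k is read off from
    [x k.+1]. *)
Lemma padic_divp x : x 1%N = 0 -> exists y, x = q%:R * y.
Proof.
move=> x1; have q0 : q%:Z != 0 by rewrite eqz_nat -lt0n prime_gt0.
have dv k : (q%:Z %| x k.+1)%Z.
  apply/dvdz_mod0P; have := padic_modD x 1 k; rewrite addn1 expr1 x1 => ->.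
  exact: mod0z.
pose f k := (x k.+1 %/ q%:Z)%Z.
have fE k : x k.+1 = f k * q%:Z by rewrite /f divzK ?dv.
have fP k : (f k.+1 = f k %[mod q%:Z ^+ k])%Z.
  apply/eqP; rewrite eqz_mod_dvd.
  have /eqP := padic_modS x k.+1; rewrite eqz_mod_dvd !fE -mulrBl exprSr.
  by rewrite dvdz_mul2r.
exists (padic_mk pr_q fP); apply: padic_eq => k.
have -> : (q%:R * padic_mk pr_q fP : Zq) k = ((q%:R : Zq) k * (padic_mk pr_q fP) k %% q%:Z ^+ k)%Z by [].
have := padic_intrE q%:Z k => ->; rewrite /= modzMm mulrC -fE.
by rewrite -(padic_modS x k) padic_mod || rewrite padic_modS padic_mod.
Qed.

Lemma padic_residue x : exists y, x = (x 1%N)%:~R + q%:R * y.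
Proof.
have [|y yE] := @padic_divp (x - (x 1%N)%:~R); last by exists y; rewrite -yE addrC subrK.
have -> : (x - (x 1%N)%:~R : Zq) 1%N
   = ((x 1%N + ((- ((x 1%N)%:~R : Zq) : Zq) 1%N)) %% q%:Z ^+ 1)%Z by [].
have -> : (- ((x 1%N)%:~R : Zq) : Zq) 1%N = (- ((x 1%N)%:~R : Zq) 1%N %% q%:Z ^+ 1)%Z by [].
by rewrite padic_intrE padic_mod modzDmr subrr mod0z.
Qed.

(** Inverses modulo the powers of q are chosen independently and are compatible because an inverse
    is unique modulo each power. *)
Lemma padic_unit_int (d : int) : coprimez d q%:Z -> exists y : Zq, d%:~R * y = 1.
Proof.
move=> cd; have cdk k : coprimez d (q%:Z ^+ k) by rewrite coprimezXr.
have ex k : exists u : int, (q%:Z ^+ k %| u * d - 1)%Z.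
  case/coprimezP: (cdk k) => -[u v] /= e; exists u.
  by apply/dvdzP; exists (- v); rewrite -e; ring.
pose f k := projT1 (cid (ex k)).
have fE k : (q%:Z ^+ k %| f k * d - 1)%Z by rewrite /f; case: cid.
have fP k : (f k.+1 = f k %[mod q%:Z ^+ k])%Z.
  apply/eqP; rewrite eqz_mod_dvd.
  have h : (q%:Z ^+ k %| (f k.+1 - f k) * d)%Z.
    have -> : (f k.+1 - f k) * d = (f k.+1 * d - 1) - (f k * d - 1) by ring.
    by apply: rpredB => //; apply: dvdz_trans (fE k.+1); rewrite exprS dvdz_mull.
  by rewrite Gauss_dvdzl // coprimez_sym in h.
exists (padic_mk pr_q fP); apply: padic_eq => k.
have -> : (d%:~R * padic_mk pr_q fP : Zq) k = ((d%:~R : Zq) k * (padic_mk pr_q fP) k %% q%:Z ^+ k)%Z by [].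
rewrite padic_intrE /= modzMm mulrC; apply/eqP.
by rewrite eqz_mod_dvd.
Qed.

Lemma intr_tofrac (m : int) : (m%:~R : Qq) = tofrac (m%:~R : Zq).
Proof. by rewrite rmorph_int. Qed.

Lemma natr_tofrac (m : nat) : (m%:R : Qq) = tofrac (m%:R : Zq).
Proof. exact: (intr_tofrac (Posz m)). Qed.

Lemma frac_intr_eq0 (m : int) : ((m%:~R : Qq) == 0) = (m == 0).
Proof.
rewrite intr_tofrac tofrac_eq0; apply/eqP/eqP => [e|->] //.
by apply: padic_intr_inj; rewrite e.
Qed.

Lemma sub_fracE (F : fieldType) (a b c d : F) : b != 0 -> d != 0 ->
  (a * d - c * b) / (b * d) = a / b - c / d.
Proof. by move=> b0 d0; field; rewrite b0 d0. Qed.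

Lemma mul_fracE (F : fieldType) (a b c d : F) : 
  (a * c) / (b * d) = a / b * (c / d).
Proof. by rewrite invfM mulrACA. Qed.

(* [ratr] is only known to be a morphism into ordered fields. *)
Definition qrat (r : rat) : Qq := ratr r.

Lemma qrat_frac (a b : int) : b != 0 -> qrat (a%:~R / b%:~R) = a%:~R / b%:~R.
Proof.
move=> b0; rewrite /qrat /ratr; set r := a%:~R / b%:~R.
have e : numq r * b = a * denq r.
  apply: (intr_inj (R := rat)); rewrite !intrM numqE /r mulrAC divfK //.
  by rewrite intr_eq0.
have bq : (b%:~R : Qq) != 0 by rewrite frac_intr_eq0.
have dq : ((denq r)%:~R : Qq) != 0 by rewrite frac_intr_eq0 denq_neq0.
apply: (mulIf bq); rewrite divfK //; apply: (mulIf dq).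
by rewrite mulrAC divfK // -!intrM e.
Qed.

Lemma qrat_zmod : zmod_morphism qrat.
Proof.
move=> r s; rewrite -{1}[r]divq_num_den -{1}[s]divq_num_den.
set a := numq r; set b := denq r; set c := numq s; set d := denq s.
have b0 : b != 0 by apply: denq_neq0. have d0 : d != 0 by apply: denq_neq0.
have -> : a%:~R / b%:~R - c%:~R / d%:~R = (a * d - c * b)%:~R / (b * d)%:~R :> rat.
  by rewrite intrB !intrM sub_fracE ?intr_eq0.
rewrite qrat_frac ?mulf_neq0 // /qrat /ratr -/a -/b -/c -/d intrB !intrM.
by rewrite sub_fracE ?frac_intr_eq0.
Qed.

Lemma qrat_monoid : monoid_morphism qrat.
Proof.
split; first by rewrite /qrat /ratr /= divr1.
move=> r s; rewrite -{1}[r]divq_num_den -{1}[s]divq_num_den.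
set a := numq r; set b := denq r; set c := numq s; set d := denq s.
have b0 : b != 0 by apply: denq_neq0. have d0 : d != 0 by apply: denq_neq0.
have -> : a%:~R / b%:~R * (c%:~R / d%:~R) = (a * c)%:~R / (b * d)%:~R :> rat.
  by rewrite !intrM mul_fracE.
rewrite qrat_frac ?mulf_neq0 // /qrat /ratr -/a -/b -/c -/d !intrM.
exact: mul_fracE.
Qed.

HB.instance Definition _ := GRing.isZmodMorphism.Build rat Qq qrat qrat_zmod.
HB.instance Definition _ := GRing.isMonoidMorphism.Build rat Qq qrat qrat_monoid.

Lemma qrat_int (m : int) : qrat m%:~R = tofrac (m%:~R : Zq).
Proof. by rewrite rmorph_int intr_tofrac. Qed.

(** If q divided the denominator, the relation [numq r = z * denq r] would make it divide the
    numerator too. *)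
Lemma integral_denq r (z : Zq) : qrat r = tofrac z -> ~~ (q%:Z %| denq r)%Z.
Proof.
move=> e; apply/negP => qd.
have h : ((numq r)%:~R : Zq) = z * (denq r)%:~R.
  apply/eqP; rewrite -tofrac_eq rmorphM /= -e -!qrat_int -rmorphM /=.
  by rewrite numqE.
have qn : (q%:Z %| numq r)%Z.
  have := congr1 (fun x : Zq => x 1%N) h; rewrite padic_intrE.
  have -> : (z * (denq r)%:~R : Zq) 1%N = (z 1%N * ((denq r)%:~R : Zq) 1%N %% q%:Z ^+ 1)%Z by [].
  rewrite padic_intrE expr1 modzMmr => h1; apply/dvdz_mod0P; rewrite h1.
  by apply/dvdz_mod0P; rewrite dvdz_mull.
have := coprime_num_den r; rewrite /coprime => /eqP g1.
have : (q %| gcdn `|numq r| `|denq r|)%N by rewrite dvdn_gcd; move: qn qd; rewrite !dvdzE => -> ->.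
by rewrite g1 dvdn1 => /eqP q1; have := prime_gt1 pr_q; rewrite q1.
Qed.

Definition red (x : Zq) : 'F_q := (x 1%N)%:~R.

Lemma Fq_intr (m : int) : ((m %% q%:Z)%Z%:~R : 'F_q) = m%:~R.
Proof.
have -> : (m%:~R : 'F_q) = ((m %/ q%:Z)%Z * q%:Z + (m %% q%:Z)%Z)%:~R by rewrite -divz_eq.
rewrite [RHS]intrD intrM.
have -> : (q%:Z)%:~R = 0 :> 'F_q by apply: pchar_Fp_0.
by rewrite mulr0 add0r.
Qed.

Lemma red_zmod : zmod_morphism red.
Proof.
move=> x y; rewrite /red.
have -> : (x - y : Zq) 1%N = ((x 1%N + (- y 1%N %% q%:Z ^+ 1)%Z) %% q%:Z ^+ 1)%Z by [].
by rewrite expr1 Fq_intr intrD Fq_intr intrN.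
Qed.

Lemma red_monoid : monoid_morphism red.
Proof.
split=> [|x y]; rewrite /red.
  have -> : (1 : Zq) 1%N = (1 %% q%:Z ^+ 1)%Z by [].
  by rewrite expr1 Fq_intr.
have -> : (x * y : Zq) 1%N = ((x 1%N * y 1%N) %% q%:Z ^+ 1)%Z by [].
by rewrite expr1 Fq_intr intrM.
Qed.

HB.instance Definition _ := GRing.isZmodMorphism.Build Zq 'F_q red red_zmod.
HB.instance Definition _ := GRing.isMonoidMorphism.Build Zq 'F_q red red_monoid.

Lemma red_q : red q%:R = 0.
Proof. by rewrite rmorph_nat pchar_Fp_0. Qed.

Lemma Fq_int_eq0 (m : int) : (m%:~R == 0 :> 'F_q) = (q%:Z %| m)%Z.
Proof.
rewrite -Fq_intr; apply/eqP/idP => [|/dvdz_mod0P -> //].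
have : 0 <= (m %% q%:Z)%Z < q%:Z.
  rewrite modz_ge0 ?ltz_pmod ?ltz_nat ?prime_gt0 // eqz_nat -lt0n prime_gt0 //.
case E : (m %% q%:Z)%Z => [n|n] // /andP [_ nlt] /eqP h.
have : (q %| n)%N by rewrite (dvdn_pcharf (pchar_Fp pr_q)).
case: n E nlt h => [|n] E nlt h; first by move=> _; apply/dvdz_mod0P.
by move/(dvdn_leq (ltn0Sn n)); rewrite leqNgt -ltz_nat nlt.
Qed.

End PadicArithmetic.

Lemma bform_shift (F : fieldType) n (G : 'M[F]_n) r (x y w w' : 'rV[F]_n) :
  bform G (x + r *: w) (y + r *: w') =
  bform G x y + r * (bform G x w' + bform G w y + r * bform G w w').
Proof. by rewrite !bformE; ring. Qed.

Lemma residue_shift (F : comNzRingType) (i r b x y w : F) :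
  (i + r * b) * x + (y + r * w) = i * x + y + r * (b * x + w).
Proof. by ring. Qed.

(** * Localisation of lattices *)

Section Localization.
Variables (q : nat) (pr_q : prime q) (n : nat).
Local Notation Zq := (padic_int pr_q).
Local Notation Qq := (padic pr_q).
Local Notation qr := (map_mx (@qrat q pr_q)).
Local Notation loc := (localize pr_q).
Implicit Types (A L M : set 'rV[rat]_n) (x y : 'rV[rat]_n) (v w : 'rV[Qq]_n).

Lemma loc_elim A (P : 'rV[Qq]_n -> Prop) : P 0 ->
  (forall a x v, A x -> P v -> P (tofrac a *: qr x + v)) ->
  forall v, loc A v -> P v.
Proof.
move=> P0 PS v [t [tA ->]]; elim: t tA => [|u t IH] tA; first by rewrite big_nil.
rewrite big_cons; apply: PS; first by apply: tA; rewrite mem_head.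
by apply: IH => u' ut; apply: tA; rewrite in_cons ut orbT.
Qed.

Lemma loc0 A : loc A 0.
Proof. by exists [::]; split=> //; rewrite big_nil. Qed.

Lemma locD A v w : loc A v -> loc A w -> loc A (v + w).
Proof.
move=> [t [tA ->]] [t' [tA' ->]]; exists (t ++ t'); split; last by rewrite big_cat.
by move=> u; rewrite mem_cat => /orP [/tA|/tA'].
Qed.

Lemma locZ A (a : Zq) v : loc A v -> loc A (tofrac a *: v).
Proof.
move=> [t [tA ->]]; exists [seq (a * u.1, u.2) | u <- t]; split.
  by move=> u /mapP [u' /tA u'A ->].
rewrite big_map scaler_sumr; apply: eq_bigr => u _ /=.
by rewrite scalerA rmorphM.
Qed.

Lemma loc_in A x : A x -> loc A (qr x).
Proof.
move=> Ax; exists [:: (1, x)]; split; first by move=> u; rewrite inE => /eqP ->.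
by rewrite big_seq1 /= rmorph1 scale1r.
Qed.

Lemma loc_sub A A' : (forall x, A x -> loc A' (qr x)) -> loc A `<=` loc A'.
Proof.
move=> AA; apply: loc_elim; first exact: loc0.
by move=> a x v Ax A'v; apply: locD => //; apply: locZ; apply: AA.
Qed.

Lemma loc_coprime A (k : nat) x : ~~ (q %| k)%N -> A (k%:R *: x) -> loc A (qr x).
Proof.
move=> qk Ax; have [|y yE] := @padic_unit_int q pr_q k%:Z.
  by rewrite coprimez_sym coprimezE prime_coprime.
have -> : qr x = tofrac y *: qr (k%:R *: x).
  apply/rowP => j; rewrite !mxE rmorphM /= rmorph_nat natr_tofrac mulrA -rmorphM /=.
  by rewrite mulrC in yE; rewrite yE rmorph1 mul1r.
exact/locZ/loc_in.
Qed.

(** Modulo q only the residues of the coefficients matter; this turns local statements into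
    congruences between rational vectors. *)
Lemma loc_residue A v : A 0 -> (forall x y, A x -> A y -> A (x - y)) -> loc A v ->
  exists x w, [/\ A x, loc A w & v = qr x + q%:R *: w].
Proof.
move=> A0 AB; move: v; apply: loc_elim.
  by exists 0, 0; split=> //; [apply: loc0|rewrite map_mx0 scaler0 addr0].
move=> a x _ Ax [y [w [Ay Aw ->]]]; have [b bE] := padic_residue a.
exists ((a 1%N)%:~R *: x + y), (tofrac b *: qr x + w); split.
- by apply: subgrpD => //; apply: subgrpZ.
- by apply: locD => //; apply: locZ; apply: loc_in.
rewrite {1}bE rmorphD rmorphM /= -intr_tofrac -natr_tofrac.
apply/rowP => j; rewrite !mxE rmorphD rmorphM /= rmorph_int.
exact: residue_shift.
Qed.

Variable G : 'M[rat]_n.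
Local Notation Gq := (form_at pr_q G).

Lemma bform_qr x y : bform Gq (qr x) (qr y) = qrat pr_q (bform G x y).
Proof.
rewrite /bform -[form_at pr_q G]/(qr G) map_trmx -!map_mxM.
by rewrite [LHS]mxE.
Qed.

Lemma loc_integral A : (forall x y, A x -> A y -> bform G x y \is a Num.int) ->
  forall v w, loc A v -> loc A w -> exists z : Zq, bform Gq v w = tofrac z.
Proof.
move=> Aint v w Av Aw; move: v Av; apply: loc_elim.
  by exists 0; rewrite bform0l rmorph0.
move=> a x v Ax [z1 e1]; suff [z2 e2] : exists z : Zq, bform Gq (qr x) w = tofrac z.
  by exists (a * z2 + z1); rewrite bformDl bformZl e1 e2 rmorphD rmorphM.
move: w Aw {e1 v z1}; apply: loc_elim; first by exists 0; rewrite bform0r rmorph0.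
move=> b y w Ay [z1 e1]; have /intrP [m mE] := Aint _ _ Ax Ay.
exists (b * m%:~R + z1).
by rewrite bformDr bformZr e1 bform_qr mE qrat_int rmorphD rmorphM.
Qed.

Lemma loc_act A (s : 'M[rat]_n) : loc (act s A) = act (qr s) (loc A).
Proof.
apply/seteqP; split=> v.
  move: v; apply: loc_elim; first by exists 0; [apply: loc0|rewrite mul0mx].
  move=> a _ _ [x Ax <-] [w Aw <-]; exists (tofrac a *: qr x + w).
    by apply: locD => //; apply/locZ/loc_in.
  by rewrite mulmxDl -scalemxAl map_mxM.
move=> [w Aw <-]; move: w Aw; apply: loc_elim; first by rewrite mul0mx; apply: loc0.
move=> a x w Ax IH; rewrite mulmxDl -scalemxAl -map_mxM; apply: locD => //.
by apply/locZ/loc_in; exists x.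
Qed.

Lemma isometry_qr s : isometry_of G s -> isometry_of Gq (qr s).
Proof.
move=> si; have e := isometry_mx si; case: si => us _.
split; first by rewrite map_unitmx.
move=> x y; rewrite /bform trmx_mul -!mulmxA; congr ((x *m _) 0 0).
rewrite !mulmxA; congr (_ *m _).
by rewrite -[form_at pr_q G]/(qr G) map_trmx -!map_mxM e.
Qed.

End Localization.

Section PadicCongruence.
Variables (p : nat) (pr_p : prime p).
Local Notation Zp := (padic_int pr_p).
Local Notation qrp := (qrat pr_p).

Lemma pZ_red r (z : Zp) : r \is a Num.int -> qrp r = tofrac z -> pZ p r = (red z == 0).
Proof.
move=> /intrP [m ->]; rewrite qrat_int => /eqP; rewrite tofrac_eq => /eqP <-.
by rewrite pZ_intr // rmorph_int Fq_int_eq0.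
Qed.

Lemma red_qrat_int (m : int) (z : Zp) : qrp m%:~R = tofrac z -> red z = m%:~R.
Proof. by rewrite qrat_int => /eqP; rewrite tofrac_eq => /eqP <-; rewrite rmorph_int. Qed.

End PadicCongruence.

Lemma int_denq_prime r : (forall q, prime q -> ~~ (q%:Z %| denq r)%Z) -> r \is a Num.int.
Proof.
move=> h; rewrite Qint_def; apply: contraT => d1.
have := denq_gt0 r; move: h d1; case: (denq r) => // d h d1 d0.
have d2 : (1 < d)%N by rewrite ltn_neqAle eq_sym -eqz_nat d1.
by have := h _ (pdiv_prime d2); rewrite dvdzE /= pdiv_dvd.
Qed.

(** * Genera seen through congruences *)

Section Genus.
Variables (n : nat) (G : 'M[rat]_n).
Local Notation B := (bform G).
Implicit Types (E s : 'M[rat]_n) (A L M : set 'rV[rat]_n) (x y v : 'rV[rat]_n).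

Lemma genus_sym L M : is_lattice L -> genus G L M -> genus G M L.
Proof.
move=> lL [lM gM]; split=> // q pr_q; have [s si sE] := gM q pr_q.
exists (invmx s); first exact: isometryV.
by rewrite -sE actK //; case: si.
Qed.

Lemma lattice_basis_act E L s : s \in unitmx -> lattice_basis E L ->
  lattice_basis (E *m s) (act s L).
Proof.
move=> us [uE ->]; split; first by rewrite unitmx_mul uE us.
apply/seteqP; split=> [_ [_ [c _ <-] <-]|_ [c _ <-]].
  by exists c => //; rewrite mulmxA.
by exists (map_mx intr c *m E); [exists c|rewrite mulmxA].
Qed.

Lemma genus_act L M s : isometry_of G s -> genus G L M -> genus G L (act s M).
Proof.
move=> si [[E lE] gM]; split.
  by exists (E *m s); apply: lattice_basis_act => //; case: si.
move=> q pr_q; have [t ti tE] := gM q pr_q.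
exists (t *m map_mx (@qrat q pr_q) s); first by apply: isometryM => //; apply: isometry_qr.
by rewrite actM tE loc_act.
Qed.

Lemma lattice_basis_in E L (c : 'rV[int]_n) : lattice_basis E L -> L (map_mx intr c *m E).
Proof. by move=> [_ ->]; exists c. Qed.

Lemma lattice0 L : is_lattice L -> L 0.
Proof.
by move=> [E lE]; have := lattice_basis_in 0 lE; rewrite map_mx0 mul0mx.
Qed.

Lemma latticeB L x y : is_lattice L -> L x -> L y -> L (x - y).
Proof.
move=> [E [uE ->]] [c _ <-] [d _ <-]; exists (c - d) => //.
by rewrite map_mxB mulmxBl.
Qed.

Lemma lattice_full L v : is_lattice L -> exists2 k : nat, (0 < k)%N & L (k%:R *: v).
Proof.
move=> [E [uE LE]]; pose c := v *m invmx E.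
pose k := (\prod_j `|denq (c ord0 j)|)%N; exists k.
  by rewrite prodn_gt0 // => j; rewrite absz_gt0 denq_neq0.
rewrite LE; exists (\row_j (numq (c 0 j) * (\prod_(i | i != j) `|denq (c ord0 i)|)%N%:Z)) => //.
have -> : k%:R *: v = (k%:R *: c) *m E by rewrite -scalemxAl /c mulmxKV.
congr (_ *m _); apply/rowP => j; rewrite [LHS]mxE [X in X%:~R]mxE [RHS]mxE intrM numqE -pmulrn.
have -> : k = (`|denq (c ord0 j)| * \prod_(i | i != j) `|denq (c ord0 i)|)%N.
  by rewrite /k (bigD1 j).
have -> : (denq (c 0 j))%:~R = `|denq (c ord0 j)|%N%:R :> rat.
  by rewrite -[in LHS](gtz0_abs (denq_gt0 (c 0 j))).
by rewrite natrM; ring.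
Qed.

(** Each [x] in [M] is the image under the local isometry of a vector of the localised [L], and
    [phi x] represents that vector modulo q. The map is chosen pointwise and need not be
    additive. *)
Lemma genus_congr L M : is_lattice L -> genus G L M ->
  (forall x y, L x -> L y -> B x y \is a Num.int) ->
  forall q (pr_q : prime q), exists phi : 'rV[rat]_n -> 'rV[rat]_n,
    (forall x, M x -> L (phi x)) /\
    forall x y, M x -> M y -> exists z : padic_int pr_q,
      qrat pr_q (B x y) = qrat pr_q (B (phi x) (phi y)) + tofrac (q%:R * z).
Proof.
move=> lL [lM gM] Lint q pr_q; have [s [us si] sE] := gM q pr_q.
have ex x : exists m, M x -> exists w, [/\ L m, localize pr_q L w &
    map_mx (@qrat q pr_q) x = (map_mx (@qrat q pr_q) m + q%:R *: w) *m s].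
  case: (pselect (M x)) => [Mx|nMx]; last by exists 0.
  have := loc_in pr_q Mx; rewrite -sE => -[v Lv ve].
  have [m [w [Lm Lw vE]]] := loc_residue (lattice0 lL) (fun x y => @latticeB L x y lL) Lv.
  by exists m => _; exists w; split=> //; rewrite -vE.
have [phi phiP] := choice ex; exists phi; split.
  by move=> x Mx; have [w [? _ _]] := phiP x Mx.
move=> x y Mx My; have [w [Lm Lw xE]] := phiP x Mx; have [w' [Lm' Lw' yE]] := phiP y My.
have I := @loc_integral q pr_q n G L Lint.
have [z1 e1] := I _ _ (loc_in pr_q Lm) Lw'; have [z2 e2] := I _ _ Lw (loc_in pr_q Lm').
have [z3 e3] := I _ _ Lw Lw'.
exists (z1 + z2 + q%:R * z3); rewrite -!bform_qr xE yE si bform_shift e1 e2 e3.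
by rewrite natr_tofrac -!tofracM -!tofracD -tofracM.
Qed.

(** A value of [B] on [M] is q-integral for every prime q, so no prime divides its denominator. *)
Lemma genus_int L M : is_lattice L -> genus G L M ->
  (forall x y, L x -> L y -> B x y \is a Num.int) ->
  forall x y, M x -> M y -> B x y \is a Num.int.
Proof.
move=> lL gM Lint x y Mx My; apply: int_denq_prime => q pr_q.
have [phi [phiL phiE]] := genus_congr lL gM Lint pr_q.
have [z e] := phiE x y Mx My; have /intrP [m mE] := Lint _ _ (phiL _ Mx) (phiL _ My).
by apply: (@integral_denq q pr_q _ (m%:~R + q%:R * z)); rewrite e mE qrat_int -rmorphD.
Qed.

Lemma genus_pZ p (pr_p : prime p) L M : is_lattice L -> genus G L M ->
  (forall x y, L x -> L y -> B x y \is a Num.int) ->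
  exists phi : 'rV[rat]_n -> 'rV[rat]_n, (forall x, M x -> L (phi x)) /\
    forall x y, M x -> M y -> pZ p (B x y - B (phi x) (phi y)).
Proof.
move=> lL gM Lint; have [phi [phiL phiE]] := genus_congr lL gM Lint pr_p.
exists phi; split=> // x y Mx My; have [z e] := phiE x y Mx My.
rewrite (@pZ_red p pr_p _ (p%:R * z)) //.
- by rewrite rmorphM /= red_q mul0r.
- by apply: rpredB; [apply: (genus_int lL gM)|apply: Lint; apply: phiL].
by rewrite rmorphB /= e addrC addKr.
Qed.

Lemma localize_index p (q : nat) (pr_p : prime p) (pr_q : prime q) (A A' : set 'rV[rat]_n) :
  p <> q -> A `<=` A' -> (forall x, A' x -> A (p%:R *: x)) ->
  localize pr_q A = localize pr_q A'.
Proof.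
move=> pq AA' A'A; apply/seteqP; split; apply: loc_sub => x Ax.
  by apply/loc_in/AA'.
apply: (@loc_coprime _ _ _ _ p); last exact: A'A.
by rewrite dvdn_prime2 //; apply/eqP => e; apply: pq.
Qed.

Lemma localize_equiv q (pr_q : prime q) (A A' : set 'rV[rat]_n) :
  (forall x, A x -> exists2 k : nat, ~~ (q %| k)%N & A' (k%:R *: x)) ->
  (forall x, A' x -> exists2 k : nat, ~~ (q %| k)%N & A (k%:R *: x)) ->
  localize pr_q A = localize pr_q A'.
Proof.
move=> AA' A'A; apply/seteqP; split; apply: loc_sub => x Ax.
  by have [k qk Ak] := AA' x Ax; apply: loc_coprime Ak.
by have [k qk Ak] := A'A x Ax; apply: loc_coprime Ak.
Qed.

End Genus.

Lemma det2E (F : comNzRingType) (A : 'M[F]_2) :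
  \det A = A 0 0 * A 1 1 - A 0 1 * A 1 0.
Proof.
rewrite (expand_det_row A 0) !big_ord_recl big_ord0 /cofactor !det_mx11 !mxE /=.
have e0 : lift (0 : 'I_2) (0 : 'I_1) = 1 by apply/val_inj.
have e1 : lift (1 : 'I_2) (0 : 'I_1) = 0 by apply/val_inj.
have e2 : lift ord0 ord0 = 1 :> 'I_2 by apply/val_inj.
by rewrite !(e0, e1, e2) /bump /= expr0 expr1 addr0; ring.
Qed.

Lemma det3E (F : comNzRingType) (A : 'M[F]_3) :
  \det A = A 0 0 * (A 1 1 * A 2%:R 2%:R - A 1 2%:R * A 2%:R 1)
   - A 0 1 * (A 1 0 * A 2%:R 2%:R - A 1 2%:R * A 2%:R 0)
   + A 0 2%:R * (A 1 0 * A 2%:R 1 - A 1 1 * A 2%:R 0).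
Proof.
rewrite (expand_det_row A 0) !big_ord_recl big_ord0 /cofactor !det2E !mxE /=.
have e1 : lift ord0 ord0 = 1 :> 'I_3 by apply/val_inj.
have e2 : lift ord0 (lift ord0 ord0) = 2%:R :> 'I_3 by apply/val_inj.
have f0 : lift (0 : 'I_3) (0 : 'I_2) = 1 by apply/val_inj.
have f1 : lift (0 : 'I_3) (1 : 'I_2) = 2%:R by apply/val_inj.
have g0 : lift (1 : 'I_3) (0 : 'I_2) = 0 by apply/val_inj.
have g1 : lift (1 : 'I_3) (1 : 'I_2) = 2%:R by apply/val_inj.
have h0 : lift (2%:R : 'I_3) (0 : 'I_2) = 0 by apply/val_inj.
have h1 : lift (2%:R : 'I_3) (1 : 'I_2) = 1 by apply/val_inj.
rewrite !(e2, e1, f0, f1, g0, g1, h0, h1) /bump /= expr0 expr1 addr0.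
rewrite -[in LHS](signr_odd _ (0 + (1 + (1 + 0)))%N) /= expr0 -[ord0]/(0 : 'I_3); ring.
Qed.

(** * Properties modulo p shared by the lattices of a genus *)

Section GoodLattices.
Variables (p : nat) (pr_p : prime p) (odd_p : odd p) (G : 'M[rat]_3).
Hypothesis posG : posdef G.
Local Notation B := (bform G).
Local Notation Q := (qform G).
Implicit Types (L M N : set 'rV[rat]_3) (x y z v : 'rV[rat]_3).

(** The Gram determinant expanded along its first row, in the form used in [good_det3]. *)
Definition gram3 x y z : rat :=
  Q x * (Q y * Q z - B y z * B y z) - B x y * (B x y * Q z - B y z * B x z)
        + B x z * (B x y * B y z - Q y * B x z).

Definition minor2 x y z t : rat := B x z * B y t - B x t * B y z.

Lemma congqE m (a : rat) : (0 < m)%N -> congq m a 0 <-> a / m%:R \is a Num.int.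
Proof.
move=> m0; have mn : m%:R != 0 :> rat by rewrite pnatr_eq0 -lt0n.
rewrite /congq subr0; split=> [[k ->]|/intrP [k kE]].
  by rewrite mulrC mulKf //.
by exists k; rewrite -kE mulrC divfK.
Qed.

Lemma congq_pZ a b : congq p a b <-> pZ p (a - b).
Proof.
by rewrite /pZ -congqE ?prime_gt0 // /congq subr0.
Qed.

(** Taking [y = 0] shows that p divides [Q x]; what remains of the condition is [2 * B x y], and p
    is odd. *)
Lemma LambdaP L : L 0 -> (forall x y, L x -> L y -> B x y \is a Num.int) ->
  forall x, Lambda G p L x <-> L x /\ forall y, L y -> pZ p (B x y).
Proof.
move=> L0 Lint x; have e y : Q (x + y) - Q y = Q x + 2 * B x y.
  by rewrite /qform !bformE [B y x]bformC //; ring.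
split=> [[Lx h]|[Lx h]]; split=> // y Ly.
  have q0 : pZ p (Q x).
    by have /congq_pZ := h 0 L0; rewrite e bform0r mulr0 addr0.
  have /congq_pZ := h y Ly; rewrite e => h2.
  apply: (pZ_cancel pr_p (p_ndvd2 pr_p odd_p)) => //; first exact: Lint.
  have -> : 2 * B x y = Q x + 2 * B x y - Q x by ring.
  exact: pZB.
apply/congq_pZ; rewrite e; apply: pZD; first exact: h.
by apply: pZMl => //; apply: h.
Qed.

Lemma primitive_int L x y : primitive_lattice G L -> L x -> L y -> B x y \is a Num.int.
Proof.
move=> pL Lx Ly; have : scale G L (B x y).
  exists [:: (1, (x, y))]; split; first by move=> u; rewrite inE => /eqP ->.
  by rewrite big_seq1 /= mul1r.
by rewrite pL => -[m _ <-]; apply: intr_int.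
Qed.

Lemma primitive_neq L : primitive_lattice G L ->
  exists x y, [/\ L x, L y & ~~ pZ p (B x y)].
Proof.
move=> pL; apply: contrapT => H.
have h x y : L x -> L y -> pZ p (B x y).
  by move=> Lx Ly; apply: contrapT => /negP n; apply: H; exists x, y.
have : scale G L 1 by rewrite pL; exists 1.
move=> [t [tL]] e; have : pZ p 1.
  rewrite e; elim: t tL {e} => [|u t IH] tL; first by rewrite big_nil pZ0.
  rewrite big_cons; apply: pZD; last first.
    by apply: IH => u' ut; apply: tL; rewrite in_cons ut orbT.
  have [|L1 L2] := tL u; first by rewrite mem_head.
  by apply: pZMl; rewrite ?intr_int //; apply: h.
rewrite -[1]/(1%:R) pZ_nat // dvdn1 => /eqP p1; by have := prime_gt1 pr_p; rewrite p1.
Qed.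

Lemma gram3E x y z : \det (mx3 x y z *m G *m (mx3 x y z)^T) = gram3 x y z.
Proof.
rewrite det3E !bform_row !row_mx3 /= /gram3 /qform.
by rewrite [B y x]bformC // [B z x]bformC // [B z y]bformC //; ring.
Qed.

Lemma lattice_detP L : is_lattice L ->
  exists2 E, lattice_basis E L & lattice_det G L = \det (E *m G *m E^T).
Proof.
move=> [E0 lE0]; rewrite /lattice_det; case: xgetP => [d -> [E lE <-]|].
  by exists E.
by move=> /(_ (\det (E0 *m G *m E0^T))) []; exists E0.
Qed.

Lemma ordq_ge1 (d : rat) : d \is a Num.int -> 1 <= ordq p d -> pZ p d.
Proof.
move=> /intrP [m ->]; rewrite /ordq numq_int denq_int /= logn1 subr0 => h.
rewrite pZ_intr //; have : (0 < logn p `|m|)%N by rewrite -ltz_nat; lia.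
by rewrite logn_gt0 mem_primes => /and3P [_ _]; rewrite dvdzE.
Qed.

(** A Gram determinant is the determinant of the lattice times the square of the determinant of an
    integral matrix of coordinates. *)
Lemma lattice_gram3 L x y z : is_lattice L ->
  (forall x y, L x -> L y -> B x y \is a Num.int) ->
  1 <= ordq p (lattice_det G L) -> L x -> L y -> L z -> pZ p (gram3 x y z).
Proof.
move=> lL Lint od Lx Ly Lz; have [E lE dE] := lattice_detP lL.
have rE i : L (row i E).
  have := lattice_basis_in (row i 1%:M) lE.
  by rewrite map_row map_mx1 -row_mul mul1mx.
have di : \det (E *m G *m E^T) \is a Num.int.
  by rewrite det3E !bform_row; repeat (first [apply: rpredD|rewrite rpredN|apply: rpredM|by apply (Lint)]).
have c v : L v -> exists c : 'rV[int]_3, v = map_mx intr c *m E.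
  by case: lE => _ -> [c _ <-]; exists c.
have [cx xE] := c _ Lx; have [cy yE] := c _ Ly; have [cz zE] := c _ Lz.
pose C : 'M[int]_3 := \matrix_(i < 3) nth 0 [:: cx; cy; cz] i.
have CE : mx3 x y z = map_mx intr C *m E.
  apply/row_matrixP => i; rewrite row_mx3 row_mul -map_row rowK xE yE zE.
  by move: i; apply: ord3P.
have -> : gram3 x y z = (\det C)%:~R * (\det C)%:~R * \det (E *m G *m E^T).
  rewrite -gram3E CE trmx_mul !mulmxA -!mulmxA !det_mulmx !det_tr -!det_map_mx /=.
  by ring.
apply: pZMl; first by rewrite -intrM intr_int.
by rewrite -dE in di *; apply: ordq_ge1.
Qed.

Lemma pZ_congM (a b c d : rat) : a \is a Num.int -> b \is a Num.int ->
  c \is a Num.int -> d \is a Num.int ->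
  pZ p (a - b) -> pZ p (c - d) -> pZ p (a * c - b * d).
Proof.
move=> ai bi ci di ab cd; have -> : a * c - b * d = (a - b) * c + b * (c - d) by ring.
by apply: pZD; [apply: pZMr|apply: pZMl].
Qed.

Lemma pZ_congB (a b c d : rat) : pZ p (a - b) -> pZ p (c - d) ->
  pZ p ((a - c) - (b - d)).
Proof.
move=> ab cd; have -> : (a - c) - (b - d) = (a - b) - (c - d) by ring.
exact: pZB.
Qed.

Lemma pZ_congD (a b c d : rat) : pZ p (a - b) -> pZ p (c - d) ->
  pZ p ((a + c) - (b + d)).
Proof.
move=> ab cd; have -> : (a + c) - (b + d) = (a - b) + (c - d) by ring.
exact: pZD.
Qed.

Lemma pZ_cong (a b : rat) : pZ p (a - b) -> pZ p b -> pZ p a.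
Proof. by move=> ab b0; rewrite -[a](subrK b); apply: pZD. Qed.

Lemma gram3_int L x y z : (forall x y, L x -> L y -> B x y \is a Num.int) ->
  L x -> L y -> L z -> gram3 x y z \is a Num.int.
Proof.
move=> Li Lx Ly Lz; rewrite /gram3 /qform.
by repeat (first [apply: rpredD|rewrite rpredN|apply: rpredM|by apply (Li)]).
Qed.

Lemma minor2_int L x y z t : (forall x y, L x -> L y -> B x y \is a Num.int) ->
  L x -> L y -> L z -> L t -> minor2 x y z t \is a Num.int.
Proof.
move=> Li Lx Ly Lz Lt; rewrite /minor2.
by repeat (first [apply: rpredD|rewrite rpredN|apply: rpredM|by apply (Li)]).
Qed.

Section Transfer.
Variables (L M : set 'rV[rat]_3) (phi : 'rV[rat]_3 -> 'rV[rat]_3).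
Hypotheses (Li : forall x y, L x -> L y -> B x y \is a Num.int)
  (Mi : forall x y, M x -> M y -> B x y \is a Num.int).
Hypotheses (phiL : forall x, M x -> L (phi x))
  (phiB : forall x y, M x -> M y -> pZ p (B x y - B (phi x) (phi y))).

Lemma minor2_cong x y z t : M x -> M y -> M z -> M t ->
  pZ p (minor2 x y z t - minor2 (phi x) (phi y) (phi z) (phi t)).
Proof.
move=> Mx My Mz Mt; apply: pZ_congB; apply: pZ_congM; auto.
Qed.

Lemma gram3_cong x y z : M x -> M y -> M z ->
  pZ p (gram3 x y z - gram3 (phi x) (phi y) (phi z)).
Proof.
move=> Mx My Mz; rewrite /gram3 /qform.
have I := (rpredB, rpredM).
apply: pZ_congD; [apply: pZ_congB|]; apply: pZ_congM; auto;
  try (by apply: rpredB; apply: rpredM; auto);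
  by apply: pZ_congB; apply: pZ_congM; auto.
Qed.

End Transfer.

(** The rank modulo p is expressed by minors so that it transfers along congruences; the link with
    Jordan splittings is [unimodular_rank1P]. *)
Definition rank1_lattice L := forall x y z t, L x -> L y -> L z -> L t ->
  pZ p (minor2 x y z t).

Section OneGenus.
Variable L : set 'rV[rat]_3.
Hypotheses (latL : is_lattice L) (primL : primitive_lattice G L)
  (ord_dL : 1 <= ordq p (lattice_det G L)).
Let Li x y : L x -> L y -> B x y \is a Num.int.
Proof. exact: primitive_int. Qed.

(** Universal properties of [L] modulo p are pulled back to [M] along [phi]; the existence
    statements are transported by [psi] in the other direction. *)
Lemma genus_good M : genus G L M -> good G p (rank1_lattice L) (Lambda G p M) M.
Proof.
move=> gM; have lM : is_lattice M by case: gM.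
have Mi := genus_int latL gM Li; have gL := genus_sym latL gM.
have [phi [phiL phiB]] := genus_pZ pr_p latL gM Li.
have [psi [psiM psiB]] := genus_pZ pr_p lM gL Mi.
split.
- split=> //; first exact: lattice0.
    by move=> x y Mx My; apply: latticeB.
  by move=> v; apply: lattice_full.
- by apply: LambdaP => //; apply: lattice0.
- have [x [y [Lx Ly xy]]] := primitive_neq primL.
  exists (psi x); first exact: psiM.
  move=> /LambdaP [] //; first exact: lattice0.
  move=> _ /(_ _ (psiM y Ly)) h; move/negP: xy; apply.
  exact: pZ_cong (psiB _ _ Lx Ly) h.
- move=> x y z Mx My Mz; apply: (pZ_cong (gram3_cong Li Mi phiL phiB Mx My Mz)).
  by apply: (lattice_gram3 latL Li ord_dL); auto.
- move=> r1 x y z t Mx My Mz Mt; apply: (pZ_cong (minor2_cong Li Mi phiL phiB Mx My Mz Mt)).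
  by apply: r1; auto.
move=> nr1; apply: contrapT => h; apply: nr1 => x y z t Lx Ly Lz Lt.
apply: (pZ_cong (minor2_cong Mi Li psiM psiB Lx Ly Lz Lt)).
apply: contrapT => /negP n; apply: h; exists (psi x), (psi y), (psi z), (psi t).
by split; auto.
Qed.

Lemma genus_rank1 M : genus G L M -> rank1_lattice M <-> rank1_lattice L.
Proof.
move=> gM; have g := genus_good gM; split=> [r1|r1].
  apply: contrapT => /(good_rank2 g) [x [y [z [t [Mx My Mz Mt /negP]]]]]; apply.
  exact: r1.
exact: (good_rank1 g r1).
Qed.

Lemma genus_refl : genus G L L.
Proof.
split=> // q pr_q; exists 1%:M; first exact: isometry1.
exact: act1.
Qed.

End OneGenus.

End GoodLattices.

(** * Residues of integral rationals and of Jordan splittings *)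

Section IntegerResidue.
Variables (p : nat) (pr_p : prime p).
(** Meant for integral rationals, where the numerator is the number itself. *)
Definition ires (r : rat) : 'F_p := (numq r)%:~R.

Lemma ires_intr (m : int) : ires m%:~R = m%:~R.
Proof. by rewrite /ires numq_int. Qed.

Lemma iresD a b : a \is a Num.int -> b \is a Num.int -> ires (a + b) = ires a + ires b.
Proof. by move=> /intrP [m ->] /intrP [k ->]; rewrite -intrD !ires_intr intrD. Qed.

Lemma iresM a b : a \is a Num.int -> b \is a Num.int -> ires (a * b) = ires a * ires b.
Proof. by move=> /intrP [m ->] /intrP [k ->]; rewrite -intrM !ires_intr intrM. Qed.

Lemma iresN a : a \is a Num.int -> ires (- a) = - ires a.
Proof. by move=> /intrP [m ->]; rewrite -intrN !ires_intr intrN. Qed.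

Lemma iresB a b : a \is a Num.int -> b \is a Num.int -> ires (a - b) = ires a - ires b.
Proof. by move=> ai bi; rewrite iresD ?rpredN // iresN. Qed.

Lemma ires_eq0 a : a \is a Num.int -> (ires a == 0) = pZ p a.
Proof. by move=> /intrP [m ->]; rewrite ires_intr Fq_int_eq0 // pZ_intr. Qed.

Lemma ires_eq a b : a \is a Num.int -> b \is a Num.int -> (ires a == ires b) = pZ p (a - b).
Proof. by move=> ai bi; rewrite -subr_eq0 -iresB // ires_eq0 ?rpredB. Qed.

Lemma ires_red a (z : padic_int pr_p) : a \is a Num.int -> qrat pr_p a = tofrac z ->
  ires a = red z.
Proof. by move=> /intrP [m ->] /red_qrat_int ->; rewrite ires_intr. Qed.

Lemma ires_det3 a b c d e f : a \is a Num.int -> b \is a Num.int -> c \is a Num.int ->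
  d \is a Num.int -> e \is a Num.int -> f \is a Num.int ->
  ires (a * (d * f - e * e) - b * (b * f - e * c) + c * (b * e - d * c)) =
  ires a * (ires d * ires f - ires e * ires e) - ires b * (ires b * ires f - ires e * ires c)
   + ires c * (ires b * ires e - ires d * ires c).
Proof.
move=> /intrP [{}a ->] /intrP [{}b ->] /intrP [{}c ->] /intrP [{}d ->] /intrP [{}e ->] /intrP [{}f ->].
transitivity (ires (a * (d * f - e * e) - b * (b * f - e * c) + c * (b * e - d * c))%:~R).
  by congr ires; rewrite !(intrM, intrB, intrD).
by rewrite !ires_intr !(intrM, intrB, intrD).
Qed.

End IntegerResidue.

Section JordanResidues.
Variables (p : nat) (pr_p : prime p) (G : 'M[rat]_3) (M : set 'rV[rat]_3).
Hypothesis symG : G^T = G.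
Local Notation Zp := (padic_int pr_p).
Local Notation Qp := (padic pr_p).
Local Notation Gp := (form_at pr_p G).
Local Notation Mp := (localize pr_p M).
Local Notation B := (bform G).
Local Notation Q := (qform G).
Hypotheses (M0 : M 0) (MB : forall x y, M x -> M y -> M (x - y)).
Hypothesis Mi : forall x y, M x -> M y -> B x y \is a Num.int.

Lemma symGp : Gp^T = Gp.
Proof. by rewrite -[Gp]/(map_mx (@qrat p pr_p) G) map_trmx symG. Qed.

Lemma natp_neq0 : (p%:R : Qp) != 0.
Proof. by rewrite -[p%:R]/((p%:Z)%:~R) frac_intr_eq0 eqz_nat -lt0n prime_gt0. Qed.

Lemma local_basis_mem (A : set 'rV[Qp]_3) F f : local_basis A F -> f \in F -> A f.
Proof.
move=> [_ ->] /(nthP 0) [i iF <-]; exists (fun j => (nat_of_ord j == i)%:R) => //.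
rewrite (bigD1 (Ordinal iF)) //= eqxx rmorph1 scale1r big1 ?addr0 // => j ji.
by rewrite (_ : _ == _ = false) ?rmorph0 ?scale0r //; apply/negbTE; move: ji; rewrite -val_eqE.
Qed.

Section Splitting.
Variable J : seq (int * seq 'rV[Qp]_3).
Hypothesis JM : jordan_splitting Gp Mp J.

Lemma jordan_mem c f : c \in J -> f \in c.2 -> Mp f.
Proof.
case: JM => _ _ _ lb cJ fc; apply: local_basis_mem lb _.
by apply/flattenP; exists c.2 => //; apply/mapP; exists c.
Qed.

Lemma jordan_key c d : c \in J -> d \in J -> c.1 = d.1 -> c = d.
Proof.
case: JM => /lt_sorted_uniq uJ _ _ _ /(nthP c) [i iJ <-] /(nthP c) [j jJ <-].
rewrite -!(nth_map c 0 fst) // => /eqP; rewrite nth_uniq ?size_map // => /eqP ->.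
by [].
Qed.

(** With a negative exponent, integrality of the form would make every entry of the invertible
    matrix [U] divisible by p. *)
Lemma jordan_ge0 c : c \in J -> 0 <= c.1.
Proof.
move=> cJ; case: (JM) => _ /(_ c cJ) [c0 [U uU gU]] _ _.
case E : c.1 => [//|k]; exfalso.
have i0 : (0 < size c.2)%N by case: (c.2) c0.
suff U0 : map_mx (@red p pr_p) U = 0.
  have : \det (map_mx (@red p pr_p) U) \is a GRing.unit.
    by rewrite det_map_mx rmorph_unit // -unitmxE.
  rewrite U0; case: (size c.2) i0 => // n _.
  by rewrite det0 unitr0.
apply/matrixP => i j; rewrite !mxE.
have [z zE] := @loc_integral p pr_p 3 G M Mi _ _ (jordan_mem cJ (mem_nth 0 (ltn_ord i)))
   (jordan_mem cJ (mem_nth 0 (ltn_ord j))).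
have := congr1 (fun A : 'M_(size c.2) => A i j) gU; rewrite !mxE zE E NegzE.
rewrite -exprnN => e.
have {}e : U i j = p%:R ^+ k.+1 * z.
  apply/eqP; rewrite -tofrac_eq tofracM e tofracXn -natr_tofrac mulVKf //.
  by rewrite expf_neq0 // natp_neq0.
by rewrite e rmorphM rmorphXn /= red_q expr0n /= mul0r.
Qed.

Lemma jordan_cross c d f g : c \in J -> d \in J -> f \in c.2 -> g \in d.2 ->
  c.1 <> 0 -> exists z : Zp, bform Gp f g = tofrac (p%:R * z).
Proof.
move=> cJ dJ fc gd c0; case: (JM) => _ Jm Jo _.
case: (pselect (c.1 = d.1)) => [cd|cd]; last first.
  by exists 0; rewrite mulr0 rmorph0; apply: Jo cd _ _ fc gd.
have dE := jordan_key cJ dJ cd; rewrite -dE in gd.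
have [_ [U uU gU]] := Jm _ cJ; have := jordan_ge0 cJ.
case/(nthP 0): fc => i ic <-; case/(nthP 0): gd => j jc <-.
have := congr1 (fun A : 'M_(size c.2) => A (Ordinal ic) (Ordinal jc)) gU.
rewrite !mxE /= => ->; case: (c.1) c0 => // -[//|k] _ _.
exists (p%:R ^+ k * U (Ordinal ic) (Ordinal jc)).
by rewrite mulrA -exprS tofracM tofracXn -natr_tofrac.
Qed.

(** The local counterpart of [Lambda_p]. *)
Definition negligible (w : 'rV[Qp]_3) := Mp w /\
  forall y, Mp y -> exists z : Zp, bform Gp w y = tofrac (p%:R * z).

Lemma negligibleD w w' : negligible w -> negligible w' -> negligible (w + w').
Proof.
move=> [Mw hw] [Mw' hw']; split; first exact: locD.
move=> y My; have [z e] := hw y My; have [z' e'] := hw' y My; exists (z + z').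
by rewrite bformDl e e' -tofracD mulrDr.
Qed.

Lemma negligibleZ (a : Zp) w : negligible w -> negligible (tofrac a *: w).
Proof.
move=> [Mw hw]; split; first exact: locZ.
by move=> y My; have [z e] := hw y My; exists (a * z); rewrite bformZl e -tofracM mulrCA.
Qed.

Lemma negligible0 : negligible 0.
Proof.
split; first exact: loc0.
by move=> y My; exists 0; rewrite bform0l mulr0 rmorph0.
Qed.

Lemma jordan_negligible c f : c \in J -> f \in c.2 -> c.1 <> 0 -> negligible f.
Proof.
move=> cJ fc c0; split; first exact: jordan_mem fc.
move=> y My; case: (JM) => _ _ _ [_ ME]; have : Mp y by [].
rewrite ME => -[a _ <-]; rewrite bform_sumr.
elim/big_ind: _ => [|u v [z1 ->] [z2 ->]|i _]; first by exists 0; rewrite mulr0 rmorph0.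
  by exists (z1 + z2); rewrite -tofracD mulrDr.
have /flattenP [_ /mapP [d dJ ->] fd] := mem_nth (0 : 'rV[Qp]_3) (ltn_ord i).
have [z e] := jordan_cross cJ dJ fc fd c0.
by exists (a i * z); rewrite bformZr e -tofracM mulrCA.
Qed.

Lemma jordan_rank1_decomp e0 : (0, [:: e0]) \in J -> forall x, Mp x ->
  exists a w, negligible w /\ x = tofrac a *: e0 + w.
Proof.
move=> eJ x; case: (JM) => _ _ _ [_ ->] -[a _ <-].
elim/big_ind: _ => [|u v [b [w [nw ->]]] [b' [w' [nw' ->]]]|i _].
- by exists 0, 0; split; [apply: negligible0|rewrite rmorph0 scale0r addr0].
- exists (b + b'), (w + w'); split; first exact: negligibleD.
  by rewrite tofracD scalerDl addrACA.
have /flattenP [_ /mapP [d dJ ->] fd] := mem_nth (0 : 'rV[Qp]_3) (ltn_ord i).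
case: (pselect (d.1 = 0)) => [d0|d0].
  have dE := jordan_key dJ eJ d0; rewrite dE in fd; move: fd; rewrite inE => /eqP ->.
  by exists (a i), 0; split; [apply: negligible0|rewrite addr0].
exists 0, (tofrac (a i) *: (flatten [seq c.2 | c <- J])`_i); split.
  by apply: negligibleZ; apply: jordan_negligible fd d0.
by rewrite rmorph0 scale0r add0r.
Qed.

(** Modulo p the form factors through the coordinate on [e0] as [a x * a y * u], so its minors
    vanish. *)
Lemma jordan_rank1 e0 : (0, [:: e0]) \in J -> rank1_lattice p G M.
Proof.
move=> eJ; have Me : Mp e0 by apply: (jordan_mem eJ); rewrite inE.
have [u uE] := @loc_integral p pr_p 3 G M Mi _ _ Me Me.
have ex x : exists a, M x -> exists w, negligible w /\
    map_mx (@qrat p pr_p) x = tofrac a *: e0 + w.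
  case: (pselect (M x)) => [Mx|?]; last by exists 0.
  by have [a [w [nw e]]] := jordan_rank1_decomp eJ (loc_in pr_p Mx); exists a => _; exists w.
have [a aP] := choice ex.
have bE x y : M x -> M y -> ires p (B x y) = red (a x) * red (a y) * red u.
  move=> Mx My; have [w [[Mw nw] xE]] := aP _ Mx; have [w' [[Mw' nw'] yE]] := aP _ My.
  have [z1 e1] := nw _ (loc_in pr_p My); have [z2 e2] := nw' _ Me.
  rewrite -!rmorphM -[RHS](_ : red (a x * a y * u + p%:R * (a x * z2 + z1)) = _); last first.
    by rewrite rmorphD [X in _ + X]rmorphM /= red_q mul0r addr0.
  apply: ires_red; first exact: Mi.
  rewrite -bform_qr xE bformDl bformZl e1 {1}yE bformDr bformZr uE [bform _ e0 w'](bform_sym _ _ symGp) e2.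
  rewrite -tofracM -tofracD -tofracM -tofracD; congr (tofrac _).
  by ring.
move=> x y z t Mx My Mz Mt; rewrite -ires_eq0 //; last exact: (minor2_int Mi).
rewrite /minor2 iresB ?iresM ?rpredM ?Mi // !bE //; apply/eqP.
by ring.
Qed.

End Splitting.

(** Replacing the basis of the component by rational representatives modulo p keeps its Gram matrix
    modulo p. *)
Lemma unimodular_residues e : unimodular_component Gp Mp e ->
  exists U : 'M[Zp]_(size e), [/\ U \in unitmx, gram_seq Gp e = map_mx (@tofrac _) U &
    exists m : 'I_(size e) -> 'rV[rat]_3, (forall i, M (m i)) /\
      forall i j, ires p (B (m i) (m j)) = red (U i j)].
Proof.
move=> [J JM eJ]; case: (JM) => _ /(_ _ eJ) [_ [U uU gU]] _ _.
exists U; split=> //; first by rewrite gU /= expr0z scale1r.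
have ex (i : 'I_(size e)) : exists m, exists w, [/\ M m, Mp w &
    e`_i = map_mx (@qrat p pr_p) m + p%:R *: w].
  by apply: loc_residue => //; apply: (jordan_mem JM eJ); rewrite mem_nth.
have [m mP] := choice ex; exists m; split=> [i|i j]; first by have [w []] := mP i.
have [w [Mm Mw ei]] := mP i; have [w' [Mm' Mw' ej]] := mP j.
have I := @loc_integral p pr_p 3 G M Mi.
have [z1 e1] := I _ _ (loc_in pr_p Mm) Mw'; have [z2 e2] := I _ _ Mw (loc_in pr_p Mm').
have [z3 e3] := I _ _ Mw Mw'.
have gE : bform Gp e`_i e`_j = tofrac (U i j).
  have := congr1 (fun A : 'M_(size e) => A i j) gU.
  by rewrite !mxE /= expr0z mul1r.
rewrite -[RHS](_ : red (U i j - p%:R * (z1 + z2 + p%:R * z3)) = _); last first.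
  by rewrite rmorphB [X in _ - X]rmorphM /= red_q mul0r subr0.
apply: ires_red; first exact: Mi.
move: gE; rewrite ei ej bform_shift e1 e2 e3 bform_qr natr_tofrac -tofracM -!tofracD -tofracM.
by move=> /eqP; rewrite eq_sym -subr_eq => /eqP <-; rewrite tofracB.
Qed.

Lemma unimodular_size e : unimodular_component Gp Mp e -> (0 < size e <= 3)%N.
Proof.
move=> [J [_ Jm _ [fr _]] eJ]; apply/andP; split.
  by have [] := Jm _ eJ; case: (e).
have : (size (flatten [seq c.2 | c <- J]) <= 3)%N.
  have := fr; rewrite /free => /eqP <-.
  by apply: leq_trans (dimvS (subvf _)) _; rewrite dimvf /dim /= mul1n.
apply: leq_trans; case/splitPr: eJ => J1 J2.
by rewrite map_cat flatten_cat /= !size_cat addnCA leq_addr.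
Qed.

Lemma unimodular_rank1_minors : unimodular_rank1 pr_p G M -> rank1_lattice p G M.
Proof.
move=> [e [J JM eJ]]; case: e eJ => [|e0 [|]] // eJ _.
exact: jordan_rank1 JM _ eJ.
Qed.

Hypothesis Mdet : forall x y z, M x -> M y -> M z -> pZ p (gram3 G x y z).

(** The component has rank at most 3, and [Mdet] excludes rank 3 because the discriminant is a unit.
    In rank 2 this unit is itself a minor, so [M] does not have rank 1. *)
Lemma unimodular_disc_residue (d0 : Zp) : unimodular_disc G M d0 ->
  red d0 != 0 /\
  ((rank1_lattice p G M /\ exists2 m, M m & ires p (Q m) = red d0) \/
   (~ rank1_lattice p G M /\ exists m m', [/\ M m, M m' &
     ires p (Q m * Q m' - B m m' * B m m') = red d0])).
Proof.
move=> [e ue dE]; have sz := unimodular_size ue.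
have [U [uU gU [m [Mm mU]]]] := unimodular_residues ue.
have dU : d0 = \det U.
  by apply/eqP; rewrite -tofrac_eq -dE gU det_map_mx.
have rd : red d0 = \det (map_mx (@red p pr_p) U) by rewrite dU det_map_mx.
have d0n : red d0 != 0.
  by rewrite -unitfE dU rmorph_unit // -unitmxE.
split=> //; move: ue sz U uU gU m Mm mU dU rd d0n {dE}.
case: e => [|a [|b [|c [|]]]] //= ue _ U uU gU m Mm mU dU rd d0n.
- left; split; first by apply: unimodular_rank1_minors; exists [:: a].
  exists (m 0); first exact: Mm.
  by rewrite /qform mU rd (det_mx11 (map_mx _ U : 'M_1)) mxE.
- have dd : red d0 = ires p (Q (m 0) * Q (m 1) - B (m 0) (m 1) * B (m 0) (m 1)).
    rewrite rd (det2E (map_mx _ U : 'M_2)) iresB ?iresM ?rpredM ?Mi // /qform !mU !mxE.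
    have -> : red (U 1 0) = red (U 0 1) by rewrite -!mU (bform_sym _ _ symG).
    by [].
  right; split; last by exists (m 0), (m 1); split; rewrite ?Mm.
  move=> r1; have := r1 _ _ _ _ (Mm 0) (Mm 1) (Mm 0) (Mm 1).
  rewrite -ires_eq0 //; last exact: (minor2_int Mi).
  rewrite /minor2 [B (m 1) (m 0)](bform_sym _ _ symG).
  by rewrite -dd (negbTE d0n).
- have := Mdet (Mm 0) (Mm 1) (Mm 2%:R).
  rewrite -ires_eq0 //; last exact: (gram3_int Mi).
  suff -> : ires p (gram3 G (m 0) (m 1) (m 2%:R)) = red d0 by rewrite (negbTE d0n).
  have s i j : red (U i j) = red (U j i) by rewrite -!mU (bform_sym _ _ symG).
  rewrite rd (det3E (map_mx _ U : 'M_3)) !mxE /gram3 /qform.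
  rewrite ires_det3 ?Mi // !mU.
  by rewrite [red (U 1 0)]s [red (U 2%:R 0)]s [red (U 2%:R 1)]s; ring.
Qed.

End JordanResidues.

Lemma scale_comb3 (F : comNzRingType) (V : lmodType F) (a y c1 c2 c3 a1 a2 a3 : F) (z1 z2 z3 : V) :
  a *: (y *: (c1 *: z1 + c2 *: z2 + c3 *: z3)) + (a1 *: z1 + a2 *: z2 + a3 *: z3) =
  (a * y * c1 + a1) *: z1 + (a * y * c2 + a2) *: z2 + (a * y * c3 + a3) *: z3.
Proof.
rewrite !scalerDl !scalerDr !scalerA; rewrite addrACA; congr (_ + _).
by rewrite addrACA.
Qed.

Lemma ortho_free (F : fieldType) (G : 'M[F]_3) z1 z2 z3 :
  bform G z1 z1 != 0 -> bform G z2 z2 != 0 -> bform G z3 z3 != 0 ->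
  bform G z1 z2 = 0 -> bform G z1 z3 = 0 -> bform G z2 z1 = 0 ->
  bform G z2 z3 = 0 -> bform G z3 z1 = 0 -> bform G z3 z2 = 0 ->
  free [:: z1; z2; z3].
Proof.
move=> n1 n2 n3 e12 e13 e21 e23 e31 e32.
apply/(@freeP _ _ 3 [tuple z1; z2; z3]) => k.
rewrite !big_ord_recl big_ord0 addr0 /= => e.
have h z : bform G (k ord0 *: z1 + (k (lift ord0 ord0) *: z2 + k (lift ord0 (lift ord0 ord0)) *: z3)) z = 0.
  by rewrite e bform0l.
have z (c d : F) : d != 0 -> c * d = 0 -> c = 0.
  by move=> d0 /eqP; rewrite mulf_eq0 (negbTE d0) orbF => /eqP.
have h1 := h z1; have h2 := h z2; have h3 := h z3.
rewrite !bformDl !bformZl e21 e31 !mulr0 !addr0 in h1.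
rewrite !bformDl !bformZl e12 e32 !mulr0 addr0 add0r in h2.
rewrite !bformDl !bformZl e13 e23 !mulr0 !add0r in h3.
have k1 := z _ _ n1 h1; have k2 := z _ _ n2 h2; have k3 := z _ _ n3 h3.
apply: ord3P.
- by rewrite -k1; congr k; apply/val_inj.
- by rewrite -k2; congr k; apply/val_inj.
by rewrite -k3; congr k; apply/val_inj.
Qed.

Lemma ord2P (P : 'I_2 -> Prop) : P 0 -> P 1 -> forall i, P i.
Proof.
move=> P0 P1 [[|[|//]] h].
  by rewrite (_ : Ordinal h = 0) //; apply/val_inj.
by rewrite (_ : Ordinal h = 1) //; apply/val_inj.
Qed.

(** * Construction of a Jordan splitting *)

Section JordanConstruction.
Variables (p : nat) (pr_p : prime p) (odd_p : odd p) (G : 'M[rat]_3).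
Hypothesis posG : posdef G.
Local Notation B := (bform G).
Local Notation Q := (qform G).
Local Notation Zp := (padic_int pr_p).
Local Notation Gp := (form_at pr_p G).
Local Notation qr := (map_mx (@qrat p pr_p)).
Variable M : set 'rV[rat]_3.
Hypothesis iM : int_lattice G M.
Local Notation Mp := (localize pr_p M).

Let M0 : M 0 := int_lattice0 iM.
Let MB x y : M x -> M y -> M (x - y) := @int_latticeB _ _ iM x y.
Let Mi x y : M x -> M y -> B x y \is a Num.int := @int_lattice_int _ _ iM x y.

Lemma int_pfactor (r : rat) : r \is a Num.int -> r != 0 ->
  exists a : nat, exists2 u : int, r = p%:R ^+ a * u%:~R & ~~ (p%:Z %| u)%Z.
Proof.
move=> /intrP [m ->]; rewrite intr_eq0 => m0.
have m1 : (0 < `|m|)%N by rewrite absz_gt0.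
have [k pk] := pfactor_coprime pr_p m1; move: (logn p _) => l mE.
exists l, ((-1) ^+ (m < 0)%R * k%:Z); last first.
  by rewrite dvdzE abszMsign /= -prime_coprime.
rewrite {1}[m]intEsign mE PoszM !intrM mulrA mulrC; congr (_ * _).
by rewrite -!pmulrn natrX.
Qed.

(** Polarisation: if p divided all norms, it would divide all the values [2 * B x y]. *)
Lemma unit_vector_exists : (exists x y, [/\ M x, M y & ~~ pZ p (B x y)]) ->
  exists2 y, M y & ~~ pZ p (Q y).
Proof.
move=> [x [y [Mx My xy]]]; apply: contrapT => h.
have q z : M z -> pZ p (Q z).
  by move=> Mz; apply: contrapT => /negP n; apply: h; exists z.
move/negP: xy; apply; apply: (pZ_cancel pr_p (p_ndvd2 pr_p odd_p)); first exact: Mi.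
have -> : 2 * B x y = Q (x + y) - Q x - Q y.
  by rewrite /qform !bformE [B y x]bformC //; ring.
by apply: pZB; [apply: pZB|]; apply: q => //; apply: subgrpD.
Qed.

(** The vector spans the axis of the product of the half turns about [y1] and [y2]. Both half turns
    send it to the same vector, so its projections to the two orthogonal lines agree and vanish. *)
Lemma ortho2_exists y1 y2 : y1 != 0 -> y2 != 0 -> B y1 y2 = 0 ->
  exists2 v, v != 0 & B y1 v = 0 /\ B y2 v = 0.
Proof.
move=> y10 y20 y12.
have [x x0 xE] := rot_axis posG (rotM (rot_halfturn posG y10) (rot_halfturn posG y20)).
have e : x *m - refl G y1 = x *m - refl G y2.
  have i2 : (- refl G y2) *m (- refl G y2) = 1%:M by rewrite mulNmx mulmxN opprK refl_invol.
  by rewrite -[in RHS]xE -!mulmxA i2 mulmx1.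
rewrite !halfturnE in e.
have {}e : proj G y1 x = proj G y2 x.
  move: e; move: (proj G y1 x) (proj G y2 x) => a b /addIr e.
  have := congr1 (fun v => (1 / 2) *: v) e; rewrite /= !scalerA.
  by rewrite (_ : 1 / 2 * 2 = 1 :> rat) // !scale1r.
have b1 : B y1 x = B y1 (proj G y1 x).
  by have := perp_ortho posG x y10; rewrite /perp !bformE => /eqP; rewrite subr_eq0 => /eqP.
have b2 : B y2 x = B y2 (proj G y2 x).
  by have := perp_ortho posG x y20; rewrite /perp !bformE => /eqP; rewrite subr_eq0 => /eqP.
exists x => //; split.
  by rewrite b1 e /proj bformZr y12 mulr0.
by rewrite b2 -e /proj bformZr [B y2 y1]bformC // y12 mulr0.
Qed.

Record ortho_local_basis y1 y2 y3 : Prop := {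
  olb1 : M y1; olb2 : M y2; olb3 : M y3;
  olb10 : y1 != 0; olb20 : y2 != 0; olb30 : y3 != 0;
  olb12 : B y1 y2 = 0; olb13 : B y1 y3 = 0; olb23 : B y2 y3 = 0;
  olb_span : forall v, M v -> exists2 k : nat, ~~ (p %| k)%N &
    exists c1 c2 c3 : int,
      k%:R *: v = c1%:~R *: y1 + c2%:~R *: y2 + c3%:~R *: y3 }.

(** [y1] has norm prime to p, [y2] is orthogonal to it with the least power of p in its norm, and
    [y3] generates the remaining line. Minimality makes the projections integral up to factors prime
    to p. *)
Lemma ortho_local_basis_exists : (exists x y, [/\ M x, M y & ~~ pZ p (B x y)]) ->
  exists y1 y2 y3 (a b : nat) (u1 u2 u3 : int),
    [/\ ortho_local_basis y1 y2 y3,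
        Q y1 = u1%:~R, Q y2 = p%:R ^+ a * u2%:~R, Q y3 = p%:R ^+ b * u3%:~R &
        [/\ ~~ (p%:Z %| u1)%Z, ~~ (p%:Z %| u2)%Z, ~~ (p%:Z %| u3)%Z & (a <= b)%N]].
Proof.
move=> /unit_vector_exists [y1 My1 u1P].
have y10 : y1 != 0.
  by apply: contraNneq u1P => ->; rewrite /qform bform0l pZ0.
have /intrP [u1 u1E] := Mi My1 My1.
have u1n : ~~ (p%:Z %| u1)%Z by move: u1P; rewrite /qform u1E pZ_intr.
pose W : set 'rV[rat]_3 := fun v => M v /\ B y1 v = 0.
have W0 : W 0 by split; rewrite ?bform0r.
have WB x y : W x -> W y -> W (x - y).
  by move=> [Mx bx] [My b_y]; split; [apply: MB|rewrite !bformE bx b_y subrr].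
pose P (a : nat) := `[< exists w, [/\ W w, w != 0 &
  exists2 u : int, Q w = p%:R ^+ a * u%:~R & ~~ (p%:Z %| u)%Z] >].
have fac w : W w -> w != 0 -> exists2 a, P a & exists2 u : int, Q w = p%:R ^+ a * u%:~R & ~~ (p%:Z %| u)%Z.
  move=> Ww w0; have [||a [u uE un]] := @int_pfactor (Q w).
  - by apply: Mi; case: Ww.
  - by rewrite qform_eq0.
  by exists a; [apply/asboolP; exists w; split=> //; exists u|exists u].
have exP : exists a, P a.
  have [w Ww w0] := perp_exists posG y1 iM.
  by have [a Pa _] := fac w Ww w0; exists a.
case: (ex_minnP exP) => a /asboolP [y2 [Wy2 y20 [u2 u2E u2n]]] amin.
have [My2 y12] := Wy2.
have dvW w : W w -> exists m : int, Q w = p%:R ^+ a * m%:~R.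
  move=> Ww; case: (eqVneq w 0) => [->|w0]; first by exists 0; rewrite /qform bform0l mulr0.
  have [b Pb [u uE _]] := fac w Ww w0; exists (p%:Z ^+ (b - a) * u).
  rewrite uE intrM rmorphXn /= mulrA -exprD subnKC //; exact: amin.
(* By polarisation the minimality of [a] bounds the pairings with [y2] as well as the norms. *)
have bW w : W w -> exists m : int, 2 * B w y2 = p%:R ^+ a * m%:~R.
  move=> Ww; have [m1 e1] := dvW _ (subgrpD W0 WB Ww Wy2); have [m2 e2] := dvW _ Ww.
  exists (m1 - m2 - u2); rewrite !intrB !mulrBr -e1 -e2 -u2E /qform !bformE [B y2 w]bformC //.
  by ring.
pose S : set 'rV[rat]_3 := fun v => W v /\ B y2 v = 0.
have S0 : S 0 by split; rewrite ?bform0r.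
have SB x y : S x -> S y -> S (x - y).
  by move=> [Wx bx] [Wy b_y]; split; [apply: WB|rewrite !bformE bx b_y subrr].
have [y3 [[[My3 y13] y23] y30 y3min]] : exists w, [/\ S w, w != 0 &
    forall v, S v -> v != 0 -> Q w <= Q v].
  apply: (shortest_exists posG iM); first by move=> v [[]].
  have [v v0 [v1 v2]] := ortho2_exists y10 y20 y12.
  have [k k0 Mk] := int_lattice_full iM v; exists (k%:R *: v).
    by split; [split=> //|]; rewrite bformZr ?v1 ?v2 mulr0.
  by rewrite scaler_eq0 negb_or v0 pnatr_eq0 -lt0n k0.
have Wy3 : W y3 by [].
have [b Pb [u3 u3E u3n]] := fac y3 Wy3 y30.
exists y1, y2, y3, a, b, u1, u2, u3; split=> //; last by split=> //; apply: amin.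
split=> // v Mv.
have /intrP [c1 c1E] := Mi Mv My1.
have Ww : W (u1%:~R *: v - c1%:~R *: y1).
  split; first by apply: MB; apply: subgrpZ.
  by rewrite !bformE [B y1 v]bformC // c1E u1E; ring.
set w := _ - _ in Ww; have wE : u1%:~R *: v = c1%:~R *: y1 + w by rewrite /w addrC subrK.
clearbody w.
have [c2 c2E] := bW _ Ww.
have St : S ((2 * u2)%:~R *: w - c2%:~R *: y2).
  split; first by apply (WB); apply (subgrpZ W0 WB).
  have pa : p%:R ^+ a != 0 :> rat by rewrite expf_neq0 // p_neq0.
  rewrite !bformE -/(Q y2) u2E [B y2 w]bformC // intrM.
  apply: (mulfI pa); rewrite mulr0.
  transitivity (p%:R ^+ a * u2%:~R * (2 * B w y2) - p%:R ^+ a * u2%:~R * (p%:R ^+ a * c2%:~R)).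
    by ring.
  by rewrite c2E; ring.
set t := _ - _ in St; have tE : (2 * u2)%:~R *: w = c2%:~R *: y2 + t by rewrite /t addrC subrK.
clearbody t.
have tp : proj G y3 t = t.
  have [[_ t1] t2] := St; apply/eqP; rewrite eq_sym -subr_eq0; apply/eqP.
  apply: (@ortho3 _ posG y1 y2 y3) => //.
  - by rewrite bformC // !bformE t1 y13; ring.
  - by rewrite bformC // !bformE t2 y23; ring.
  by rewrite bformC //; apply: perp_ortho.
have /intrP [c3 c3E] : B t y3 / Q y3 \is a Num.int.
  by apply: (shortest_mult posG SB _ y30 y3min) => //; rewrite -[X in S X]/(proj G y3 t) tp.
have {}tE : (2 * u2)%:~R *: w = c2%:~R *: y2 + c3%:~R *: y3 by rewrite tE -tp /proj c3E.
(* The factor clears first [Q y1], then twice the unit part of [Q y2]. *)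
have nk : ~~ (p %| `|(2 * u2 * u1)%R|)%N.
  rewrite !abszM; apply: (p_ndvdM pr_p); last by move: u1n; rewrite dvdzE.
  by apply: (p_ndvdM pr_p); [apply: p_ndvd2|move: u2n; rewrite dvdzE].
have kE : (2 * u2 * u1)%:~R *: v = (2 * u2 * c1)%:~R *: y1 + c2%:~R *: y2 + c3%:~R *: y3.
  by rewrite intrM -scalerA wE scalerDr tE scalerA -intrM addrA.
exists `|(2 * u2 * u1)%R|%N => //.
case: (ltrgt0P (2 * u2 * u1)) => s.
- exists (2 * u2 * c1), c2, c3; rewrite -kE; congr (_ *: _).
  by rewrite -[in RHS](gtz0_abs s).
- exists (- (2 * u2 * c1)), (- c2), (- c3); rewrite !intrN !scaleNr -!opprD -kE -scaleNr.
  congr (_ *: _); by rewrite -intrN -[in RHS](ltz0_abs s).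
by rewrite s absz0 dvdn0 in nk.
Qed.

Lemma unit_intr (u : int) : ~~ (p%:Z %| u)%Z -> (u%:~R : Zp) \is a GRing.unit.
Proof.
move=> un; have [|y yE] := @padic_unit_int p pr_p u; last by apply/unitrPr; exists y.
by rewrite coprimez_sym coprimezE prime_coprime //; move: un; rewrite dvdzE.
Qed.

Lemma ortho_local_free y1 y2 y3 : ortho_local_basis y1 y2 y3 ->
  free [:: qr y1; qr y2; qr y3].
Proof.
move=> [_ _ _ y10 y20 y30 y12 y13 y23 _].
have qn y : y != 0 -> bform Gp (qr y) (qr y) != 0.
  by move=> y0; rewrite bform_qr fmorph_eq0 -/(Q y) qform_eq0.
have q0 x y : B x y = 0 -> bform Gp (qr x) (qr y) = 0.
  by move=> e; rewrite bform_qr e rmorph0.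
have y21 : B y2 y1 = 0 by rewrite bformC. have y31 : B y3 y1 = 0 by rewrite bformC.
have y32 : B y3 y2 = 0 by rewrite bformC.
by apply: ortho_free; auto.
Qed.

Lemma ortho_local_basisP y1 y2 y3 : ortho_local_basis y1 y2 y3 ->
  local_basis Mp [:: qr y1; qr y2; qr y3].
Proof.
move=> ob; split; first exact: ortho_local_free.
case: ob => m1 m2 m3 _ _ _ _ _ _ sp.
have fold (c : 'I_3 -> Zp) : \sum_(i < 3) tofrac (c i) *: [:: qr y1; qr y2; qr y3]`_i =
   tofrac (c 0) *: qr y1 + tofrac (c 1) *: qr y2 + tofrac (c 2%:R) *: qr y3.
  rewrite !big_ord_recl big_ord0 addr0 /= addrA; congr (_ + _ + _).
  - by congr (tofrac (c _) *: _); apply/val_inj.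
  by congr (tofrac (c _) *: _); apply/val_inj.
apply/seteqP; split=> v /=.
  suff H : forall w, Mp w -> exists a1 a2 a3 : Zp,
      w = tofrac a1 *: qr y1 + tofrac a2 *: qr y2 + tofrac a3 *: qr y3.
    move=> /H [a1 [a2 [a3 ->]]].
    by exists (fun i : 'I_3 => nth 0 [:: a1; a2; a3] i) => //; rewrite fold.
  apply: loc_elim; first by exists 0, 0, 0; rewrite rmorph0 !scale0r !addr0.
  move=> a x w Mx [a1 [a2 [a3 ->]]]; have [k kn [c1 [c2 [c3 e]]]] := sp _ Mx.
  have [|y yE] := @padic_unit_int p pr_p k%:Z.
    by rewrite coprimez_sym coprimezE prime_coprime.
  exists (a * y * c1%:~R + a1), (a * y * c2%:~R + a2), (a * y * c3%:~R + a3).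
  have -> : qr x = tofrac y *: (tofrac c1%:~R *: qr y1 + tofrac c2%:~R *: qr y2 + tofrac c3%:~R *: qr y3).
    have -> : tofrac c1%:~R *: qr y1 + tofrac c2%:~R *: qr y2 + tofrac c3%:~R *: qr y3 = qr (k%:R *: x).
      by rewrite e !map_mxD !map_mxZ /= !qrat_int.
    rewrite map_mxZ /= rmorph_nat natr_tofrac scalerA -tofracM mulrC yE rmorph1 scale1r //.
  rewrite !tofracD !tofracM; exact: scale_comb3.
move=> [c _ <-]; rewrite fold.
by do ![apply: locD]; apply: locZ; apply: loc_in.
Qed.

Lemma qrat_pfactor (a : nat) (u : int) :
  qrat pr_p (p%:R ^+ a * u%:~R) = p%:R ^ a%:Z * tofrac (u%:~R : Zp).
Proof. by rewrite rmorphM rmorphXn /= rmorph_nat qrat_int. Qed.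

Lemma modular_line y (a : nat) (u : int) : Q y = p%:R ^+ a * u%:~R ->
  ~~ (p%:Z %| u)%Z -> modular Gp a%:Z [:: qr y].
Proof.
move=> yE un; exists ((u%:~R)%:M : 'M[Zp]_1); first by rewrite unitmxE det_scalar1 unit_intr.
apply/matrixP => i j; rewrite (ord1 i) (ord1 j) mxE /= bform_qr -/(Q y) yE qrat_pfactor.
by rewrite ![in RHS]mxE eqxx mulr1n.
Qed.

Lemma modular_plane y z (a : nat) (u v : int) : Q y = p%:R ^+ a * u%:~R ->
  Q z = p%:R ^+ a * v%:~R -> B y z = 0 ->
  ~~ (p%:Z %| u)%Z -> ~~ (p%:Z %| v)%Z -> modular Gp a%:Z [:: qr y; qr z].
Proof.
move=> yE zE yz un vn; have zy : B z y = 0 by rewrite bformC.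
exists (diag_mx (\row_(i < 2) nth 0 [:: u%:~R; v%:~R : Zp] i)).
  by rewrite unitmxE det_diag !big_ord_recl big_ord0 !mxE /= mulr1 unitrM !unit_intr.
apply/matrixP; apply: ord2P; apply: ord2P; rewrite mxE /= bform_qr -/(Q _) ?yE ?zE ?yz ?zy
  ?qrat_pfactor ![in RHS]mxE /= ?mulr1n //.
- by rewrite rmorph0 rmorph0 mulr0.
- by rewrite rmorph0 rmorph0 mulr0.
Qed.

(** The minor of [y1] and [y2] forces [0 < a], so [y1] alone is the unimodular component; [y2] and
    [y3] form one further component when [a = b] and two otherwise. *)
Lemma rank1_unimodular : (exists x y, [/\ M x, M y & ~~ pZ p (B x y)]) ->
  rank1_lattice p G M -> unimodular_rank1 pr_p G M.
Proof.
move=> /ortho_local_basis_exists [y1 [y2 [y3 [a [b [u1 [u2 [u3 [ob e1 e2 e3 [n1 n2 n3 ab]]]]]]]]]] r1.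
have lb := ortho_local_basisP ob.
case: ob => m1 m2 m3 y10 y20 y30 y12 y13 y23 _.
have a0 : (0 < a)%N.
  rewrite lt0n; apply/eqP => a0; have := r1 _ _ _ _ m1 m2 m1 m2.
  rewrite /minor2 y12 mul0r subr0 -/(Q y1) -/(Q y2) e1 e2 a0 expr0 mul1r => /(pZM pr_p).
  by rewrite !intr_int !pZ_intr // (negbTE n1) (negbTE n2) => /(_ isT isT) [].
have y21 : B y2 y1 = 0 by rewrite bformC. have y31 : B y3 y1 = 0 by rewrite bformC.
have y32 : B y3 y2 = 0 by rewrite bformC.
have q0 x y : B x y = 0 -> bform Gp (qr x) (qr y) = 0.
  by move=> e; rewrite bform_qr e rmorph0.
have l1 : modular Gp 0 [:: qr y1] by apply: (@modular_line y1 0 u1) => //; rewrite expr0 mul1r.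
exists [:: qr y1] => //.
case: (ltngtP a b) ab => // [ab _|ab _].
  exists [:: (0, [:: qr y1]); (a%:Z, [:: qr y2]); (b%:Z, [:: qr y3])]; last by rewrite inE eqxx.
  split=> //=.
  - by rewrite !ltz_nat a0 ab.
  - move=> c; rewrite !inE => /or3P [] /eqP -> /=; split=> //.
      exact: modular_line e2 n2.
    exact: modular_line e3 n3.
  - move=> c d; rewrite !inE => /or3P [] /eqP -> /or3P [] /eqP -> //= _ x y;
      rewrite !inE => /eqP -> /eqP ->; exact: q0.
exists [:: (0, [:: qr y1]); (a%:Z, [:: qr y2; qr y3])]; last by rewrite inE eqxx.
split=> //=.
- by rewrite ltz_nat a0.
- move=> c; rewrite !inE => /orP [] /eqP -> /=; split=> //.
  by apply: modular_plane e2 _ y23 n2 n3; rewrite e3 ab.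
- move=> c d; rewrite !inE => /orP [] /eqP -> /orP [] /eqP -> //= _ x y;
    rewrite !inE; [move=> /eqP -> /orP [] /eqP ->|move=> /orP [] /eqP -> /eqP ->]; exact: q0.
Qed.

Lemma unimodular_rank1P : (exists x y, [/\ M x, M y & ~~ pZ p (B x y)]) ->
  unimodular_rank1 pr_p G M <-> rank1_lattice p G M.
Proof.
move=> ex; split; last exact: rank1_unimodular.
by apply: unimodular_rank1_minors => //; case: posG.
Qed.

End JordanConstruction.

(** * Special symmetries in terms of special axes *)

Section SpecialSymmetries.
Variables (p : nat) (pr_p : prime p) (odd_p : odd p) (G : 'M[rat]_3).
Hypothesis posG : posdef G.
Local Notation B := (bform G).
Local Notation Q := (qform G).
Local Notation prj := (proj G).
Implicit Types (s t : 'M[rat]_3) (x y v w : 'rV[rat]_3) (M N : set 'rV[rat]_3).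

Lemma mx_eq_act s t : (forall v : 'rV[rat]_3, v *m s = v *m t) -> s = t.
Proof.
move=> h; apply/row_matrixP => i.
by rewrite -[s]mul1mx -[t]mul1mx !row_mul h.
Qed.

Lemma symmetry_refl s x : is_symmetry_along G s x -> x != 0 /\ s = refl G x.
Proof.
move=> [x0 sx]; split; first exact/eqP.
by apply: mx_eq_act => v; rewrite sx refl_tau.
Qed.

Lemma refl_symmetry x : x != 0 -> is_symmetry_along G (refl G x) x.
Proof. by move=> x0; split; [exact/eqP|move=> v; rewrite refl_tau]. Qed.

Lemma refl_scale a x : a != 0 -> refl G (a *: x) = refl G x.
Proof.
move=> a0; apply: mx_eq_act => v.
have h y : v *m refl G y = v - 2 *: prj y v.
  by rewrite -[LHS]opprK -mulmxN halfturnE opprB.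
by rewrite !h proj_scale.
Qed.

Lemma refl_axis x y : x != 0 -> y *m refl G x = - y -> prj x y = y.
Proof.
move=> x0 e; have := halfturnE G x y; rewrite mulmxN e opprK.
move: (prj x y) => z h; have := congr1 (fun v => (1 / 2) *: (v + y)) h.
rewrite /= subrK scalerA (_ : 1 / 2 * 2 = 1 :> rat) // scale1r => <-.
by apply/rowP => j; rewrite !rvE; field.
Qed.

Lemma proj_axis x y : prj x y = y -> exists a, y = a *: x.
Proof. by move=> <-; exists (B y x / Q x). Qed.

(** A shortest vector of [M] on the axis generates all of [M] there, so the primitive vectors along
    the axis are this one and its opposite, and the choice made by [xget] does not matter. *)
Lemma symmetry_normP M s x : int_lattice G M -> x != 0 -> s = refl G x ->
  exists x0, [/\ M x0, x0 != 0, prj x x0 = x0,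
    forall y, M y -> prj x y = y -> exists k : int, y = k%:~R *: x0 &
    symmetry_norm G M s = Q x0].
Proof.
move=> iM x0 ->; pose S : set 'rV[rat]_3 := fun v => M v /\ prj x v = v.
have S0 : S 0 by split; [apply: int_lattice0 iM|rewrite proj_ortho ?bform0r].
have SB y z : S y -> S z -> S (y - z).
  move=> [My ey] [Mz ez]; split; first exact: (int_latticeB iM).
  by rewrite -[- z]scaleN1r projD projZ ey ez.
have [w [[Mw ew] w0 wmin]] : exists w, [/\ S w, w != 0 &
    forall v, S v -> v != 0 -> Q w <= Q v].
  apply: (shortest_exists posG iM); first by move=> v [].
  have [k k0 Mk] := int_lattice_full iM x; exists (k%:R *: x).
    by split=> //; rewrite proj_id.
  by rewrite scaler_eq0 negb_or x0 pnatr_eq0 -lt0n k0.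
have mult y : M y -> prj x y = y -> exists k : int, y = k%:~R *: w.
  move=> My ey; have [a aE] := proj_axis ey; have [b bE] := proj_axis ew.
  have b0 : b != 0 by apply: contraNneq w0 => b0; rewrite bE b0 scale0r.
  have yE : y = (a / b) *: w by rewrite bE scalerA divfK.
  have /intrP [k kE] : a / b \is a Num.int.
    by apply: (shortest_mult posG SB _ w0 wmin) => //; rewrite -yE.
  by exists k; rewrite -kE.
have rw : refl G w = refl G x.
  have [b bE] := proj_axis ew; rewrite bE refl_scale //.
  by apply: contraNneq w0 => b0; rewrite bE b0 scale0r.
exists w; split=> //; rewrite /symmetry_norm.
have prim_w : primitive_vector M w.
  split=> //; first exact/eqP.
  move=> k y My wE; have k0 : k != 0 by apply: contraNneq w0 => k0; rewrite wE k0 scale0r.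
  have ey : prj x y = y.
    have kr : k%:~R != 0 :> rat by rewrite intr_eq0.
    by apply: (scalerI kr); rewrite -projZ -wE.
  have [l lE] := mult _ My ey; move: wE; rewrite lE scalerA -intrM => /eqP.
  rewrite -subr_eq0 -{1}[w]scale1r -scalerBl scaler_eq0 (negbTE w0) orbF.
  rewrite -[1]/(1%:~R) -intrB intr_eq0 subr_eq0 => /eqP e.
  have : (`|k| * `|l| = 1)%N by rewrite -abszM -e.
  move/eqP; rewrite muln_eq1 => /andP [/eqP k1 _].
  by move: k1; case: k {k0 e} => [[|[|]]|[|]] //; [left|right].
case: xgetP => [d _ [y [[My y0 ymin] sy] <-]|]; last first.
  move=> /(_ (Q w)) []; exists w => //; split=> //.
  by rewrite -rw; apply: refl_symmetry.
have [_ ry] := symmetry_refl sy; have ey : prj x y = y.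
  apply: refl_axis => //; rewrite ry reflE.
  have yn : Q y != 0 by rewrite qform_eq0 //; exact/eqP.
  rewrite -/(Q y) -mulrA divff // mulr1 -[X in X - _]scale1r -scalerBl.
  by rewrite -scaleN1r; congr (_ *: _).
have [k kE] := mult _ My ey.
by have [k1|k1] := ymin k w Mw kE; rewrite kE k1 /qform bformZl bformZr; ring.
Qed.

Section OnGood.
Variables (r1 : Prop) (N M : set 'rV[rat]_3).
Hypothesis gM : good G p r1 N M.

Lemma special_axis_scale a x : a != 0 ->
  special_axis G r1 N M (a *: x) <-> special_axis G r1 N M x.
Proof.
move=> a0; rewrite /special_axis /axis_in.
have e v : prj (a *: x) v = prj x v by rewrite proj_scale.
have h : (forall y, M y -> prj (a *: x) y = y -> N y) <->
         (forall y, M y -> prj x y = y -> N y).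
  by split=> H y My ey; apply: H => //; rewrite ?e // -e.
by rewrite h.
Qed.

Lemma stab_split x : x != 0 -> (forall v, M (v *m refl G x) <-> M v) ->
  split_axis G p M x.
Proof.
move=> x0 sM; apply: (split_halfturn pr_p odd_p gM x0) => v Mv.
rewrite -halfturnE mulmxN; apply: (il_N (good_il gM)); exact/sM.
Qed.

(** The axis is split, so by [axis_norm] its generator lies in [N] as soon as p divides its norm. *)
Lemma symmetry_norm_axis x : x != 0 -> (forall v, M (v *m refl G x) <-> M v) ->
  congq p (symmetry_norm G M (refl G x)) 0 <-> axis_in G N M x.
Proof.
move=> x0 sM; have sx := stab_split x0 sM.
have [w [Mw w0 ew mult ->]] := symmetry_normP (good_il gM) x0 erefl.
rewrite (congq_pZ pr_p) subr0; split=> [pw y My ey|ax]; last first.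
  exact: (axis_in_norm gM ax).
have Nw := axis_norm posG pr_p gM x0 sx Mw ew pw.
have [k ->] := mult _ My ey.
exact: (il_Z k (good_ilN pr_p gM)).
Qed.

Lemma specialP x : x != 0 -> (forall v, M (v *m refl G x) <-> M v) ->
  (unimodular_rank1 pr_p G M <-> r1) ->
  special pr_p G M (refl G x) <-> special_axis G r1 N M x.
Proof.
move=> x0 sM ur; rewrite /special /special_axis ur symmetry_norm_axis //.
split=> [[_ h] //|h]; split=> //; split; last by exists x; apply: refl_symmetry.
have ri := refl_isom posG x0; split=> //.
by apply/act_stabP => //; case: ri.
Qed.

End OnGood.

End SpecialSymmetries.

(** * Cardinals of sets and finite groups of matrices *)

Lemma ncard_inj (T : finType) (U : choiceType) (A : pred T) (f : T -> U) (S : set U) :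
  {in A &, injective f} -> (forall u, S u <-> exists2 x, x \in A & f x = u) ->
  ncard S = #|A|.
Proof.
move=> fi SP; pose l := [seq f x | x in A].
have -> : S = [set` seq_fset tt l].
  apply/seteqP; split=> u.
    move/SP => [x xA <-]; change (f x \in seq_fset tt l); rewrite seq_fsetE; by apply/fintype.imageP; exists x.
  change (u \in seq_fset tt l -> S u); rewrite seq_fsetE => /fintype.imageP [x xA ->].
  by apply/SP; exists x.
rewrite /ncard set_fsetK size_seq_fset undup_id ?size_image //.
rewrite map_inj_in_uniq ?enum_uniq // => x y; rewrite !mem_enum; exact: fi.
Qed.

(** Bundles the closure proofs so that the type [mxg A] can carry a structure of finite group. *)
Record mxgroup := MxGroup { mxset :> {fset 'M[rat]_3};
  mxset1 : 1%:M \in mxset;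
  mxsetM : forall s t, s \in mxset -> t \in mxset -> s *m t \in mxset;
  mxsetV : forall s, s \in mxset -> invmx s \in mxset;
  mxsetU : forall s, s \in mxset -> s \in unitmx }.

Definition mxg (A : mxgroup) : Type := fset_sub_type A.
HB.instance Definition _ (A : mxgroup) := Finite.copy (mxg A) (fset_sub_type A).

Section MatrixGroup.
Variable A : mxgroup.
Local Notation gT := (mxg A).
Definition mxv (g : gT) : 'M[rat]_3 := fsval g.
Lemma mxvP (g : gT) : mxv g \in mxset A. Proof. exact: fsvalP. Qed.
Lemma mxv_inj : injective mxv. Proof. exact: val_inj. Qed.
Definition mxg_of s (sA : s \in mxset A) : gT := FSetSub sA.
Definition mxg_one : gT := mxg_of (mxset1 A).
Definition mxg_mul (g h : gT) : gT := mxg_of (mxsetM (mxvP g) (mxvP h)).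
Definition mxg_inv (g : gT) : gT := mxg_of (mxsetV (mxvP g)).
Fact mxg_mulA : associative mxg_mul.
Proof. by move=> g h k; apply: mxv_inj; rewrite /= mulmxA. Qed.
Fact mxg_mul1 : left_id mxg_one mxg_mul.
Proof. by move=> g; apply: mxv_inj; rewrite /= mul1mx. Qed.
Fact mxg_mulV : left_inverse mxg_one mxg_inv mxg_mul.
Proof. by move=> g; apply: mxv_inj; rewrite /= mulVmx // (mxsetU (mxvP g)). Qed.

End MatrixGroup.

HB.instance Definition _ (A : mxgroup) := Finite_isGroup.Build (mxg A)
  (@mxg_mulA A) (@mxg_mul1 A) (@mxg_mulV A).

Section MatrixGroupTheory.
Variable A : mxgroup.
Local Open Scope group_scope.
Lemma mxv1 : mxv (1 : mxg A) = 1%:M%R. Proof. by []. Qed.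
Lemma mxvM (g h : mxg A) : mxv (g * h) = (mxv g *m mxv h)%R. Proof. by []. Qed.
Lemma mxvV (g : mxg A) : mxv g^-1 = invmx (mxv g). Proof. by []. Qed.
Lemma mxvU (g : mxg A) : mxv g \in unitmx. Proof. exact: mxsetU (mxvP g). Qed.
Lemma mxv_eq1 (g : mxg A) : mxv g = 1%:M%R -> g = 1.
Proof. by move=> e; apply: mxv_inj. Qed.
Lemma mxg_exists s : s \in mxset A -> exists g : mxg A, mxv g = s.
Proof. by move=> sA; exists (mxg_of sA). Qed.

End MatrixGroupTheory.

Section OrderFacts.
Local Open Scope group_scope.
Variable gT : finGroupType.
Lemma order4P (g : gT) : g ^+ 4 = 1 -> g ^+ 2 <> 1 -> #[g] = 4%N.
Proof.
move=> g4 g2; have d : (#[g] %| 4)%N by rewrite order_dvdn g4.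
have nd : ~~ ((#[g] %| 2)%N) by rewrite order_dvdn; apply/eqP.
by have := dvdn_leq (isT : 0 < 4)%N d; move: d nd; case: #[g] => [|[|[|[|[|]]]]].
Qed.
Lemma order6P (g : gT) : g ^+ 6 = 1 -> g ^+ 2 <> 1 -> g ^+ 3 <> 1 -> #[g] = 6%N.
Proof.
move=> g6 g2 g3; have d : (#[g] %| 6)%N by rewrite order_dvdn g6.
have nd : ~~ ((#[g] %| 2)%N) by rewrite order_dvdn; apply/eqP.
have nd3 : ~~ ((#[g] %| 3)%N) by rewrite order_dvdn; apply/eqP.
by have := dvdn_leq (isT : 0 < 6)%N d; move: d nd nd3; case: #[g] => [|[|[|[|[|[|[|]]]]]]].
Qed.
Lemma mulg_cancel (x a b : gT) : x * a = x * b -> a = b.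
Proof. exact: mulgI. Qed.
Lemma mulg_cancelr (x a b : gT) : a * x = b * x -> a = b.
Proof. exact: mulIg. Qed.
Lemma exp2g (g : gT) : g ^+ 2 = g * g. Proof. by []. Qed.
Lemma exp3g (g : gT) : g ^+ 3 = g * g * g. Proof. by rewrite !expgSr expg0 mul1g. Qed.
Lemma exp4g (g : gT) : g ^+ 4 = g * g * g * g. Proof. by rewrite !expgSr expg0 mul1g. Qed.
Lemma exp6g (g : gT) : g ^+ 6 = g * g * g * g * g * g. Proof. by rewrite !expgSr expg0 mul1g. Qed.

End OrderFacts.

(** * The rotations of a lattice form a group of crystallographic type *)

Section LatticeGroup.
Variable G : 'M[rat]_3.
Hypothesis posG : posdef G.
Local Notation Q := (qform G).
Local Notation prj := (proj G).

Lemma axis_pm (x : 'rV[rat]_3) h : x != 0 -> isometry_of G h -> prj x (x *m h) = x *m h ->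
  x *m h = x \/ x *m h = - x.
Proof.
move=> x0 hi /proj_axis [c cE]; have q : Q (x *m h) = Q x by case: hi => _; rewrite /qform => ->.
have qx : Q x != 0 by rewrite qform_eq0.
move: q; rewrite cE /qform bformZl bformZr -/(Q x) => /eqP.
rewrite mulrA -subr_eq0 -{2}[Q x]mul1r -mulrBl mulf_eq0 (negbTE qx) orbF subr_eq0.
rewrite -expr2 sqrf_eq1 => /orP [] /eqP ->; [left|right].
  by rewrite scale1r.
by rewrite scaleN1r.
Qed.

Lemma invol_halfturn t x : rot G t -> t <> 1%:M -> t *m t = 1%:M -> x != 0 ->
  x *m t = x -> t = - refl G x.
Proof.
move=> rt t1 tt x0 xt; apply: mx_eq_act => v.
by rewrite halfturnE (rot_invol posG v rt t1 tt x0 xt).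
Qed.

Variable N : set 'rV[rat]_3.
Hypothesis iN : int_lattice G N.
Variable A : mxgroup.
Hypothesis AP : forall s, s \in mxset A <-> rot G s /\ forall v, N (v *m s) <-> N v.
Local Notation gT := (mxg A).
Implicit Types g h t z : gT.
Local Open Scope group_scope.

Lemma mxg_rot g : rot G (mxv g).
Proof. by have /AP [] := mxvP g. Qed.

Lemma mxg_stab g v : N (v *m mxv g)%R <-> N v.
Proof. by have /AP [_] := mxvP g; apply. Qed.

Lemma mxg_ex s : rot G s -> (forall v, N (v *m s)%R <-> N v) -> exists g : gT, mxv g = s.
Proof. by move=> rs sN; apply: mxg_exists; apply/AP. Qed.

Lemma mxg_axis g : exists2 x : 'rV[rat]_3, (x != 0)%R & (x *m mxv g = x)%R.
Proof. exact: rot_axis posG _ (mxg_rot g). Qed.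

Lemma mxv_neq1 g : g <> 1 -> mxv g <> 1%:M%R.
Proof. by move=> g1 e; apply: g1; apply: mxv_eq1. Qed.

Lemma mxg_cases g : g <> 1 ->
  [\/ rotcos (mxv g) = (-2)%R /\ #[g] = 2%N, rotcos (mxv g) = (-1)%R /\ #[g] = 3%N,
      rotcos (mxv g) = 0%R /\ #[g] = 4%N | rotcos (mxv g) = 1%R /\ #[g] = 6%N].
Proof.
move=> g1; have [x x0 xg] := mxg_axis g.
have [w sw] := shortest_perp_exists posG x iN.
have ne h : h <> 1 -> h != 1 by move=> ?; apply/eqP.
have [[l e]|[l [e n]]|[l [e n]]|[l [e [n n']]]] :=
  rot_order_cases posG iN (mxg_rot g) (mxv_neq1 g1) (mxg_stab g) x0 xg sw.
- constructor 1; split=> //; apply: nt_prime_order => //; first by apply: mxv_inj.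
  exact: ne.
- constructor 2; split=> //; apply: nt_prime_order => //; last exact: ne.
  by apply: mxv_inj; rewrite exp3g.
- constructor 3; split=> //; apply: order4P; first by apply: mxv_inj; rewrite exp4g.
  by move=> h; apply: n; rewrite -mxvM -exp2g h.
constructor 4; split=> //; apply: order6P; first by apply: mxv_inj; rewrite exp6g.
  by move=> h; apply: n; rewrite -mxvM -exp2g h.
by move=> h; apply: n'; rewrite -!mxvM -exp3g h.
Qed.

Lemma order_neq1 g k : #[g] = k.+2 -> g <> 1.
Proof. by move=> gk g1; rewrite g1 order1 in gk. Qed.

Lemma order3_rotcos g : #[g] = 3%N -> rotcos (mxv g) = (-1)%R.
Proof.
by move=> g3; have [[_ e]|[//]|[_ e]|[_ e]] := mxg_cases (order_neq1 g3); rewrite e in g3.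
Qed.

Lemma order4_rotcos g : #[g] = 4%N -> rotcos (mxv g) = 0%R.
Proof.
by move=> g3; have [[_ e]|[_ e]|[//]|[_ e]] := mxg_cases (order_neq1 g3); rewrite e in g3.
Qed.

Lemma order2_mx t : #[t] = 2%N -> [/\ rot G (mxv t), mxv t <> 1%:M%R & (mxv t *m mxv t = 1%:M)%R].
Proof.
move=> t2; have /eqP/order2P [t1 tt] := t2; split; first exact: mxg_rot.
  exact: mxv_neq1.
by rewrite -mxvM tt.
Qed.

Lemma mxg_order g : #[g] \in [:: 1; 2; 3; 4; 6]%N.
Proof.
case: (eqVneq g 1) => [->|/eqP g1]; first by rewrite order1.
  by have [[_ ->]|[_ ->]|[_ ->]|[_ ->]] := mxg_cases g1.
Qed.

Lemma mxg_dihedral g : (2 < #[g])%N -> exists2 h, #[h] = 2%N & g ^ h = g^-1.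
Proof.
move=> g2; have n2 : (mxv g *m mxv g <> 1%:M)%R.
    rewrite -mxvM => e; have : (#[g] %| 2)%N by rewrite order_dvdn exp2g; apply/eqP/mxv_eq1.
    by move/dvdn_leq => /(_ isT); rewrite leqNgt g2.
  have [s [rs sN ss s1 gs]] := dihedral_exists posG iN (mxg_rot g) n2 (mxg_stab g).
  have [h hE] := mxg_ex rs sN.
  have h2 : #[h] = 2%N.
    apply/eqP/order2P; split; first by move=> e; apply: s1; rewrite -hE e.
    by apply: mxv_inj; rewrite mxvM hE.
  exists h => //; rewrite conjgE (invol_inv h2); apply: (mulg_cancel (x := g)); rewrite mulgV.
  by apply: mxv_inj; rewrite mxv1 !mxvM hE -gs !mulmxA.
Qed.

Lemma mxg_cent3 z a b : #[z] = 3%N -> #[a] = 2%N -> #[b] = 2%N ->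
  commute a z -> commute b z -> a = b.
Proof.
move=> z3 a2 b2 az bz; have [x x0 xz] := mxg_axis z.
  have zz : (mxv z *m mxv z *m mxv z = 1%:M)%R.
    have e3 : z ^+ 3 = 1 by rewrite -z3 expg_order.
    by rewrite -!mxvM -exp3g e3.
  have z1 := mxv_neq1 (order_neq1 z3).
  have [ra a1 aa] := order2_mx a2; have [rb b1 bb] := order2_mx b2.
  have xa : (x *m mxv a = x)%R.
    by apply: (invol_cent3_axis posG ra (mxg_rot z) a1 z1 aa zz _ x0 xz); rewrite -!mxvM az.
  have xb : (x *m mxv b = x)%R.
    by apply: (invol_cent3_axis posG rb (mxg_rot z) b1 z1 bb zz _ x0 xz); rewrite -!mxvM bz.
  exact/mxv_inj/(invol_axis_eq posG ra rb a1 b1 aa bb x0 xa xb).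
Qed.

(** An element [c] outside [1], [a], [b], [a * b] would give four half turns with pairwise
    orthogonal axes in dimension 3. *)
Lemma mxg_exp2 (K : {group gT}) : (forall g, g \in K -> g ^+ 2 = 1) -> (#|K| <= 4)%N.
Proof.
move=> K2; rewrite leqNgt; apply/negP => K5.
have o2 g : g \in K -> g <> 1 -> #[g] = 2%N.
  by move=> gK g1; apply/eqP/order2P; split=> //; rewrite -exp2g K2.
have cK g h : g \in K -> h \in K -> g * h = h * g.
  move=> gK hK; have inv k : k \in K -> k^-1 = k.
    by move=> kK; apply: (mulg_cancel (x := k)); rewrite mulgV -exp2g K2.
  by rewrite -(inv (g * h)) ?groupM // invMg !inv.
have ex (s : seq gT) : (size s <= 4)%N -> exists2 g, g \in K & g \notin s.
  move=> s4; have : ~~ (K \subset s).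
    apply/negP => /subset_leq_card Ks; have := leq_trans K5 Ks.
    by rewrite ltnNge (leq_trans (card_size s)).
  by case/subsetPn => g gK gs; exists g.
have [a aK] := ex [:: 1] isT; rewrite inE => /eqP a1.
have [b bK] := ex [:: 1; a] isT; rewrite !inE negb_or => /andP [/eqP b1 /eqP ba].
have [c cK'] := ex [:: 1; a; b; a * b] isT.
rewrite !inE !negb_or => /and4P [/eqP c1 /eqP ca /eqP cb /eqP cab].
have [ra a1' aa] := order2_mx (o2 _ aK a1); have [rb b1' bb] := order2_mx (o2 _ bK b1).
have [rc c1' cc] := order2_mx (o2 _ cK' c1).
have ab1 : a * b <> 1.
  move=> e; apply: ba; apply: (mulg_cancel (x := a)); rewrite e -exp2g K2 //.
have [rd d1' dd] := order2_mx (o2 _ (groupM aK bK) ab1).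
have [x x0 xa] := mxg_axis a; have [y y0 yb] := mxg_axis b.
have [z z0 zd] := mxg_axis (a * b); have [u u0 uc] := mxg_axis c.
have ne g h : g <> h -> mxv g <> mxv h by move=> gh /mxv_inj.
have cm g h : g \in K -> h \in K -> (mxv g *m mxv h = mxv h *m mxv g)%R.
  by move=> gK hK; rewrite -!mxvM cK.
have dK := groupM aK bK.
have [xy _] := commuting_axes posG ra rb a1' b1' aa bb (ne _ _ (nesym ba)) (cm _ _ aK bK) x0 y0 xa yb.
have nad : a <> a * b by move=> e; apply: b1; apply: (mulg_cancel (x := a)); rewrite -e mulg1.
have nbd : b <> a * b by move=> e; apply: a1; apply: (mulg_cancelr (x := b)); rewrite -e mul1g.
have [xz _] := commuting_axes posG ra rd a1' d1' aa dd (ne _ _ nad) (cm _ _ aK dK) x0 z0 xa zd.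
have [yz _] := commuting_axes posG rb rd b1' d1' bb dd (ne _ _ nbd) (cm _ _ bK dK) y0 z0 yb zd.
have [ux _] := commuting_axes posG rc ra c1' a1' cc aa (ne _ _ ca) (cm _ _ cK' aK) u0 x0 uc xa.
have [uy _] := commuting_axes posG rc rb c1' b1' cc bb (ne _ _ cb) (cm _ _ cK' bK) u0 y0 uc yb.
have [uz _] := commuting_axes posG rc rd c1' d1' cc dd (ne _ _ cab) (cm _ _ cK' dK) u0 z0 uc zd.
by have := ortho3 posG x0 y0 z0 xy xz yz ux uy uz => e; rewrite e eqxx in u0.
Qed.

Lemma mxg_crystal : crystal_group gT.
Proof.
split; [exact: mxg_order|exact: mxg_dihedral|exact: mxg_cent3|exact: mxg_exp2].
Qed.

End LatticeGroup.

(** * The rotation group acting on Gamma *)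

Section LatticeAction.
Variables (p : nat) (pr_p : prime p) (odd_p : odd p) (G : 'M[rat]_3).
Hypothesis posG : posdef G.
Local Notation prj := (proj G).
Variable N : set 'rV[rat]_3.
Hypothesis iN : int_lattice G N.
Variable A : mxgroup.
Hypothesis AP : forall s, s \in mxset A <-> rot G s /\ forall v, N (v *m s) <-> N v.
Local Notation gT := (mxg A).
Variables (Gam : set (set 'rV[rat]_3)) (r1 : Prop).
Hypothesis finGam : finite_set Gam.
Hypothesis Gam_act : forall g : gT, forall M, Gam M -> Gam (act (mxv g) M).
Hypothesis Gam_good : forall M, Gam M -> good G p r1 N M.

Definition gamT : Type := fset_sub_type (fset_set Gam).
HB.instance Definition _ := Finite.copy gamT (fset_sub_type (fset_set Gam)).
Definition gamv (M : gamT) : set 'rV[rat]_3 := fsval M.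
Implicit Types (M : gamT) (g h t z : gT) (x y : 'rV[rat]_3).

Lemma gamvP M : Gam (gamv M).
Proof. by have := fsvalP M; rewrite in_fset_set // inE. Qed.

Lemma gamv_inj : injective gamv. Proof. exact: val_inj. Qed.

Lemma gam_exists K : Gam K -> exists M, gamv M = K.
Proof.
move=> GK; have KG : K \in fset_set Gam by rewrite in_fset_set // inE.
by exists (FSetSub KG).
Qed.

Fact gam_to_subproof M g : act (mxv g) (gamv M) \in fset_set Gam.
Proof. by rewrite in_fset_set // inE; apply/Gam_act/gamvP. Qed.
Definition gam_to M g : gamT := FSetSub (gam_to_subproof M g).

Lemma gam_toE M g : gamv (gam_to M g) = act (mxv g) (gamv M). Proof. by []. Qed.

Fact gam_to1 M : gam_to M 1%g = M.
Proof. by apply: gamv_inj; rewrite gam_toE act1. Qed.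
Fact gam_toM M : act_morph gam_to M.
Proof. by move=> g h; apply: gamv_inj; rewrite !gam_toE mxvM actM. Qed.
Definition gam_action : {action gT &-> gamT} := TotalAction gam_to1 gam_toM.
Local Notation to := gam_action.

Lemma gam_stabP M g : reflect (forall v, gamv M (v *m mxv g) <-> gamv M v) (g \in 'C[M | to]%g).
Proof.
apply: (iffP idP) => [/astab1P e|h].
  apply/(act_stabP _ (mxvU g)); rewrite -gam_toE; congr gamv; exact: e.
by apply/astab1P; apply: gamv_inj; change (act (mxv g) (gamv M) = gamv M); apply/(act_stabP _ (mxvU g)).
Qed.

(** Stated with some axis vector; by [gam_specialE] every vector of the axis gives the same
    answer. *)
Definition gam_special M t : bool :=
  [&& #[t]%g == 2%N, t \in 'C[M | to]%g &
      `[< exists x, [/\ x != 0, x *m mxv t = x & special_axis G r1 N (gamv M) x] >]].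

Lemma axis_line t x y : t <> 1%g -> x != 0 -> y != 0 -> x *m mxv t = x -> y *m mxv t = y ->
  exists2 c, c != 0 & y = c *: x.
Proof.
move=> t1 x0 y0 xt yt.
have e := rot_fix_line posG (mxg_rot AP t) (mxv_neq1 t1) x0 xt yt.
have [c cE] := proj_axis e; exists c => //.
by apply: contraNneq y0 => c0; rewrite cE c0 scale0r.
Qed.

Lemma gam_specialE M t x : #[t]%g = 2%N -> t \in 'C[M | to]%g -> x != 0 -> x *m mxv t = x ->
  gam_special M t = `[< special_axis G r1 N (gamv M) x >].
Proof.
move=> t2 tM x0 xt; rewrite /gam_special t2 tM /=.
apply: asbool_equiv_eq; split=> [[y [y0 yt sy]]|sx]; last by exists x.
have [c c0 yE] := axis_line (order_neq1 t2) x0 y0 xt yt.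
by move: sy; rewrite yE special_axis_scale.
Qed.

Lemma gam_specialP M t : gam_special M t -> exists x,
  [/\ #[t]%g = 2%N, t \in 'C[M | to]%g, x != 0, x *m mxv t = x &
      special_axis G r1 N (gamv M) x].
Proof. by move=> /and3P [/eqP t2 tM /asboolP [x [x0 xt sx]]]; exists x. Qed.

Lemma mxv_halfturn t x : #[t]%g = 2%N -> x != 0 -> x *m mxv t = x -> mxv t = - refl G x.
Proof.
move=> t2 x0 xt; have [rt t1 tt] := order2_mx AP t2.
exact: (invol_halfturn posG rt t1 tt x0 xt).
Qed.

Lemma gam_refl_stab M t x : #[t]%g = 2%N -> x != 0 -> x *m mxv t = x ->
  t \in 'C[M | to]%g -> forall v, gamv M (v *m refl G x) <-> gamv M v.
Proof.
move=> t2 x0 xt tM v; have iM := good_il (Gam_good (gamvP M)).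
rewrite -(gam_stabP M t tM v) (mxv_halfturn t2 x0 xt) mulmxN.
by split=> h; [apply: (il_N iM)|rewrite -[_ *m _]opprK; apply: (il_N iM)].
Qed.

Lemma gam_split M t x : #[t]%g = 2%N -> x != 0 -> x *m mxv t = x ->
  t \in 'C[M | to]%g -> split_axis G p (gamv M) x.
Proof.
move=> t2 x0 xt tM; apply: (stab_split pr_p odd_p (Gam_good (gamvP M)) x0).
exact: gam_refl_stab t2 x0 xt tM.
Qed.

Lemma cent_axis t h x : t <> 1%g -> x != 0 -> x *m mxv t = x -> (t * h = h * t)%g ->
  x *m mxv h = x \/ x *m mxv h = - x.
Proof.
move=> t1 x0 xt th; have [hi _] := mxg_rot AP h; apply: (axis_pm posG x0 hi).
apply: (rot_fix_line posG (mxg_rot AP t) (mxv_neq1 t1) x0 xt).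
by rewrite -mulmxA -mxvM -th mxvM mulmxA xt.
Qed.

Lemma gam_axis_stab M x h : x != 0 -> split_axis G p (gamv M) x ->
  special_axis G r1 N (gamv M) x -> x *m mxv h = x \/ x *m mxv h = - x ->
  h \in 'C[M | to]%g.
Proof.
move=> x0 sx spx xh; have [hi _] := mxg_rot AP h; apply/gam_stabP.
exact: (special_axis_stab posG pr_p (Gam_good (gamvP M)) x0 sx spx hi (mxg_stab AP h) xh).
Qed.

Lemma gam_double M t x : #[t]%g = 2%N -> x != 0 -> x *m mxv t = x ->
  t \in 'C[M | to]%g -> forall v, gamv M v -> gamv M (2%:R *: prj x v).
Proof.
move=> t2 x0 xt tM v Mv; have iM := good_il (Gam_good (gamvP M)).
rewrite -[_ *: _](subrK v) -halfturnE -(mxv_halfturn t2 x0 xt); apply: (il_D iM) => //.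
exact/(gam_stabP M t tM).
Qed.

Lemma special_turn M z x : z <> 1%g -> z \in 'C[M | to]%g -> x != 0 -> x *m mxv z = x ->
  rotcos (mxv z) = 0 \/ rotcos (mxv z) = -1 /\ p <> 3%N ->
  split_axis G p (gamv M) x /\ special_axis G r1 N (gamv M) x.
Proof.
move=> z1 zM x0 xz lam; have gM := Gam_good (gamvP M).
have zs := gam_stabP M z zM; have rz := mxg_rot AP z; have z1' := mxv_neq1 z1.
split; first exact: (turn_split posG pr_p odd_p gM rz z1' x0 xz zs lam).
exact: (turn_special posG pr_p odd_p gM rz z1' x0 xz zs lam).
Qed.

Lemma norm_axis z h x : #[z]%g = 3%N -> x != 0 -> x *m mxv z = x ->
  (h \in 'N(<[z]>))%g -> x *m mxv h = x \/ x *m mxv h = - x.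
Proof.
move=> z3 x0 xz hN; have z1 := order_neq1 z3.
have [hi _] := mxg_rot AP h; apply: (axis_pm posG x0 hi).
apply: (rot_fix_line posG (mxg_rot AP z) (mxv_neq1 z1) x0 xz).
have xzV : x *m mxv z^-1%g = x by rewrite mxvV -{1}xz mulmxK // mxvU.
have hz : (h * z ^ h = z * h)%g by rewrite -conjgC.
case: (conj_order3 z3 hN) => zh.
  by rewrite -mulmxA -mxvM -{1}zh hz mxvM mulmxA xz.
have -> : z = ((z ^ h)^-1)%g by rewrite zh invgK.
have hz' : (h * (z ^ h)^-1 = z^-1 * h)%g by rewrite -conjVg conjgE !mulgA mulgV mul1g.
by rewrite -mulmxA -mxvM hz' mxvM mulmxA xzV.
Qed.

Lemma refl_neqN1 x : x != 0 -> - refl G x <> 1%:M.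
Proof.
move=> x0 e; have := refl_trace posG x0; rewrite -[refl G x]opprK e raddfN /= mxtrace1.
by move/eqP.
Qed.

(** By [turn3_halfturn] the half turn about the axis of [z] preserves [N]; it commutes with [z], so
    the product has order 6. *)
Lemma gam_order6_exists M z : p = 3%N -> z \in 'C[M | to]%g -> #[z]%g = 3%N ->
  exists y : gT, #[y]%g = 6%N.
Proof.
move=> e3 zM z3; have [x x0 xz] := mxg_axis posG AP z.
have z1 := order_neq1 z3; have l := order3_rotcos posG iN AP z3.
have hN := turn3_halfturn posG pr_p (Gam_good (gamvP M)) e3 (mxg_rot AP z)
  (mxv_neq1 z1) x0 xz (gam_stabP M z zM) l.
have rh := rot_halfturn posG x0.
have hh : (- refl G x) *m (- refl G x) = 1%:M by rewrite mulNmx mulmxN opprK refl_invol.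
have hs v : N (v *m - refl G x) <-> N v.
  move: v; apply: stab_invol => // v Nv; rewrite halfturnE.
  apply: (int_latticeB iN) => //; rewrite -[2]/(2%:R); apply: (il_Zn _ iN); exact: hN.
have [t tE] := mxg_ex AP rh hs.
have t2 : #[t]%g = 2%N.
  apply/eqP/order2P; split.
    by move=> t1; apply: (refl_neqN1 x0); rewrite -tE t1.
  by apply: mxv_inj; rewrite mxvM tE.
have ct : commute t z.
  apply: mxv_inj; rewrite !mxvM tE; apply: mx_eq_act => v.
  rewrite !mulmxA !halfturnE mulmxBl.
  have e : prj x (v *m mxv z) = prj x v.
    by rewrite /proj -{1}xz (rotB _ _ (mxg_rot AP z)).
  have e' : prj x v *m mxv z = prj x v by rewrite /proj -scalemxAl xz.
  by rewrite e -scalemxAl e'.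
by exists (t * z)%g; rewrite orderM ?t2 ?z3.
Qed.

Hypothesis p3 : #|[set: gT]%SET| = 12%N -> p <> 3%N.

Lemma gam_special_invol : forall M t, gam_special M t -> t \in 'C[M | to]%g /\ #[t]%g = 2%N.
Proof.
by move=> M t /gam_specialP [x [t2 tM _ _ _]].
Qed.

Lemma gam_special_cent : forall M t, gam_special M t -> ('C[t] \subset 'C[M | to])%g.
Proof.
move=> M t /gam_specialP [x [t2 tM x0 xt sx]]; apply/fintype.subsetP => h /cent1P ht.
  apply: gam_axis_stab (gam_split t2 x0 xt tM) sx _ => //.
  exact: cent_axis (order_neq1 t2) x0 xt _.
Qed.

Lemma gam_special_inj : forall M M' t, gam_special M t -> gam_special M' t -> M = M'.
Proof.
move=> M M' t /gam_specialP [x [t2 tM x0 xt sx]] spM'; apply: gamv_inj.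
  have tM' : t \in 'C[M' | to]%g by case/and3P: spM'.
  have sx' : special_axis G r1 N (gamv M') x.
    by move: spM'; rewrite (gam_specialE t2 tM' x0 xt) => /asboolP.
  exact: (special_axis_inj posG pr_p (Gam_good (gamvP M)) (Gam_good (gamvP M')) x0
    (gam_split t2 x0 xt tM) (gam_split t2 x0 xt tM') sx sx').
Qed.

Lemma gam_special_V4 : forall M a b, a \in 'C[M | to]%g -> b \in 'C[M | to]%g ->
    #[a]%g = 2%N -> #[b]%g = 2%N -> a <> b -> commute a b ->
    (gam_special M a + gam_special M b + gam_special M (a * b)%g)%N = 1%N.
Proof.
move=> M a b aM bM a2 b2 ab cab.
  have abM : (a * b)%g \in 'C[M | to]%g by rewrite groupM.
  have /eqP/order2P [a1 aa] := a2; have /eqP/order2P [b1 bb] := b2.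
  have ab1 : (a * b)%g <> 1%g.
    by move=> e; apply: ab; apply: (mulg_cancel (x := a)); rewrite e aa.
  have ab2 : #[a * b]%g = 2%N.
    apply/eqP/order2P; split=> //.
    by rewrite {2}cab mulgA -[(a * b * b)%g]mulgA bb mulg1 aa.
  have [x x0 xa] := mxg_axis posG AP a; have [y y0 yb] := mxg_axis posG AP b.
  have [z z0 zd] := mxg_axis posG AP (a * b)%g.
  have [ra a1' ma] := order2_mx AP a2; have [rb b1' mb] := order2_mx AP b2.
  have [rd d1' md] := order2_mx AP ab2.
  have ne (g h : gT) : g <> h -> mxv g <> mxv h by move=> gh /mxv_inj.
  have cm (g h : gT) : commute g h -> mxv g *m mxv h = mxv h *m mxv g by move=> e; rewrite -!mxvM e.
  have nad : a <> (a * b)%g by move=> e; apply: b1; apply: (mulg_cancel (x := a)); rewrite -e mulg1.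
  have nbd : b <> (a * b)%g by move=> e; apply: a1; apply: (mulg_cancelr (x := b)); rewrite -e mul1g.
  have cad : commute a (a * b)%g by apply: commuteM.
  have cbd : commute b (a * b)%g by apply: commuteM => //; apply: commute_sym.
  have [xy _] := commuting_axes posG ra rb a1' b1' ma mb (ne _ _ ab) (cm _ _ cab) x0 y0 xa yb.
  have [xz _] := commuting_axes posG ra rd a1' d1' ma md (ne _ _ nad) (cm _ _ cad) x0 z0 xa zd.
  have [yz _] := commuting_axes posG rb rd b1' d1' mb md (ne _ _ nbd) (cm _ _ cbd) y0 z0 yb zd.
  rewrite (gam_specialE a2 aM x0 xa) (gam_specialE b2 bM y0 yb) (gam_specialE ab2 abM z0 zd).
  have := special_axis_V4 posG pr_p odd_p (Gam_good (gamvP M)) x0 y0 z0 xy xz yz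
    (gam_double a2 x0 xa aM) (gam_double b2 y0 yb bM) (gam_double ab2 z0 zd abM).
  by case=> -[h1 h2 h3]; rewrite ?(asboolT h1) ?(asboolT h2) ?(asboolT h3)
    ?(asboolF h1) ?(asboolF h2) ?(asboolF h3).
Qed.

Lemma gam_special_order4 : forall M z, z \in 'C[M | to]%g -> #[z]%g = 4%N -> gam_special M (z ^+ 2)%g.
Proof.
move=> M z zM z4; have [x x0 xz] := mxg_axis posG AP z.
  have zz2 := order_pow2 z4.
  rewrite (@gam_specialE M (z ^+ 2)%g x) // ?groupX //; last first.
    by rewrite exp2g mxvM mulmxA !xz.
  apply/asboolP; apply: (proj2 (special_turn (order_neq1 z4) zM x0 xz _)).
  by left; apply: (order4_rotcos posG iN AP).
Qed.

Lemma gam_special_order6 : forall M z, #|[set: gT]%SET| = 12%N -> z \in 'C[M | to]%g ->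
    #[z]%g = 6%N -> gam_special M (z ^+ 3)%g.
Proof.
move=> M z c12 zM z6; have [x x0 xz] := mxg_axis posG AP z.
  have o3 : #[z ^+ 2]%g = 3%N by rewrite orderXdiv z6.
  have o2 : #[z ^+ 3]%g = 2%N by rewrite orderXdiv z6.
  have xz2 : x *m mxv (z ^+ 2)%g = x by rewrite exp2g mxvM mulmxA !xz.
  rewrite (@gam_specialE M (z ^+ 3)%g x) // ?groupX //; last first.
    by rewrite exp3g !mxvM !mulmxA !xz.
  apply/asboolP; apply: (proj2 (special_turn (order_neq1 o3) _ x0 xz2 _)).
    by rewrite groupX.
  by right; split; [apply: (order3_rotcos posG iN AP)|apply: p3].
Qed.

(** The dichotomy is whether p is 3. If not, the axis is special and determines the lattice; if so,
    an element of order 6 exists and the hypothesis excludes order 12. *)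
Lemma gam_special_order3 : forall M z, z \in 'C[M | to]%g -> #[z]%g = 3%N ->
    (('N(<[z]>) \subset 'C[M | to])%g /\
       forall M', z \in 'C[M' | to]%g -> M' = M) \/
    (#|[set: gT]%SET| <> 12%N /\ exists y : gT, #[y]%g = 6%N).
Proof.
move=> M z zM z3; have [x x0 xz] := mxg_axis posG AP z.
have z1 := order_neq1 z3; have l := order3_rotcos posG iN AP z3.
case: (pselect (p = 3%N)) => [e3|n3]; last first.
  have st K : z \in 'C[K | to]%g -> split_axis G p (gamv K) x /\ special_axis G r1 N (gamv K) x.
    by move=> zK; apply: (special_turn z1 zK x0 xz); right.
  left; have [sx spx] := st _ zM; split.
    apply/fintype.subsetP => h hN; apply: (gam_axis_stab x0 sx spx).
    exact: norm_axis z3 x0 xz hN.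
  move=> M' zM'; have [sx' spx'] := st _ zM'; apply: gamv_inj.
  exact: (special_axis_inj posG pr_p (Gam_good (gamvP M')) (Gam_good (gamvP M)) x0 sx' sx spx' spx).
right; split; first by move/p3.
exact: (gam_order6_exists e3 zM z3).
Qed.

Lemma gam_special_action : special_action to gam_special.
Proof.
split; [exact: gam_special_invol|exact: gam_special_cent|exact: gam_special_inj
  |exact: gam_special_V4|exact: gam_special_order4|exact: gam_special_order6
  |exact: gam_special_order3].
Qed.

End LatticeAction.

(** * The cubic frame: integrality of N / p and the common norm *)

Section CubicFrame.
Variables (p : nat) (pr_p : prime p) (odd_p : odd p) (G : 'M[rat]_3).
Hypothesis posG : posdef G.
Local Notation B := (bform G).
Local Notation Q := (qform G).
Variables (r1 : Prop) (N L : set 'rV[rat]_3).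
Hypotheses (gL : good G p r1 N L) (primL : primitive_lattice G L).
Variables (f1 f2 f3 : 'rV[rat]_3) (g : 'M[rat]_3) (eps : rat).
Hypotheses (nf1 : f1 != 0) (nf2 : f2 != 0) (nf3 : f3 != 0)
  (f12 : B f1 f2 = 0) (f13 : B f1 f3 = 0) (f23 : B f2 f3 = 0)
  (qf1 : Q f1 = eps) (qf2 : Q f2 = eps) (qf3 : Q f3 = eps).
(** The lattice [N / p], which contains [L]. *)
Let K : set 'rV[rat]_3 := fun v => N (p%:R *: v).
Hypotheses (Kf1 : K f1) (Kf2 : K f2) (Kf3 : K f3).
Hypothesis coord : forall v, K v -> exists a b c : int,
  2 *: v = a%:~R *: f1 + b%:~R *: f2 + c%:~R *: f3.
Hypotheses (gi : isometry_of G g) (gN : forall v, N (v *m g) <-> N v).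
Hypotheses (fg1 : f1 *m g = f2) (fg2 : f2 *m g = f3) (fg3 : f3 *m g = f1).
Implicit Types (u v w x y l : 'rV[rat]_3).

Let iN : int_lattice G N := good_ilN pr_p gL.
Let iL : int_lattice G L := good_il gL.
Let pn : p%:R != 0 :> rat.
Proof. by rewrite pnatr_eq0 -lt0n prime_gt0. Qed.

Lemma cube_K0 : K 0. Proof. by rewrite /K scaler0; apply: (int_lattice0 iN). Qed.
Lemma cube_KB x y : K x -> K y -> K (x - y).
Proof. by rewrite /K scalerBr; apply: (int_latticeB iN). Qed.
Lemma cube_KD x y : K x -> K y -> K (x + y). Proof. exact: (subgrpD cube_K0 cube_KB). Qed.
Lemma cube_KZ (k : int) x : K x -> K (k%:~R *: x). Proof. exact: (subgrpZ cube_K0 cube_KB). Qed.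
Lemma cube_LK x : L x -> K x. Proof. exact: (good_p pr_p gL). Qed.
Lemma cube_NK x : N x -> K x. Proof. by move=> Nx; apply: (il_Zn _ iN). Qed.

Lemma cube_bform v w (a b c a' b' c' : int) :
  2 *: v = a%:~R *: f1 + b%:~R *: f2 + c%:~R *: f3 ->
  2 *: w = a'%:~R *: f1 + b'%:~R *: f2 + c'%:~R *: f3 ->
  4 * B v w = eps * (a * a' + b * b' + c * c')%:~R.
Proof.
move=> vE wE; have -> : 4 * B v w = B (2 *: v) (2 *: w) by rewrite bformZl bformZr; ring.
rewrite vE wE !bformE -/(Q f1) -/(Q f2) -/(Q f3) qf1 qf2 qf3.
rewrite [B f2 f1]bformC // [B f3 f1]bformC // [B f3 f2]bformC // f12 f13 f23.
by rewrite !intrD !intrM; ring.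
Qed.

Lemma cube_coord1 : 2 *: f1 = (2 : int)%:~R *: f1 + (0 : int)%:~R *: f2 + (0 : int)%:~R *: f3.
Proof. by rewrite !scale0r !addr0. Qed.
Lemma cube_coord2 : 2 *: f2 = (0 : int)%:~R *: f1 + (2 : int)%:~R *: f2 + (0 : int)%:~R *: f3.
Proof. by rewrite !scale0r addr0 add0r. Qed.
Lemma cube_coord3 : 2 *: f3 = (0 : int)%:~R *: f1 + (0 : int)%:~R *: f2 + (2 : int)%:~R *: f3.
Proof. by rewrite !scale0r !add0r. Qed.

(** Induction on an expression of 1 as a combination of values of [B] on [L], which exists because
    [L] is primitive. *)
Lemma scale_ind (P : rat -> Prop) : P 0 -> (forall a b, P a -> P b -> P (a + b)) ->
  (forall (k : int) x y, L x -> L y -> P (k%:~R * B x y)) -> P 1.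
Proof.
move=> P0 PD PM; have : scale G L 1 by rewrite primL; exists 1.
move=> [t [tL ->]]; elim: t tL => [|u t IH] tL; first by rewrite big_nil.
rewrite big_cons; apply: PD; last by apply: IH => u' ut; apply: tL; rewrite in_cons ut orbT.
by have [|? ?] := tL u; [rewrite mem_head|apply: PM].
Qed.

(** All values of [B] on [K] are integral multiples of [eps / 4], and 1 is a combination of such
    values. *)
Lemma cube_scale : exists m : int, eps * m%:~R = 4.
Proof.
have [m mE] : exists m : int, 4 * 1 = eps * m%:~R.
  apply: (scale_ind (P := fun r => exists m : int, 4 * r = eps * m%:~R)).
  - by exists 0; rewrite !mulr0.
  - by move=> a b [m1 e1] [m2 e2]; exists (m1 + m2); rewrite intrD !mulrDr e1 e2.
  move=> k x y Lx Ly; have [a [b [c e]]] := coord (cube_LK Lx).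
  have [a' [b' [c' e']]] := coord (cube_LK Ly).
  exists (k * (a * a' + b * b' + c * c')).
  by rewrite mulrCA (cube_bform e e') [in RHS]intrM; ring.
by exists m; rewrite -mE mulr1.
Qed.

Lemma cube_eps0 : 0 < eps. Proof. by rewrite -qf1; apply: qform_gt0. Qed.

Lemma pdvd_double (a : int) : (p%:Z %| 2 * a)%Z -> (p%:Z %| a)%Z.
Proof.
rewrite !dvdzE abszM /= Euclid_dvdM //.
by case/orP => //; rewrite (negbTE (p_ndvd2 pr_p odd_p)).
Qed.

(** Vectors of [K] pair integrally with [L]. If p divided [m], the pairings with [f1], [f2], [f3]
    would make all coordinates of vectors of [L] divisible by p and put [L] into [N]. *)
Lemma cube_scale_coprime (m : int) : eps * m%:~R = 4 -> ~~ (p%:Z %| m)%Z.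
Proof.
move=> mE; apply/negP => pm; have [x Lx nNx] := good_neq gL; apply: nNx.
have [a [b [c e]]] := coord (cube_LK Lx).
have key (h : 'rV[rat]_3) (d : int) : K h -> 4 * B h x = eps * (2 * d)%:~R -> (p%:Z %| d)%Z.
  move=> Kh h4; have /intrP [k kE] : B h x \is a Num.int.
    have := good_N gL Kh Lx; rewrite /pZ bformZl mulrAC divff // mul1r.
    by [].
  apply: pdvd_double; apply: dvdz_trans pm _; apply/dvdzP; exists k.
  apply: (intr_inj (R := rat)); rewrite [RHS]intrM -kE.
  have m0 : 4 != 0 :> rat by [].
  by apply: (mulfI m0); rewrite [RHS]mulrA h4 mulrAC mE.
have pa : (p%:Z %| a)%Z.
  by apply: (key f1) => //; rewrite (cube_bform cube_coord1 e) !mul0r !addr0.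
have pb : (p%:Z %| b)%Z.
  by apply: (key f2) => //; rewrite (cube_bform cube_coord2 e) !mul0r addr0 add0r.
have pc : (p%:Z %| c)%Z.
  by apply: (key f3) => //; rewrite (cube_bform cube_coord3 e) !mul0r !add0r.
apply: (good_N_cancel pr_p gL (p_ndvd2 pr_p odd_p) Lx).
have [a' aE] := dvdzP pa; have [b' bE] := dvdzP pb; have [c' cE] := dvdzP pc.
rewrite aE bE cE in e.
have -> : 2%:R *: x = p%:R *: (a'%:~R *: f1 + b'%:~R *: f2 + c'%:~R *: f3).
  by rewrite e !scalerDr !scalerA !intrM -!pmulrn ![p%:R * _]mulrC.
by apply: cube_KD; [apply: cube_KD|]; apply: cube_KZ.
Qed.

(** The coordinates make [m * B v w] an integer, and [p^2 * B v w] is a value of [B] on [N]; [m] is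
    prime to p. *)
Lemma cube_K_int v w : K v -> K w -> B v w \is a Num.int.
Proof.
move=> Kv Kw; have [m mE] := cube_scale; have pm := cube_scale_coprime mE.
have [a [b [c e]]] := coord Kv; have [a' [b' [c' e']]] := coord Kw.
have h := cube_bform e e'.
have e0 : eps != 0 by apply: lt0r_neq0 cube_eps0.
have mB : m%:~R * B v w \is a Num.int.
  suff -> : m%:~R * B v w = (a * a' + b * b' + c * c')%:~R by apply: intr_int.
  by apply: (mulfI e0); rewrite -h mulrA mE.
have pB : (p * p)%N%:R * B v w \is a Num.int.
  have := int_lattice_int iN Kv Kw; rewrite bformZl bformZr mulrA -natrM.
  by [].
have : coprimez m (p * p)%:Z.
  have cp : coprime `|m|%N p by rewrite coprime_sym prime_coprime //; move: pm; rewrite dvdzE.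
  by rewrite coprimezE coprimeMr cp.
case/coprimezP => -[u u'] /= uE.
have -> : B v w = u%:~R * (m%:~R * B v w) + u'%:~R * ((p * p)%N%:R * B v w).
  have := congr1 (fun z : int => z%:~R * B v w) uE; rewrite mul1r => {1}<-.
  by rewrite intrD !intrM -!pmulrn !natrM; ring.
by apply: rpredD; apply: rpredM => //; apply: intr_int.
Qed.

(** [eps] is an integer dividing 4. If it were 2, integrality of [B v v] and of [B v (v *m g)] would
    make [a^2 + b^2 + c^2] and [a b + b c + c a] even, hence [a], [b], [c] even, and [B] would take
    only even values on the primitive lattice [L]. *)
Lemma cube_eps : eps = 1 \/ eps = 4.
Proof.
have [m mE] := cube_scale; have /intrP [n nE] := cube_K_int Kf1 Kf1.
rewrite -/(Q f1) qf1 in nE; have e0 := cube_eps0.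
have n0 : 0 < n by rewrite -(ltr0z rat) -nE.
have nm : n * m = 4 by apply: (intr_inj (R := rat)); rewrite intrM -nE mE.
have m0 : 0 < m by rewrite -(pmulr_rgt0 _ n0) nm.
have : [\/ n = 1, n = 2 | n = 4].
  have nn : (`|n|%N * `|m|%N = 4)%N by rewrite -abszM nm.
  have : (`|n|%N %| 4)%N by rewrite -nn dvdn_mulr.
  have -> : n = `|n|%N by rewrite gtz0_abs.
  move=> d; have := dvdn_leq (isT : 0 < 4)%N d; move: d.
  by case: `|n|%N => [|[|[|[|[|]]]]] // _ _; [constructor 1|constructor 2|constructor 3].
case=> n_; rewrite n_ in nE; [by left| |by right].
have par v : K v -> exists a b c : int,
    2 *: v = (2 * a)%:~R *: f1 + (2 * b)%:~R *: f2 + (2 * c)%:~R *: f3.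
  move=> Kv; have [a [b [c e]]] := coord Kv.
  have eg : 2 *: (v *m g) = c%:~R *: f1 + a%:~R *: f2 + b%:~R *: f3.
    rewrite scalemxAl e !mulmxDl -!scalemxAl fg1 fg2 fg3.
    by rewrite addrC addrA.
  have Kg : K (v *m g) by rewrite /K scalemxAl; apply/gN.
  have /intrP [s sE] := cube_K_int Kv Kv; have /intrP [t tE] := cube_K_int Kv Kg.
  have h1 := cube_bform e e; have h2 := cube_bform e eg.
  rewrite sE nE -[4]/(4%:~R) -!intrM in h1; rewrite tE nE -[4]/(4%:~R) -!intrM in h2.
  have {}h1 := intr_inj h1; have {}h2 := intr_inj h2.
  have k1 : (2 %| a)%Z /\ (2 %| b)%Z /\ (2 %| c)%Z.
    have q (z : int) : exists k r : int, z = 2 * k + r /\ (r = 0 \/ r = 1).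
      exists (z %/ 2)%Z, (z %% 2)%Z; split; first by rewrite mulrC -divz_eq.
      by have := modz_ge0 z (isT : 2 != 0 :> int); have := ltz_pmod z (isT : 0 < 2 :> int); lia.
    have [ka [ra [aE ra01]]] := q a; have [kb [rb [bE rb01]]] := q b.
    have [kc [rc [cE rc01]]] := q c.
    have [ra0 [rb0 rc0]] : ra = 0 /\ rb = 0 /\ rc = 0.
      by move: h1 h2 ra01 rb01 rc01; rewrite aE bE cE; clear; nia.
    by rewrite aE bE cE ra0 rb0 rc0 !addr0; split; [|split]; apply: dvdz_mulr.
  have [/dvdzP [a' aE] [/dvdzP [b' bE] /dvdzP [c' cE]]] := k1.
  by exists a', b', c'; rewrite ![2 * _]mulrC -aE -bE -cE.
exfalso; have [k kE] : exists k : int, 1 = 2 * k%:~R :> rat.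
  apply: (scale_ind (P := fun r => exists m : int, r = 2 * m%:~R)).
  - by exists 0; rewrite mulr0.
  - by move=> a b [m1 ->] [m2 ->]; exists (m1 + m2); rewrite intrD mulrDr.
  move=> k x y Lx Ly; have [a [b [c e]]] := par _ (cube_LK Lx).
  have [a' [b' [c' e']]] := par _ (cube_LK Ly).
  exists (k * (a * a' + b * b' + c * c')).
  have h := cube_bform e e'; have f0 : 4 != 0 :> rat by [].
  apply: (mulfI f0); rewrite mulrCA h nE !(intrM, intrD); ring.
have : (1 : int) = 2 * k by apply: (intr_inj (R := rat)); rewrite intrM.
by clear; lia.
Qed.

End CubicFrame.

(** * Subgroups of Z^n and lattices between p L and L / p *)

Section IntegerSpan.
Lemma int_subgroup_gen (S : int -> Prop) : S 0 -> (forall a b, S a -> S b -> S (a - b)) ->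
  exists2 d, S d & forall a, S a -> (d %| a)%Z.
Proof.
move=> S0 SB; have SN a : S a -> S (- a) by move=> Sa; rewrite -sub0r; apply: SB.
have SD a b : S a -> S b -> S (a + b) by move=> Sa Sb; rewrite -[b]opprK; apply: SB => //; apply: SN.
have SM (k : int) a : S a -> S (k * a).
  have nat_case (n : nat) : S a -> S (n%:Z * a).
    by move=> Sa; elim: n => [|n IH]; rewrite ?mul0r // -addn1 PoszD mulrDl mul1r; apply: SD.
  by move=> Sa; case: (intP k) => [|n|n]; rewrite ?mul0r ?mulNr //; [|apply: SN]; apply: nat_case.
case: (pselect (exists n : nat, `[< S n.+1%:Z >])) => [ex|nex]; last first.
  exists 0 => // a Sa; suff -> : a = 0 by [].
  case: (intP a) Sa => // n Sn; exfalso; apply: nex; exists n; apply/asboolP => //.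
  by rewrite -[n.+1%:Z]opprK; apply: SN.
case: (ex_minnP ex) => n /asboolP Sn nmin; exists n.+1%:Z => // a Sa.
have Sr : S (a %% n.+1%:Z)%Z by rewrite /modz; apply: SB => //; apply: SM.
apply/dvdz_mod0P; have := modz_ge0 a (isT : n.+1%:Z != 0); have := ltz_pmod a (isT : 0 < n.+1%:Z).
case: (a %% n.+1%:Z)%Z Sr => // -[//|k] Sk klt _; exfalso.
have : (n <= k)%N by apply: nmin; apply/asboolP.
by move: klt; rewrite ltz_nat; lia.
Qed.

(** The matrix is square but may be singular, so subgroups of any rank are covered. *)
Definition spanned n (S : set 'rV[int]_n) :=
  exists E : 'M[int]_n, forall v, S v <-> exists c : 'rV[int]_n, v = c *m E.

(** Hermite reduction: the first coordinates of [S] are the multiples of some [d], [s0] completes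
    [d] to a vector of [S], and the vectors with first coordinate 0 are handled by the induction
    hypothesis. *)
Lemma int_span_step n :
  (forall S : set 'rV[int]_n, S 0 -> (forall x y, S x -> S y -> S (x - y)) -> spanned S) ->
  forall S : set 'rV[int]_(1 + n), S 0 -> (forall x y, S x -> S y -> S (x - y)) -> spanned S.
Proof.
move=> IH S S0 SB.
have SN a : S a -> S (- a) by move=> Sa; rewrite -sub0r; apply: SB.
have SD a b : S a -> S b -> S (a + b) by move=> Sa Sb; rewrite -[b]opprK; apply: SB => //; apply: SN.
have SM (k : int) a : S a -> S (k *: a).
  have nat_case (m : nat) : S a -> S (m%:Z *: a).
    by move=> Sa; elim: m => [|m IHm]; rewrite ?scale0r // -[m.+1]addn1 PoszD scalerDl scale1r; apply: SD.
  by move=> Sa; case: (intP k) => [|m|m]; rewrite ?scale0r ?scaleNr //; [|apply: SN]; apply: nat_case.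
pose S' : set 'rV[int]_n := fun v => S (row_mx (0 : 'rV_1) v : 'rV_(1 + n)).
have [||E' E'P] := IH S'.
- by rewrite /S' row_mx0.
- by move=> x y; rewrite /S' => Sx Sy; have := SB _ _ Sx Sy; rewrite opp_row_mx add_row_mx subrr.
pose D (d : int) := exists2 v : 'rV[int]_n, True & S (row_mx (d%:M : 'rV_1) v : 'rV_(1 + n)).
have [||d [s0 _ Ss0] dmin] := @int_subgroup_gen D.
- by exists 0 => //; rewrite (_ : 0%:M = 0) ?row_mx0 //; apply/matrixP => i j; rewrite !mxE mul0rn.
- move=> a b [v _ Sv] [w _ Sw]; exists (v - w) => //.
  have := SB _ _ Sv Sw; rewrite opp_row_mx add_row_mx; congr (S (row_mx _ _)).
  by apply/matrixP => i j; rewrite !mxE mulrnBl.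
exists (block_mx (d%:M : 'M_1) s0 0 E' : 'M_(1 + n)) => v; split.
  move=> Sv; pose v0 : int := (v : 'rV_(1 + n)) 0 (lshift n 0).
  pose v' : 'rV_n := rsubmx (v : 'rV_(1 + n)).
  have vE : v = row_mx (v0%:M : 'rV_1) v' :> 'rV_(1 + n).
    rewrite -[LHS](hsubmxK (v : 'rV_(1 + n))); congr row_mx.
    by apply/rowP => j; rewrite !ord1 !mxE mulr1n.
  have /dvdzP [k kE] : (d %| v0)%Z by apply: dmin; exists v' => //; rewrite -vE.
  have : S' (v' - k *: s0).
    rewrite /S'; have := SB _ _ Sv (SM k _ Ss0); rewrite {1}vE scale_row_mx opp_row_mx add_row_mx.
    congr (S (row_mx _ _)); apply/rowP => j; rewrite !ord1 !mxE !mulr1n kE.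
    by rewrite mulrC subrr.
  move/E'P => [c' c'E]; exists (row_mx (k%:M : 'rV_1) c' : 'rV_(1 + n)).
  have e2 : (k%:M : 'M_1) *m s0 + c' *m E' = v' by rewrite mul_scalar_mx -c'E addrC subrK.
  have e1 : (k%:M : 'M_1) *m (d%:M : 'M_1) = v0%:M by rewrite -scalar_mxM -kE.
  by rewrite (mul_row_block (k%:M : 'rV_1) c' (d%:M : 'M_1) s0 0 E') mulmx0 addr0 e1 e2.
move=> [c ->]; rewrite -[c](hsubmxK (c : 'rV_(1 + n))).
rewrite (mul_row_block (lsubmx (c : 'rV_(1 + n))) _ (d%:M : 'M_1) s0 0 E') mulmx0 addr0.
set k : int := lsubmx (c : 'rV_(1 + n)) 0 0.
have lE : lsubmx (c : 'rV_(1 + n)) = k%:M by apply/rowP => j; rewrite !ord1 [in RHS]mxE mulr1n.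
have S2 : S (row_mx (0 : 'rV_1) (rsubmx (c : 'rV_(1 + n)) *m E') : 'rV_(1 + n)).
  by apply/E'P; exists (rsubmx (c : 'rV_(1 + n))).
have e1 : lsubmx (c : 'rV_(1 + n)) *m (d%:M : 'M_1) = k *: d%:M by rewrite lE mul_scalar_mx.
have e2 : lsubmx (c : 'rV_(1 + n)) *m s0 = k *: s0 by rewrite lE mul_scalar_mx.
have := SD _ _ (SM k _ Ss0) S2; rewrite scale_row_mx add_row_mx addr0.
by rewrite e1 e2.
Qed.

Lemma int_subgroup_span n (S : set 'rV[int]_n) : S 0 ->
  (forall x y, S x -> S y -> S (x - y)) -> spanned S.
Proof.
elim: n S => [|n IH] S S0 SB; last exact: (int_span_step IH).
exists 0 => v; split=> [_|_]; first by exists 0; rewrite mul0mx; apply/rowP => -[].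
by rewrite (_ : v = 0) //; apply/rowP => -[].
Qed.

(** Scaled by p and written in a basis of [L], [S] becomes a subgroup of Z^3 containing [p^2 Z^3],
    so the matrix that spans it is invertible. *)
Lemma between_lattice (p : nat) (L S : set 'rV[rat]_3) : (0 < p)%N -> is_lattice L ->
  S 0 -> (forall x y, S x -> S y -> S (x - y)) ->
  (forall x, L x -> S (p%:R *: x)) -> (forall x, S x -> L (p%:R *: x)) -> is_lattice S.
Proof.
move=> p0 lL S0 SB LS SL; have [E0 [uE0 LE]] := lL.
have pn : p%:R != 0 :> rat by rewrite pnatr_eq0 -lt0n.
pose T : set 'rV[int]_3 := fun c => S (p%:R^-1 *: (map_mx intr c *m E0)).
have [||E1 E1P] := @int_subgroup_span 3 T.
- by rewrite /T map_mx0 mul0mx scaler0.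
- by move=> x y Tx Ty; rewrite /T map_mxB mulmxBl scalerBr; apply: SB.
have TS v : S v <-> exists2 c, T c & v = p%:R^-1 *: (map_mx intr c *m E0).
  split=> [Sv|[c Tc ->]] //; have := SL _ Sv; rewrite LE => -[c _ cE].
  have vE : v = p%:R^-1 *: (map_mx intr c *m E0) by rewrite cE scalerA mulVf // scale1r.
  by exists c => //; rewrite /T -vE.
have uE1 : (map_mx intr E1 : 'M[rat]_3) \in unitmx.
  have ex (i : 'I_3) : exists c : 'rV[int]_3, (p * p)%:Z *: row i 1%:M = c *m E1.
    apply/E1P; rewrite /T map_mxZ /= map_row map_mx1 -scalemxAl scalerA -row_mul mul1mx.
    have -> : (p%:R^-1 * (p * p)%N%:~R) = p%:R :> rat by rewrite -pmulrn natrM mulKf.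
    apply: LS; have := lattice_basis_in (row i 1%:M) (conj uE0 LE : lattice_basis E0 L).
    by rewrite map_row map_mx1 -row_mul mul1mx.
  have [C CP] := choice ex; pose C1 : 'M[int]_3 := \matrix_i C i.
  have e : C1 *m E1 = ((p * p)%:Z)%:M.
    apply/row_matrixP => i; rewrite row_mul rowK -CP -[in RHS]scalemx1.
    by rewrite linearZ.
  have := congr1 (fun A : 'M[int]_3 => (\det A)%:~R : rat) e; rewrite /= det_mulmx det_scalar intrM => h.
  rewrite unitmxE unitfE det_map_mx /=; apply/eqP => d0; move: h; rewrite d0 mulr0 => /esym/eqP.
  by rewrite intr_eq0 expf_eq0 /= eqz_nat muln_eq0 orbb -leqn0 leqNgt p0.
exists (p%:R^-1 *: (map_mx intr E1 *m E0)); split.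
  by rewrite unitmxZ ?unitmx_mul ?uE1 // unitfE invr_eq0.
apply/seteqP; split=> v.
  move/TS => [c /E1P [c' ->] ->]; exists c' => //.
  by rewrite map_mxM -scalemxAr mulmxA.
move=> [c' _ <-]; apply/TS; exists (c' *m E1); first by apply/E1P; exists c'.
by rewrite map_mxM -scalemxAr mulmxA.
Qed.

End IntegerSpan.

Lemma gram_int_eq (n1 n2 n3 n4 e D : int) (q1 q2 q3 q4 gr : rat) :
  q1 = n1%:~R -> q2 = n2%:~R -> q3 = n3%:~R -> q4 = n4%:~R ->
  gr = q1 * (q2 * q3 - q4 * q4) ->
  64 * gr = e%:~R * e%:~R * (e%:~R * e%:~R) * (e%:~R * e%:~R) * D%:~R * D%:~R ->
  8 * 8 * (n1 * (n2 * n3 - n4 * n4)) = e * e * (e * e) * (e * e) * D * D.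
Proof.
move=> -> -> -> -> -> h; apply: (intr_inj (R := rat)); rewrite !(intrM, intrB) -h.
by ring.
Qed.

(** In the application [x5] is the factor that clears the projections and [x4] is the 8 coming from
    doubled coordinates. *)
Lemma square_quotient (F : fieldType) (x1 x2 x3 x4 x5 x6 x7 x8 : F) :
  x4 * x4 * (x1 * (x5 ^+ 2 * x6 * (x5 ^+ 2 * x7) - x5 ^+ 2 * x8 * (x5 ^+ 2 * x8))) =
    x2 * x2 * (x2 * x2) * (x2 * x2) * x3 * x3 -> x5 != 0 -> x4 != 0 ->
  x1 * (x6 * x7 - x8 * x8) = (x2 ^+ 3 * x3 / (x4 * x5 ^+ 2)) ^+ 2.
Proof.
move=> h n5 n4; apply: (mulfI (mulf_neq0 (expf_neq0 2 n4) (expf_neq0 4 n5))).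
rewrite expr_div_n exprMn mulrA -[RHS]mulrA.
transitivity (x4 * x4 * (x1 * (x5 ^+ 2 * x6 * (x5 ^+ 2 * x7) - x5 ^+ 2 * x8 * (x5 ^+ 2 * x8)))).
  by ring.
by rewrite h; field; rewrite n4 n5.
Qed.

Lemma ires_det2 p a b c : a \is a Num.int -> b \is a Num.int -> c \is a Num.int ->
  ires p (a * b - c * c) = ires p a * ires p b - ires p c * ires p c.
Proof. by move=> ai bi ci; rewrite iresB ?rpredM // !iresM. Qed.

(** * The axes in N / p that come from lattices of the genus *)

Section CubicGenus.
Variables (p : nat) (pr_p : prime p) (odd_p : odd p) (G : 'M[rat]_3).
Hypothesis posG : posdef G.
Local Notation B := (bform G).
Local Notation Q := (qform G).
Local Notation prj := (proj G).
Local Notation prp := (perp G).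
Variable L : set 'rV[rat]_3.
Hypotheses (latL : is_lattice L) (primL : primitive_lattice G L)
  (ord_dL : 1 <= ordq p (lattice_det G L)).
Let N := Lambda G p L.
Let r1 := rank1_lattice p G L.
Let K : set 'rV[rat]_3 := fun v => N (p%:R *: v).
Variables (f1 f2 f3 : 'rV[rat]_3) (eta : int).
Let eps : rat := eta%:~R * eta%:~R.
Hypothesis eta12 : eta = 1 \/ eta = 2.
Hypotheses (f12 : B f1 f2 = 0) (f13 : B f1 f3 = 0) (f23 : B f2 f3 = 0)
  (qf1 : Q f1 = eps) (qf2 : Q f2 = eps) (qf3 : Q f3 = eps).
Hypotheses (Kf1 : K f1) (Kf2 : K f2) (Kf3 : K f3).
Hypothesis coord : forall v, K v -> exists a b c : int,
  2 *: v = a%:~R *: f1 + b%:~R *: f2 + c%:~R *: f3.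
Hypothesis Ki : forall v w, K v -> K w -> B v w \is a Num.int.
Implicit Types (u v w x y l : 'rV[rat]_3).

Let gL : good G p r1 N L := genus_good pr_p odd_p posG latL primL ord_dL (genus_refl G latL).
Let iN : int_lattice G N := good_ilN pr_p gL.
Let iL : int_lattice G L := good_il gL.
Let Li x y : L x -> L y -> B x y \is a Num.int := @int_lattice_int _ _ iL x y.
Let pn : p%:R != 0 :> rat.
Proof. by rewrite pnatr_eq0 -lt0n prime_gt0. Qed.

Let KB := cube_KB pr_p gL.
Let K0 := cube_K0 pr_p gL.
Let KD := cube_KD pr_p gL.
Let KZ := cube_KZ pr_p gL.
Let LK := cube_LK pr_p gL.
Let NK := cube_NK pr_p gL.
Let bf := cube_bform posG f12 f13 f23 qf1 qf2 qf3.

Lemma KZr (a : rat) x : a \is a Num.int -> K x -> K (a *: x).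
Proof. by move=> /intrP [k ->]; apply: KZ. Qed.

Lemma NZr (a : rat) x : a \is a Num.int -> N x -> N (a *: x).
Proof. by move=> /intrP [k ->]; apply: (il_Z _ iN). Qed.

Lemma pZ_KN (a : rat) x : pZ p a -> K x -> N (a *: x).
Proof.
move=> pa Kx; have -> : a *: x = (a / p%:R) *: (p%:R *: x) by rewrite scalerA divfK.
exact: NZr.
Qed.

Lemma N_pK x : N x -> exists2 v, K v & x = p%:R *: v.
Proof.
move=> Nx; exists (p%:R^-1 *: x); last by rewrite scalerA divff // scale1r.
by rewrite /K scalerA divff // scale1r.
Qed.

Lemma NK_pZ x v : N x -> K v -> pZ p (B x v).
Proof. by move=> /N_pK [w Kw ->] Kv; rewrite bformZl; apply: pZp => //; apply: Ki. Qed.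

Lemma eta_int : eps \is a Num.int.
Proof. by rewrite /eps -intrM intr_int. Qed.

Lemma eta_unit : ~~ pZ p eta%:~R.
Proof.
rewrite pZ_intr // dvdzE; case: eta12 => -> /=; last exact: p_ndvd2.
by rewrite dvdn1; apply/eqP => p1; have := prime_gt1 pr_p; rewrite p1.
Qed.

Lemma pZ_int_cancel (a b : rat) : a \is a Num.int -> b \is a Num.int -> ~~ pZ p a ->
  pZ p (a * b) -> pZ p b.
Proof. by move=> ai bi an /(pZM pr_p) [] // h; rewrite h in an. Qed.

Lemma eps_cancel (a : rat) : a \is a Num.int -> pZ p (eps * a) -> pZ p a.
Proof.
move=> ai; rewrite /eps -mulrA => /(pZ_int_cancel (intr_int _ _) _ eta_unit).
move=> h; apply: (pZ_int_cancel (intr_int _ eta) ai eta_unit); apply: h.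
by rewrite rpredM // intr_int.
Qed.

Lemma pZ2 : ~~ pZ p 2.
Proof. by rewrite -[2]/(2%:R) pZ_nat // p_ndvd2. Qed.

(** The form on [K / N] over the field with p elements is nondegenerate: up to the units 2 and
    [eta], the coordinates of [x] are its pairings with [f1], [f2], [f3]. *)
Lemma cube_unimodular x : K x -> (forall v, K v -> pZ p (B x v)) -> N x.
Proof.
move=> Kx h; have [a [b [c e]]] := coord Kx.
have key (d : int) v : K v -> 4 * B x v = eps * (d * 2)%:~R -> pZ p d%:~R.
  move=> Kv e4; apply: (pZ_int_cancel (a := 2)) => //; first exact: pZ2.
  apply: eps_cancel; first by rewrite rpredM // intr_int.
  have -> : eps * (2 * d%:~R) = 4 * B x v by rewrite e4 intrM; ring.
  by apply: pZMl => //; apply: h.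
have pa : pZ p a%:~R.
  by apply: (key a f1) => //; rewrite (bf e (cube_coord1 f1 f2 f3)) !mulr0 !addr0.
have pb : pZ p b%:~R.
  by apply: (key b f2) => //; rewrite (bf e (cube_coord2 f1 f2 f3)) !mulr0 addr0 add0r.
have pc : pZ p c%:~R.
  by apply: (key c f3) => //; rewrite (bf e (cube_coord3 f1 f2 f3)) !mulr0 !add0r.
apply: (subgrp_coprime pr_p (int_lattice0 iN) (@int_latticeB _ _ iN) (p_ndvd2 pr_p odd_p)) => //.
by rewrite -[2%:R]/2 e; do ![apply: (il_D iN)]; apply: pZ_KN.
Qed.

(** Modulo [N] this is the line of [w] in rank 1 and the plane orthogonal to [w] otherwise. *)
Definition axis_lattice w : set 'rV[rat]_3 := fun v => K v /\
  ((r1 /\ exists a : int, N (v - a%:~R *: w)) \/ (~ r1 /\ pZ p (B v w))).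

Lemma axis_lattice_scale (s : int) w v : K w -> ~~ (p%:Z %| s)%Z ->
  axis_lattice (s%:~R *: w) v <-> axis_lattice w v.
Proof.
move=> Kw ps; rewrite /axis_lattice.
have [u [t tE]] : exists u t : int, u * s + t * p%:Z = 1.
  have : coprimez s p%:Z by rewrite coprimez_sym coprimezE prime_coprime //; move: ps; rewrite dvdzE.
  by case/coprimezP => -[u t] /= e; exists u, t.
split=> -[Kv h]; split=> //; case: h => -[h1 h2]; [left|right|left|right]; split=> //.
- by case: h2 => a Na; exists (a * s); rewrite intrM -scalerA.
- move: h2; rewrite bformZr; apply: pZ_int_cancel; rewrite ?intr_int ?Ki //.
  by rewrite pZ_intr.
- case: h2 => a Na; exists (a * u).
  have -> : v - (a * u)%:~R *: (s%:~R *: w) = (v - a%:~R *: w) + (a * t)%:~R *: (p%:R *: w).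
    rewrite !scalerA -addrA -!scaleNr -scalerDl; congr (_ + _ *: _).
    have := congr1 (fun z : int => z%:~R : rat) tE; rewrite intrD !intrM -pmulrn => e.
    have h : a%:~R = a%:~R * u%:~R * s%:~R + a%:~R * t%:~R * p%:R :> rat.
      by rewrite -!mulrA -mulrDr e mulr1.
    by rewrite {2}h; ring.
  by apply: (il_D iN) => //; apply: (il_Z _ iN).
by rewrite bformZr; apply: pZMl => //; apply: intr_int.
Qed.

(** As [Q y] and [Q l] agree modulo p, the symmetry along [y - l] exchanges [y] and [l] modulo p
    once its denominator is cleared by the factor [Q (y - l)]. *)
Lemma axis_lattice_refl y l v : K y -> K l -> pZ p (Q y - Q l) ->
  axis_lattice y v -> axis_lattice l (Q (y - l) *: (v *m refl G (y - l))).
Proof.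
move=> Ky Kl yl [Kv h]; set z := y - l; have Kz : K z by apply: KB.
have [z0|z0] := eqVneq z 0.
  rewrite z0 /qform bform0l scale0r; split; first exact: K0.
  case: h => -[h1 _]; [left|right]; split=> //.
    by exists 0; rewrite scale0r subrr; apply: (int_lattice0 iN).
  by rewrite bform0l pZ0.
have qz : Q z != 0 by rewrite qform_eq0.
have tE u : Q z *: (u *m refl G z) = Q z *: u - (2 * B u z) *: z.
  by rewrite reflE scalerBr scalerA mulrCA divff // mulr1.
have Kt u : K u -> K (Q z *: (u *m refl G z)).
  move=> Ku; rewrite tE; apply: KB; apply: KZr => //; first exact: Ki.
  by rewrite rpredM // Ki.
split; first exact: Kt.
case: h => -[h1 h2]; [left|right]; split=> //.
  case: h2 => a Na; have /intrP [n nE] := Ki Kz Kz; exists (a * n).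
  have -> : Q z *: (v *m refl G z) - (a * n)%:~R *: l =
     Q z *: ((v - a%:~R *: y) *m refl G z) + (a%:~R * (Q l - Q y)) *: z.
    rewrite !tE intrM -nE -/(Q z).
    have -> : Q l - Q y = Q z - 2 * B y z.
      by rewrite /z /qform !bformE [B l y]bformC //; ring.
    have -> : B (v - a%:~R *: y) z = B v z - a%:~R * B y z by rewrite bformDl bformNl bformZl.
    move: (B v z) (B y z) (Q z) => b1 b2 q; rewrite /z.
    by apply/rowP => j; rewrite !rvE; ring.
  apply: (il_D iN).
    rewrite tE; apply: (int_latticeB iN); first by apply: NZr => //; apply: Ki.
    by apply: pZ_KN => //; apply: pZMl => //; apply: NK_pZ.
  apply: pZ_KN => //; apply: pZMl; first exact: intr_int.
  by rewrite -opprB; apply: pZN.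
rewrite tE.
have -> : B (Q z *: v - (2 * B v z) *: z) l = Q z * B v y - (Q y - Q l) * B v z.
  rewrite /z /qform !bformE [B l y]bformC //.
  by move: (B v y) (B v l) (B y y) (B y l) (B l l) => *; ring.
by apply: pZB; [apply: pZMl|apply: pZMr] => //; apply: Ki.
Qed.

Lemma axis_lattice_N w v : K w -> N v -> axis_lattice w v.
Proof.
move=> Kw Nv; split; first exact: NK.
case: (pselect r1) => h; [left|right]; split=> //; last exact: NK_pZ.
by exists 0; rewrite scale0r subr0.
Qed.

Lemma axis_lattice0 w : K w -> axis_lattice w 0.
Proof. by move=> Kw; apply: axis_lattice_N => //; apply: (int_lattice0 iN). Qed.

Lemma axis_latticeB w u v : axis_lattice w u -> axis_lattice w v -> axis_lattice w (u - v).
Proof.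
move=> [Ku hu] [Kv hv]; split; first exact: KB.
case: hu => -[r hu]; case: hv => -[r' hv] //; [left|right]; split=> //.
  case: hu => a Na; case: hv => b Nb; exists (a - b).
  have -> : u - v - (a - b)%:~R *: w = (u - a%:~R *: w) - (v - b%:~R *: w).
    by apply/rowP => j; rewrite !rvE intrB; ring.
  exact: (int_latticeB iN).
by rewrite !bformE; apply: pZB.
Qed.

(** The pairings of [Q y *: v - B v y *: y] with [L] are minors, so this vector lies in [N] and [y]
    generates [L] modulo [N]. *)
Lemma axis_lattice_rank1 y : r1 -> L y -> ~~ pZ p (Q y) -> L = axis_lattice y.
Proof.
move=> r Ly qy; have Ky := LK Ly; apply/seteqP; split=> v.
  move=> Lv; have [k kE] := int_abs (Li Ly Ly).
  have Nk : N (Q y *: v - B v y *: y).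
    apply/(good_Lambda gL); split.
      have /intrP [a aE] := Li Ly Ly; have /intrP [b bE] := Li Lv Ly.
      by rewrite /qform aE bE; apply: (int_latticeB iL); apply: (il_Z _ iL).
    move=> z Lz; have := good_rank1 gL r Ly Lv Ly Lz.
    rewrite !bformE -/(Q y); congr (pZ p _); rewrite [B y z * _]mulrC.
    by [].
  have An : axis_lattice y (Q y *: v).
    split; first by apply: KZr; [apply: Ki|apply: LK].
    have /intrP [b bE] := Li Lv Ly.
    by left; split=> //; exists b; rewrite -bE.
  have Ak : axis_lattice y (k%:R *: v).
    case: kE => kE; rewrite /qform kE in An => //.
    rewrite -[_ *: v]opprK -scaleNr; apply: (subgrpN (axis_lattice0 Ky)) => //.
    exact: axis_latticeB.
  have pk : ~~ (p %| k)%N.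
    apply: contra qy => pk; rewrite /qform; case: kE => ->; rewrite ?pZ_nat //.
    by apply: pZN; rewrite pZ_nat.
  apply: (subgrp_coprime pr_p (axis_lattice0 Ky) (@axis_latticeB y) pk Ak).
  exact: (axis_lattice_N Ky (LK Lv)).
move=> [Kv [[_ [a Na]]|[//]]].
rewrite -[v](subrK (a%:~R *: y)); apply: (il_D iL); first exact: (good_sub gL).
exact: (il_Z _ iL).
Qed.

(** The vector product in coordinates with respect to [f1], [f2], [f3]. The arguments are doubled
    coordinates, hence the powers of 2 in the identities below. *)
Definition cross (a b c a' b' c' : int) : 'rV[rat]_3 :=
  (b * c' - c * b')%:~R *: f1 + (c * a' - a * c')%:~R *: f2 + (a * b' - b * a')%:~R *: f3.

Definition det_coord (a b c a1 b1 c1 a2 b2 c2 : int) : int :=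
  a * (b1 * c2 - c1 * b2) + b * (c1 * a2 - a1 * c2) + c * (a1 * b2 - b1 * a2).

Lemma gram3_coord x u w (a b c a1 b1 c1 a2 b2 c2 : int) :
  2 *: x = a%:~R *: f1 + b%:~R *: f2 + c%:~R *: f3 ->
  2 *: u = a1%:~R *: f1 + b1%:~R *: f2 + c1%:~R *: f3 ->
  2 *: w = a2%:~R *: f1 + b2%:~R *: f2 + c2%:~R *: f3 ->
  64 * gram3 G x u w =
  eps * eps * eps * (det_coord a b c a1 b1 c1 a2 b2 c2)%:~R * (det_coord a b c a1 b1 c1 a2 b2 c2)%:~R.
Proof.
move=> ex eu ew; have h v v' z : 4 * B v v' = z -> B v v' = z / 4.
  by move=> <-; rewrite mulrC mulKf.
rewrite /gram3 /qform (h _ _ _ (bf ex ex)) (h _ _ _ (bf ex eu)) (h _ _ _ (bf ex ew)).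
rewrite (h _ _ _ (bf eu eu)) (h _ _ _ (bf eu ew)) (h _ _ _ (bf ew ew)) /det_coord.
by rewrite !(intrD, intrB, intrM); field.
Qed.

Lemma cross_bform x (a b c a1 b1 c1 a2 b2 c2 : int) :
  2 *: x = a%:~R *: f1 + b%:~R *: f2 + c%:~R *: f3 ->
  2 * B x (cross a1 b1 c1 a2 b2 c2) = eps * (det_coord a b c a1 b1 c1 a2 b2 c2)%:~R.
Proof.
move=> ex; rewrite -bformZl ex /cross /det_coord !bformE -/(Q f1) -/(Q f2) -/(Q f3) qf1 qf2 qf3.
rewrite [B f2 f1]bformC // [B f3 f1]bformC // [B f3 f2]bformC // f12 f13 f23.
by rewrite !(intrD, intrB, intrM); ring.
Qed.

Lemma cross_qform u w (a1 b1 c1 a2 b2 c2 : int) :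
  2 *: u = a1%:~R *: f1 + b1%:~R *: f2 + c1%:~R *: f3 ->
  2 *: w = a2%:~R *: f1 + b2%:~R *: f2 + c2%:~R *: f3 ->
  eps * Q (cross a1 b1 c1 a2 b2 c2) = 16 * (Q u * Q w - B u w * B u w).
Proof.
move=> eu ew; have h v v' z : 4 * B v v' = z -> B v v' = z / 4.
  by move=> <-; rewrite mulrC mulKf.
rewrite /qform (h _ _ _ (bf eu eu)) (h _ _ _ (bf eu ew)) (h _ _ _ (bf ew ew)).
rewrite /cross !bformE -/(Q f1) -/(Q f2) -/(Q f3) qf1 qf2 qf3.
rewrite [B f2 f1]bformC // [B f3 f1]bformC // [B f3 f2]bformC // f12 f13 f23.
by rewrite !(intrD, intrB, intrM); field.
Qed.

Lemma pZ_square (a : rat) : a \is a Num.int -> pZ p (a * a) -> pZ p a.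
Proof. by move=> ai /(pZM pr_p) []. Qed.

Lemma sixteen_unit : ~~ pZ p 16.
Proof.
rewrite -[16]/(16%:R) pZ_nat // -[16%N]/(2 * (2 * (2 * 2)))%N.
have two := p_ndvd2 pr_p odd_p.
exact: (p_ndvdM pr_p two (p_ndvdM pr_p two (p_ndvdM pr_p two two))).
Qed.

(** The axis is the vector product [y] of [u] and [w]. For [v] in [L] the Gram determinant of [v],
    [u], [w] is divisible by p and equals the square of [B v y] up to units. Conversely, a vector of
    [K] orthogonal to [y] modulo p is, up to units, a combination of [u] and [w] plus a multiple of
    [y] in [N]. *)
Lemma axis_lattice_rank2 u w : ~ r1 -> L u -> L w ->
  ~~ pZ p (Q u * Q w - B u w * B u w) ->
  exists y, [/\ K y, ~~ pZ p (Q y), eps * Q y = 16 * (Q u * Q w - B u w * B u w) &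
    L = axis_lattice y].
Proof.
move=> nr Lu Lw D0; set D := _ - _ in D0 *.
have Di : D \is a Num.int by rewrite /D rpredB ?rpredM ?Li.
have [a1 [b1 [c1 eu]]] := coord (LK Lu); have [a2 [b2 [c2 ew]]] := coord (LK Lw).
pose y := cross a1 b1 c1 a2 b2 c2.
have Ky : K y by rewrite /y /cross; do ![apply: KD]; apply: KZ.
have yq : eps * Q y = 16 * D := cross_qform eu ew.
have yB x a b c : 2 *: x = a%:~R *: f1 + b%:~R *: f2 + c%:~R *: f3 ->
    2 * B x y = eps * (det_coord a b c a1 b1 c1 a2 b2 c2)%:~R by apply: cross_bform.
clearbody y.
have qy : ~~ pZ p (Q y).
  apply: contra D0 => h; have h16 : pZ p (16 * D) by rewrite -yq; apply: pZMl => //; apply: eta_int.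
  have i16 : (16 : rat) \is a Num.int by [].
  exact: (pZ_int_cancel i16 Di sixteen_unit h16).
exists y; split=> //.
have uy0 : B u y = 0.
  have t0 : 2 != 0 :> rat by [].
  by apply: (mulfI t0); rewrite (yB _ _ _ _ eu) mulr0 (_ : det_coord _ _ _ _ _ _ _ _ _ = 0) ?mulr0 // /det_coord; ring.
have wy0 : B w y = 0.
  have t0 : 2 != 0 :> rat by [].
  by apply: (mulfI t0); rewrite (yB _ _ _ _ ew) mulr0 (_ : det_coord _ _ _ _ _ _ _ _ _ = 0) ?mulr0 // /det_coord; ring.
apply/seteqP; split=> v.
  move=> Lv; split; first exact: LK.
  right; split=> //; have [a [b [c ev]]] := coord (LK Lv).
  have := good_det3 gL Lv Lu Lw; rewrite -/(gram3 G v u w) => g3.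
  have Bi : B v y \is a Num.int by apply: Ki => //; apply: LK.
  apply: (pZ_int_cancel (a := 2) _ Bi pZ2) => //.
  rewrite (yB _ _ _ _ ev); apply: pZMl; first exact: eta_int.
  apply: pZ_square; first exact: intr_int.
  have h : pZ p (64 * gram3 G v u w) by apply: pZMl.
  rewrite (gram3_coord ev eu ew) in h.
  have ei := eta_int; have dz := intr_int rat (det_coord a b c a1 b1 c1 a2 b2 c2).
  set d := (det_coord _ _ _ _ _ _ _ _ _)%:~R in h dz *.
  have i1 : d * d \is a Num.int by apply: rpredM.
  have i2 : eps * (d * d) \is a Num.int by apply: rpredM.
  have i3 : eps * (eps * (d * d)) \is a Num.int by apply: rpredM.
  apply: (eps_cancel i1); apply: (eps_cancel i2); apply: (eps_cancel i3).
  suff -> : eps * (eps * (eps * (d * d))) = eps * eps * eps * d * d by [].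
  by move: (eps) (d) => e1 d1; ring.
move=> [Kv [[//]|[_ vy]]].
(* Cramer coefficients that make [n] orthogonal to [u] and [w], so that [n] lies on the line of
   [y]. *)
pose al := B v u * Q w - B v w * B u w; pose be := B v w * Q u - B v u * B u w.
have Ku := LK Lu; have Kw := LK Lw.
have ali : al \is a Num.int by rewrite /al rpredB ?rpredM ?Ki.
have bei : be \is a Num.int by rewrite /be rpredB ?rpredM ?Ki.
pose n := D *: v - al *: u - be *: w.
have nu : B n u = 0.
  rewrite /n !bformE /al /be /D /qform [B w u]bformC //; ring.
have nw : B n w = 0.
  rewrite /n !bformE /al /be /D /qform; ring.
have ny : B n y = D * B v y by rewrite /n !bformE uy0 wy0; ring.
have nD : n = D *: v - al *: u - be *: w by [].
clearbody n.
have Dn0 : D != 0 by apply: contraNneq D0 => ->; rewrite pZ0.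
have y0 : y != 0 by apply: contraNneq qy => ->; rewrite /qform bform0l pZ0.
have u0 : u != 0.
  by apply: contraNneq Dn0 => e; rewrite /D e /qform !bform0l; apply/eqP; ring.
have nE : n = prj y n.
  pose w' := Q u *: w - B u w *: u.
  have w'0 : w' != 0.
    apply: contraNneq Dn0 => e; have : B w' w = 0 by rewrite e bform0l.
    by rewrite /w' !bformE -/(Q w) /D => ->.
  have uw' : B u w' = 0 by rewrite /w' !bformE -/(Q u); ring.
  have pu : B (n - prj y n) u = 0.
    by rewrite bformDl nu bformNl /proj bformZl [B y u]bformC // uy0; ring.
  have pw : B (n - prj y n) w = 0.
    by rewrite bformDl nw bformNl /proj bformZl [B y w]bformC // wy0; ring.
  apply/eqP; rewrite -subr_eq0; apply/eqP.
  apply: (@ortho3 _ posG y u w') => //.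
  - by rewrite bformC.
  - by rewrite /w' !bformE [B y w]bformC // [B y u]bformC // uy0 wy0; ring.
  - by rewrite bformC //; apply: perp_ortho.
  by rewrite /w' bformDr bformNr !bformZr pu pw; ring.
have Nn : N (Q y *: n).
  rewrite nE /proj scalerA mulrC divfK ?qform_eq0 // ny.
  by apply: pZ_KN => //; apply: pZMl.
have LQ : L ((Q y * D) *: v).
  have -> : (Q y * D) *: v = Q y *: n + (Q y * al) *: u + (Q y * be) *: w.
    by rewrite nD; move: (Q y) (D) (al) (be) => q t1 t2 t3; apply/rowP => j; rewrite !rvE; ring.
  have Qi : Q y \is a Num.int by apply: Ki.
  have /intrP [k1 ->] : Q y * al \is a Num.int by rewrite rpredM.
  have /intrP [k2 ->] : Q y * be \is a Num.int by rewrite rpredM.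
  by do ![apply: (il_D iL)]; [apply: (good_sub gL)|apply: (il_Z _ iL)|apply: (il_Z _ iL)].
have QD : ~~ pZ p (Q y * D).
  by apply/negP => /(pZM pr_p) [||h|h]; rewrite ?Ki //; [rewrite h in qy|rewrite h in D0].
apply: (good_M_cancel_int pr_p gL _ QD LQ); last exact: (good_sub gL).
by rewrite rpredM // Ki.
Qed.

Lemma gram3_ortho x u v : B x u = 0 -> B x v = 0 ->
  gram3 G x u v = Q x * (Q u * Q v - B u v * B u v).
Proof. by move=> e1 e2; rewrite /gram3 e1 e2; ring. Qed.

Section AxisInGenus.
Variables (y l : 'rV[rat]_3).
Hypotheses (Ky : K y) (Kl : K l) (ql : ~~ pZ p (Q l)) (Ly : L = axis_lattice y).
Hypotheses (yl : pZ p (Q y - Q l)) (yl0 : ~~ pZ p (Q (y - l))).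

(** Away from p all lattices between [N] and [K] have the same localisation. At p the symmetry along
    [y - l] maps each lattice into the other after multiplication by [Q (y - l)], which is prime to
    p. *)
Lemma axis_lattice_genus : genus G L (axis_lattice l).
Proof.
have p0 := prime_gt0 pr_p; split.
  apply: (between_lattice p0 latL (axis_lattice0 Kl) (@axis_latticeB l)).
    by move=> x Lx; apply: axis_lattice_N => //; apply: (good_p pr_p gL).
  by move=> x [Kx _]; apply: (good_sub gL).
move=> q pr_q; case: (pselect (p = q)) => [e|ne]; last first.
  exists 1%:M; first exact: isometry1.
  rewrite act1; transitivity (localize pr_q N).
    apply/esym; apply: (localize_index pr_p pr_q ne); first by move=> x; apply: (good_sub gL).
    by move=> x; apply: (good_p pr_p gL).
  apply: (localize_index pr_p pr_q ne); first by move=> x; apply: axis_lattice_N.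
  by move=> x [].
move: (q) e pr_q => _ <- pr_q.
have z0 : y - l != 0 by apply: contraNneq yl0 => ->; rewrite /qform bform0l pZ0.
exists (map_mx (@qrat p pr_q) (refl G (y - l))); first exact/isometry_qr/refl_isom.
rewrite -loc_act; have [n nE] : exists n : nat, Q (y - l) = n%:R.
  have [n [//|e]] := int_abs (Ki (KB Ky Kl) (KB Ky Kl)); first by exists n.
  exists 0%N; apply/eqP; rewrite eq_le qform_ge0 // andbT /qform e oppr_le0 ler0n //.
have pn' : ~~ (p %| n)%N by move: yl0; rewrite nE pZ_nat.
apply: localize_equiv => x.
  move=> [v Lv <-]; exists n => //; rewrite -nE; rewrite Ly in Lv.
  exact: axis_lattice_refl.
move=> Ax; exists n => //; have ly : pZ p (Q l - Q y) by rewrite -opprB; apply: pZN.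
have := axis_lattice_refl Kl Ky ly Ax; rewrite -Ly.
have -> : l - y = (-1) *: (y - l) by rewrite scaleN1r opprB.
rewrite refl_scale // (_ : Q _ = n%:R); last by rewrite -nE /qform bformZl bformZr; ring.
move=> Ln; exists (n%:R *: (x *m refl G (y - l))) => //.
by rewrite -scalemxAl -mulmxA refl_invol // mulmx1.
Qed.

(** Since [Q l] is prime to p, the form restricted to the line of [l], or to the plane orthogonal to
    it, has no radical modulo [N]. *)
Lemma axis_lattice_Gamma : Gamma G p L N (axis_lattice l).
Proof.
have gM := axis_lattice_genus; split=> //.
have gd := genus_good pr_p odd_p posG latL primL ord_dL gM.
have Al : r1 -> axis_lattice l l.
  by move=> r; split=> //; left; split=> //; exists 1; rewrite scale1r subrr; apply: (int_lattice0 iN).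
apply/seteqP; split=> x.
  move/(good_Lambda gd) => [[Kx h] hx]; case: h => -[r h].
    case: h => a Na; have := hx _ (Al r).
    have -> : B x l = B (x - a%:~R *: l) l + a%:~R * Q l by rewrite /qform !bformE; ring.
    move=> h; have {}h : pZ p (a%:~R * Q l).
      by have := pZB h (NK_pZ Na Kl); rewrite addrAC subrr add0r.
    have pa : pZ p a%:~R.
      by move: h; rewrite mulrC; apply: pZ_int_cancel => //; apply: Ki.
    rewrite -[x](subrK (a%:~R *: l)); apply: (il_D iN) => //; exact: pZ_KN.
  apply: cube_unimodular => // v Kv.
  have Qi : Q l \is a Num.int by apply: Ki.
  apply: (pZ_int_cancel Qi) => //; first exact: Ki.
  have Aw : axis_lattice l (Q l *: v - B v l *: l).
    split; first by apply: KB; apply: KZr => //; apply: Ki.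
    right; split=> //; rewrite !bformE -/(Q l) mulrC subrr; exact: pZ0.
  have := hx _ Aw; rewrite !bformE => h1.
  have -> : Q l * B x v = (Q l * B x v - B v l * B x l) + B v l * B x l by ring.
  by apply: pZD => //; apply: pZMl => //; apply: Ki.
move=> Nx; apply/(good_Lambda gd); split; first exact: axis_lattice_N.
by move=> v [Kv _]; apply: NK_pZ.
Qed.

End AxisInGenus.

Lemma eight_neq0 : (8 : int)%:~R != 0 :> 'F_p.
Proof.
rewrite (Fq_int_eq0 pr_p); change (~~ (p %| 2 * (2 * 2))%N).
have two := p_ndvd2 pr_p odd_p.
exact: (p_ndvdM pr_p two (p_ndvdM pr_p two two)).
Qed.

Lemma ires_nat_neq0 (k : nat) : ~~ (p %| k)%N -> ires p k%:R != 0.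
Proof. by move=> pk; rewrite (ires_eq0 pr_p) // pZ_nat. Qed.

(** By orthogonality the Gram determinant of [l], [u], [v] is [Q l] times a 2 by 2 determinant; by
    [gram3_coord] 64 times it is [eps ^ 3] times a square, and [eps] is the square of [eta]. *)
Lemma rank2_square l u v m m' (k : nat) : K l -> K u -> K v -> B l u = 0 -> B l v = 0 ->
  B m m \is a Num.int -> B m' m' \is a Num.int -> B m m' \is a Num.int -> ~~ (p %| k)%N ->
  ires p (B u u) = ires p k%:R ^+ 2 * ires p (B m m) ->
  ires p (B v v) = ires p k%:R ^+ 2 * ires p (B m' m') ->
  ires p (B u v) = ires p k%:R ^+ 2 * ires p (B m m') ->
  exists b : 'F_p, ires p (Q l) * ires p (Q m * Q m' - B m m' * B m m') = b ^+ 2.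
Proof.
move=> Kl Ku Kv lu lv mi mi' mmi pk e1 e2 e3.
have [a [b [c el]]] := coord Kl; have [a1 [b1 [c1 eu]]] := coord Ku.
have [a2 [b2 [c2 ev]]] := coord Kv.
have g3 := gram3_coord el eu ev; have gE := gram3_ortho lu lv.
move: (det_coord _ _ _ _ _ _ _ _ _) g3 => D g3.
have /intrP [n1 n1E] := Ki Kl Kl; have /intrP [n2 n2E] := Ki Ku Ku.
have /intrP [n3 n3E] := Ki Kv Kv; have /intrP [n4 n4E] := Ki Ku Kv.
have gI := gram_int_eq n1E n2E n3E n4E gE g3.
have {}gI := congr1 (fun z : int => z%:~R : 'F_p) gI.
exists (eta%:~R ^+ 3 * D%:~R / ((8 : int)%:~R * ires p k%:R ^+ 2)).
rewrite n2E ires_intr in e1; rewrite n3E ires_intr in e2; rewrite n4E ires_intr in e3.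
rewrite /= !(intrM, intrB) e1 e2 e3 in gI.
rewrite /qform (ires_det2 p mi mi' mmi) n1E ires_intr.
exact: (square_quotient gI (ires_nat_neq0 pk) eight_neq0).
Qed.

Variable d0 : padic_int pr_p.
Hypothesis disc : unimodular_disc G L d0.
Let delta := red d0.

Lemma delta_cases : delta != 0 /\
  ((r1 /\ exists2 m, L m & ires p (Q m) = delta) \/
   (~ r1 /\ exists m m', [/\ L m, L m' & ires p (Q m * Q m' - B m m' * B m m') = delta])).
Proof.
apply: (unimodular_disc_residue _ _ _ _ _ disc).
- by case: posG.
- exact: (int_lattice0 iL).
- exact: (@int_latticeB _ _ iL).
- exact: Li.
by move=> x y z Lx Ly Lz; apply: (good_det3 gL).
Qed.

(** In rank 1 the axis vector represents [delta] itself; in rank 2 it is the vector product, with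
    [eta ^ 2 * Q y] equal to [16 * delta] modulo p. Either way [Q y] and [delta] agree up to
    squares. *)
Lemma L_axis : exists y, [/\ K y, ~~ pZ p (Q y), L = axis_lattice y &
  exists2 c : 'F_p, c != 0 & ires p (Q y) * c ^+ 2 = delta].
Proof.
have [d0n [[r [m Lm mE]]|[nr [m [m' [Lm Lm' mE]]]]]] := delta_cases.
  have qm : ~~ pZ p (Q m) by rewrite -(ires_eq0 pr_p) ?mE //; apply: Li.
  exists m; split=> //; [exact: LK|exact: axis_lattice_rank1|].
  by exists 1; rewrite ?oner_neq0 // expr1n mulr1.
have Di : Q m * Q m' - B m m' * B m m' \is a Num.int by rewrite rpredB ?rpredM ?Li.
have D0 : ~~ pZ p (Q m * Q m' - B m m' * B m m') by rewrite -(ires_eq0 pr_p) ?mE.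
have [y [Ky qy yq LE]] := axis_lattice_rank2 nr Lm Lm' D0.
exists y; split=> //.
have e4 : ires p 4 != 0.
  rewrite (ires_eq0 pr_p) // -[4]/(4%:R) pZ_nat // -[4%N]/(2 * 2)%N.
  by apply: p_ndvdM => //; apply: p_ndvd2.
have ee : ires p eta%:~R != 0 by rewrite (ires_eq0 pr_p) ?intr_int // eta_unit.
exists (ires p eta%:~R / ires p 4); first by rewrite mulf_neq0 // invr_eq0.
have := congr1 (ires p) yq.
have Qi : Q y \is a Num.int by apply: Ki.
have -> : 16 = 4 * 4 :> rat by ring.
rewrite !iresM ?rpredM ?intr_int // mE => h.
by rewrite expr_div_n !expr2 mulrA [_ * (_ * _)]mulrC h; field.
Qed.

(** After scaling [l] by some [s], the norms of [y] and [s l] agree modulo p. The norms of [y - s l]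
    and [y + s l] add up to [4 * Q y] modulo p, so for one sign the symmetry along the difference is
    available. *)
Lemma axis_square_Gamma l : K l -> ~~ pZ p (Q l) ->
  (exists b : 'F_p, ires p (Q l) * delta = b ^+ 2) -> Gamma G p L N (axis_lattice l).
Proof.
move=> Kl ql [b bE]; have [y [Ky qy LE [c c0 cE]]] := L_axis.
have Qli : Q l \is a Num.int by apply: Ki. have Qyi : Q y \is a Num.int by apply: Ki.
have rl : ires p (Q l) != 0 by rewrite (ires_eq0 pr_p).
have ry : ires p (Q y) != 0 by rewrite (ires_eq0 pr_p).
have [t tE] : exists t : 'F_p, ires p (Q y) = t ^+ 2 * ires p (Q l).
  exists (b / (c * ires p (Q l))).
  by rewrite expr_div_n -bE -cE; field; rewrite c0 rl.
pose s : int := (nat_of_ord t)%:Z.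
have st : s%:~R = t :> 'F_p by rewrite -pmulrn natr_Zp.
have ps : ~~ (p%:Z %| s)%Z.
  rewrite -(Fq_int_eq0 pr_p) st; apply: contraNneq ry => t0.
  by rewrite tE t0 expr0n mul0r.
have go (s' : int) : ~~ (p%:Z %| s')%Z -> s'%:~R ^+ 2 = t ^+ 2 :> 'F_p ->
    ~~ pZ p (Q (y - s'%:~R *: l)) -> Gamma G p L N (axis_lattice l).
  move=> ps' s't nz; have Ksl : K (s'%:~R *: l) by apply: KZ.
  have -> : axis_lattice l = axis_lattice (s'%:~R *: l).
    by apply/seteqP; split=> v; rewrite (axis_lattice_scale _ Kl ps').
  have qE : Q (s'%:~R *: l) = s'%:~R * s'%:~R * Q l by rewrite /qform bformZl bformZr mulrA.
  have qi : Q (s'%:~R *: l) \is a Num.int by apply: Ki.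
  apply: (axis_lattice_Gamma Ky Ksl _ LE) => //.
    apply/negP => h; move/negP: ql; apply; move: h; rewrite qE.
    apply: pZ_int_cancel => //; first by rewrite rpredM ?intr_int.
    by apply/negP => /(pZ_square (intr_int _ _)); rewrite pZ_intr // (negbTE ps').
  rewrite -(ires_eq pr_p) // qE !iresM ?rpredM ?intr_int // ires_intr -expr2 s't tE.
  by [].
case: (boolP (pZ p (Q (y - s%:~R *: l)))) => [h|]; last by apply: go => //; rewrite st.
apply: (go (- s)); first by rewrite dvdzN || (rewrite dvdzE abszN -dvdzE).
  by rewrite intrN sqrrN st.
apply/negP => h'; move/negP: qy; apply.
have hs : pZ p (Q y - s%:~R * s%:~R * Q l).
  rewrite -(ires_eq pr_p) ?iresM ?rpredM ?intr_int // ires_intr st -expr2 tE.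
  by [].
apply: (pZ_int_cancel (a := 2)) => //; first exact: pZ2.
apply: (pZ_int_cancel (a := 2)); rewrite ?rpredM //; first exact: pZ2.
have -> : 2 * (2 * Q y) = Q (y - s%:~R *: l) + Q (y - (- s)%:~R *: l) + 2 * (Q y - s%:~R * s%:~R * Q l).
  by rewrite intrN /qform !bformE; ring.
by apply: pZD; [apply: pZD|apply: pZMl].
Qed.

(** The discriminants of [M] and [L] are compared through the maps between lattices of a genus. In
    rank 1 the axis contains a vector [y] of unit norm proportional to [l], and [Q (phi y)] is
    [delta] up to squares. Otherwise two vectors representing [delta] are moved to [M] and projected
    orthogonally to [l], which changes their Gram matrix modulo p only by [k ^ 2]. *)
Lemma Gamma_axis_square M l : Gamma G p L N M -> l != 0 -> K l -> ~~ pZ p (Q l) ->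
  split_axis G p M l -> special_axis G r1 N M l ->
  exists b : 'F_p, ires p (Q l) * delta = b ^+ 2.
Proof.
move=> [gLM MN] l0 Kl ql sl spl.
have gM : good G p r1 N M.
  by rewrite -MN; apply: (genus_good pr_p odd_p posG latL primL ord_dL gLM).
have iM := good_il gM; have Mi x y : M x -> M y -> B x y \is a Num.int by apply: (int_lattice_int iM).
have MK x : M x -> K x by apply: (good_p pr_p gM).
have lM : is_lattice M by case: gLM.
have Qli : Q l \is a Num.int by apply: Ki.
have [d0n [[r [m Lm mE]]|[nr [m [m' [Lm Lm' mE]]]]]] := delta_cases.
  have [y [My ey qy]] := not_axis_in posG pr_p gM l0 sl (proj1 spl r).
  have [phi [phiL phiB]] := genus_pZ pr_p latL gLM Li.
  have Lp := phiL _ My.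
  have Qyi : Q y \is a Num.int by apply: Mi.
  have Qpi : Q (phi y) \is a Num.int by apply: Li.
  have Qmi : Q m \is a Num.int by apply: Li.
  have Bpm : B (phi y) m \is a Num.int by apply: Li.
  have Byl : B y l \is a Num.int by apply: Ki => //; apply: MK.
  have e1 : ires p (Q y) = ires p (Q (phi y)).
    by apply/eqP; rewrite (ires_eq pr_p Qyi Qpi); apply: phiB.
  have e2 : ires p (Q (phi y)) * delta = ires p (B (phi y) m) ^+ 2.
    rewrite -mE -iresM // expr2 -iresM //; apply/eqP.
    rewrite (ires_eq pr_p) ?rpredM //.
    by have := r _ _ _ _ Lp Lm Lp Lm; rewrite /minor2 [B m (phi y)]bformC.
  have e3 : ires p (Q y) * ires p (Q l) = ires p (B y l) ^+ 2.
    rewrite -iresM // expr2 -iresM //; congr ires.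
    by have [c cE] := proj_axis ey; rewrite cE /qform !bformE; ring.
  have y0 : ires p (Q y) != 0 by rewrite (ires_eq0 pr_p).
  exists (ires p (B (phi y) m) * ires p (B y l) / ires p (Q y)).
  rewrite expr_div_n exprMn -e2 -e3 -e1; field; exact: y0.
have ax := proj2 spl nr; have [k pk kM] := sl.
have [psi [psiM psiB]] := genus_pZ pr_p lM (genus_sym latL gLM) Mi.
pose w x := k%:R *: prp l x.
have Mw x : M x -> M (w x) by move=> Mx; apply: (split_perp gM kM).
have lw x : B l (w x) = 0 by rewrite /w bformZr perp_ortho // mulr0.
have kE x x' : M x -> M x' -> ires p (B (w x) (w x')) = ires p k%:R ^+ 2 * ires p (B x x').
  move=> Mx Mx'; have Bi := Mi _ _ Mx Mx'; have Bw := Mi _ _ (Mw _ Mx) (Mw _ Mx').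
  have ki : (k%:R : rat) \is a Num.int by [].
  have kk : (k%:R : rat) * k%:R \is a Num.int by apply: rpredM.
  have kb : k%:R * k%:R * B x x' \is a Num.int by apply: rpredM.
  rewrite expr2 -(iresM p ki ki) -(iresM p kk Bi); apply/eqP.
  rewrite eq_sym (ires_eq pr_p kb Bw).
  have Np : N (k%:R *: prj l x).
    by apply: ax; [apply: kM|rewrite projZ parallel_proj].
  have -> : k%:R * k%:R * B x x' - B (w x) (w x') = B (k%:R *: prj l x) (k%:R *: prj l x').
    rewrite /w -{1}[x](proj_perp G l) -{1}[x'](proj_perp G l).
    have o1 : B (prp l x) (prj l x') = 0 by apply: bform_perp_proj.
    have o2 : B (prj l x) (prp l x') = 0 by rewrite bformC //; apply: bform_perp_proj.
    move: (prp l x) (prp l x') (prj l x) (prj l x') o1 o2 => a b c d o1 o2.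
    by rewrite !bformE o1 o2; ring.
  by apply: (good_N gM Np); apply: kM.
have mm x x' : L x -> L x' -> ires p (B x x') = ires p (B (psi x) (psi x')).
  move=> Lx Lx'; apply/eqP.
  by rewrite (ires_eq pr_p (Li Lx Lx') (Mi _ _ (psiM _ Lx) (psiM _ Lx'))); apply: psiB.
have Pm := psiM _ Lm; have Pm' := psiM _ Lm'; rewrite -mE.
apply: (@rank2_square l (w (psi m)) (w (psi m')) m m' k Kl (MK _ (Mw _ Pm)) (MK _ (Mw _ Pm'))
  (lw _) (lw _) (Li Lm Lm) (Li Lm' Lm') (Li Lm Lm') pk).
- by rewrite (kE _ _ Pm Pm) (mm _ _ Lm Lm).
- by rewrite (kE _ _ Pm' Pm') (mm _ _ Lm' Lm').
by rewrite (kE _ _ Pm Pm') (mm _ _ Lm Lm').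
Qed.

End CubicGenus.

(** * Counting isometry classes in Gamma *)

Section Counting.
Variables (p : nat) (pr_p : prime p) (odd_p : odd p) (G : 'M[rat]_3).
Hypothesis posG : posdef G.
Variable L : set 'rV[rat]_3.
Hypotheses (latL : is_lattice L) (primL : primitive_lattice G L)
  (ord_dL : 1 <= ordq p (lattice_det G L)).
Let N := Lambda G p L.
Let Gam := Gamma G p L N.
Let r1 := rank1_lattice p G L.
Hypothesis finO : finite_set (isom_group G N).
Local Notation Q := (qform G).

Lemma Gamma_good M : Gam M -> good G p r1 N M.
Proof.
move=> [gM <-]; exact: (genus_good pr_p odd_p posG latL primL ord_dL gM).
Qed.

Lemma Gamma_L : Gam L.
Proof. by split=> //; apply: genus_refl. Qed.

Lemma Gamma_N : int_lattice G N.
Proof. exact: (good_ilN pr_p (Gamma_good Gamma_L)). Qed.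

Lemma Lambda_act s M : isometry_of G s -> Lambda G p (act s M) = act s (Lambda G p M).
Proof.
move=> [us si]; have q x : Q (x *m s) = Q x by rewrite /qform si.
apply/seteqP; split=> v.
  move=> [[x Mx <-] h]; exists x => //; split=> // y My.
  have := h (y *m s); rewrite -mulmxDl !q; apply; by exists y.
move=> [x [Mx h] <-]; split; first by exists x.
by move=> _ [y My <-]; rewrite -mulmxDl !q; apply: h.
Qed.

Lemma Gamma_act s M : isometry_of G s -> act s N = N -> Gam M -> Gam (act s M).
Proof.
move=> si sN [gM MN]; split; first exact: genus_act.
by rewrite Lambda_act // MN.
Qed.

Lemma Gamma_isom M s : Gam M -> isom_group G M s -> isom_group G N s.
Proof.
move=> [_ MN] [si sM]; split=> //.
by rewrite -[in RHS]MN -[in RHS]sM Lambda_act // MN.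
Qed.

(** Every [M] lies between [p L] and [L / p], so it is determined by the residues modulo p^2 of p
    times the coordinates of its vectors. *)
Lemma finite_Gamma : finite_set Gam.
Proof.
have [E [uE LE]] := latL; pose T := {ffun 'I_3 -> 'I_(p * p)}.
pose row (c : T) : 'rV[rat]_3 := (\row_i ((c i)%:R / p%:R)) *m E.
pose Psi (S : {set T}) : set 'rV[rat]_3 :=
  fun v => exists c m, [/\ c \in S, L m & v = row c + p%:R *: m].
apply: (@sub_finite_set _ _ (Psi @` [set: {set T}])); last first.
  apply: finite_image; have -> : [set: {set T}] = [set` (predT : pred {set T})].
    by apply/seteqP; split.
  exact: finite_finpred.
move=> M GM; have gM := Gamma_good GM; have gL := Gamma_good Gamma_L.
have iM := good_il gM; have iL := good_il gL.
exists [set c : T | `[< M (row c) >]]%SET => //.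
have LM m : L m -> M (p%:R *: m) by move=> Lm; apply: (good_sub gM); apply: (good_p pr_p gL).
apply/seteqP; split=> v.
  move=> [c [m [+ Lm ->]]]; rewrite finset.inE => /asboolP Mc.
  by apply: (il_D iM) => //; apply: LM.
move=> Mv; have : L (p%:R *: v) by apply: (good_sub gL); apply: (good_p pr_p gM).
rewrite LE => -[d _ dE].
have pp : (0 < p * p)%N by rewrite muln_gt0 prime_gt0.
have pz : (p * p)%:Z != 0 by rewrite eqz_nat -lt0n.
pose D i := d 0 i.
have rlt i : (`|(D i %% (p * p)%:Z)%Z|%N < p * p)%N.
  by rewrite -ltz_nat gez0_abs ?modz_ge0 // ltz_pmod.
pose c : T := [ffun i => Ordinal (rlt i)].
pose e : 'rV[int]_3 := \row_i (D i %/ (p * p)%:Z)%Z.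
have vE : v = row c + p%:R *: (map_mx intr e *m E).
  have pn : p%:R != 0 :> rat by rewrite pnatr_eq0 -lt0n prime_gt0.
  apply: (scalerI pn); rewrite -dE scalerDr /row !scalemxAl -mulmxDl; congr (_ *m _).
  apply/rowP => i; rewrite !mxE ffunE /= -/(D i) [in LHS](divz_eq (D i) (p * p)%:Z).
  rewrite intrD intrM mulrCA divff // mulr1 addrC.
  have -> : `|(D i %% (p * p)%N)%Z|%:R = (D i %% (p * p)%N)%Z%:~R :> rat.
    by rewrite -[in RHS](gez0_abs (modz_ge0 (D i) pz)).
  by congr (_ + _); rewrite -pmulrn natrM; ring.
exists c, (map_mx intr e *m E); split=> //; last by rewrite LE; exists e.
rewrite finset.inE; apply/asboolP.
have -> : row c = v - p%:R *: (map_mx intr e *m E) by rewrite vE addrK.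
by apply: (int_latticeB iM) => //; apply: LM; rewrite LE; exists e.
Qed.

Let Rset := [set s | rot G s /\ forall v, N (v *m s) <-> N v].

Lemma finite_Rset : finite_set Rset.
Proof.
apply: sub_finite_set finO => s [rs sN]; split; first by case: rs.
by apply/act_stabP; first exact: rot_unit rs.
Qed.

Fact Rset1 : 1%:M \in fset_set Rset.
Proof.
rewrite in_fset_set ?inE; last exact: finite_Rset.
by split; [apply: rot1|move=> v; rewrite mulmx1].
Qed.
Fact RsetM s t : s \in fset_set Rset -> t \in fset_set Rset -> s *m t \in fset_set Rset.
Proof.
rewrite !in_fset_set ?inE; try exact: finite_Rset.
move=> [rs sN] [rt tN]; split; first exact: rotM.
by move=> v; rewrite mulmxA tN sN.
Qed.
Fact RsetV s : s \in fset_set Rset -> invmx s \in fset_set Rset.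
Proof.
rewrite !in_fset_set ?inE; try exact: finite_Rset.
move=> [rs sN]; split; first exact: rotV.
by move=> v; rewrite -{2}[v](mulmxKV (rot_unit rs)) sN.
Qed.
Fact RsetU s : s \in fset_set Rset -> s \in unitmx.
Proof.
rewrite !in_fset_set ?inE; last exact: finite_Rset.
by move=> [rs _]; apply: rot_unit rs.
Qed.
Definition rotgroup := MxGroup Rset1 RsetM RsetV RsetU.
Local Notation A := rotgroup.
Local Notation gT := (mxg A).

Lemma rotgroupP s : s \in mxset A <-> rot G s /\ forall v, N (v *m s) <-> N v.
Proof. by rewrite /= in_fset_set ?inE //; apply: finite_Rset. Qed.
Local Notation AP := rotgroupP.

Lemma rot_Gamma (g : gT) M : Gam M -> Gam (act (mxv g) M).
Proof.
have [gi _] := mxg_rot AP g; apply: Gamma_act => //.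
by apply/(act_stabP _ (mxvU g)); apply: mxg_stab AP g.
Qed.

Local Notation X := (gamT Gam).
Local Notation to := (gam_action finite_Gamma rot_Gamma).
Local Notation sp := (@gam_special G N A Gam r1 finite_Gamma rot_Gamma).
Local Notation stabP := (gam_stabP finite_Gamma rot_Gamma).

Lemma rot_crystal : crystal_group gT.
Proof. exact: (mxg_crystal posG Gamma_N AP). Qed.

(** The factor 2 is the sign: -1 preserves [K] and has determinant -1, and [C] collects the
    rotations. *)
Lemma isom_ncard (K : set 'rV[rat]_3) (C : {set gT}) :
  K 0 -> (forall x y, K x -> K y -> K (x - y)) ->
  (forall s, isom_group G K s -> isom_group G N s) ->
  (forall g, reflect (forall v, K (v *m mxv g) <-> K v) (g \in C)) ->
  ncard (isom_group G K) = (#|C| * 2)%N.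
Proof.
move=> K0 KB KN CP.
have sgn s : (forall v, K (v *m - s) <-> K v) <-> (forall v, K (v *m s) <-> K v).
  have neg v : K (- v) <-> K v.
    by split=> h; [rewrite -[v]opprK|]; apply: subgrpN.
  by split=> h v; have := h v; rewrite mulmxN neg.
have -> : (#|C| * 2)%N = #|[predX (mem C) & (predT : pred bool)]|.
  by rewrite cardX card_bool.
have dn (s : 'M[rat]_3) : \det (- s) = - \det s :> rat.
  by rewrite -scaleN1r detZ; ring.
apply: (@ncard_inj _ _ _ (fun u : gT * bool => if u.2 then - mxv u.1 else mxv u.1)).
  move=> [g b] [h c] _ _ /=.
  have [_ dg] := mxg_rot AP g; have [_ dh] := mxg_rot AP h.
  case: b c => -[] e.
  - by rewrite (mxv_inj (oppr_inj e)).
  - by have := congr1 determinant e; rewrite dn dg dh => /eqP; rewrite -subr_eq0.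
  - by have := congr1 determinant e; rewrite dn dg dh => /eqP; rewrite -subr_eq0.
  by rewrite (mxv_inj e).
move=> s; split.
  move=> sK; have [si sN] := KN _ sK; have [_ sK'] := sK; have us : s \in unitmx by case: si.
  have {}sN := (act_stabP _ us).1 sN; have {}sK' := (act_stabP _ us).1 sK'.
  have NB := int_latticeB Gamma_N.
  have [d|d] := isom_det posG si.
    have [g gE] := mxg_ex AP (conj si d : rot G s) sN; exists (g, false) => //=.
    by rewrite !inE andbT /=; apply/CP; rewrite gE.
  have [||g gE] := @mxg_ex _ _ _ AP (- s).
  - by split; [apply: isometryN|rewrite dn d opprK].
  - move=> v; rewrite mulmxN -(sN v).
    split=> h; last exact: (il_N Gamma_N).
    by rewrite -[_ *m _]opprK; apply: (il_N Gamma_N).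
  exists (g, true) => /=; last by rewrite gE opprK.
  by rewrite !inE andbT /=; apply/CP; rewrite gE; apply/sgn.
move=> [[g b]]; rewrite !inE andbT /= => /CP gC <-.
have [gi _] := mxg_rot AP g; case: b; last first.
  by split=> //; apply/(act_stabP _ (mxvU g)).
have ni := isometryN gi; split=> //; apply/act_stabP; first by case: ni.
exact/sgn.
Qed.

Lemma isom_N_ncard : ncard (isom_group G N) = (#|[set: gT]%SET| * 2)%N.
Proof.
apply: isom_ncard => //; first exact: (int_lattice0 Gamma_N).
  by move=> x y; apply: (int_latticeB Gamma_N).
by move=> g; rewrite finset.in_setT; constructor; apply: mxg_stab AP g.
Qed.

Lemma isom_M_ncard (M : X) : ncard (isom_group G (gamv M)) = (#|'C[M | to]%g| * 2)%N.
Proof.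
have GM := gamvP finite_Gamma M; have iM := good_il (Gamma_good GM).
apply: isom_ncard; first exact: (int_lattice0 iM).
- by move=> x y; apply: (int_latticeB iM).
- by move=> s; apply: Gamma_isom.
by move=> g; apply: stabP.
Qed.

Lemma Gamma_ncard : ncard Gam = #|{: X}|.
Proof.
apply: (@ncard_inj _ _ predT (@gamv Gam)); first by move=> x y _ _; apply: gamv_inj.
move=> K; split=> [/(gam_exists finite_Gamma) [M <-]|[M _ <-]]; first by exists M.
exact: (gamvP finite_Gamma M).
Qed.

(** An isometry between two lattices of Gamma preserves [N], which is [Lambda_p] of both; up to a
    sign, which moves no lattice, it is a rotation. *)
Lemma isometric_orbit (M M' : X) : isometry_class G (gamv M) (gamv M') ->
  exists g : gT, M' = to M g.
Proof.
move=> [s si sE]; have GM := gamvP finite_Gamma M; have GM' := gamvP finite_Gamma M'.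
have iM := good_il (Gamma_good GM).
have sN : act s N = N.
  by case: (GM) => _ <-; case: (GM') => _ e; rewrite -Lambda_act // sE e; case: GM => _ ->.
have us : s \in unitmx by case: si.
have {}sN := (act_stabP _ us).1 sN.
have dn (t : 'M[rat]_3) : \det (- t) = - \det t :> rat by rewrite -scaleN1r detZ; ring.
have [d|d] := isom_det posG si.
  have [g gE] := mxg_ex AP (conj si d : rot G s) sN; exists g; apply: gamv_inj.
  by rewrite -sE -gE.
have [||g gE] := @mxg_ex _ _ _ AP (- s).
- by split; [apply: isometryN|rewrite dn d opprK].
- move=> v; rewrite mulmxN -(sN v).
  split=> h; last exact: (il_N Gamma_N).
  by rewrite -[_ *m _]opprK; apply: (il_N Gamma_N).
exists g; apply: gamv_inj; rewrite -sE; change (act s (gamv M) = act (mxv g) (gamv M)).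
rewrite gE; apply/seteqP; split=> _ [x Mx <-]; exists (- x); rewrite ?mulmxN ?mulNmx ?opprK //;
  exact: (il_N iM).
Qed.

Lemma isometry_class_trans K K' K'' : isometry_class G K K' -> isometry_class G K' K'' ->
  isometry_class G K K''.
Proof.
move=> [s si <-] [t ti <-]; exists (s *m t); first exact: isometryM.
by rewrite actM.
Qed.

Lemma isometry_class_refl K : isometry_class G K K.
Proof. by exists 1%:M; [apply: isometry1|apply: act1]. Qed.

Lemma to_isometric (M : X) g : isometry_class G (gamv M) (gamv (to M g)).
Proof. by exists (mxv g); [case: (mxg_rot AP g)|]. Qed.

Lemma count_classes_orbits d : count_classes G Gam (d * 2) = orbit_count to d.
Proof.
pose f (O : {set X}) : set (set 'rV[rat]_3) :=
  fun K => exists2 M, M \in O & isometry_class G (gamv M) K.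
have fE M : f (orbit to [set: gT]%SET M) = isometry_class G (gamv M).
  apply/seteqP; split=> K.
    move=> [_ /orbitP [g _ <-]]; exact/isometry_class_trans/to_isometric.
  by move=> MK; exists M => //; apply: orbit_refl.
apply: (@ncard_inj _ _ _ f).
  move=> _ _ /imsetP [M _ ->] /imsetP [M' _ ->]; rewrite !fE => e.
  have [|g gE] := @isometric_orbit M M'; first by rewrite e; apply: isometry_class_refl.
  by apply/esym/orbit_eqP; rewrite gE mem_orbit ?finset.in_setT.
move=> C; split.
  move=> [K [/(gam_exists finite_Gamma) [M <-]]]; rewrite isom_M_ncard => /eqP.
  rewrite eqn_pmul2r // => Md <-; exists (orbit to [set: gT]%SET M) => //.
  by apply: imset_f; rewrite finset.inE.
move=> [_ /imsetP [M + ->] <-]; rewrite finset.inE => /eqP Md.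
exists (gamv M); last by rewrite fE.
by split; [apply: (gamvP finite_Gamma M)|rewrite isom_M_ncard Md].
Qed.

Lemma symmetriesP s : symmetries G N s <-> exists2 t : gT, #[t]%g = 2%N & - mxv t = s.
Proof.
split.
  move=> [[si sN] [x sx]]; have [x0 sE] := symmetry_refl posG sx.
  have us : s \in unitmx by case: si.
  have {}sN := (act_stabP _ us).1 sN.
  have [||t tE] := @mxg_ex _ _ _ AP (- s).
  - by rewrite sE; apply: rot_halfturn.
  - move=> v; rewrite mulmxN -(sN v).
    split=> h; last exact: (il_N Gamma_N).
    by rewrite -[_ *m _]opprK; apply: (il_N Gamma_N).
  exists t; last by rewrite tE opprK.
  apply/eqP/order2P; split.
    by move=> t1; apply: (refl_neqN1 posG x0); rewrite -sE -tE t1.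
  by apply: mxv_inj; rewrite mxvM tE sE mulNmx mulmxN opprK refl_invol.
move=> [t t2 <-]; have [x x0 xt] := mxg_axis posG AP t.
have tE := mxv_halfturn posG AP t2 x0 xt; rewrite tE opprK.
split; last by exists x; apply: refl_symmetry.
have ri := refl_isom posG x0; split=> //; apply/act_stabP; first by case: ri.
move=> v; rewrite -(mxg_stab AP t v) tE mulmxN.
split=> h; first exact: (il_N Gamma_N).
by rewrite -[_ *m _]opprK; apply: (il_N Gamma_N).
Qed.

Lemma Gamma_fix_ncard (t : gT) : ncard (Gamma_fix G p L N (- mxv t)) = #|'Fix_to[t]%g|.
Proof.
apply: (@ncard_inj _ _ _ (@gamv Gam)); first by move=> x y _ _; apply: gamv_inj.
have key (M : X) : act (- mxv t) (gamv M) = gamv M <-> to M t = M.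
  have iM := good_il (Gamma_good (gamvP finite_Gamma M)).
  have e : act (- mxv t) (gamv M) = act (mxv t) (gamv M).
    apply/seteqP; split=> _ [x Mx <-]; exists (- x); rewrite ?mulmxN ?mulNmx ?opprK //;
      exact: (il_N iM).
  by rewrite e; split=> [h|h]; [apply: gamv_inj|rewrite -[in RHS]h].
move=> K; split.
  move=> [/(gam_exists finite_Gamma) [M <-] h]; exists M => //.
  by apply/afix1P/key.
by move=> [M /afix1P h <-]; split; [apply: (gamvP finite_Gamma M)|apply/key].
Qed.

Lemma symmetry_sum : \sum_(s \in symmetries G N) ((ncard (Gamma_fix G p L N s))%:R : rat)
  = (\sum_(t : gT | #[t]%g == 2%N) #|'Fix_to[t]%g|)%N%:R.
Proof.
have finS : finite_set (symmetries G N) by apply: sub_finite_set finO => s [].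
rewrite fsbig_finite //=.
pose l := [seq - mxv t | t <- enum [pred t : gT | #[t]%g == 2%N]].
have perm : perm_eq (fset_set (symmetries G N)) l.
  apply: uniq_perm; first exact: fset_uniq.
    rewrite map_inj_uniq ?enum_uniq // => t t' /oppr_inj; exact: mxv_inj.
  move=> s; rewrite in_fset_set //; apply/idP/idP.
    rewrite inE => /symmetriesP [t t2 <-]; apply: map_f.
    by rewrite mem_enum inE t2.
  move=> /mapP [t]; rewrite mem_enum inE => /eqP t2 ->.
  by apply/symmetriesP; exists t.
rewrite (perm_big _ perm) big_map big_enum_cond /= natr_sum.
by apply: eq_big => [t|t _]; rewrite ?andbT ?inE // Gamma_fix_ncard.
Qed.

Lemma unimodular_rank1_Gamma M : Gam M -> unimodular_rank1 pr_p G M <-> r1.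
Proof.
move=> GM; have gM := Gamma_good GM.
rewrite (unimodular_rank1P pr_p odd_p posG (good_il gM)).
  by case: GM => gLM _; apply: genus_rank1.
have [x Mx nNx] := good_neq gM; apply: contrapT => h; apply: nNx.
apply/(good_Lambda gM); split=> // y My; apply: contrapT => /negP n.
by apply: h; exists x, y.
Qed.

Lemma special_symmetries_ncard :
  ncard [set s | symmetries G N s /\
     exists2 M, Gamma_fix G p L N s M & special pr_p G M s] =
  #|[set t | [exists M, sp M t]]%SET|.
Proof.
have key (t : gT) (M : X) : #[t]%g = 2%N -> act (- mxv t) (gamv M) = gamv M ->
    special pr_p G (gamv M) (- mxv t) <-> sp M t.
  move=> t2 tM; have [x x0 xt] := mxg_axis posG AP t.
  have tE := mxv_halfturn posG AP t2 x0 xt; rewrite tE opprK in tM *.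
  have GM := gamvP finite_Gamma M; have iM := good_il (Gamma_good GM).
  have ur : refl G x \in unitmx by case: (refl_isom posG x0).
  have st := (act_stabP _ ur).1 tM.
  rewrite (specialP odd_p posG (Gamma_good GM) x0 st (unimodular_rank1_Gamma GM)).
  have tC : t \in 'C[M | to]%g.
    apply/stabP => v; rewrite tE mulmxN -(st v).
    split=> h; last exact: (il_N iM).
    by rewrite -[_ *m _]opprK; apply: (il_N iM).
  rewrite (gam_specialE posG AP r1 t2 tC x0 xt).
  by split=> /asboolP.
apply: (@ncard_inj _ _ _ (fun t : gT => - mxv t)).
  by move=> t t' _ _ /oppr_inj; apply: mxv_inj.
move=> s; split.
  move=> [/symmetriesP [t t2 <-] [K [/(gam_exists finite_Gamma) [M <-] tM] spt]].
  exists t => //; rewrite finset.inE; apply/existsP; exists M.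
  exact/(key _ _ t2 tM).
move=> [t]; rewrite finset.inE => /existsP [M spM] <-.
have /and3P [/eqP t2 tC _] := spM.
split; first by apply/symmetriesP; exists t.
have iM := good_il (Gamma_good (gamvP finite_Gamma M)).
have tM : act (- mxv t) (gamv M) = gamv M.
  have ni := isometryN (proj1 (mxg_rot AP t)).
  apply/act_stabP; first by case: ni.
  move=> v; rewrite mulmxN -(stabP _ _ tC v).
  split=> h; last exact: (il_N iM).
  by rewrite -[_ *m _]opprK; apply: (il_N iM).
exists (gamv M); last exact/(key _ _ t2 tM).
by split=> //; apply: (gamvP finite_Gamma M).
Qed.

Lemma rot_special_action : (ncard (isom_group G N) = 24%N -> p <> 3%N) -> special_action to sp.
Proof.
move=> n3; apply: (gam_special_action pr_p odd_p posG Gamma_N AP finite_Gamma rot_Gamma Gamma_good).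
by move=> c; apply: n3; rewrite isom_N_ncard c.
Qed.
Lemma proj_isom (h : 'M[rat]_3) x v : isometry_of G h ->
  proj G (x *m h) (v *m h) = proj G x v *m h.
Proof. by move=> [_ hi]; rewrite /proj /qform !hi -scalemxAl. Qed.

Lemma proj_frame f1 f2 f3 v : f1 != 0 -> f2 != 0 -> f3 != 0 ->
  bform G f1 f2 = 0 -> bform G f1 f3 = 0 -> bform G f2 f3 = 0 ->
  v = proj G f1 v + proj G f2 v + proj G f3 v.
Proof.
move=> n1 n2 n3 f12 f13 f23; have symG : G^T = G by case: posG.
apply/eqP; rewrite -subr_eq0; apply/eqP; apply: (@ortho3 _ posG f1 f2 f3) => //.
- rewrite bformDl bformNl !bformDl /proj !bformZl [bform G f2 f1]bformC // [bform G f3 f1]bformC //.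
  by rewrite f12 f13 !mulr0 !addr0 -/(Q f1) divfK ?qform_eq0 // subrr.
- rewrite bformDl bformNl !bformDl /proj !bformZl [bform G f3 f2]bformC //.
  by rewrite f12 f23 !mulr0 addr0 add0r -/(Q f2) divfK ?qform_eq0 // subrr.
rewrite bformDl bformNl !bformDl /proj !bformZl.
by rewrite f13 f23 !mulr0 !add0r -/(Q f3) divfK ?qform_eq0 // subrr.
Qed.

Let K : set 'rV[rat]_3 := fun v => N (p%:R *: v).

(** The common norm is recorded through its square root [eta], so that it is visibly a square modulo
    p. *)
Record cubic_frame (z g : gT) f1 f2 f3 (eta : int) : Prop := CubicFrame {
  cf_z : #[z]%g = 4%N; cf_g : #[g]%g = 3%N; cf_1z : f1 *m mxv z = f1;
  cf_1g : f1 *m mxv g = f2; cf_2g : f2 *m mxv g = f3; cf_3g : f3 *m mxv g = f1;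
  cf_n1 : f1 != 0; cf_12 : bform G f1 f2 = 0; cf_13 : bform G f1 f3 = 0;
  cf_23 : bform G f2 f3 = 0; cf_q1 : Q f1 = eta%:~R * eta%:~R;
  cf_q2 : Q f2 = eta%:~R * eta%:~R; cf_q3 : Q f3 = eta%:~R * eta%:~R;
  cf_eta : eta = 1 \/ eta = 2; cf_K1 : K f1; cf_K2 : K f2; cf_K3 : K f3;
  cf_coord : forall v, K v -> exists a b c : int,
    2 *: v = a%:~R *: f1 + b%:~R *: f2 + c%:~R *: f3;
  cf_int : forall v w, K v -> K w -> bform G v w \is a Num.int }.

(** [z ^+ 2] and its conjugate by [g] are commuting half turns, so [g] carries the axis of [z]
    through three orthogonal axes. The vector [f1] is a generator of [N] on the axis of [z], divided
    by p. As [z ^+ 2] preserves [N], twice the projection of a vector of [N] to this axis is in [N],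
    hence a multiple of the generator: this yields [cf_coord]. *)
Lemma cubic_frame_exists : #|[set: gT]%SET| = 24%N ->
  exists z g f1 f2 f3 eta, cubic_frame z g f1 f2 f3 eta.
Proof.
move=> c24; have [z [g [z4 g3 cm ne]]] := card24_frame rot_crystal c24.
have pn : p%:R != 0 :> rat by rewrite pnatr_eq0 -lt0n prime_gt0.
have [x x0 xz] := mxg_axis posG AP z.
have [w [Nw w0 ew mult _]] := symmetry_normP posG Gamma_N x0 erefl.
have [c cE] := proj_axis ew.
have c0 : c != 0 by apply: contraNneq w0 => c0; rewrite cE c0 scale0r.
pose f1 := p%:R^-1 *: w; pose f2 := f1 *m mxv g; pose f3 := f2 *m mxv g.
have f1E : f1 = (p%:R^-1 * c) *: x by rewrite /f1 cE scalerA.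
have wE : w = p%:R *: f1 by rewrite /f1 scalerA divff // scale1r.
have n1 : f1 != 0 by rewrite /f1 scaler_eq0 invr_eq0 (negbTE pn).
have [gi _] := mxg_rot AP g.
have qg v v' : bform G (v *m mxv g) (v' *m mxv g) = bform G v v' by case: gi.
have ggg : (g * g * g)%g = 1%g by rewrite -exp3g -g3 expg_order.
have f1z : f1 *m mxv z = f1 by rewrite f1E -scalemxAl xz.
have f3g : f3 *m mxv g = f1 by rewrite /f3 /f2 -!mulmxA -!mxvM mulgA ggg mxv1 mulmx1.
have nz (v : 'rV[rat]_3) : v != 0 -> v *m mxv g != 0.
  by move=> v0; rewrite -(qform_eq0 posG) /qform qg -/(Q v) qform_eq0.
have n2 : f2 != 0 by apply: nz. have n3 : f3 != 0 by apply: nz.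
have zz2 := order_pow2 z4.
have f1zz : f1 *m mxv (z ^+ 2)%g = f1 by rewrite exp2g mxvM mulmxA !f1z.
have f2zz : f2 *m mxv ((z ^+ 2) ^ g)%g = f2.
  by rewrite /f2 -mulmxA -mxvM -conjgC mxvM mulmxA f1zz.
have zg2 : #[(z ^+ 2) ^ g]%g = 2%N by rewrite orderJ.
have f12 : bform G f1 f2 = 0.
  have [ra a1 aa] := order2_mx AP zz2; have [rb b1 bb] := order2_mx AP zg2.
  have neq : mxv (z ^+ 2)%g <> mxv ((z ^+ 2) ^ g)%g by move=> /mxv_inj.
  have cm' : mxv (z ^+ 2)%g *m mxv ((z ^+ 2) ^ g)%g = mxv ((z ^+ 2) ^ g)%g *m mxv (z ^+ 2)%g.
    by rewrite -!mxvM cm.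
  by have [] := commuting_axes posG ra rb a1 b1 aa bb neq cm' n1 n2 f1zz f2zz.
have f23 : bform G f2 f3 = 0 by rewrite /f3 {1}/f2 qg.
have f13 : bform G f1 f3 = 0.
  by rewrite -{1}f3g {2}/f3 qg bformC // f23.
have q2 : Q f2 = Q f1 by rewrite /qform /f2 qg.
have q3 : Q f3 = Q f1 by rewrite -q2 /qform {1 2}/f3 qg.
have Kg v : K v -> K (v *m mxv g).
  by move=> Kv; rewrite /K scalemxAl; apply/(mxg_stab AP g).
have KgV v : K (v *m mxv g) -> K v.
  by rewrite /K scalemxAl => /(mxg_stab AP g).
have K1 : K f1 by rewrite /K -wE.
have K2 : K f2 by apply: Kg. have K3 : K f3 by apply: Kg.
have P1 v : K v -> exists a : int, 2 *: proj G f1 v = a%:~R *: f1.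
  move=> Kv; have N2 : N (2 *: proj G f1 (p%:R *: v)).
    have e := halfturnE G f1 (p%:R *: v).
    rewrite -(mxv_halfturn posG AP zz2 n1 f1zz) in e.
    have -> : 2 *: proj G f1 (p%:R *: v) = (p%:R *: v) *m mxv (z ^+ 2)%g + p%:R *: v.
      by rewrite e subrK.
    by apply: (il_D Gamma_N) => //; apply/(mxg_stab AP).
  have [|k kE] := mult _ N2.
    have -> : proj G x = proj G f1.
      by apply: funext => u; rewrite f1E proj_scale // mulf_neq0 // invr_eq0.
    by move: (p%:R *: v) => u; rewrite projZ parallel_proj.
  exists k; apply: (scalerI pn); rewrite scalerA mulrC -scalerA -projZ kE wE.
  have swap (a b : rat) (u : 'rV[rat]_3) : a *: (b *: u) = b *: (a *: u).
    by rewrite !scalerA mulrC.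
  exact: swap.
have Pg (f v : 'rV[rat]_3) : (forall u, K u -> exists a : int, 2 *: proj G f u = a%:~R *: f) ->
    K v -> exists a : int, 2 *: proj G (f *m mxv g) v = a%:~R *: (f *m mxv g).
  move=> Pf Kv; have vE : v = (v *m invmx (mxv g)) *m mxv g by rewrite mulmxKV // mxvU.
  have Kv' : K (v *m invmx (mxv g)) by apply: KgV; rewrite -vE.
  have [a aE] := Pf _ Kv'; exists a.
  by rewrite vE proj_isom // !scalemxAl aE.
have P2 v : K v -> exists a : int, 2 *: proj G f2 v = a%:~R *: f2 by apply: Pg.
have P3 v : K v -> exists a : int, 2 *: proj G f3 v = a%:~R *: f3 by apply: Pg.
have coord v : K v -> exists a b d : int,
    2 *: v = a%:~R *: f1 + b%:~R *: f2 + d%:~R *: f3.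
  move=> Kv; have [a aE] := P1 _ Kv; have [b bE] := P2 _ Kv; have [d dE] := P3 _ Kv.
  exists a, b, d; rewrite -aE -bE -dE -!scalerDr; congr (_ *: _).
  exact: proj_frame.
have gL := Gamma_good Gamma_L.
have Ki v v' : K v -> K v' -> bform G v v' \is a Num.int.
  exact: (cube_K_int pr_p odd_p posG gL primL n1 f12 f13 f23 erefl q2 q3 K1 K2 K3 coord).
have := cube_eps pr_p odd_p posG gL primL n1 n2 n3 f12 f13 f23 erefl q2 q3 K1 K2 K3 coord
  (mxg_stab AP g) erefl erefl f3g.
case=> e.
  by exists z, g, f1, f2, f3, 1; split=> //; rewrite ?q2 ?q3 ?e //; left.
by exists z, g, f1, f2, f3, 2; split=> //; rewrite ?q2 ?q3 ?e //; right.
Qed.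

Lemma axis_lattice_stab (h : gT) l v : l *m mxv h = l ->
  axis_lattice p G L l (v *m mxv h) <-> axis_lattice p G L l v.
Proof.
move=> lh; have [[_ hi] _] := mxg_rot AP h; have hN := mxg_stab AP h.
have e1 : N (p%:R *: (v *m mxv h)) <-> N (p%:R *: v) by rewrite scalemxAl hN.
have e2 : bform G (v *m mxv h) l = bform G v l by rewrite -{1}lh hi.
have e3 (a : int) : N (v *m mxv h - a%:~R *: l) <-> N (v - a%:~R *: l).
  by rewrite -(hN (v - _)) mulmxBl -scalemxAl lh.
rewrite /axis_lattice e2; split=> -[/e1 Kv h']; split=> //.
  by case: h' => -[r' h']; [left|right]; split=> //; case: h' => a /e3; exists a.
by case: h' => -[r' h']; [left|right]; split=> //; case: h' => a /e3; exists a.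
Qed.

Definition squareb (a : 'F_p) := [exists b : 'F_p, b ^+ 2 == a].

Lemma legendre_squareb (d0 : padic_int pr_p) : red d0 != 0 ->
  (1 + legendre d0) / 2 = (squareb (red d0))%:R.
Proof.
by rewrite /legendre /squareb /red => /negbTE ->; case: ifP.
Qed.

Section Cubic.
Variables (z g : gT) (f1 f2 f3 : 'rV[rat]_3) (eta : int).
Hypothesis cf : cubic_frame z g f1 f2 f3 eta.
Variable d0 : padic_int pr_p.
Hypothesis disc : unimodular_disc G L d0.

(** A rotation of this kind fixes a lattice only if its axis is special to it; conversely it fixes
    the [axis_lattice] of its axis, which lies in Gamma under the square condition. *)
Lemma cubic_stable (h : gT) (l : 'rV[rat]_3) : h <> 1%g -> l != 0 -> l *m mxv h = l -> K l ->
  ~~ pZ p (Q l) -> rotcos (mxv h) = 0 \/ rotcos (mxv h) = -1 /\ p <> 3%N ->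
  (exists M : X, h \in 'C[M | to]%g) <-> exists b : 'F_p, ires p (Q l) * red d0 = b ^+ 2.
Proof.
case: cf => _ _ _ _ _ _ _ f12 f13 f23 q1 q2 q3 e12 K1 K2 K3 coord Ki h1 l0 lh Kl ql lam.
split=> [[M hM]|sq].
  have [sl spl] := special_turn pr_p odd_p posG AP Gamma_good h1 hM l0 lh lam.
  exact: (Gamma_axis_square odd_p posG latL primL ord_dL f12 f13 f23 q1 q2 q3 coord Ki disc
    (gamvP finite_Gamma M) l0 Kl ql sl spl).
have GM := axis_square_Gamma odd_p posG latL primL ord_dL e12 f12 f13 f23 q1 q2 q3 K1 K2 K3
  coord Ki disc Kl ql sq.
have [M ME] := gam_exists finite_Gamma GM.
by exists M; apply/stabP => v; rewrite ME; apply: axis_lattice_stab.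
Qed.

Lemma ires_eta : ires p eta%:~R != 0.
Proof.
rewrite ires_intr (Fq_int_eq0 pr_p) dvdzE; case: (cf_eta cf) => -> /=; last exact: (p_ndvd2 pr_p odd_p).
by rewrite dvdn1; apply/eqP => p1; have := prime_gt1 pr_p; rewrite p1.
Qed.

Lemma square_scale (a b : 'F_p) : a != 0 -> (exists c, a ^+ 2 * b = c ^+ 2) <-> squareb b.
Proof.
move=> a0; split=> [[c cE]|/existsP [c /eqP <-]]; last by exists (a * c); rewrite exprMn.
apply/existsP; exists (c / a); rewrite expr_div_n -cE mulrC mulKf //.
by rewrite expf_neq0.
Qed.

Lemma cubic_order4 : (exists M : X, z \in 'C[M | to]%g) <-> squareb (red d0).
Proof.
have z4 := cf_z cf; have q1 := cf_q1 cf.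
have qe : ires p (Q f1) = ires p eta%:~R ^+ 2.
  by rewrite q1 expr2 iresM ?intr_int.
rewrite (cubic_stable (order_neq1 z4) (cf_n1 cf) (cf_1z cf) (cf_K1 cf)).
- by rewrite qe; apply: square_scale ires_eta.
- by rewrite -(ires_eq0 pr_p) ?q1 -?intrM ?intr_int // intrM -q1 qe expf_neq0 // ires_eta.
by left; apply: (order4_rotcos posG Gamma_N AP z4).
Qed.

Lemma cubic_order3 : p <> 3%N ->
  (exists M : X, g \in 'C[M | to]%g) <-> squareb (red (3 * d0)).
Proof.
move=> p3; have g3 := cf_g cf; pose l := f1 + f2 + f3.
have [_ _ _ g1 g2 g3' n1 f12 f13 f23 q1 q2 q3 _ K1 K2 K3 _ Ki] := cf.
have lg : l *m mxv g = l by rewrite /l !mulmxDl g1 g2 g3' addrC addrA.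
have Ql : Q l = 3 * (eta%:~R * eta%:~R).
  rewrite /l /qform !bformE -/(Q f1) -/(Q f2) -/(Q f3) q1 q2 q3.
  by rewrite [bform G f2 f1]bformC // [bform G f3 f1]bformC // [bform G f3 f2]bformC // f12 f13 f23; ring.
have Kl : K l.
  have gL := Gamma_good Gamma_L.
  by rewrite /l; apply: (cube_KD pr_p gL) => //; apply: (cube_KD pr_p gL).
have e3 : (3 : int)%:~R != 0 :> 'F_p.
  rewrite (Fq_int_eq0 pr_p) dvdzE; change (~~ (p %| 3)%N).
  by rewrite dvdn_prime2 //; apply/eqP.
have i3 : (3 : rat) \is a Num.int by [].
have ei : (eta%:~R * eta%:~R : rat) \is a Num.int by rewrite -intrM intr_int.
have qe : ires p (Q l) = (3 : int)%:~R * ires p eta%:~R ^+ 2.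
  by rewrite Ql iresM // expr2 iresM ?intr_int // -[3]/((3 : int)%:~R) ires_intr.
have qi : Q l \is a Num.int by apply: Ki.
have qn : ~~ pZ p (Q l).
  by rewrite -(ires_eq0 pr_p) // qe mulf_neq0 // expf_neq0 // ires_eta.
have l0 : l != 0 by apply: contraNneq qn => ->; rewrite /qform bform0l pZ0.
rewrite (cubic_stable (order_neq1 g3) l0 lg Kl qn); last first.
  by right; split=> //; apply: (order3_rotcos posG Gamma_N AP g3).
have -> : red (3 * d0) = (3 : int)%:~R * red d0 by rewrite rmorphM rmorph_nat.
rewrite qe [_ * _ ^+ 2]mulrC.
rewrite -(square_scale _ ires_eta); split=> -[c cE]; exists c; rewrite -cE mulrA //.
Qed.

End Cubic.

Hypothesis n3 : ncard (isom_group G N) = 24%N -> p <> 3%N.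
Let cg := rot_crystal.
Let sa := rot_special_action n3.
Local Notation oc := (orbit_count to).
Local Notation sc := (stab_count to).

Section CardN.
Hypothesis cardG : #|[set: gT]%SET| \in [:: 1; 2; 4; 6; 8; 12; 24]%N.

Lemma cubic_counts (d0 : padic_int pr_p) : #|[set: gT]%SET| = 24%N -> unimodular_disc G L d0 ->
  (oc 6)%:R = (1 - (p == 3%N)%:R) * ((1 + legendre (3 * d0)) / 2) :> rat /\
  (oc 8)%:R = (1 + legendre d0) / 2 :> rat.
Proof.
move=> c24 disc; have [z [g [f1 [f2 [f3 [eta cf]]]]]] := cubic_frame_exists c24.
have d0n : red d0 != 0.
  have gL := Gamma_good Gamma_L; have iL := good_il gL; have symG : G^T = G by case: posG.
  by have [] := unimodular_disc_residue symG (int_lattice0 iL) (@int_latticeB _ _ iL)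
    (@int_lattice_int _ _ iL) (good_det3 gL) disc.
have le8 := orbit_count8_le1 cg sa cardG; have le6 := orbit_count6_le1 cg sa cardG.
have val n (b : bool) : (n <= 1)%N -> (n = 1%N <-> b) -> n%:R = b%:R :> rat.
  move=> n1 nb; congr (_%:R); case: n n1 nb => [|[|]] // _ nb; case: b nb => nb //.
    by have /nb := isT.
  by have /nb := erefl 1%N.
split; last first.
  rewrite legendre_squareb //; apply: val => //.
  rewrite (orbit_count8_order4 cg sa cardG c24 (cf_z cf)); exact: (cubic_order4 cf disc).
case: eqP => [e3|p3] /=.
  rewrite subrr mul0r; apply/eqP; rewrite pnatr_eq0; apply/eqP.
  case E : (oc 6) le6 => [|[|]] // _.
  have [M gM] := (orbit_count6_order3 cg sa cardG c24 (cf_g cf)).1 E.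
  have [y y6] := gam_order6_exists pr_p posG Gamma_N AP Gamma_good e3 gM (cf_g cf).
  by have := card24_no_order6 cg c24 y6.
rewrite subr0 mul1r legendre_squareb; last first.
  rewrite rmorphM mulf_neq0 // rmorph_nat; apply/eqP => h.
  have : (p %| 3)%N by rewrite (dvdn_pcharf (pchar_Fp pr_p)); apply/eqP.
  by rewrite dvdn_prime2 // => /eqP.
apply: val => //.
rewrite (orbit_count6_order3 cg sa cardG c24 (cf_g cf)); exact: (cubic_order3 cf disc p3).
Qed.

(** When [k.+1] does not divide the order of the group, both sides are 0 by [orbit_count0]. *)
Lemma stab_countE k : sc k.+1 = (#|[set: gT]%SET| %/ k.+1 * oc k.+1)%N.
Proof.
have cM := orbit_countM to k.+1.
have [/divnK e|kn] := boolP (k.+1 %| #|[set: gT]%SET|)%N; last first.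
  by move: cM; rewrite (orbit_count0 to kn) !muln0 => /eqP; rewrite muln_eq0 /= ?orbF => /eqP.
apply/eqP; rewrite -(@eqn_pmul2r k.+1) // mulnAC e; apply/eqP.
by rewrite -cM mulnC.
Qed.

Lemma count_sums : 
  [/\ ncard Gam = (sc 1 + sc 2 + sc 4 + sc 6 + sc 8 + sc 12)%N,
      \sum_(s \in symmetries G N) ((ncard (Gamma_fix G p L N s))%:R : rat)
        = (sc 2 + 3 * sc 4 + 3 * sc 6 + 5 * sc 8 + 7 * sc 12)%N%:R &
      (4 %| #|[set: gT]%SET|)%N ->
      ncard [set s | symmetries G N s /\
        exists2 M, Gamma_fix G p L N s M & special pr_p G M s] = (sc 4 + sc 8 + sc 12)%N].
Proof.
split.
- by rewrite Gamma_ncard (card_stab_sum cg sa cardG) !big_cons big_nil !addnA addn0.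
- rewrite symmetry_sum (fix_stab_sum cg sa cardG) !big_cons big_nil /invol_number /=.
  have e (a b c d i j : nat) : (a * 0 + (b * 1 + (c * 3 + (d * 3 + (i * 5 + (j * 7 + 0))))) =
      b + 3 * c + 3 * d + 5 * i + 7 * j)%N by lia.
  by congr (_%:R); apply: e.
move=> d4; rewrite special_symmetries_ncard (special_stab_sum cg sa cardG d4) !big_cons big_nil.
by rewrite /special_number /= !muln0 !muln1 !add0n !addn0 !addnA.
Qed.

End CardN.

(** The interface to the final computation: [n] is the order of the rotation group and [o d] the
    number of classes with rotation stabiliser of order d, so that only linear equations and
    congruences remain. *)
Record class_counts (n : nat) (o : nat -> nat) : Prop := ClassCounts {
  cc_h : forall d, count_classes G Gam (d * 2) = o d;
  cc_dvd : forall k, ~~ (k %| n)%N -> o k = 0%N;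
  cc_w : ncard Gam = (n * o 1 + n %/ 2 * o 2 + n %/ 4 * o 4 + n %/ 6 * o 6 + n %/ 8 * o 8
    + n %/ 12 * o 12)%N;
  cc_f : \sum_(s \in symmetries G N) ((ncard (Gamma_fix G p L N s))%:R : rat)
    = (n %/ 2 * o 2 + 3 * (n %/ 4 * o 4) + 3 * (n %/ 6 * o 6) + 5 * (n %/ 8 * o 8)
       + 7 * (n %/ 12 * o 12))%N%:R;
  cc_s : (4 %| n)%N -> ncard [set s | symmetries G N s /\
      exists2 M, Gamma_fix G p L N s M & special pr_p G M s]
    = (n %/ 4 * o 4 + n %/ 8 * o 8 + n %/ 12 * o 12)%N;
  cc_24 : o 24%N = 0%N; cc_12 : n <> 12%N -> o 12%N = 0%N; cc_6 : n = 12%N -> o 6%N = 0%N;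
  cc_6le : (o 6 <= 1)%N; cc_8le : (o 8 <= 1)%N; cc_12le : (o 12 <= 1)%N;
  cc_disc : n = 24%N -> forall d0 : padic_int pr_p, unimodular_disc G L d0 ->
    (o 6)%:R = (1 - (p == 3%N)%:R) * ((1 + legendre (3 * d0)) / 2) :> rat /\
    (o 8)%:R = (1 + legendre d0) / 2 :> rat }.

Lemma class_counts_exist n : ncard (isom_group G N) = (n * 2)%N ->
  n \in [:: 1; 2; 4; 6; 8; 12; 24]%N -> exists o, class_counts n o.
Proof.
rewrite isom_N_ncard => /eqP; rewrite eqn_pmul2r // => /eqP <- cardG; exists oc.
have [ww ff ss] := count_sums cardG.
split.
- exact: count_classes_orbits.
- by move=> k; apply: orbit_count0.
- by rewrite ww !stab_countE divn1.
- by rewrite ff !stab_countE.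
- by move=> /ss ->; rewrite !stab_countE.
- exact: (orbit_count24 cg sa cardG).
- exact: (orbit_count12 cg sa cardG).
- exact: (orbit_count6 cg sa cardG).
- exact: (orbit_count6_le1 cg sa cardG).
- exact: (orbit_count8_le1 cg sa cardG).
- exact: (orbit_count12_le1 cg sa cardG).
by move=> c24 d0; apply: cubic_counts.
Qed.

End Counting.

(** * The class numbers for each order of O(N) *)

Lemma finite_ncard (T : choiceType) (S : set T) : ncard S <> 0%N -> finite_set S.
Proof.
move=> S0; apply: contrapT => nS; apply: S0.
by rewrite /ncard /fset_set; case: pselect => //; rewrite cardfs0.
Qed.

Theorem theorem6p2 (p : nat) (pr_p : prime p) (odd_p : odd p)
  (G : 'M[rat]_3) (posG : posdef G)
  (L : set 'rV[rat]_3) (latL : is_lattice L) (primL : primitive_lattice G L)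
  (ord_dL : 2 <= ordq p (lattice_det G L))
  (p_neq3 : ncard (isom_group G (Lambda G p L)) = 24%N -> p <> 3%N) :
  let N := Lambda G p L in
  let Gam := Gamma G p L N in
  let oN := ncard (isom_group G N) in
  let wn : nat := ncard Gam in
  let w : rat := wn%:R in
  let w2 : rat := (wn %% 2)%N%:R in
  let w3 : rat := (wn %% 3)%N%:R in
  let f : rat :=
    \sum_(sigma \in symmetries G N) ((ncard (Gamma_fix G p L N sigma))%:R : rat) in
  let s : rat :=
    (ncard [set sigma | symmetries G N sigma /\
       exists2 M, Gamma_fix G p L N sigma M & special pr_p G M sigma])%:R in
  let h (k : nat) : rat := (count_classes G Gam k)%:R in
  (oN = 2%N ->
     [/\ h 2%N = w, h 4%N = 0, h 8%N = 0
       & [/\ h 12%N = 0, h 16%N = 0 & h 24%N = 0]]) /\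
  (oN = 4%N ->
     [/\ h 2%N = (w - f) / 2, h 4%N = f, h 8%N = 0
       & [/\ h 12%N = 0, h 16%N = 0 & h 24%N = 0]]) /\
  (oN = 8%N ->
     [/\ h 2%N = (w - f + 2 * s) / 4, h 4%N = (f - 3 * s) / 2,
         h 8%N = s
       & [/\ h 12%N = 0, h 16%N = 0 & h 24%N = 0]]) /\
  (oN = 12%N ->
     [/\ h 2%N = (w - f + 2 * w3) / 6, h 4%N = (f - 3 * w3) / 3,
         h 8%N = 0
       & [/\ h 12%N = w3, h 16%N = 0 & h 24%N = 0]]) /\
  (oN = 16%N ->
     [/\ h 2%N = (w - f + 2 * s + 2 * w2) / 8,
         h 4%N = (f - 3 * s - 2 * w2) / 4,
         h 8%N = (s - w2) / 2
       & [/\ h 12%N = 0, h 16%N = w2 & h 24%N = 0]]) /\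
  (oN = 24%N ->
     [/\ h 2%N = (w - f + 2 * s + 4 * w3) / 12,
         h 4%N = (f - 3 * s - 4 * w3) / 6,
         h 8%N = (s - w3) / 3
       & [/\ h 12%N = 0, h 16%N = 0 & h 24%N = w3]]) /\
  (oN = 48%N ->
     [/\ h 24%N = 0, h 48%N = 0,
         forall d0 : padic_int pr_p, unimodular_disc G L d0 ->
           h 12%N = (1 - (p == 3%N)%:R) * ((1 + legendre (3 * d0)) / 2) /\
           h 16%N = (1 + legendre d0) / 2
       & [/\ h 8%N = (s - 3 * h 16%N) / 6,
             h 4%N =
               (f - 18 * h 8%N - 12 * h 12%N - 15 * h 16%N) / 12
           & h 2%N =
               (w - f + 12 * h 8%N + 8 * h 12%N + 12 * h 16%N) / 24]]).
Proof.
move=> N Gam oN wn w w2 w3 f s h.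
have ord1 : 1 <= ordq p (lattice_det G L) by apply: le_trans ord_dL.
have key n : oN = (n * 2)%N -> n \in [:: 1; 2; 4; 6; 8; 12; 24]%N ->
    exists o, class_counts pr_p G L n o.
  (* [ncard] is 0 on infinite sets, so a positive order makes O(N) finite. *)
  move=> oE nI; have finO : finite_set (isom_group G N).
    by apply: finite_ncard; rewrite -/oN oE => /eqP; rewrite muln_eq0 orbF => /eqP n0; rewrite n0 in nI.
  exact: (class_counts_exist pr_p odd_p posG latL primL ord1 finO p_neq3 oE nI).
have hE n o (cc : class_counts pr_p G L n o) d : h (d * 2)%N = (o d)%:R by rewrite /h (cc_h cc).
have {}hE n o (cc : class_counts pr_p G L n o) : [/\ h 2%N = (o 1%N)%:R, h 4%N = (o 2%N)%:R,
    h 8%N = (o 4%N)%:R & [/\ h 12%N = (o 6%N)%:R, h 16%N = (o 8%N)%:R, h 24%N = (o 12%N)%:R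
    & h 48%N = (o 24%N)%:R]].
  by split; [exact: (hE _ _ cc 1%N)|exact: (hE _ _ cc 2%N)|exact: (hE _ _ cc 4%N)|split;
    [exact: (hE _ _ cc 6%N)|exact: (hE _ _ cc 8%N)|exact: (hE _ _ cc 12%N)|exact: (hE _ _ cc 24%N)]].
split; last split; last split; last split; last split; last split.
- move=> oE; have [//|o cc] := key 1%N oE.
  have [-> -> -> [-> -> -> _]] := hE _ _ cc.
  have z k : ~~ (k %| 1)%N -> (o k)%:R = 0 :> rat by move=> /(cc_dvd cc) ->.
  have wE : wn = o 1%N by rewrite /wn (cc_w cc) /divn /=; lia.
  by rewrite (z 2%N) // (z 4%N) // (z 6%N) // (z 8%N) // (z 12%N) // /w wE.
- move=> oE; have [//|o cc] := key 2%N oE.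
  have [-> -> -> [-> -> -> _]] := hE _ _ cc.
  have z k : ~~ (k %| 2)%N -> (o k)%:R = 0 :> rat by move=> /(cc_dvd cc) ->.
  have wE : wn = (2 * o 1 + o 2)%N by rewrite /wn (cc_w cc) /divn /=; lia.
  have fE : f = (o 2%N)%:R.
    by rewrite /f (cc_f cc); congr (_%:R); rewrite /divn /=; lia.
  by rewrite (z 4%N) // (z 6%N) // (z 8%N) // (z 12%N) // /w wE fE natrD natrM; repeat split; lra.
- move=> oE; have [//|o cc] := key 4%N oE.
  have [-> -> -> [-> -> -> _]] := hE _ _ cc.
  have z k : ~~ (k %| 4)%N -> (o k)%:R = 0 :> rat by move=> /(cc_dvd cc) ->.
  have wE : w = 4 * (o 1%N)%:R + 2 * (o 2%N)%:R + (o 4%N)%:R.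
    rewrite -!natrM -!natrD /w /wn (cc_w cc); congr (_%:R); rewrite /divn /=; lia.
  have fE : f = 2 * (o 2%N)%:R + 3 * (o 4%N)%:R.
    rewrite -!natrM -!natrD /f (cc_f cc); congr (_%:R); rewrite /divn /=; lia.
  have sE : s = (o 4%N)%:R by rewrite /s (cc_s cc) //; congr (_%:R); rewrite /divn /=; lia.
  by rewrite (z 6%N) // (z 8%N) // (z 12%N) // wE fE sE; repeat split; lra.
- move=> oE; have [//|o cc] := key 6%N oE.
  have [-> -> -> [-> -> -> _]] := hE _ _ cc.
  have z k : ~~ (k %| 6)%N -> (o k)%:R = 0 :> rat by move=> /(cc_dvd cc) ->.
  have le := cc_6le cc.
  have wn' : wn = (6 * o 1 + 3 * o 2 + o 6)%N.
    by rewrite /wn (cc_w cc) (cc_dvd cc (k := 4)) //; rewrite /divn /=; lia.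
  have wE : w = 6 * (o 1%N)%:R + 3 * (o 2%N)%:R + (o 6%N)%:R by rewrite -!natrM -!natrD /w wn'.
  (* [o 6] is at most 1 and the other terms of [wn] are multiples of 3. *)
  have w3E : w3 = (o 6%N)%:R by rewrite /w3 wn'; congr (_%:R); lia.
  have fE : f = 3 * (o 2%N)%:R + 3 * (o 6%N)%:R.
    rewrite -!natrM -!natrD /f (cc_f cc) (cc_dvd cc (k := 4)) //; congr (_%:R); rewrite /divn /=; lia.
  by rewrite (z 4%N) // (z 8%N) // (z 12%N) // wE fE w3E; repeat split; lra.
- move=> oE; have [//|o cc] := key 8%N oE.
  have [-> -> -> [-> -> -> _]] := hE _ _ cc.
  have z k : ~~ (k %| 8)%N -> (o k)%:R = 0 :> rat by move=> /(cc_dvd cc) ->.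
  have o6 : o 6%N = 0%N by apply: (cc_dvd cc).
  have le := cc_8le cc.
  have wn' : wn = (8 * o 1 + 4 * o 2 + 2 * o 4 + o 8)%N.
    by rewrite /wn (cc_w cc) o6 /divn /=; lia.
  have wE : w = 8 * (o 1%N)%:R + 4 * (o 2%N)%:R + 2 * (o 4%N)%:R + (o 8%N)%:R.
    by rewrite -!natrM -!natrD /w wn'.
  (* [o 8] is at most 1 and the other terms of [wn] are even. *)
  have w2E : w2 = (o 8%N)%:R by rewrite /w2 wn'; congr (_%:R); lia.
  have fE : f = 4 * (o 2%N)%:R + 6 * (o 4%N)%:R + 5 * (o 8%N)%:R.
    rewrite -!natrM -!natrD /f (cc_f cc) o6; congr (_%:R); rewrite /divn /=; lia.
  have sE : s = 2 * (o 4%N)%:R + (o 8%N)%:R.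
    by rewrite -natrM -natrD /s (cc_s cc) //; congr (_%:R); rewrite /divn /=; lia.
  by rewrite (z 6%N) // (z 12%N) // wE fE sE w2E; repeat split; lra.
- move=> oE; have [//|o cc] := key 12%N oE.
  have [-> -> -> [-> -> -> _]] := hE _ _ cc.
  have o8 : o 8%N = 0%N by apply: (cc_dvd cc).
  have o6 := cc_6 cc erefl; have le := cc_12le cc.
  have wn' : wn = (12 * o 1 + 6 * o 2 + 3 * o 4 + o 12)%N.
    by rewrite /wn (cc_w cc) o6 o8 /divn /=; lia.
  have wE : w = 12 * (o 1%N)%:R + 6 * (o 2%N)%:R + 3 * (o 4%N)%:R + (o 12%N)%:R.
    by rewrite -!natrM -!natrD /w wn'.
  (* [o 12] is at most 1 and the coefficients 12, 6 and 3 are multiples of 3. *)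
  have w3E : w3 = (o 12%N)%:R by rewrite /w3 wn'; congr (_%:R); lia.
  have fE : f = 6 * (o 2%N)%:R + 9 * (o 4%N)%:R + 7 * (o 12%N)%:R.
    rewrite -!natrM -!natrD /f (cc_f cc) o6 o8; congr (_%:R); rewrite /divn /=; lia.
  have sE : s = 3 * (o 4%N)%:R + (o 12%N)%:R.
    by rewrite -natrM -natrD /s (cc_s cc) // o8; congr (_%:R); rewrite /divn /=; lia.
  by rewrite o6 o8 wE fE sE w3E; repeat split; lra.
move=> oE; have [//|o cc] := key 24%N oE.
have [-> -> -> [-> -> -> ->]] := hE _ _ cc.
have o12 : o 12%N = 0%N by apply: (cc_12 cc).
have wE : w = 24 * (o 1%N)%:R + 12 * (o 2%N)%:R + 6 * (o 4%N)%:R + 4 * (o 6%N)%:R + 3 * (o 8%N)%:R.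
  rewrite -!natrM -!natrD /w /wn (cc_w cc) o12; congr (_%:R); rewrite /divn /=; lia.
have fE : f = 12 * (o 2%N)%:R + 18 * (o 4%N)%:R + 12 * (o 6%N)%:R + 15 * (o 8%N)%:R.
  rewrite -!natrM -!natrD /f (cc_f cc) o12; congr (_%:R); rewrite /divn /=; lia.
have sE : s = 6 * (o 4%N)%:R + 3 * (o 8%N)%:R.
  by rewrite -!natrM -natrD /s (cc_s cc) // o12; congr (_%:R); rewrite /divn /=; lia.
rewrite (cc_24 cc) o12 wE fE sE; split=> //; first exact: (cc_disc cc).
by repeat split; lra.
Qed.
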